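(* There exists a sequence $\epsilon_k\to 0$ such that the following holds. Let $(I,\sigma)$ be a uniform instance–solution pair where either (a) $I$ is a graph on $n$ vertices with $dn/2$ edges, $d\le(1-\epsilon_k)k\ln k$, and $\sigma$ is a $k$-coloring of $I$; or (b) $I$ is a $k$-uniform hypergraph on $n$ vertices with $rn$ edges, $r\le(1-\epsilon_k)\frac{2^{k-1}}{k}\ln k$, and $\sigma$ is a 2-coloring of $I$. Then w.h.p. every variable in $(I,\sigma)$ is $o(n)$-loose, i.e. there is a function $g(n)=o(n)$ such that w.h.p. every variable is $g(n)$-loose.
   Context: Instances: (a) graphs on vertex set $\{1,\dots,n\}$ with $m$ edges, solutions are proper $k$-colorings $\sigma\in\{1,\dots,k\}^n$; (b) sets of $m$ distinct $k$-subsets of $\{1,\dots,n\}$, solutions are maps $\{1,\dots,n\}\to\{1,2\}$ with no monochromatic edge. $\mathcal{S}(I)$ is the set of solutions; $D$ is the color domain ($\{1,\dots,k\}$ resp. $\{1,2\}$). A uniform instance–solution pair is generated by choosing $I$ uniformly among all instances with the given number of constraints and then, if $\mathcal{S}(I)\ne\emptyset$, choosing $\sigma\in\mathcal{S}(I)$ uniformly. A variable $v$ is $f(n)$-loose in $(I,\sigma)$ if for every $j\in D$ there is $\tau\in\mathcal{S}(I)$ with $\tau(v)=j$ and Hamming distance $\mathrm{dist}(\sigma,\tau)\le f(n)$. W.h.p. means with probability tending to 1 as $n\to\infty$. *)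

(* Defs.v *)
From HB Require Import structures.
From mathcomp Require Import all_boot all_order all_algebra.
From mathcomp Require Import all_classical all_reals all_analysis.

Set Implicit Arguments.
Unset Strict Implicit.
Unset Printing Implicit Defensive.

Import Order.TTheory GRing.Theory Num.Theory.
Import numFieldNormedType.Exports.

Local Open Scope ring_scope.

(** A hypergraph on the vertex set ['I_n] is its set of edges; simple graphs
    are the 2-uniform ones. *)
Definition hypergraph (n : nat) := {set {set 'I_n}}.

Definition uniform_hypergraphs (n k m : nat) : {set hypergraph n} :=
  [set E : hypergraph n | [forall e in E, #|e| == k] && (#|E| == m)].

Definition graphs (n m : nat) : {set hypergraph n} :=
  uniform_hypergraphs n 2 m.

Definition proper_colorings (n k : nat) (E : hypergraph n) :
    {set {ffun 'I_n -> 'I_k}} :=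
  [set s : {ffun 'I_n -> 'I_k} |
    [forall u, forall v, ([set u; v]%SET \in E) ==> (s u != s v)]].

Definition monochromatic (n : nat) (D : finType) (s : {ffun 'I_n -> D})
    (e : {set 'I_n}) : bool :=
  [exists c : D, forall v in e, s v == c].

Definition two_colorings (n : nat) (E : hypergraph n) :
    {set {ffun 'I_n -> 'I_2}} :=
  [set s : {ffun 'I_n -> 'I_2} | [forall e in E, ~~ monochromatic s e]].

Definition hamming (n : nat) (D : finType) (s t : {ffun 'I_n -> D}) : nat :=
  #|[set v | s v != t v]%SET|.

Definition loose (R : realType) (n : nat) (D : finType)
    (S : {set {ffun 'I_n -> D}}) (f : R) (s : {ffun 'I_n -> D}) (v : 'I_n) :
    bool :=
  [forall j : D, exists t in S, (t v == j) && ((hamming s t)%:R <= f)].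

(** Probability that the uniform instance-solution experiment (an instance [I]
    uniform in [Inst], then, when [Sol I] is nonempty, [s] uniform in [Sol I])
    produces a pair [(I, s)] satisfying [A].  Instances without solutions
    produce no pair, hence count against every event [A]. *)
Definition pair_prob (R : realType) (T U : finType) (Inst : {set T})
    (Sol : T -> {set U}) (A : T -> U -> bool) : R :=
  \sum_(I in Inst) \sum_(s in Sol I | A I s) #|Inst|%:R^-1 * #|Sol I|%:R^-1.

Definition all_loose_prob (R : realType) (n : nat) (D : finType)
    (Inst : {set hypergraph n})
    (Sol : hypergraph n -> {set {ffun 'I_n -> D}}) (f : R) : R :=
  pair_prob R Inst Sol (fun I s => [forall v, loose (Sol I) f s v]).

(* Main.v *)
Require Import Defs.
From HB Require Import structures.
From mathcomp Require Import all_boot all_order all_algebra.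
From mathcomp Require Import all_classical all_reals all_analysis.
From mathcomp Require Import ring lra zify.
Import mathcomp.boot.fintype mathcomp.boot.finset.

Set Implicit Arguments.
Unset Strict Implicit.
Unset Printing Implicit Defensive.

Import Order.TTheory GRing.Theory Num.Theory.
Import numFieldNormedType.Exports.

Local Open Scope ring_scope.

(** Colourings of both kinds are maps without monochromatic edge, so graphs are
    the case of edges of size 2.

    A second moment computation over balanced colourings shows that the number of
    solutions is at least its mean up to a factor [exp (o(n))] with probability
    [exp (- o(n))]. The blow-up inequality for product measures then gives, with
    high probability, a subinstance missing only [o(n)] constraints that still has
    that many solutions, and repairing these solutions as described below carries
    the bound over to the instance itself. Consequently, an event of probability
    [exp (- c n)] for the planted pair (first [s], then an instance uniform among
    those solved by [s]) has vanishing probability for the uniform pair.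

    For graphs, call a colour free at a vertex if no neighbour has it, and a vertex
    poor if it has few free colours. Below [(1 - eps) k ln k] a given colour is free
    with probability at least [exp (sqrt (ln k) / 2) / k], so poor vertices are so
    rare that the closure of [o(n)] vertices under poor neighbours has size [o(n)],
    up to an exponentially small probability in the planted model. The closure and
    its neighbours span a sparse graph, hence can be recoloured greedily from the
    free colours with any prescribed colour at one vertex. For hypergraphs, [w] is
    free if no edge becomes monochromatic when [w] is flipped; an edge that would
    become so is saved by flipping one of its free vertices as well, chosen greedily
    by the same sparsity, and edges with few free vertices play the role of poor
    vertices. *)

(** * Planted configurations in a uniform subset *)

(** The second moment shows many solutions only with probability [exp (- o(n))], and the logarithm
    of their number is not Lipschitz in the instance: one more edge may destroy all of them. So the
    blow-up inequality is applied to the Hamming distance from the rich instances. It leaves a small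
    set of edges to put back, and repair has to do this without losing an exponential factor. The
    repair property is therefore invoked at two scales. At the target radius it gives looseness,
    with some failure rate [c]. At a much smaller radius, chosen after [c] so that a Hamming ball
    has at most [exp (c n / 4)] points, it maps solutions of the subinstance to solutions of the
    instance with small fibres. The error rates of the counting are chosen after both failure rates.
    The density enters sharply only through the probability that a colour or a vertex is free. The
    second moment has a constant factor to spare, which is why a pointwise entropy inequality with
    crude constants is enough. *)

Lemma sum_subsets_weight (R : realType) (X : finType) (W : {set X} -> R) (Q : R)
    (t : nat) :
  0 <= Q -> 
  (forall T : {set X}, (#|T| < t)%N ->
     \sum_(e | e \notin T) W (e |: T)%SET <= Q * W T) ->
  t`!%:R * \sum_(T : {set X} | #|T| == t) W T <= Q ^+ t * W set0.
Proof.
move=> Q0; elim: t => [|t IH] HW.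
  rewrite fact0 expr0 !mul1r (big_pred1 set0) // => T.
  by rewrite /= cards_eq0.
(* Count pairs of a [t.+1]-set and one of its elements, the one added last; this uses up the factor
   [t.+1] of the factorial. The hypothesis [HW] then prices each added element at [Q]. *)
have -> : t.+1`!%:R * \sum_(T : {set X} | #|T| == t.+1) W T =
    t`!%:R * \sum_(T : {set X} | #|T| == t) \sum_(e | e \notin T) W (e |: T)%SET.
  rewrite factS mulnC natrM -mulrA; congr (_ * _).
  transitivity (\sum_(T : {set X} | #|T| == t.+1) \sum_(e in T) W T).
    rewrite mulr_sumr; apply: eq_bigr => T /eqP cT.
    by rewrite sumr_const cT mulr_natl.
  rewrite (exchange_big_dep xpredT) //= [RHS](exchange_big_dep xpredT) //=.
  apply: eq_bigr => e _.
  rewrite (reindex_onto (fun T => e |: T)%SET (fun T => T :\ e)%SET) /=.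
    apply: eq_bigl => T.
    rewrite setU11 andbT.
    case: (boolP (e \in T)) => eT.
      rewrite andbF; apply/negbTE/negP => /andP[_ /eqP h].
      by move: eT; rewrite -h !inE eqxx.
    by rewrite setU1K // eqxx cardsU1 eT /= add1n eqSS !andbT.
  by move=> T /andP[_ eT]; rewrite setD1K.
apply: (@le_trans _ _ (t`!%:R * \sum_(T : {set X} | #|T| == t) Q * W T)).
  apply: ler_wpM2l => //; apply: ler_sum => T /eqP cT.
  by apply: HW; rewrite cT.
rewrite -mulr_sumr mulrCA exprS -mulrA; apply: ler_wpM2l => //.
by apply: IH => T cT; apply: HW; rewrite ltnW.
Qed.

(** An instance of the sequential bound: whatever has been chosen, one more element of [Y]
    contributes at most the sum of all [a x]. *)
Lemma elementary_symmetric_le (R : realType) (X : finType) (Y : {set X})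
    (a : X -> R) (j : nat) :
  (forall x, 0 <= a x) ->
  j`!%:R * (\sum_(A : {set X} | (A \subset Y) && (#|A| == j)) \prod_(x in A) a x)
    <= (\sum_(x in Y) a x) ^+ j.
Proof.
move=> a0.
pose W (A : {set X}) : R := if A \subset Y then \prod_(x in A) a x else 0.
have := @sum_subsets_weight R X W (\sum_(x in Y) a x) j.
rewrite {4}/W sub0set big_set0 mulr1.
have -> : \sum_(T : {set X} | #|T| == j) W T =
   \sum_(A : {set X} | (A \subset Y) && (#|A| == j)) \prod_(x in A) a x.
  rewrite /W -big_mkcondr; apply: eq_bigl => A; exact: andbC.
apply; first by apply: sumr_ge0.
move=> T _; rewrite /W.
case: (boolP (T \subset Y)) => TY; last first.
  rewrite mulr0 big1 // => e _; rewrite ifF //.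
  apply/negbTE; apply: contra TY => /subsetP h; apply/subsetP => x xT.
  by apply: h; rewrite inE xT orbT.
rewrite mulr_suml big_mkcond /= [leRHS]big_mkcond /=.
apply: ler_sum => e _.
case: (boolP (e \in T)) => eT /=.
  by case: ifP => // _; apply: mulr_ge0 => //; apply: prodr_ge0.
rewrite subUset sub1set TY andbT; case: ifP => // _.
by rewrite big_setU1.
Qed.

Lemma natr_forall (R : realType) (X : finType) (P : pred X) :
  ([forall x, P x])%:R = \prod_x (P x)%:R :> R.
Proof.
case: (boolP [forall x, P x]) => [/forallP h|].
  by rewrite big1 // => x _; rewrite h.
rewrite negb_forall => /existsP[x nPx].
by rewrite (bigD1 x) //= (negbTE nPx) mul0r.
Qed.

(** The law of a random subset of [Om] that keeps each point with probability [p], as a function of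
    all sets [H]. Points outside [Om] get the factor 0 or 1, so a sum over all [H] factors over the
    points. *)
Definition bernoulli_set (R : realType) (X : finType) (p : R) (Om H : {set X}) : R :=
  \prod_x (if x \in Om then (if x \in H then p else 1 - p) else (x \notin H)%:R).

Lemma bernoulli_set_ge0 (R : realType) (X : finType) (p : R) (Om H : {set X}) :
  0 <= p <= 1 -> 0 <= bernoulli_set p Om H.
Proof.
move=> p01; apply: prodr_ge0 => x _; case: ifP => _ //; case: ifP => _; lra.
Qed.

Lemma bernoulli_setE (R : realType) (X : finType) (p : R) (Om H : {set X}) :
  H \subset Om ->
  bernoulli_set p Om H = p ^+ #|H| * (1 - p) ^+ (#|Om| - #|H|).
Proof.
move=> HO.
have -> : bernoulli_set p Om H =
    (\prod_(x in H) p) * (\prod_(x in Om :\: H) (1 - p)).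
  rewrite /bernoulli_set [X in _ = X * _]big_mkcond [X in _ = _ * X]big_mkcond.
  rewrite -big_split /=; apply: eq_bigr => x _; rewrite !inE.
  case: (boolP (x \in H)) => xH; first by rewrite (subsetP HO _ xH) /= mulr1.
  by rewrite /= mul1r; case: ifP.
by rewrite !prodr_const cardsD (setIidPr HO).
Qed.

Lemma bernoulli_set_sum (R : realType) (X : finType) (p : R) (Om T G : {set X}) :
  T \subset Om -> G \subset Om -> [disjoint T & G] ->
  \sum_(H : {set X}) bernoulli_set p Om H * (T \subset H)%:R * [disjoint H & G]%:R
   = p ^+ #|T| * (1 - p) ^+ #|G|.
Proof.
move=> TO GO TG.
pose a x : R := if (x \in Om) && (x \notin G) then p else 0.
pose b x : R := if x \in Om then (if x \in T then 0 else 1 - p) else 1.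
transitivity (\sum_(H : {set X}) \prod_x (if x \in H then a x else b x)).
  apply: eq_bigr => H _.
  have -> : (T \subset H) = [forall x, (x \in T) ==> (x \in H)].
    apply/subsetP/forallP => h x; first by apply/implyP; apply: h.
    by move=> xT; have /implyP := h x; apply.
  have -> : [disjoint H & G] = [forall x, ~~ ((x \in H) && (x \in G))].
    rewrite disjoint_subset; apply/subsetP/forallP => h x.
      by apply/negP => /andP[xH]; apply/negP; exact: h.
    by move=> xH; have := h x; rewrite xH.
  rewrite !natr_forall -!big_split /=; apply: eq_bigr => x _.
  rewrite /a /b; case: (boolP (x \in Om)) => xO /=.
    case: (x \in H) => /=; case: (x \in T) => /=; case: (x \in G) => /=; ring.
  have -> : x \in T = false by apply/negbTE; apply: contra xO; apply: (subsetP TO).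
  have -> : x \in G = false by apply/negbTE; apply: contra xO; apply: (subsetP GO).
  by case: (x \in H) => /=; ring.
rewrite -bigA_distr.
transitivity ((\prod_(x in T) p) * (\prod_(x in G) (1 - p))); last first.
  by rewrite !prodr_const.
rewrite [X in _ = X * _]big_mkcond [X in _ = _ * X]big_mkcond.
rewrite -big_split /=; apply: eq_bigr => x _; rewrite /a /b.
case: (boolP (x \in T)) => xT.
  have -> : x \in G = false by apply/negbTE; move/disjointFr: TG => ->.
  by rewrite (subsetP TO _ xT) /=; ring.
case: (boolP (x \in G)) => xG; first by rewrite (subsetP GO _ xG) /=; ring.
by case: (x \in Om) => /=; ring.
Qed.

(** Disjoint blocks are missed independently. [G] is there for the induction: the term of the
    expansion in which block [i] is missed is the same kind of sum, with [S i] added to [G]. *)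
Lemma bernoulli_set_hits (R : realType) (X : finType) (p th : R)
    (Om T G : {set X}) (I : eqType) (S : I -> {set X}) (xs : seq I) :
  T \subset Om -> G \subset Om -> [disjoint T & G] -> uniq xs ->
  (forall i, i \in xs ->
     [/\ S i \subset Om, [disjoint T & S i] & [disjoint G & S i]]) ->
  (forall i j, i \in xs -> j \in xs -> i != j -> [disjoint S i & S j]) ->
  \sum_(H : {set X}) bernoulli_set p Om H * (T \subset H)%:R * [disjoint H & G]%:R
     * \prod_(i <- xs) (1 - th * [disjoint H & S i]%:R)
   = p ^+ #|T| * (1 - p) ^+ #|G| * \prod_(i <- xs) (1 - th * (1 - p) ^+ #|S i|).
Proof.
move=> TO; elim: xs G => [|i xs IH] G GO TG.
  move=> _ _ _; rewrite big_nil mulr1 -(bernoulli_set_sum _ TO GO TG).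
  by apply: eq_bigr => H _; rewrite big_nil mulr1.
move=> /= /andP[ixs uxs] hS hd.
have [SO TS GS] := hS i (mem_head _ _).
have xi j : j \in xs -> j \in i :: xs by rewrite inE => ->; rewrite orbT.
have disjU (H : {set X}) : [disjoint H & G :|: S i] = [disjoint H & G] && [disjoint H & S i].
  by rewrite -!(@setI_eq0 X) setIUr setU_eq0.
have cGS : #|G :|: S i| = (#|G| + #|S i|)%N.
  by rewrite cardsU; move: GS; rewrite -setI_eq0 => /eqP ->; rewrite cards0 subn0.
have E1 := IH G GO TG uxs (fun j jx => hS j (xi j jx))
   (fun j k jx kx => hd j k (xi j jx) (xi k kx)).
have E2 : \sum_(H : {set X}) bernoulli_set p Om H * (T \subset H)%:R *
      [disjoint H & G :|: S i]%:R * \prod_(i <- xs) (1 - th * [disjoint H & S i]%:R)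
   = p ^+ #|T| * (1 - p) ^+ #|G :|: S i| *
      \prod_(i <- xs) (1 - th * (1 - p) ^+ #|S i|).
  apply: IH => //.
  - by rewrite subUset GO.
  - by rewrite disjU TG.
  - move=> j jx; have [h1 h2 h3] := hS j (xi j jx); split => //.
    rewrite disjoint_sym disjU disjoint_sym h3 /=.
    apply: hd; rewrite ?mem_head ?xi //; apply: contraNneq ixs => <- //.
  - by move=> j k jx kx; apply: hd; apply: xi.
transitivity (\sum_(H : {set X}) bernoulli_set p Om H * (T \subset H)%:R *
     [disjoint H & G]%:R * \prod_(i <- xs) (1 - th * [disjoint H & S i]%:R) -
   th * \sum_(H : {set X}) bernoulli_set p Om H * (T \subset H)%:R *
      [disjoint H & G :|: S i]%:R * \prod_(i <- xs) (1 - th * [disjoint H & S i]%:R)).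
  rewrite mulr_sumr -sumrB; apply: eq_bigr => H _.
  rewrite big_cons disjU.
  by case: [disjoint H & G]; case: [disjoint H & S i] => /=; ring.
by rewrite E1 E2 big_cons cGS exprD; ring.
Qed.

(** For [p = h / M] the value [h] is a mode of the binomial law, so its probability is at least
    [1 / (M + 1)]; the statement is cleared of denominators. In the proof [B j] is the probability
    of [j] times [M ^ M]. *)
Lemma binomial_mode (M h : nat) : (h <= M)%N ->
  (M ^ M <= M.+1 * ('C(M, h) * (h ^ h * (M - h) ^ (M - h))))%N.
Proof.
move=> hM.
pose B j := ('C(M, j) * (h ^ j * (M - h) ^ (M - j)))%N.
have stepE j : (j < M)%N -> (B j * j.+1 = ('C(M, j) * (h ^ j * (M - h) ^ (M - j.+1))) * (j.+1 * (M - h)))%N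
   /\ (B j.+1 * j.+1 = ('C(M, j) * (h ^ j * (M - h) ^ (M - j.+1))) * ((M - j) * h))%N.
  move=> jM; rewrite /B; split.
    rewrite -[in LHS](subnSK jM) expnS; ring.
  rewrite [LHS]mulnC mulnA mul_bin_left expnS; ring.
have up j : (j < h)%N -> (B j <= B j.+1)%N.
  move=> jh; have [e1 e2] := stepE j (leq_trans jh hM).
  rewrite -(leq_pmul2r (ltn0Sn j)) e1 e2 leq_mul2l; apply/orP; right.
  by rewrite mulnC; apply: leq_mul => //; apply: leq_sub2l; exact: ltnW.
have down j : (h <= j)%N -> (j < M)%N -> (B j.+1 <= B j)%N.
  move=> jh jM; have [e1 e2] := stepE j jM.
  rewrite -(leq_pmul2r (ltn0Sn j)) e1 e2 leq_mul2l; apply/orP; right.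
  by rewrite mulnC; apply: leq_mul; [exact: leqW | exact: leq_sub2l].
have Bup i : (i <= h)%N -> (B (h - i) <= B h)%N.
  elim: i => [|i IH] ih; first by rewrite subn0.
  apply: leq_trans (IH (ltnW ih)); rewrite -(subnSK ih); apply: up.
  by rewrite -subSn // subSS leq_subr.
have Bdown i : (h + i <= M)%N -> (B (h + i) <= B h)%N.
  elim: i => [|i IH] ih; first by rewrite addn0.
  rewrite addnS in ih *.
  by apply: leq_trans (IH (ltnW ih)); apply: down; rewrite ?leq_addr.
have Bmax j : (j <= M)%N -> (B j <= B h)%N.
  move=> jM; case: (leqP j h) => jh.
    by have := Bup (h - j)%N (leq_subr _ _); rewrite subKn.
  by have := Bdown (j - h)%N; rewrite subnKC ?(ltnW jh) //; apply.
rewrite -[X in (X ^ _ <= _)%N](subnK hM) expnDn.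
apply: leq_trans (_ : \sum_(i < M.+1) B h <= _)%N.
  apply: leq_sum => i _; apply: leq_trans (Bmax i _); last by rewrite -ltnS.
  by rewrite /B mulnC [((M - h) ^ _ * _)%N]mulnC mulnC.
by rewrite sum_nat_const card_ord /B.
Qed.

(** A uniform [h]-subset is a Bernoulli set of density [h / M] conditioned on its size, an event of
    probability at least [1 / (M + 1)]. Independence is bought for a polynomial factor, harmless
    against exponential rates. *)
Lemma card_slice_le (R : realType) (X : finType) (Om : {set X}) (h : nat)
    (P : pred {set X}) :
  (h <= #|Om|)%N -> (0 < #|Om|)%N ->
  #|[set H : {set X} | [&& H \subset Om, #|H| == h & P H]]|%:R
   <= (#|Om|.+1)%:R * 'C(#|Om|, h)%:R *
      \sum_(H | P H) bernoulli_set (h%:R / #|Om|%:R) Om H :> R.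
Proof.
move=> hM M0; set M := #|Om| in hM M0 *; set p : R := h%:R / M%:R.
have M0' : 0 < M%:R :> R by rewrite ltr0n.
have p01 : 0 <= p <= 1.
  by rewrite /p divr_ge0 // ler_pdivrMr // mul1r ler_nat.
set F := [set H : {set X} | _].
have w0 : 0 <= p ^+ h * (1 - p) ^+ (M - h).
  by apply: mulr_ge0; apply: exprn_ge0; lra.
have mode : 1 <= (M.+1)%:R * 'C(M, h)%:R * (p ^+ h * (1 - p) ^+ (M - h)).
  have -> : 1 - p = (M - h)%:R / M%:R.
    by rewrite /p natrB // mulrBl divff // gt_eqF.
  rewrite /p !expr_div_n.
  have -> : h%:R ^+ h / M%:R ^+ h * ((M - h)%:R ^+ (M - h) / M%:R ^+ (M - h))
    = (h ^ h * (M - h) ^ (M - h))%:R / M%:R ^+ M :> R.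
    rewrite -[in RHS](subnK hM) exprD natrM !natrX (subnK hM).
    by field; rewrite !expf_neq0 // gt_eqF.
  rewrite mulrA ler_pdivlMr ?exprn_gt0 // mul1r -natrX -!natrM ler_nat.
  by rewrite -mulnA; apply: binomial_mode.
have sumF : #|F|%:R * (p ^+ h * (1 - p) ^+ (M - h)) <=
     \sum_(H | P H) bernoulli_set p Om H.
  rewrite -sum1_card natr_sum mulr_suml /=.
  rewrite (_ : \sum_(i in F) _ = \sum_(H in F) bernoulli_set p Om H); last first.
    apply: eq_bigr => H; rewrite inE => /and3P[HO /eqP cH _].
    by rewrite bernoulli_setE // cH mul1r.
  rewrite big_mkcond [leRHS]big_mkcond; apply: ler_sum => H _ /=.
  rewrite inE; case: (P H); rewrite ?andbF //; last first.
  by rewrite andbT; case: ifP => // _; apply: bernoulli_set_ge0.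
apply: le_trans (_ : #|F|%:R * ((M.+1)%:R * 'C(M, h)%:R * (p ^+ h * (1 - p) ^+ (M - h))) <= _).
  by rewrite ler_peMr.
rewrite mulrCA; apply: ler_wpM2l => //.
Qed.

(* Exponential Markov inequality: each unhit block costs a factor 1/2, and the
   blocks are independent. *)
Lemma card_few_unhit_le (R : realType) (X : finType) (Om : {set X}) (h : nat)
    (T : {set X}) (I : finType) (Y : {set I}) (S : I -> {set X}) (l : nat) (z : R) :
  (h <= #|Om|)%N -> (0 < #|Om|)%N -> T \subset Om -> 0 <= z ->
  (forall i, i \in Y ->
     [/\ S i \subset Om, [disjoint T & S i] &
      z <= (1 - h%:R / #|Om|%:R) ^+ #|S i|]) ->
  (forall i j, i \in Y -> j \in Y -> i != j -> [disjoint S i & S j]) ->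
  #|[set H : {set X} | [&& H \subset Om, #|H| == h &
       (T \subset H) && (#|[set i in Y | [disjoint H & S i]]| <= l)%N]]|%:R
   <= (#|Om|.+1)%:R * 'C(#|Om|, h)%:R *
      ((h%:R / #|Om|%:R) ^+ #|T| * 2 ^+ l * (1 - z / 2) ^+ #|Y|) :> R.
Proof.
move=> hM M0 TO z0 hS hd.
have dis0 (A : {set X}) : [disjoint A & set0] by rewrite -setI_eq0 setI0.
apply: (le_trans (card_slice_le _ _ hM M0)).
apply: ler_wpM2l; first by rewrite mulr_ge0.
set p : R := h%:R / _.
have p01 : 0 <= p <= 1.
  by rewrite /p divr_ge0 // ler_pdivrMr ?ltr0n // mul1r ler_nat.
have := @bernoulli_set_hits R X p (1/2) Om T set0 I S (enum Y) TO (sub0set _).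
rewrite dis0 enum_uniq cards0 expr0 mulr1 => /(_ isT isT).
have h1 : forall i, i \in enum Y ->
     [/\ S i \subset Om, [disjoint T & S i] & [disjoint set0 & S i]].
  by move=> i; rewrite mem_enum => /hS[a b c]; split => //; rewrite disjoint_sym.
have h2 : forall i j, i \in enum Y -> j \in enum Y -> i != j -> [disjoint S i & S j].
  by move=> i j; rewrite !mem_enum; apply: hd.
move=> /(_ h1 h2) E.
apply: (@le_trans _ _ (2 ^+ l * (p ^+ #|T| *
        \prod_(i <- enum Y) (1 - 1 / 2 * (1 - p) ^+ #|S i|)))).
  rewrite -E mulr_sumr big_mkcond /=; apply: ler_sum => H _.
  have b0 := bernoulli_set_ge0 Om H p01.
  have pr0 : 0 <= \prod_(i <- enum Y) (1 - 1 / 2 * [disjoint H & S i]%:R) :> R.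
    by apply: prodr_ge0 => i _; case: [disjoint _ & _] => /=; lra.
  case: ifP => [/andP[TH cl]|_]; last first.
    by rewrite !mulr_ge0.
  rewrite TH dis0 !mulr1 mulrCA ler_peMr //.
  rewrite big_enum /= (bigID (fun i => [disjoint H & S i])) /=.
  rewrite [X in _ * (_ * X)]big1 ?mulr1; last first.
    by move=> i /andP[_ /negbTE ->]; rewrite mulr0 subr0.
  rewrite (eq_bigr (fun=> 1 / 2)); last first.
    by move=> i /andP[_ ->]; rewrite mulr1; lra.
  rewrite prodr_const -sum1_card.
  have -> : (\sum_(i in fun i => (i \in Y) && [disjoint H & S i]) 1)%N = #|[set i in Y | [disjoint H & S i]]|.
    by rewrite -sum1_card; apply: eq_bigl => i; rewrite !inE.
  rewrite -(subnK cl) exprD -mulrA -exprMn.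
  have -> : 2 * (1 / 2) = 1 :> R by lra.
  by rewrite expr1n mulr1 exprn_ege1 // ler1n.
rewrite mulrCA mulrA; apply: ler_wpM2l.
  by apply: mulr_ge0; apply: exprn_ge0; lra.
rewrite big_enum /= -prodr_const; apply: ler_prod => i iY.
have [_ _ zS] := hS i iY.
have : (1 - p) ^+ #|S i| <= 1 by apply: exprn_ile1; lra.
by rewrite -/p in zS; move=> ?; apply/andP; split; lra.
Qed.

(** * The blow-up inequality *)

Definition tuple_dist (X : eqType) (m : nat) (x y : m.-tuple X) : nat :=
  count (fun ab => ab.1 != ab.2) (zip x y).

Definition tuple_measure (R : realType) (X : finType) (mu : X -> R) (m : nat)
  (x : m.-tuple X) : R := \prod_(a <- x) mu a.

Lemma sum_tupleS (R : nmodType) (X : finType) (m : nat) (F : m.+1.-tuple X -> R) :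
  \sum_(x : m.+1.-tuple X) F x = \sum_(a : X) \sum_(x : m.-tuple X) F [tuple of a :: x].
Proof.
rewrite pair_big /=.
rewrite (reindex (fun ax : X * m.-tuple X => [tuple of ax.1 :: ax.2])) //=.
exists (fun x : m.+1.-tuple X => (thead x, [tuple of behead x])).
  by move=> [a x] _ /=; congr (_, _); apply: val_inj.
by move=> x _ /=; rewrite [RHS](tuple_eta x).
Qed.

(* Induction on [m]: with [u] the relative measure of the section of [A] over
   the first coordinate, [min (1/u) w <= 1 + w - w u]. *)
Lemma tuple_blowup (R : realType) (X : finType) (mu : X -> R) (w : R) (m : nat)
    (A : pred (m.-tuple X)) (d : m.-tuple X -> nat) :
  (forall a, 0 <= mu a) -> \sum_a mu a = 1 -> 1 <= w ->
  (forall x y, A y -> (d x <= tuple_dist x y)%N) ->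
  (\sum_x tuple_measure mu x * w ^+ d x) * (\sum_(x | A x) tuple_measure mu x)
    <= ((1 + w) ^+ 2 / (4 * w)) ^+ m.
Proof.
move=> mu0 mu1 w1.
have w0 : 0 < w by lra.
have tm0 k (x : k.-tuple X) : 0 <= tuple_measure mu x by apply: prodr_ge0.
have c0 : 0 <= (1 + w) ^+ 2 / (4 * w).
  by apply: divr_ge0; [exact: sqr_ge0 | lra].
elim: m A d => [|m IH] A d hd.
  have E (P : pred (0.-tuple X)) (F : 0.-tuple X -> R) : \sum_(x | P x) F x = if P [tuple] then F [tuple] else 0.
    rewrite big_mkcond (big_pred1 [tuple]) // => x /=.
    by apply/esym/eqP/val_inj; case: x => [[|]].
  rewrite expr0 !E /=; case: ifP => [At|]; last by rewrite mulr0.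
  have -> : d [tuple] = 0%N.
    by have := hd [tuple] [tuple] At; rewrite /tuple_dist /= leqn0 => /eqP.
  by rewrite expr0 /tuple_measure big_nil !mulr1.
set c := (1 + w) ^+ 2 / (4 * w) in IH c0 *.
pose As a : pred (m.-tuple X) := fun x => A [tuple of a :: x].
pose B : pred (m.-tuple X) := fun x => [exists a, As a x].
pose Pm (C : pred (m.-tuple X)) : R := \sum_(x | C x) tuple_measure mu x.
pose E a : R := \sum_x tuple_measure mu x * w ^+ d [tuple of a :: x].
have tmS a (x : m.-tuple X) : tuple_measure mu [tuple of a :: x] = mu a * tuple_measure mu x.
  by rewrite /tuple_measure /= big_cons.
have PmB0 : 0 <= Pm B by apply: sumr_ge0.
have PA0 a : 0 <= Pm (As a) by apply: sumr_ge0.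
have PAB a : Pm (As a) <= Pm B.
  rewrite /Pm big_mkcond [leRHS]big_mkcond; apply: ler_sum => x _ /=.
  case: ifP => // Ax; last by case: ifP.
  by rewrite ifT //; apply/existsP; exists a.
have E0 a : 0 <= E a by apply: sumr_ge0 => x _; rewrite mulr_ge0 // exprn_ge0 // ltW.
have E1 a : E a * Pm (As a) <= c ^+ m.
  apply: (IH (As a) (fun x => d [tuple of a :: x])) => x y Ay.
  by apply: leq_trans (hd _ _ Ay) _; rewrite /tuple_dist /= eqxx.
(* [B] is the projection of [A]. Matching a point of [B] may cost one mismatch in the first
   coordinate, so only the predecessor of [d] is under control and a factor [w] is paid. *)
have E2 a : E a * Pm B <= w * c ^+ m.
  apply: (@le_trans _ _ (w * ((\sum_x tuple_measure mu x * w ^+ (d [tuple of a :: x]).-1) * Pm B))).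
    rewrite mulrA; apply: ler_wpM2r => //.
    rewrite mulr_sumr; apply: ler_sum => x _; rewrite mulrCA; apply: ler_wpM2l => //.
    by rewrite -exprS; apply: ler_weXn2l => //; case: (d _).
  apply: ler_wpM2l; first exact: ltW.
  apply: IH => x y /existsP[b Ay].
  have := hd [tuple of a :: x] [tuple of b :: y] Ay.
  by rewrite /tuple_dist /=; case: (a != b) => /=; case: (d _) => //= k; lia.
have -> : \sum_x tuple_measure mu x * w ^+ d x = \sum_a mu a * E a.
  rewrite sum_tupleS; apply: eq_bigr => a _; rewrite /E mulr_sumr.
  by apply: eq_bigr => x _; rewrite tmS mulrA.
have -> : \sum_(x | A x) tuple_measure mu x = \sum_a mu a * Pm (As a).
  rewrite big_mkcond sum_tupleS; apply: eq_bigr => a _; rewrite /Pm mulr_sumr.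
  by rewrite [RHS]big_mkcond /=; apply: eq_bigr => x _; rewrite tmS.
have cm0 : 0 <= c ^+ m by apply: exprn_ge0.
case: (ltrP 0 (Pm B)) => PB; last first.
  rewrite [X in _ * X]big1 ?mulr0 ?exprn_ge0 // => a _.
  have -> : Pm (As a) = 0 by apply/eqP; rewrite eq_le PA0 (le_trans (PAB a)).
  by rewrite mulr0.
pose u a := Pm (As a) / Pm B.
have uE a : Pm (As a) = u a * Pm B by rewrite /u mulfVK // gt_eqF.
have u01 a : 0 <= u a <= 1.
  by rewrite /u divr_ge0 //= ler_pdivrMr // mul1r.
have E3 a : E a * Pm B <= c ^+ m * (1 + w - w * u a).
  case: (lerP 1 (w * u a)) => wu; last first.
    apply: (le_trans (E2 a)); rewrite mulrC; apply: ler_wpM2l => //; lra.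
  have ua0 : 0 < u a.
    by rewrite lt_neqAle; have /andP[-> _] := u01 a; rewrite andbT; apply/eqP => h; move: wu; rewrite -h; lra.
  have h1 : E a * Pm B * u a <= c ^+ m by have := E1 a; rewrite uE; lra.
  rewrite -(ler_pM2r ua0); apply: (le_trans h1).
  rewrite -mulrA ler_peMr //.
  have /andP[_ u1] := u01 a; have : 0 <= (1 - u a) * (w * u a - 1) by apply: mulr_ge0; lra.
  by lra.
pose ub := \sum_a mu a * u a.
have S1 : (\sum_a mu a * E a) * Pm B <= c ^+ m * (1 + w - w * ub).
  have -> : c ^+ m * (1 + w - w * ub) = \sum_a mu a * (c ^+ m * (1 + w - w * u a)).
    transitivity (c ^+ m * ((1 + w) * \sum_a mu a - w * ub)); first by rewrite mu1 mulr1.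
    rewrite /ub !mulr_sumr -sumrB mulr_sumr; apply: eq_bigr => a _; ring.
  rewrite mulr_suml; apply: ler_sum => a _; rewrite -mulrA; apply: ler_wpM2l => //.
have S2 : \sum_a mu a * Pm (As a) = ub * Pm B.
  by rewrite /ub mulr_suml; apply: eq_bigr => a _; rewrite uE mulrA.
have ub0 : 0 <= ub by apply: sumr_ge0 => a _; apply: mulr_ge0 => //; case/andP: (u01 a).
rewrite S2 (_ : _ * (ub * Pm B) = (\sum_a mu a * E a) * Pm B * ub); last by ring.
apply: (le_trans (ler_wpM2r ub0 S1)).
rewrite exprSr -mulrA; apply: ler_wpM2l => //.
rewrite /c ler_pdivlMr; last lra.
(* Maximising [ub * (1 + w - w * ub)] over [ub] is what produces the constant
   [(1 + w) ^+ 2 / (4 * w)]. *)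
have : 0 <= (1 + w - 2 * w * ub) ^+ 2 by exact: sqr_ge0.
rewrite !expr2; lra.
Qed.

(** * Balanced colourings *)

Definition color_class (n : nat) (D : finType) (s : {ffun 'I_n -> D}) (c : D) :
  {set 'I_n} := [set v | s v == c].

Definition edges (n kap : nat) : hypergraph n := [set e : {set 'I_n} | #|e| == kap].

Definition allowed (n kap : nat) (D : finType) (s : {ffun 'I_n -> D}) : hypergraph n :=
  [set e in edges n kap | ~~ monochromatic s e].

Definition mono_frac (R : realType) (n kap : nat) (D : finType)
    (s : {ffun 'I_n -> D}) : R :=
  (\sum_c 'C(#|color_class s c|, kap))%:R / 'C(n, kap)%:R.

Definition freq (R : realType) (n : nat) (D : finType) (s : {ffun 'I_n -> D})
  (c : D) : R := #|color_class s c|%:R / n%:R.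

(** Only large classes are excluded: they alone raise the number of monochromatic edges, and the
    cells of a pair of balanced colourings inherit the upper bound. *)
Definition balanced (R : realType) (xi : R) (n : nat) (D : finType)
    (s : {ffun 'I_n -> D}) : bool :=
  [forall c, #|color_class s c|%:R <= (#|D|%:R^-1 + xi) * n%:R].

(** A pair of colourings as one colouring with product colours: its class frequencies form the
    overlap matrix, and the estimates for a single colouring apply to it. *)
Definition pairing (n : nat) (D1 D2 : finType) (s : {ffun 'I_n -> D1})
    (t : {ffun 'I_n -> D2}) : {ffun 'I_n -> D1 * D2} := [ffun v => (s v, t v)].

Lemma monochromaticP (n : nat) (D : finType) (s : {ffun 'I_n -> D})
    (e : {set 'I_n}) :
  reflect (exists c, forall v, v \in e -> s v = c) (monochromatic s e).
Proof.
apply: (iffP existsP) => [[c /forall_inP h]|[c h]]; exists c.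
  by move=> v /h /eqP.
by apply/forall_inP => v /h ->.
Qed.

Lemma monochromatic_pairing (n : nat) (D1 D2 : finType) (s : {ffun 'I_n -> D1})
    (t : {ffun 'I_n -> D2}) (e : {set 'I_n}) :
  monochromatic (pairing s t) e = monochromatic s e && monochromatic t e.
Proof.
apply/monochromaticP/andP => [[[c d] h]|[/monochromaticP[c h] /monochromaticP[d h']]].
  by split; apply/monochromaticP; [exists c|exists d] => v /h; rewrite ffunE => -[].
by exists (c, d) => v ve; rewrite ffunE h // h'.
Qed.

Lemma card_edges (n kap : nat) : #|edges n kap| = 'C(n, kap).
Proof. by rewrite /edges card_draws card_ord. Qed.

Lemma card_monochromatic (n kap : nat) (D : finType) (s : {ffun 'I_n -> D}) :
  (0 < kap)%N ->
  #|[set e in edges n kap | monochromatic s e]| =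
    (\sum_c 'C(#|color_class s c|, kap))%N.
Proof.
move=> k0.
have -> : [set e in edges n kap | monochromatic s e] =
   \bigcup_(c : D) [set e : {set 'I_n} | e \subset color_class s c & #|e| == kap].
  apply/setP => e; apply/idP/bigcupP.
    rewrite !inE => /andP[ck /monochromaticP[c h]]; exists c => //.
    by rewrite inE ck andbT; apply/subsetP => v /h <-; rewrite inE.
  move=> [c _]; rewrite !inE => /andP[/subsetP sub ck]; rewrite ck /=.
  by apply/monochromaticP; exists c => v /sub; rewrite inE => /eqP.
rewrite -(eq_bigr _ (fun c _ => cards_draws (color_class s c) kap)).
rewrite -sum1_card partition_disjoint_bigcup /=.
  by apply: eq_bigr => c _; rewrite sum1_card.
move=> c d cd; apply/setDidPl/setP => e; rewrite !inE.
case: (boolP (e \subset color_class s c)) => [/subsetP h1|]; last by rewrite ?andbF.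
case: (boolP (#|e| == kap)) => [/eqP ck|]; last by rewrite ?andbF.
rewrite !andbT; apply/negP => /subsetP h2.
have /card_gt0P[v ve] : (0 < #|e|)%N by rewrite ck.
by move: cd; have := h1 v ve; have := h2 v ve; rewrite !inE => /eqP -> /eqP ->; rewrite eqxx.
Qed.

Lemma card_allowed (n kap : nat) (D : finType) (s : {ffun 'I_n -> D}) :
  (0 < kap)%N ->
  (#|allowed kap s| + \sum_c 'C(#|color_class s c|, kap))%N = 'C(n, kap).
Proof.
move=> k0; rewrite -card_monochromatic // -card_edges addnC.
rewrite -(cardsID [set e | monochromatic s e] (edges n kap)); congr (_ + _)%N.
  by apply: eq_card => e; rewrite !inE.
by apply: eq_card => e; rewrite !inE andbC.
Qed.

Lemma allowed_frac (R : realType) (n kap : nat) (D : finType) (s : {ffun 'I_n -> D}) :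
  (0 < kap <= n)%N ->
  #|allowed kap s|%:R / 'C(n, kap)%:R = 1 - mono_frac R kap s.
Proof.
move=> /andP[k0 kn]; rewrite /mono_frac.
have N0 : 'C(n, kap)%:R != 0 :> R by rewrite pnatr_eq0 -lt0n bin_gt0.
apply: (mulIf N0); rewrite mulrBl !mulfVK // mul1r.
by rewrite -(card_allowed s k0) natrD addrK.
Qed.

Lemma allowed_pair_frac (R : realType) (n kap : nat) (D1 D2 : finType)
    (s : {ffun 'I_n -> D1}) (t : {ffun 'I_n -> D2}) :
  (0 < kap <= n)%N ->
  #|allowed kap s :&: allowed kap t|%:R / 'C(n, kap)%:R =
    1 - mono_frac R kap s - mono_frac R kap t + mono_frac R kap (pairing s t).
Proof.
move=> kn.
have c1 : (#|allowed kap s :&: allowed kap t| + #|allowed kap (pairing s t)|)%N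
    = (#|allowed kap s| + #|allowed kap t|)%N.
  have -> : allowed kap (pairing s t) = allowed kap s :|: allowed kap t.
    by apply/setP => e; rewrite !inE monochromatic_pairing negb_and -andb_orr.
  by rewrite addnC cardsUI.
have := congr1 (fun x => x%:R / 'C(n, kap)%:R : R) c1.
rewrite !natrD !mulrDl !allowed_frac // => /eqP.
by rewrite -subr_eq => /eqP <-; ring.
Qed.

Lemma ffact_le_expn (x kap : nat) : (x ^_ kap <= x ^ kap)%N.
Proof.
elim: kap => // j IHj; rewrite ffactnSr expnSr; apply: leq_mul => //.
exact: leq_subr.
Qed.

(** Draws with and without repetition differ by lower order terms. The constant is crude but uniform
    in [x <= n], which makes the approximations below uniform in the colouring. *)
Lemma expn_ffact_le (n x kap : nat) : (x <= n)%N ->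
  (x ^ kap.+1 <= x ^_ kap.+1 + kap.+1 ^ 2 * n ^ kap)%N.
Proof.
move=> xn; elim: kap => [|kap IH].
  by rewrite ffactn1 !expn0 expn1 leq_addr.
have fle : (x ^_ kap.+1 <= n ^ kap.+1)%N.
  by apply: leq_trans (ffact_le_expn _ _) _; rewrite leq_exp2r.
have xx : (x * x ^_ kap.+1 <= x ^_ kap.+2 + kap.+1 * x ^_ kap.+1)%N.
  rewrite [in X in (_ <= X + _)%N]ffactnSr mulnC [(kap.+1 * _)%N]mulnC -mulnDr leq_mul2l.
  by apply/orP; right; lia.
rewrite expnS; apply: leq_trans (leq_mul (leqnn x) IH) _.
rewrite mulnDr; apply: leq_trans (leq_add xx (leqnn _)) _.
rewrite -addnA leq_add2l.
have h1 : (x * (kap.+1 ^ 2 * n ^ kap) <= kap.+1 ^ 2 * n ^ kap.+1)%N.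
  by rewrite mulnCA leq_mul2l [(n ^ kap.+1)%N]expnS; apply/orP; right; apply: leq_mul.
apply: leq_trans (leq_add (leq_mul (leqnn kap.+1) fle) h1) _.
rewrite -mulnDl leq_mul2r; apply/orP; right; rewrite !expnS expn0; nia.
Qed.

Lemma card_color_class_le (n : nat) (D : finType) (s : {ffun 'I_n -> D}) (c : D) :
  (#|color_class s c| <= n)%N.
Proof. by rewrite -[X in (_ <= X)%N]card_ord max_card. Qed.

Lemma sum_color_class (n : nat) (D : finType) (s : {ffun 'I_n -> D}) :
  (\sum_c #|color_class s c|)%N = n.
Proof.
rewrite -[RHS]card_ord -sum1_card (partition_big s xpredT) //=.
by apply: eq_bigr => c _; rewrite -sum1_card; apply: eq_bigl => v; rewrite inE.
Qed.

Lemma freq_ge0 (R : realType) (n : nat) (D : finType) (s : {ffun 'I_n -> D}) c :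
  0 <= freq R s c.
Proof. exact: divr_ge0. Qed.

Lemma sum_freq (R : realType) (n : nat) (D : finType) (s : {ffun 'I_n -> D}) :
  (0 < n)%N -> \sum_c freq R s c = 1.
Proof.
by move=> n0; rewrite -mulr_suml -natr_sum sum_color_class divff // pnatr_eq0 -lt0n.
Qed.

Lemma freq_le1 (R : realType) (n : nat) (D : finType) (s : {ffun 'I_n -> D}) c :
  (0 < n)%N -> freq R s c <= 1.
Proof.
move=> n0; rewrite /freq ler_pdivrMr ?ltr0n // mul1r ler_nat.
exact: card_color_class_le.
Qed.

Lemma near_large_nat (R : realType) (K : R) : \forall n \near \oo%classic, K <= n%:R.
Proof. by near=> n; near: n; exact: nbhs_infty_ger. Unshelve. all: by end_near. Qed.

Lemma mono_frac_approx (R : realType) (kap : nat) (D : finType) (eta : R) :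
  (0 < kap)%N -> 0 < eta ->
  \forall n \near \oo%classic, forall s : {ffun 'I_n -> D},
    `|mono_frac R kap s - \sum_c freq R s c ^+ kap| <= eta.
Proof.
case: kap => // kap _ eta0.
near=> n => s.
have K1 : ((kap.+1 ^ 2)%:R * 2 + 1 : R) <= n%:R.
  by near: n; apply: near_large_nat.
have K2 : ((#|D| * kap.+1 ^ 2)%:R / eta : R) <= n%:R.
  by near: n; apply: near_large_nat.
have K3 : ((2 * kap.+1 ^ 2)%:R / eta : R) <= n%:R.
  by near: n; apply: near_large_nat.
have kk : 0 <= (kap.+1 ^ 2)%:R :> R by [].
have n0 : 0 < n%:R :> R by lra.
have n0' : (0 < n)%N by rewrite -(ltr0n R).
set S := \sum_c _.
have S0 : 0 <= S by apply: sumr_ge0 => c _; apply: exprn_ge0; exact: freq_ge0.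
have S1 : S <= 1.
  rewrite -(sum_freq R s n0'); apply: ler_sum => c _.
  by rewrite exprS ler_piMr ?freq_ge0 // exprn_ile1 ?freq_ge0 ?freq_le1.
(* Powers and falling factorials of numbers up to [n] differ by at most [a * n%:R ^+ kap.+1]. The
   numerator has [#|D|] such errors and the denominator one. *)
set a : R := (kap.+1 ^ 2)%:R / n%:R.
have a0 : 0 <= a by apply: divr_ge0.
have a2 : a <= 1 / 2 by rewrite /a ler_pdivrMr //; lra.
have np : 0 < n%:R ^+ kap.+1 :> R by apply: exprn_gt0.
have nE : n%:R ^+ kap = n%:R ^+ kap.+1 / n%:R :> R by rewrite exprSr mulfK // gt_eqF.
have low x : (x <= n)%N -> x%:R ^+ kap.+1 - a * n%:R ^+ kap.+1 <= (x ^_ kap.+1)%:R :> R.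
  move=> xn; have := expn_ffact_le kap xn; rewrite -(ler_nat R) natrD natrM !natrX nE.
  by rewrite /a natrX lerBlDr; lra.
have upp x : (x ^_ kap.+1)%:R <= x%:R ^+ kap.+1 :> R.
  by rewrite -natrX ler_nat ffact_le_expn.
pose F : R := \sum_c (#|color_class s c| ^_ kap.+1)%:R.
have fE : mono_frac R kap.+1 s = F / (n ^_ kap.+1)%:R.
  have -> : F = (\sum_c 'C(#|color_class s c|, kap.+1))%:R * kap.+1`!%:R.
    rewrite /F natr_sum mulr_suml; apply: eq_bigr => c _.
    by rewrite -natrM bin_ffact.
  by rewrite /mono_frac -bin_ffact natrM -mulf_div divff ?mulr1.
have SE : S * n%:R ^+ kap.+1 = \sum_c #|color_class s c|%:R ^+ kap.+1.
  rewrite /S mulr_suml; apply: eq_bigr => c _.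
  by rewrite /freq expr_div_n mulfVK // gt_eqF.
have F1 : F <= S * n%:R ^+ kap.+1 by rewrite SE; apply: ler_sum.
have F2 : (S - #|D|%:R * a) * n%:R ^+ kap.+1 <= F.
  rewrite mulrBl SE /F.
  have -> : #|D|%:R * a * n%:R ^+ kap.+1 = \sum_(c : D) a * n%:R ^+ kap.+1.
    by rewrite sumr_const -mulrA mulr_natl.
  rewrite -sumrB; apply: ler_sum => c _; apply: low; exact: card_color_class_le.
have n1 := low n (leqnn n); have n2 := upp n.
have nf0 : 0 < (n ^_ kap.+1)%:R :> R.
  apply: lt_le_trans n1; rewrite -{1}[n%:R ^+ kap.+1]mul1r -mulrBl mulr_gt0 //; lra.
have F0 : 0 <= F by apply: sumr_ge0.
have aD : #|D|%:R * a <= eta.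
  by rewrite /a mulrA -natrM ler_pdivrMr // mulrC -ler_pdivrMr.
have a3 : 2 * a <= eta.
  by rewrite /a mulrA -natrM ler_pdivrMr // mulrC -ler_pdivrMr.
rewrite ler_norml fE; apply/andP; split.
  rewrite lerBrDr ler_pdivlMr //.
  have : (S - eta) * (n ^_ kap.+1)%:R <= (S - #|D|%:R * a) * n%:R ^+ kap.+1 \/ S - eta < 0.
    case: (ltrP (S - eta) 0) => h; [by right|left].
    apply: ler_pM => //; lra.
  case=> h; last by apply: le_trans F0; rewrite mulrC pmulr_rle0 //; lra.
  by rewrite addrC; apply: le_trans h F2.
rewrite lerBlDr ler_pdivrMr //; apply: (le_trans F1).
apply: (@le_trans _ _ ((eta + S) * ((1 - a) * n%:R ^+ kap.+1))); last first.
  apply: ler_wpM2l; [lra | by rewrite mulrBl mul1r].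
rewrite mulrA; apply: ler_wpM2r; first exact: ltW.
have : 0 <= (eta - 2 * a) * (1 - a) by apply: mulr_ge0; lra.
have : 0 <= a * (1 - S) by apply: mulr_ge0; lra.
have : 0 <= a * (1 - 2 * a) by apply: mulr_ge0; lra.
nra.
Unshelve. all: by end_near. Qed.

Lemma bernoulli_ineq (R : realType) (x : R) (k : nat) : 0 <= x ->
  1 + k%:R * (x - 1) <= x ^+ k.
Proof.
move=> x0; elim: k => [|k IH]; first by rewrite mul0r addr0 expr0.
rewrite exprS; apply: le_trans (ler_wpM2l x0 IH).
rewrite -natr1; have : 0 <= k%:R * (x - 1) ^+ 2 :> R by rewrite mulr_ge0 // sqr_ge0.
by rewrite expr2; lra.
Qed.

(** Bernoulli's inequality at the points [p c * #|D|%:R]: the linear terms sum to zero because [p]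
    sums to 1. *)
Lemma power_mean (R : realType) (D : finType) (p : D -> R) (k : nat) :
  (0 < #|D|)%N -> (forall c, 0 <= p c) -> \sum_c p c = 1 ->
  #|D|%:R / #|D|%:R ^+ k <= \sum_c p c ^+ k.
Proof.
move=> D0 p0 p1; have q0 : 0 < #|D|%:R :> R by rewrite ltr0n.
rewrite ler_pdivrMr ?exprn_gt0 // mulr_suml.
apply: (@le_trans _ _ (\sum_c (1 + k%:R * (p c * #|D|%:R - 1)))).
  rewrite big_split /= -mulr_sumr sumrB -mulr_suml p1 sumr_const mul1r.
  by rewrite subrr mulr0 addr0.
by apply: ler_sum => c _; rewrite -exprMn; apply: bernoulli_ineq; rewrite mulr_ge0 // ltW.
Qed.

(** The point is that [C] does not depend on [xi], so the tolerance can be chosen after it. *)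
Lemma exprn_perturb (R : realType) (a : R) (j : nat) : 0 <= a ->
  exists2 C : R, 0 <= C & forall xi : R, 0 <= xi <= 1 -> (a + xi) ^+ j <= a ^+ j + xi * C.
Proof.
move=> a0; elim: j => [|j [C C0 IH]].
  by exists 0 => // xi _; rewrite !expr0 mulr0 addr0.
exists (a ^+ j + (a + 1) * C).
  by apply: addr_ge0; [exact: exprn_ge0 | apply: mulr_ge0 => //; lra].
move=> xi xi01; have /andP[x0 x1] := xi01.
rewrite exprS; apply: (@le_trans _ _ ((a + xi) * (a ^+ j + xi * C))).
  by apply: ler_wpM2l; [lra | exact: IH].
rewrite exprS.
have : 0 <= (1 - xi) * xi * C by apply: mulr_ge0 => //; apply: mulr_ge0; lra.
by lra.
Qed.

Lemma balanced_freq (R : realType) (xi : R) (n : nat) (D : finType)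
    (s : {ffun 'I_n -> D}) (c : D) :
  (0 < n)%N -> balanced xi s -> freq R s c <= #|D|%:R^-1 + xi.
Proof.
by move=> n0 /forallP /(_ c); rewrite /freq ler_pdivrMr ?ltr0n.
Qed.

Lemma balanced_sum_freq (R : realType) (xi : R) (n kap : nat) (D : finType)
    (s : {ffun 'I_n -> D}) :
  (0 < n)%N -> balanced xi s ->
  \sum_c freq R s c ^+ kap.+1 <= (#|D|%:R^-1 + xi) ^+ kap.
Proof.
move=> n0 bs; rewrite -[leRHS]mul1r -[X in _ <= X * _](sum_freq R s n0) mulr_suml.
apply: ler_sum => c _; rewrite exprS; apply: ler_wpM2l; first exact: freq_ge0.
have h := balanced_freq c n0 bs; have := freq_ge0 R s c => f0.
by rewrite lerXn2r ?nnegrE //; lra.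
Qed.

Lemma sum_ffun_class_gen (R : realType) (n : nat) (D : finType) (c : D) (w : R) :
  \sum_(s : {ffun 'I_n -> D}) w ^+ #|color_class s c| = (#|D|%:R - 1 + w) ^+ n.
Proof.
transitivity (\prod_(i < n) \sum_(d : D) (if d == c then w else 1)).
  rewrite bigA_distr_bigA /=; apply: eq_bigr => s _.
  rewrite -big_mkcond /= prodr_const; congr (_ ^+ _).
  by apply: eq_card => v; rewrite !inE.
rewrite prodr_const card_ord; congr (_ ^+ _).
rewrite (bigD1 c) //= eqxx addrC; congr (_ + _).
rewrite (eq_bigr (fun=> 1)); last by move=> d /negbTE ->.
rewrite sumr_const.
by rewrite (eq_card (B := predC1 c)) // cardC1 -subn1 natrB //; apply/card_gt0P; exists c.
Qed.

Lemma card_unbalanced (R : realType) (D : finType) (xi : R) :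
  (0 < #|D|)%N -> 0 < xi <= 1 ->
  forall n, #|[set s : {ffun 'I_n -> D} | ~~ balanced xi s]|%:R <=
    #|D|%:R * (#|D|%:R ^+ n * expR (- (xi ^+ 2 / 8) * n%:R)) :> R.
Proof.
move=> D0 /andP[x0 x1] n; have q0 : 0 < #|D|%:R :> R by rewrite ltr0n.
have q1 : #|D|%:R^-1 <= 1 :> R by rewrite invf_le1 // ler1n.
have qi0 : 0 < #|D|%:R^-1 :> R by rewrite invr_gt0.
(* Exponential Markov with weight [w] per vertex of the class. The gain in the exponent is at least
   [nu * xi - 2 * nu ^+ 2], as [#|D|%:R^-1 + xi <= 2]. The choice [nu = xi / 4] maximises this, with
   value [xi ^+ 2 / 8]. *)
pose nu := xi / 4; pose w := 1 + nu.
have w1 : 1 <= w by rewrite /w /nu; lra.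
have lnw : nu - nu ^+ 2 <= ln w.
  have w0 : 0 < w by lra.
  have : 0 < w^-1 by rewrite invr_gt0.
  move=> wi; have := @le_ln1Dx R (w^-1 - 1).
  have -> : -1 < w^-1 - 1 by lra.
  rewrite addrC subrK lnV ?posrE // => /(_ isT) h2.
  have : nu - nu ^+ 2 <= 1 - w^-1; last by lra.
  have -> : w^-1 = 1 / w by rewrite mul1r.
  have : (nu - nu ^+ 2 - 1) * w <= -1.
    have : 0 <= nu ^+ 3 by apply: exprn_ge0; rewrite /nu; lra.
    by rewrite /w !exprS expr0; lra.
  by rewrite -ler_pdivlMr //; lra.
have one c : #|[set s : {ffun 'I_n -> D} | (#|D|%:R^-1 + xi) * n%:R < #|color_class s c|%:R]|%:R
    <= #|D|%:R ^+ n * expR (- (xi ^+ 2 / 8) * n%:R) :> R.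
  set B := [set s | _].
  have E : #|B|%:R * expR (ln w * ((#|D|%:R^-1 + xi) * n%:R)) <= (#|D|%:R - 1 + w) ^+ n.
    rewrite -(sum_ffun_class_gen n c w) -sum1_card natr_sum mulr_suml big_mkcond /=.
    apply: ler_sum => s _; case: ifP => [|_]; last by apply: exprn_ge0; lra.
    rewrite inE => h; rewrite mul1r -[X in _ <= X ^+ _]lnK ?posrE; last lra.
    rewrite -expRM_natl ler_expR mulrC; apply: ler_wpM2r; last exact: ltW.
    by apply: ln_ge0; lra.
  have E2 : (#|D|%:R - 1 + w) ^+ n <= #|D|%:R ^+ n * expR (nu / #|D|%:R * n%:R).
    rewrite [nu / _ * _]mulrC expRM_natl -exprMn; apply: lerXn2r; rewrite ?nnegrE.
    - by have : 1 <= #|D|%:R :> R; [rewrite ler1n | lra].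
    - by rewrite mulr_ge0 ?expR_ge0 // ltW.
    have -> : #|D|%:R - 1 + w = #|D|%:R * (1 + nu / #|D|%:R).
      by rewrite /w; field; rewrite gt_eqF.
    by apply: ler_wpM2l; [exact: ltW | exact: expR_ge1Dx].
  have := le_trans E E2; rewrite -ler_pdivlMr ?expR_gt0 // => h.
  apply: (le_trans h); rewrite -expRN -[leLHS]mulrA -expRD; apply: ler_wpM2l; first by apply: exprn_ge0; exact: ltW.
  rewrite ler_expR mulrA -mulNr -mulrDl; apply: ler_wpM2r => //.
  have : (nu - nu ^+ 2) * (#|D|%:R^-1 + xi) <= ln w * (#|D|%:R^-1 + xi).
    by apply: ler_wpM2r => //; lra.
  have : nu ^+ 2 * (#|D|%:R^-1 + xi) <= nu ^+ 2 * 2.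
    by apply: ler_wpM2l; [exact: sqr_ge0 | lra].
  rewrite /nu !expr2; lra.
have -> : [set s : {ffun 'I_n -> D} | ~~ balanced xi s] =
   \bigcup_(c : D) [set s : {ffun 'I_n -> D} | (#|D|%:R^-1 + xi) * n%:R < #|color_class s c|%:R].
  apply/setP => s; rewrite inE negb_forall; apply/existsP/bigcupP => [[c h]|[c _ h]]; exists c => //.
    by rewrite inE ltNge.
  by rewrite inE in h; rewrite -ltNge.
apply: (@le_trans _ _ (\sum_(c : D) (#|D|%:R ^+ n * expR (- (xi ^+ 2 / 8) * n%:R)))).
  apply: le_trans (ler_sum _ (fun c _ => one c)).
  rewrite -natr_sum ler_nat.
  elim/big_rec2: _ => [|c A B _ h]; first by rewrite cards0.
  by apply: leq_trans (leq_card_setU _ _) _; rewrite leq_add2l.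
by rewrite sumr_const mulr_natl.
Qed.

(** * The second moment of the number of solutions *)

(** The limiting probability that a random edge is not monochromatic under a balanced colouring,
    [1 - q ^ (1 - kap)] for [q] colours. By the power mean inequality no colouring does
    asymptotically better. *)
Definition edge_phi (R : realType) (D : finType) (kap : nat) : R :=
  1 - #|D|%:R / #|D|%:R ^+ kap.

Lemma edge_phi_gt0 (R : realType) (D : finType) (kap : nat) :
  (1 < #|D|)%N -> (1 < kap)%N -> 0 < edge_phi R D kap.
Proof.
move=> D1; case: kap => [|[|k]] // _.
have q0 : 0 < #|D|%:R :> R by rewrite ltr0n ltnW.
rewrite /edge_phi subr_gt0 ltr_pdivrMr ?exprn_gt0 // mul1r exprS.
by rewrite ltr_pMr // exprn_egt1 // ltr1n.
Qed.

Lemma edge_phi_le1 (R : realType) (D : finType) (kap : nat) : edge_phi R D kap <= 1.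
Proof. by rewrite /edge_phi lerBlDr lerDl divr_ge0 // exprn_ge0. Qed.

(* Every colouring of type [g / n] has the same probability under the product
   measure [g / n], and there are at most [n.+1 ^ #|X|] types. *)
Lemma sum_prod_freq_le (R : realType) (n : nat) (X : finType) :
  (0 < n)%N ->
  \sum_(f : {ffun 'I_n -> X}) \prod_v freq R f (f v) <= n.+1%:R ^+ #|X|.
Proof.
move=> n0.
pose ty (f : {ffun 'I_n -> X}) : {ffun X -> 'I_n.+1} :=
  [ffun x => inord #|color_class f x|].
have tyE f x : ty f x = #|color_class f x| :> nat.
  by rewrite ffunE inordK // ltnS card_color_class_le.
rewrite (partition_big ty xpredT) //=.
apply: (@le_trans _ _ (\sum_(g : {ffun X -> 'I_n.+1}) 1)); last first.
  by rewrite sumr_const card_ffun card_ord -natrX.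
apply: ler_sum => g _.
case: (boolP (\sum_x (g x : nat) == n)%N) => [/eqP gn|gn]; last first.
  rewrite big_pred0 ?ler01 // => f; apply/negbTE; apply: contra gn => /eqP <-.
  by apply/eqP; rewrite -[RHS](sum_color_class f); apply: eq_bigr => x _; rewrite tyE.
apply: (@le_trans _ _ (\sum_(f : {ffun 'I_n -> X}) \prod_v ((g (f v) : nat)%:R / n%:R))).
  rewrite big_mkcond; apply: ler_sum => f _; case: ifP => [/eqP <-|_].
    by apply: ler_prod => v _; rewrite /freq tyE lexx andbT divr_ge0.
  by apply: prodr_ge0 => v _; rewrite divr_ge0.
rewrite -(bigA_distr_bigA (fun (v : 'I_n) x => (g x : nat)%:R / n%:R)) /=.
rewrite prodr_const -mulr_suml -natr_sum gn divff ?expr1n //.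
by rewrite pnatr_eq0 -lt0n.
Qed.

(** For [Q = #|X|] the left side is the exponential of [n] times the entropy of the type relative to
    the uniform law, and the right side is a likelihood that [sum_prod_freq_le] sums over all
    colourings. The two lemmas together replace Stirling's formula. *)
Lemma expR_sum_freq (R : realType) (n : nat) (X : finType) (f : {ffun 'I_n -> X})
    (Q : R) :
  (0 < n)%N -> 0 < Q ->
  expR (\sum_x #|color_class f x|%:R * ln (Q * freq R f x)) =
    Q ^+ n * \prod_v freq R f (f v).
Proof.
move=> n0 Q0.
have -> : Q ^+ n * \prod_v freq R f (f v) = \prod_v (Q * freq R f (f v)).
  by rewrite [RHS]big_split /= prodr_const card_ord.
rewrite (partition_big f xpredT) //= expR_sum; apply: eq_bigr => x _.
rewrite expRM_natl.
transitivity (\prod_(v in color_class f x) (Q * freq R f x)).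
  rewrite prodr_const; case: (posnP #|color_class f x|) => [->|c0] //.
  rewrite lnK // posrE mulr_gt0 // /freq divr_gt0 ?ltr0n //.
by apply: eq_big => [v|v]; rewrite inE // => /eqP ->.
Qed.

Lemma near_poly_le_expR (R : realType) (j : nat) (eta : R) : 0 < eta ->
  \forall n \near \oo%classic, n.+1%:R ^+ j <= expR (eta * n%:R) :> R.
Proof.
move=> eta0.
have [->|j0] := posnP j.
  by near=> n; rewrite expr0 -expR0 ler_expR mulr_ge0 // ltW.
have jR : 0 < j%:R :> R by rewrite ltr0n.
near=> n.
pose a : R := eta / j%:R.
have a0 : 0 < a by rewrite divr_gt0.
have -> : eta * n%:R = (a * n%:R) *+ j.
  by rewrite -mulr_natl /a; field; rewrite gt_eqF.
rewrite -[X in expR X]mulr_natl expRM_natl; apply: lerXn2r; rewrite ?nnegrE ?expR_ge0 //.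
have an0 : 0 <= a * n%:R / 2 by rewrite divr_ge0 // mulr_ge0 // ltW.
have K : 4 / a ^+ 2 <= n%:R by near: n; exact: near_large_nat.
have h : 1 + a * n%:R / 2 <= expR (a * n%:R / 2) by exact: expR_ge1Dx.
have -> : a * n%:R = (a * n%:R / 2) *+ 2 by rewrite mulr2n; lra.
rewrite -[X in expR X]mulr_natl expRM_natl.
apply: (@le_trans _ _ ((1 + a * n%:R / 2) ^+ 2)); last first.
  by apply: lerXn2r; rewrite ?nnegrE ?expR_ge0 //; lra.
have K2 : 4 <= a ^+ 2 * n%:R by rewrite mulrC -ler_pdivrMr ?exprn_gt0.
have : 4 * n%:R <= a ^+ 2 * n%:R * n%:R by apply: ler_wpM2r.
rewrite -natr1 !expr2 in K2 *.
have : 0 <= a * n%:R by lra.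
lra.
Unshelve. all: by end_near. Qed.

Lemma allowed_frac_ge0 (R : realType) (n kap : nat) (A : hypergraph n) :
  0 <= #|A|%:R / 'C(n, kap)%:R :> R.
Proof. exact: divr_ge0. Qed.

Lemma near_nat_large (K : nat) : \forall n \near \oo%classic, (K <= n)%N.
Proof. exact: nbhs_infty_ge. Qed.

Lemma allowed_frac_bounds (R : realType) (kap : nat) (D : finType) (eta : R) :
  (1 < #|D|)%N -> (1 < kap)%N -> 0 < eta ->
  exists2 xi0 : R, 0 < xi0 & forall xi : R, 0 < xi <= xi0 ->
  \forall n \near \oo%classic, forall s : {ffun 'I_n -> D},
    #|allowed kap s|%:R / 'C(n, kap)%:R <= edge_phi R D kap + eta /\
    (balanced xi s -> edge_phi R D kap - eta <= #|allowed kap s|%:R / 'C(n, kap)%:R).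
Proof.
move=> D1; case: kap => [|kap] // kap1 eta0.
have q0 : 0 < #|D|%:R :> R by rewrite ltr0n ltnW.
have qi0 : 0 <= #|D|%:R^-1 :> R by rewrite invr_ge0 ltW.
have [C C0 HC] := exprn_perturb kap qi0.
have eta2 : 0 < eta / 2 by rewrite divr_gt0.
exists (Num.min 1 (eta / 2 / (C + 1))).
  by rewrite lt_min ltr01 divr_gt0 //; lra.
move=> xi; rewrite le_min => /and3P[x0 x1 x2].
near=> n.
have n0 : (kap.+1 <= n)%N by near: n; exact: near_nat_large.
have ap0 : forall s : {ffun 'I_n -> D},
    `|mono_frac R kap.+1 s - \sum_c freq R s c ^+ kap.+1| <= eta / 2.
  by near: n; exact: mono_frac_approx.
move=> s; have ap := ap0 s.
rewrite allowed_frac ?n0 //.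
have D0 : (0 < #|D|)%N by exact: ltnW.
have n0' : (0 < n)%N by exact: leq_trans n0.
have := power_mean kap.+1 D0 (freq_ge0 R s) (sum_freq R s n0').
move: ap; rewrite ler_norml => /andP[a1 a2] pm.
rewrite /edge_phi; split; first by lra.
move=> bs; have := balanced_sum_freq kap n0' bs.
have := HC xi; rewrite (ltW x0) x1 => /(_ isT).
have -> : #|D|%:R / #|D|%:R ^+ kap.+1 = #|D|%:R^-1 ^+ kap :> R.
  by rewrite exprS invfM mulrA divff ?gt_eqF // mul1r exprVn.
have : xi * C <= eta / 2.
  rewrite ler_pdivlMr in x2; last lra.
  by have := ltW x0; lra.
lra.
Unshelve. all: by end_near. Qed.

Lemma near_linear_le (R : realType) (r b : R) (m : nat -> nat) :
  (forall n, (m n)%:R <= r * n%:R + 1) -> r < b ->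
  \forall n \near \oo%classic, (m n)%:R <= b * n%:R.
Proof.
move=> hm rb; near=> n; apply: (le_trans (hm n)).
have : 1 / (b - r) <= n%:R by near: n; exact: near_large_nat.
by rewrite ler_pdivrMr; lra.
Unshelve. all: by end_near. Qed.

Lemma first_moment (R : realType) (kap : nat) (D : finType) (r eta : R)
    (m : nat -> nat) :
  (1 < #|D|)%N -> (1 < kap)%N -> 0 <= r -> 0 < eta ->
  (forall n, (m n)%:R <= r * n%:R + 1) ->
  exists2 xi0 : R, 0 < xi0 & forall xi : R, 0 < xi <= xi0 ->
  \forall n \near \oo%classic, forall s : {ffun 'I_n -> D}, forall h, (h <= m n)%N ->
    (#|allowed kap s|%:R / 'C(n, kap)%:R) ^+ h
      <= expR (eta * n%:R) * edge_phi R D kap ^+ h /\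
    (balanced xi s -> expR (- (eta * n%:R)) * edge_phi R D kap ^+ h <=
        (#|allowed kap s|%:R / 'C(n, kap)%:R) ^+ h).
Proof.
move=> D1 k1 r0 eta0 hm.
set phi := edge_phi R D kap; have phi0 : 0 < phi by exact: edge_phi_gt0.
(* [e1 / phi] is the relative error per edge. The lower bound uses [1 - a >= exp (- 2 a)] for
   [a <= 1 / 2], hence [phi / 2] and the factor 2. Over at most [(r + 1) n] edges the total is
   [eta n]. *)
pose e1 := Num.min (phi / 2) (eta * phi / (2 * (r + 1))).
have r1 : 0 < 2 * (r + 1) by lra.
have e10 : 0 < e1.
  by rewrite lt_min; apply/andP; split; apply: divr_gt0 => //; exact: mulr_gt0.
have [xi0 x00 H] := allowed_frac_bounds D1 k1 e10.
exists xi0 => // xi hxi; near=> n.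
have H12 : forall s : {ffun 'I_n -> D}, #|allowed kap s|%:R / 'C(n, kap)%:R <= phi + e1 /\
    (balanced xi s -> phi - e1 <= #|allowed kap s|%:R / 'C(n, kap)%:R).
  by near: n; exact: H.
have mn : (m n)%:R <= (r + 1) * n%:R by near: n; apply: near_linear_le hm _; lra.
move=> s h hmn; have [h1 h2] := H12 s.
have e1p : e1 <= phi / 2 by rewrite ge_min lexx.
have e1e : e1 <= eta * phi / (2 * (r + 1)) by rewrite ge_min lexx orbT.
have hn : h%:R <= (r + 1) * n%:R by apply: le_trans mn; rewrite ler_nat.
set x := _ / _ in h1 h2 *; have x0 : 0 <= x by exact: allowed_frac_ge0.
have key : h%:R * (2 * e1 / phi) <= eta * n%:R.
  have : 2 * e1 / phi <= eta / (r + 1).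
    rewrite ler_pdivrMr //; apply: (@le_trans _ _ (2 * (eta * phi / (2 * (r + 1))))); first lra.
    by rewrite le_eqVlt; apply/orP; left; apply/eqP; field; lra.
  move=> hh; apply: (@le_trans _ _ ((r + 1) * n%:R * (eta / (r + 1)))).
    apply: ler_pM => //; apply: divr_ge0; lra.
  by rewrite le_eqVlt; apply/orP; left; apply/eqP; field; lra.
split.
  apply: (@le_trans _ _ ((expR (e1 / phi) * phi) ^+ h)).
    apply: lerXn2r; rewrite ?nnegrE //.
      by rewrite mulr_ge0 ?expR_ge0 // ltW.
    apply: (le_trans h1).
    have -> : phi + e1 = (1 + e1 / phi) * phi by field; rewrite gt_eqF.
    by apply: ler_wpM2r; [exact: ltW | exact: expR_ge1Dx].
  rewrite exprMn; apply: ler_wpM2r; first by rewrite exprn_ge0 // ltW.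
  rewrite -expRM_natl ler_expR; apply: le_trans key.
  apply: ler_wpM2l => //; rewrite -mulrA; have : 0 <= e1 / phi by rewrite divr_ge0 ?ltW.
  lra.
move=> /h2 h3.
apply: (@le_trans _ _ ((expR (- (2 * e1 / phi)) * phi) ^+ h)).
  rewrite exprMn; apply: ler_wpM2r; first by rewrite exprn_ge0 // ltW.
  by rewrite -expRM_natl ler_expR mulrN lerN2.
apply: lerXn2r; rewrite ?nnegrE //.
  by rewrite mulr_ge0 ?expR_ge0 // ltW.
apply: le_trans h3.
set a := e1 / phi; have aE : 2 * e1 / phi = 2 * a by rewrite /a mulrA.
have e1E : e1 = a * phi by rewrite /a mulfVK // gt_eqF.
have a0 : 0 <= a by rewrite divr_ge0 ?ltW.
have a1 : a <= 1 / 2 by rewrite /a ler_pdivrMr //; lra.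
rewrite aE e1E -{2}[phi]mul1r -mulrBl; apply: ler_wpM2r; first exact: ltW.
rewrite expRN invf_ple ?posrE ?expR_gt0 //; last lra.
apply: le_trans (expR_ge1Dx _).
rewrite -[(1 - a)^-1]mul1r ler_pdivrMr; last lra.
have : 0 <= a * (1 - 2 * a) by apply: mulr_ge0; lra.
lra.
Unshelve. all: by end_near. Qed.

Lemma sum_pairing (R : nmodType) (n : nat) (D1 D2 : finType)
    (F : {ffun 'I_n -> D1} -> {ffun 'I_n -> D2} -> R) (G : {ffun 'I_n -> D1 * D2} -> R) :
  (forall s t, F s t = G (pairing s t)) ->
  \sum_s \sum_t F s t = \sum_f G f.
Proof.
move=> FG; rewrite pair_big /= [RHS](reindex (fun st => pairing st.1 st.2)) /=.
  by apply: eq_bigr => -[s t] _; exact: FG.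
exists (fun f => ([ffun v => (f v).1], [ffun v => (f v).2])).
  by move=> [s t] _ /=; congr pair; apply/ffunP => v; rewrite !ffunE.
by move=> f _; apply/ffunP => v; rewrite !ffunE; case: (f v).
Qed.

(* The overlap [p] of a pair of balanced colourings contributes
   [sum_x (p x)^kap - q^(2-2 kap)] to the pair probability; this is dominated by
   the entropy loss cell by cell. *)
Lemma second_moment (R : realType) (kap : nat) (D : finType) (r lam smax eta : R)
    (m : nat -> nat) :
  (1 < #|D|)%N -> (1 < kap)%N -> 0 <= r -> 0 < eta ->
  r * #|D|%:R ^+ 2 < lam * edge_phi R D kap ^+ 2 * (#|D|%:R ^+ 2) ^+ kap ->
  #|D|%:R < smax ->
  (forall s : R, 0 <= s <= smax ->
     lam * (s ^+ kap - 1 - kap%:R * (s - 1)) <= s * ln s - s + 1) ->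
  (forall n, (m n)%:R <= r * n%:R + 1) ->
  exists2 xi0 : R, 0 < xi0 & forall xi : R, 0 < xi <= xi0 ->
  \forall n \near \oo%classic,
    \sum_(s : {ffun 'I_n -> D} | balanced xi s) \sum_(t : {ffun 'I_n -> D} | balanced xi t)
       (#|allowed kap s :&: allowed kap t|%:R / 'C(n, kap)%:R) ^+ m n
    <= expR (eta * n%:R) * edge_phi R D kap ^+ (2 * m n) * #|D|%:R ^+ (2 * n).
Proof.
move=> D1 k1 r0 eta0 hlam hs hpt hm.
set q : R := #|D|%:R in hlam hs *.
have q0 : 0 < q by rewrite ltr0n ltnW.
set phi := edge_phi R D kap in hlam *; have phi0 : 0 < phi by exact: edge_phi_gt0.
(* The density that [lam] can still dominate; the strict inequality [r < r'] absorbs the rounding of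
   [m n]. *)
pose r' := lam * phi ^+ 2 * (q ^+ 2) ^+ kap / q ^+ 2.
have rr' : r < r' by rewrite /r' ltr_pdivlMr // exprn_gt0.
(* Three monochromatic fractions are approximated within [e1] each, which costs half of [eta]; the
   other half pays for the number of types. *)
pose e1 := eta * phi ^+ 2 / (6 * (r + 1)).
have p2 : 0 < phi ^+ 2 by exact: exprn_gt0.
have e10 : 0 < e1 by rewrite /e1 divr_gt0 ?mulr_gt0 //; lra.
(* A cell lies inside a class of the first colouring, so its frequency times [q ^+ 2] is at most
   [q + q ^+ 2 * xi]. This must not exceed [smax]. *)
exists ((smax - q) / q ^+ 2); first by rewrite divr_gt0 ?exprn_gt0 //; lra.
move=> xi /andP[x0 x1]; near=> n.
have nk : (kap <= n)%N by near: n; exact: near_nat_large.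
have n0 : (0 < n)%N by apply: leq_trans nk; exact: ltnW.
have nR : 0 < n%:R :> R by rewrite ltr0n.
have m1 : (m n)%:R <= (r + 1) * n%:R by near: n; apply: near_linear_le hm _; lra.
have m2 : (m n)%:R <= r' * n%:R by near: n; apply: near_linear_le hm rr'.
have ap1 : forall s : {ffun 'I_n -> D},
    `|mono_frac R kap s - \sum_c freq R s c ^+ kap| <= e1.
  by near: n; apply: mono_frac_approx => //; exact: ltnW.
have ap2 : forall s : {ffun 'I_n -> D * D},
    `|mono_frac R kap s - \sum_c freq R s c ^+ kap| <= e1.
  by near: n; apply: mono_frac_approx => //; exact: ltnW.
have poly : n.+1%:R ^+ #|{: D * D}| <= expR (eta / 2 * n%:R) :> R.
  by near: n; apply: near_poly_le_expR; rewrite divr_gt0.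
have cD : #|{: D * D}|%:R = q ^+ 2 :> R by rewrite card_prod natrM expr2.
pose G (f : {ffun 'I_n -> D * D}) : R := phi ^+ (2 * m n) * expR (eta / 2 * n%:R) *
   (q ^+ (2 * n) * \prod_v freq R f (f v)).
have G0 f : 0 <= G f.
  have : 0 <= \prod_v freq R f (f v) by apply: prodr_ge0 => v _; exact: freq_ge0.
  move=> h; apply: mulr_ge0; apply: mulr_ge0 => //; rewrite ?expR_ge0 //;
    by apply: exprn_ge0; exact: ltW.
have pt (s t : {ffun 'I_n -> D}) : balanced xi s -> balanced xi t ->
   (#|allowed kap s :&: allowed kap t|%:R / 'C(n, kap)%:R) ^+ m n <= G (pairing s t).
  move=> bs bt; set f := pairing s t.
  pose S := \sum_x freq R f x ^+ kap.
  pose Q2 := q ^+ 2 / (q ^+ 2) ^+ kap.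
  have D0 : (0 < #|D|)%N by exact: ltnW.
  have S0 : Q2 <= S.
    rewrite /Q2 -cD; apply: power_mean; rewrite ?card_prod ?muln_gt0 ?D0 //.
      exact: freq_ge0.
    exact: sum_freq.
  have up : #|allowed kap s :&: allowed kap t|%:R / 'C(n, kap)%:R <=
      phi ^+ 2 + (S - Q2) + 3 * e1.
    rewrite allowed_pair_frac ?nk ?(ltnW k1) //.
    have := ap1 s; have := ap1 t; have := ap2 f.
    rewrite !ler_norml -/S => /andP[_ u1] /andP[u2 _] /andP[u3 _].
    have := power_mean kap D0 (freq_ge0 R s) (sum_freq R s n0).
    have := power_mean kap D0 (freq_ge0 R t) (sum_freq R t n0).
    have -> : phi ^+ 2 = 1 - 2 * (q / q ^+ kap) + Q2.
      rewrite /phi /edge_phi -/q /Q2 -exprM mulnC exprM.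
      by field; rewrite gt_eqF ?exprn_gt0.
    rewrite -/q; lra.
  apply: (@le_trans _ _ ((phi ^+ 2 * expR ((S - Q2 + 3 * e1) / phi ^+ 2)) ^+ m n)).
    apply: lerXn2r; rewrite ?nnegrE ?allowed_frac_ge0 //.
      by rewrite mulr_ge0 ?expR_ge0 // ltW.
    apply: (le_trans up).
    have -> : phi ^+ 2 + (S - Q2) + 3 * e1 = phi ^+ 2 * (1 + (S - Q2 + 3 * e1) / phi ^+ 2).
      by field; rewrite gt_eqF.
    by apply: ler_wpM2l; [exact: ltW | exact: expR_ge1Dx].
  rewrite exprMn -exprM /G -mulrA; apply: ler_wpM2l; first by rewrite exprn_ge0 // ltW.
  rewrite -expRM_natl exprM -(expR_sum_freq f n0) ?exprn_gt0 // -expRD ler_expR.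
  have -> : (m n)%:R * ((S - Q2 + 3 * e1) / phi ^+ 2) =
     (m n)%:R * ((S - Q2) / phi ^+ 2) + (m n)%:R * (3 * e1 / phi ^+ 2).
    by rewrite -mulrDr -mulrDl.
  rewrite addrC; apply: lerD.
    apply: (@le_trans _ _ ((r + 1) * n%:R * (3 * e1 / phi ^+ 2))).
      by apply: ler_wpM2r => //; apply: divr_ge0; [lra | exact: ltW].
    by rewrite le_eqVlt; apply/orP; left; apply/eqP; rewrite /e1; field; rewrite gt_eqF //; lra.
  apply: (@le_trans _ _ (r' * n%:R * ((S - Q2) / phi ^+ 2))).
    by apply: ler_wpM2r => //; rewrite divr_ge0 ?subr_ge0 // ltW.
  pose sx x := q ^+ 2 * freq R f x.
  have sx0 x : 0 <= sx x <= smax.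
    rewrite mulr_ge0 ?freq_ge0 ?exprn_ge0 ?(ltW q0) //=.
    have : freq R f x <= q^-1 + xi.
      apply: le_trans (balanced_freq x.1 n0 bs); rewrite /freq ler_pM2r ?invr_gt0 //.
      rewrite ler_nat; apply: subset_leq_card; apply/subsetP => v.
      by rewrite !inE ffunE => /eqP <-.
    rewrite -(ler_pM2l (exprn_gt0 2 q0)) => h; apply: (le_trans h).
    rewrite mulrDr expr2 mulfK ?gt_eqF // -expr2.
    by have := x1; rewrite ler_pdivlMr ?exprn_gt0 // mulrC; lra.
  (* The linear terms [kap%:R * (sx x - 1)] are free, since the rescaled frequencies have mean 1.
     Subtracting them makes both sides of the pointwise inequality vanish to second order at 1. *)
  have -> : r' * n%:R * ((S - Q2) / phi ^+ 2) =
     n%:R / q ^+ 2 * \sum_x (lam * (sx x ^+ kap - 1 - kap%:R * (sx x - 1))).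
    rewrite -mulr_sumr !sumrB -mulr_sumr sumrB /sx -mulr_sumr sum_freq //.
    rewrite sumr_const cD mulr1 subrr mulr0 subr0.
    rewrite (eq_bigr (fun x => (q ^+ 2) ^+ kap * freq R f x ^+ kap)); last first.
      by move=> x _; rewrite exprMn.
    rewrite -mulr_sumr -/S /r' /Q2; field.
    by rewrite !gt_eqF ?exprn_gt0.
  apply: (@le_trans _ _ (n%:R / q ^+ 2 * \sum_x (sx x * ln (sx x) - sx x + 1))).
    apply: ler_wpM2l; first by rewrite divr_ge0 // exprn_ge0 // ltW.
    by apply: ler_sum => x _; apply: hpt.
  rewrite big_split /= sumrB /sx -mulr_sumr sum_freq // sumr_const cD mulr1 subrK.
  rewrite mulr_sumr le_eqVlt; apply/orP; left; apply/eqP/eq_bigr => x _.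
  by rewrite /freq; field; rewrite !gt_eqF ?exprn_gt0.
apply: (@le_trans _ _ (\sum_s \sum_t G (pairing s t))).
  rewrite big_mkcond; apply: ler_sum => s _; case: ifP => bs; last first.
    by apply: sumr_ge0.
  rewrite big_mkcond; apply: ler_sum => t _; case: ifP => bt //.
  exact: pt.
rewrite (sum_pairing (G := G)) // /G -mulr_sumr -mulr_sumr.
have -> : expR (eta * n%:R) = expR (eta / 2 * n%:R) * expR (eta / 2 * n%:R).
  by rewrite -expRD -mulrDl; congr (expR (_ * _)); lra.
set u := expR (eta / 2 * n%:R) in poly *; set Sf := \sum_i _.
have -> : u * u * phi ^+ (2 * m n) * q ^+ (2 * n) =
  phi ^+ (2 * m n) * u * (q ^+ (2 * n) * u) by ring.
apply: ler_wpM2l; first by rewrite mulr_ge0 ?expR_ge0 ?exprn_ge0 // ltW.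
apply: ler_wpM2l; first by rewrite exprn_ge0 // ltW.
exact: le_trans (sum_prod_freq_le _ _ n0) poly.
Unshelve. all: by end_near. Qed.

(** * From the planted to the uniform pair *)

(** Each [m]-set has [m!] orderings. Edge sets are compared with tuples of independent edges because
    the blow-up inequality lives on product measures. *)
Lemma card_uniq_tuples_onto (X : finType) (m : nat) (Om : {set X}) (P : pred {set X}) :
  (m`! * #|[set E : {set X} | [&& E \subset Om, #|E| == m & P E]]| <=
   #|[set x : m.-tuple X | [&& uniq x, all (mem Om) x & P [set y in x]]]|)%N.
Proof.
set F := [set E | _]; set G := [set x | _].
rewrite mulnC -sum_nat_const.
rewrite -[X in (_ <= X)%N]sum1_card (partition_big (fun x : m.-tuple X => [set y in x]) xpredT) //=.
rewrite big_mkcond /=; apply: leq_sum => E _; case: ifP => // EF.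
move: EF; rewrite inE => /and3P[EO /eqP cE PE].
rewrite -ffactnn -{1}cE -(card_uniq_tuples m (mem E)) sum1_card.
apply: subset_leq_card; apply/subsetP => x; rewrite !inE => /andP[xE ux].
have eE : [set y in x] = E.
  apply/eqP; rewrite eqEcard; apply/andP; split.
    by apply/subsetP => y; rewrite inE => yx; exact: (allP xE).
  by rewrite cardsE cE (card_uniqP ux) size_tuple.
apply/andP; split; last by apply/eqP.
rewrite inE ux eE PE andbT /=; apply/allP => y yx.
by apply: (subsetP EO); exact: (allP xE).
Qed.

Lemma sum_hamming_gen (R : realType) (n : nat) (D : finType) (t : {ffun 'I_n -> D}) (w : R) :
  \sum_(s : {ffun 'I_n -> D}) w ^+ hamming s t = (1 + (#|D|%:R - 1) * w) ^+ n.
Proof.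
transitivity (\prod_(i < n) \sum_(d : D) (if d != t i then w else 1)).
  rewrite bigA_distr_bigA /=; apply: eq_bigr => s _.
  rewrite -big_mkcond /= prodr_const; congr (_ ^+ _).
  by rewrite /hamming; apply: eq_card => v; rewrite !inE.
rewrite -[in RHS](card_ord n) -prodr_const; apply: eq_bigr => i _.
rewrite (bigD1 (t i)) //= eqxx; congr (_ + _).
rewrite (eq_bigr (fun=> w)); last by move=> d ->.
rewrite sumr_const (eq_card (B := predC1 (t i))) // cardC1 -[LHS]mulr_natl.
rewrite (_ : #|D|.-1%:R = #|D|%:R - 1) // -subn1 natrB //.
by apply/card_gt0P; exists (t i).
Qed.

(** Exponential Markov on the generating function of the distance. A small [w], and then [g] small
    in terms of [w], make the rate as small as desired. *)
Lemma card_hamming_ball (R : realType) (n : nat) (D : finType) (t : {ffun 'I_n -> D})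
    (w g : R) :
  0 < w <= 1 -> (0 < #|D|)%N ->
  #|[set s : {ffun 'I_n -> D} | (hamming s t)%:R <= g * n%:R]|%:R
    <= expR ((#|D|%:R * w - g * ln w) * n%:R).
Proof.
move=> /andP[w0 w1] D0; set B := [set s | _].
have lw : ln w <= 0 by exact: ln_le0.
have E : #|B|%:R * expR (ln w * (g * n%:R)) <= (1 + (#|D|%:R - 1) * w) ^+ n.
  rewrite -(sum_hamming_gen t w) -sum1_card natr_sum mulr_suml big_mkcond /=.
  apply: ler_sum => s _; case: ifP => [|_]; last by apply: exprn_ge0; exact: ltW.
  rewrite inE => h; rewrite mul1r -[X in _ <= X ^+ _]lnK ?posrE //.
  by rewrite -expRM_natl ler_expR mulrC; apply: ler_wnM2r.
have E2 : (1 + (#|D|%:R - 1) * w) ^+ n <= expR (#|D|%:R * w * n%:R).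
  rewrite [_ * n%:R]mulrC expRM_natl; apply: lerXn2r; rewrite ?nnegrE ?expR_ge0 //.
    apply: addr_ge0 => //; apply: mulr_ge0; last exact: ltW.
    by rewrite subr_ge0 ler1n.
  by apply: le_trans (expR_ge1Dx _); rewrite lerD2l mulrBl; lra.
have := le_trans E E2; rewrite -ler_pdivlMr ?expR_gt0 // => h; apply: (le_trans h).
by rewrite -expRN -expRD ler_expR; lra.
Qed.

(** Draws without replacement stay inside a subset with at most the probability of draws with
    replacement. *)
Lemma bin_ratio_le (M N h : nat) : (M <= N)%N -> ('C(M, h) * N ^ h <= M ^ h * 'C(N, h))%N.
Proof.
move=> MN; rewrite -(leq_pmul2r (fact_gt0 h)) -mulnA [(N ^ h * _)%N]mulnC mulnA.
rewrite -[(M ^ h * _ * _)%N]mulnA !bin_ffact.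
elim: h => // h IH; rewrite !ffactnSr !expnSr.
rewrite [X in (X <= _)%N](_ : _ = (M ^_ h * N ^ h) * ((M - h) * N))%N; last by ring.
rewrite [X in (_ <= X)%N](_ : _ = (M ^ h * N ^_ h) * (M * (N - h)))%N; last by ring.
apply: leq_mul => //.
have [Mh|hM] := leqP M h; first by move/eqP: Mh => ->; rewrite mul0n.
nia.
Qed.

Lemma near_bin_superlinear (R : realType) (kap : nat) (K : R) :
  (1 < kap)%N -> \forall n \near \oo%classic, K * n%:R <= 'C(n, kap)%:R.
Proof.
move=> k1; near=> n.
have nk : (kap.+1 * 2 <= n)%N by near: n; exact: nbhs_infty_ge.
have K2 : 4 * K <= n%:R by near: n; exact: near_large_nat.
have c2 : ('C(n, 2) <= 'C(n, kap))%N.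
  have mono j : (2 <= j)%N -> (j < kap)%N -> ('C(n, j) <= 'C(n, j.+1))%N.
    move=> j2 jk; rewrite -(leq_pmul2l (ltn0Sn j)) mul_bin_left.
    by apply: leq_mul => //; lia.
  have H j : (2 + j <= kap)%N -> ('C(n, 2) <= 'C(n, 2 + j))%N.
    elim: j => // j IH jk; apply: leq_trans (IH _) _; first lia.
    by rewrite addnS; apply: mono; lia.
  by have := H (kap - 2)%N; rewrite subnKC //; apply.
apply: (@le_trans _ _ 'C(n, 2)%:R); last by rewrite ler_nat.
have : 2 * 'C(n, 2)%:R = n%:R * (n%:R - 1) :> R.
  have -> : n%:R - 1 = n.-1%:R :> R by rewrite -subn1 natrB //; lia.
  by rewrite -!natrM; congr (_%:R); have := mul_bin_left n 1; rewrite bin1; lia.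
have : 2 <= n%:R :> R by rewrite ler_nat; lia.
nra.
Unshelve. all: by end_near. Qed.

Definition colorings (n : nat) (D : finType) (E : hypergraph n) :
    {set {ffun 'I_n -> D}} :=
  [set s : {ffun 'I_n -> D} | [forall e in E, ~~ monochromatic s e]].

Lemma colorings_allowed (n kap : nat) (D : finType) (E : hypergraph n)
    (s : {ffun 'I_n -> D}) :
  E \subset edges n kap -> (s \in colorings D E) = (E \subset allowed kap s).
Proof.
move=> /subsetP EO; rewrite inE; apply/forall_inP/subsetP => h e eE.
  by rewrite inE EO //= h.
by have := h e eE; rewrite inE => /andP[].
Qed.

Lemma uniform_hypergraphsE (n kap m : nat) (E : hypergraph n) :
  (E \in uniform_hypergraphs n kap m) = (E \subset edges n kap) && (#|E| == m).
Proof.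
rewrite inE; congr (_ && _); apply/forall_inP/subsetP => h e eE.
  by rewrite inE; apply: h.
by have := h e eE; rewrite inE.
Qed.

Lemma card_uniform_hypergraphs (n kap m : nat) :
  #|uniform_hypergraphs n kap m| = 'C('C(n, kap), m).
Proof.
rewrite -(card_edges n kap) -cards_draws; apply: eq_card => E.
by rewrite uniform_hypergraphsE !inE.
Qed.

Definition balanced_colorings (R : realType) (xi : R) (n : nat) (D : finType)
    (E : hypergraph n) : {set {ffun 'I_n -> D}} :=
  [set s in colorings D E | balanced xi s].

Lemma near_exp_decay (R : realType) (a K eps : R) : 0 < a -> 0 <= K -> 0 < eps ->
  \forall n \near \oo%classic, K * expR (- (a * n%:R)) <= eps.
Proof.
move=> a0 K0 e0; near=> n.
have h : K / eps / a <= n%:R by near: n; exact: near_large_nat.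
rewrite expRN ler_pdivrMr ?expR_gt0 //.
have := expR_ge1Dx (a * n%:R).
move: h; rewrite !ler_pdivrMr // => h1 h2.
have : eps * (1 + a * n%:R) <= eps * expR (a * n%:R) by apply: ler_wpM2l => //; exact: ltW.
lra.
Unshelve. all: by end_near. Qed.

(** * Many solutions after the deletion of few edges *)

Lemma sum_tuple_all (R : realType) (X : finType) (mu : X -> R) (m : nat) (P : pred X) :
  \sum_(x : m.-tuple X) tuple_measure mu x * (all P x)%:R =
  (\sum_(a | P a) mu a) ^+ m.
Proof.
elim: m => [|m IH].
  rewrite (big_pred1 [tuple]) => [|x]; last first.
    by apply/esym/eqP/val_inj; case: x => [[|]].
  by rewrite /tuple_measure big_nil mulr1.
rewrite sum_tupleS exprS -IH [X in _ = X * _]big_mkcond /= mulr_suml.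
apply: eq_bigr => a _; rewrite mulr_sumr; apply: eq_bigr => x _.
rewrite /tuple_measure /= big_cons; case: (P a) => /=; last by rewrite mulr0 mul0r.
by rewrite mulrA.
Qed.

Lemma paley_zygmund (R : realType) (X : finType) (mu Z : X -> R) (S : R) :
  (forall x, 0 <= mu x) -> \sum_x mu x = 1 -> (forall x, 0 <= Z x) ->
  let e := \sum_x mu x * Z x in
  0 < e -> 0 < S -> \sum_x mu x * Z x ^+ 2 <= S ->
  e ^+ 2 <= 4 * S * \sum_(x | e / 2 <= Z x) mu x.
Proof.
move=> mu0 mu1 Z0 e e0 S0 hS.
set P := \sum_(x | _) _.
(* In place of Cauchy-Schwarz, [Z <= Z ^+ 2 / (2 a) + a / 2] is used where [Z] is at least half its
   mean. This [a] makes the quadratic term at most [e / 4]. *)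
pose a := 2 * S / e.
have a0 : 0 < a by rewrite /a divr_gt0 ?mulr_gt0.
have h : e <= e / 2 + (\sum_x mu x * Z x ^+ 2) / (2 * a) + a / 2 * P.
  rewrite {1}/e /P [X in _ <= _ + _ * X]big_mkcond /=.
  have -> : e / 2 + (\sum_x mu x * Z x ^+ 2) / (2 * a) +
     a / 2 * (\sum_i if e / 2 <= Z i then mu i else 0) =
     \sum_x (mu x * (e / 2) + mu x * Z x ^+ 2 / (2 * a) +
              a / 2 * (if e / 2 <= Z x then mu x else 0)).
    by rewrite !big_split /= -!mulr_suml mu1 mul1r -mulr_sumr.
  apply: ler_sum => x _.
  have sq : Z x <= Z x ^+ 2 / (2 * a) + a / 2.
    have -> : Z x ^+ 2 / (2 * a) + a / 2 = (Z x ^+ 2 + a ^+ 2) / (2 * a).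
      by field; rewrite gt_eqF.
    rewrite ler_pdivlMr; last lra.
    have := sqr_ge0 (Z x - a); rewrite sqrrB; lra.
  case: ifP => ex.
    have := ler_wpM2l (mu0 x) sq; have : 0 <= mu x * (e / 2).
      by rewrite mulr_ge0 // ltW // divr_gt0.
    by rewrite -mulrA; lra.
  rewrite mulr0 addr0; move/negbT: ex; rewrite -ltNge => /ltW ex.
  have : 0 <= mu x * Z x ^+ 2 / (2 * a).
    by apply: divr_ge0; [rewrite mulr_ge0 ?sqr_ge0 | lra].
  by have := ler_wpM2l (mu0 x) ex; lra.
have P0 : 0 <= P by apply: sumr_ge0.
have h2 : (\sum_x mu x * Z x ^+ 2) / (2 * a) <= e / 4.
  rewrite ler_pdivrMr; last lra.
  apply: (le_trans hS).
  by rewrite le_eqVlt; apply/orP; left; apply/eqP; rewrite /a; field; rewrite gt_eqF.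
have h3 : e / 4 <= a / 2 * P by lra.
have : e / 4 * (4 * e) <= a / 2 * P * (4 * e).
  by apply: ler_wpM2r => //; rewrite mulr_ge0 // ltW.
have -> : a / 2 * P * (4 * e) = 4 * S * P by rewrite /a; field; rewrite gt_eqF.
by rewrite expr2; lra.
Qed.

(** The number of possible edges grows faster than linearly and [m n] linearly, so [m n] independent
    edges are distinct with probability [exp (- o(n))]. Passing from tuples to edge sets thus costs
    a factor that the exponential bounds absorb. *)
Lemma expn_le_ffact_exp (R : realType) (kap : nat) (r eta : R) (m : nat -> nat) :
  (1 < kap)%N -> 0 <= r -> 0 < eta -> (forall n, (m n)%:R <= r * n%:R + 1) ->
  \forall n \near \oo%classic, (m n <= 'C(n, kap))%N /\
     'C(n, kap)%:R ^+ m n <= expR (eta * n%:R) * ('C(n, kap) ^_ m n)%:R :> R.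
Proof.
move=> k1 r0 eta0 hm.
(* The first summand leaves room for [m n] edges, the second makes the square of [m n] divided by
   [N - m n] at most [eta n]. *)
pose K := (r + 1) + (r + 1) ^+ 2 / eta.
near=> n.
have NK : K * n%:R <= 'C(n, kap)%:R by near: n; exact: near_bin_superlinear.
set N := 'C(n, kap) in NK *.
have mn : (m n)%:R <= (r + 1) * n%:R by near: n; apply: near_linear_le hm _; lra.
have n0 : (1 : R) <= n%:R by near: n; exact: near_large_nat.
have r1 : 0 < (r + 1) ^+ 2 by apply: exprn_gt0; lra.
have r2 : 0 < (r + 1) ^+ 2 / eta by rewrite divr_gt0.
have Nm : (r + 1) ^+ 2 / eta * n%:R <= N%:R - (m n)%:R.
  by move: NK; rewrite /K mulrDl; lra.
have Nm0 : 0 < (r + 1) ^+ 2 / eta * n%:R by rewrite mulr_gt0 //; lra.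
have mN : (m n <= N)%N by rewrite -(ler_nat R); lra.
split => //.
have NmE : N%:R - (m n)%:R = (N - m n)%:R :> R by rewrite natrB.
apply: (@le_trans _ _ (expR (eta * n%:R) * (N - m n)%:R ^+ m n)); last first.
  apply: ler_wpM2l; first exact: expR_ge0.
  rewrite -natrX ler_nat.
  have H j : (j <= m n)%N -> ((N - m n) ^ j <= N ^_ j)%N.
    elim: j => // j IH jm; rewrite ffactnSr expnSr; apply: leq_mul.
      by apply: IH; exact: ltnW.
    by apply: leq_sub2l; exact: ltnW.
  exact: H.
have d0 : 0 < (N - m n)%:R :> R by rewrite -NmE; lra.
have e1 : N%:R = (1 + (m n)%:R / (N - m n)%:R) * (N - m n)%:R :> R.
  by rewrite mulrDl mulfVK ?gt_eqF // -NmE; lra.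
rewrite {1}e1 exprMn; apply: ler_wpM2r; first by rewrite exprn_ge0.
apply: (@le_trans _ _ (expR ((m n)%:R / (N - m n)%:R) ^+ m n)).
  apply: lerXn2r; rewrite ?nnegrE ?expR_ge0 ?addr_ge0 ?divr_ge0 //.
  exact: expR_ge1Dx.
rewrite -expRM_natl ler_expR mulrA ler_pdivrMr //.
apply: (@le_trans _ _ (((r + 1) * n%:R) * ((r + 1) * n%:R))).
  by apply: ler_pM.
apply: (@le_trans _ _ (eta * n%:R * ((r + 1) ^+ 2 / eta * n%:R))).
  by rewrite le_eqVlt; apply/orP; left; apply/eqP; field; rewrite gt_eqF.
by apply: ler_wpM2l; [apply: mulr_ge0; lra | rewrite -NmE].
Unshelve. all: by end_near. Qed.

(** What is left of richness after [delta n] coordinates of the tuple of edges have been changed: a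
    rich [H] inside [E] in place of a rich [E]. *)
Definition nearly_rich (R : realType) (xi delta eta : R) (n kap m : nat) (D : finType)
    (E : hypergraph n) : bool :=
  [exists H : hypergraph n, [&& H \subset E, #|E :\: H|%:R <= delta * n%:R &
     expR (- (eta * n%:R)) * edge_phi R D kap ^+ m * #|D|%:R ^+ n
       <= #|balanced_colorings xi D H|%:R]].

(** [H] consists of the entries at positions where the two tuples agree. *)
Lemma tuple_dist_agree (X : finType) (m : nat) (x y : m.-tuple X) :
  exists2 H : {set X}, H \subset [set a in x] &
    H \subset [set a in y] /\ (#|[set a in x] :\: H| <= tuple_dist x y)%N.
Proof.
rewrite /tuple_dist; case: x y => x sx [y sy] /=.
elim: x m sx y sy => [|a x IH] m sx y sy.
  exists set0; first exact: sub0set.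
  split; first exact: sub0set.
  by rewrite setD0 (_ : [set b in [::]] = set0) ?cards0 //; apply/setP => b; rewrite !inE.
case: m sx sy => // m sx sy; case: y sy => // b y sy.
have [H H1 [H2 H3]] := IH m sx y sy.
have ax : [set c in a :: x] = a |: [set c in x] by apply/setP => c; rewrite !inE.
have by_ : [set c in b :: y] = b |: [set c in y] by apply/setP => c; rewrite !inE.
case: (eqVneq a b) => [ab|nab].
  exists (a |: H); first by rewrite ax setUS.
  split; first by rewrite by_ -ab setUS.
  rewrite /= ab eqxx add0n -ab ax; apply: leq_trans H3; apply: subset_leq_card.
  by apply/subsetP => c; rewrite !inE negb_or; case: (c == a) => //=.
exists H; first by rewrite ax; apply: subset_trans H1 (subsetUr _ _).
split; first by rewrite by_; apply: subset_trans H2 (subsetUr _ _).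
rewrite /= nab ax setDUl; apply: leq_trans (leq_card_setU _ _) _.
apply: leq_add => //; apply: leq_trans (subset_leq_card (subsetDl _ _)) _.
by rewrite cards1.
Qed.

Lemma nearly_rich_whp (R : realType) (kap : nat) (D : finType)
    (r lam smax delta eta : R) (m : nat -> nat) :
  (1 < #|D|)%N -> (1 < kap)%N -> 0 <= r -> 0 < delta -> 0 < eta ->
  r * #|D|%:R ^+ 2 < lam * edge_phi R D kap ^+ 2 * (#|D|%:R ^+ 2) ^+ kap ->
  #|D|%:R < smax ->
  (forall s : R, 0 <= s <= smax ->
     lam * (s ^+ kap - 1 - kap%:R * (s - 1)) <= s * ln s - s + 1) ->
  (forall n, (m n)%:R <= r * n%:R + 1) ->
  exists2 xi0 : R, 0 < xi0 & forall xi : R, 0 < xi <= xi0 -> forall eps : R, 0 < eps ->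
  \forall n \near \oo%classic,
    #|[set E in uniform_hypergraphs n kap (m n) |
        ~~ nearly_rich xi delta eta kap (m n) D E]|%:R
    <= eps * #|uniform_hypergraphs n kap (m n)|%:R :> R.
Proof.
move=> D1 k1 r0 de0 eta0 hlam hs hpt hm.
set q : R := #|D|%:R; set phi := edge_phi R D kap.
have q0 : 0 < q by rewrite ltr0n ltnW.
have phi0 : 0 < phi by exact: edge_phi_gt0.
(* The blow-up weight is [1 + nu]. A distance of [delta n] gains [nu * delta / 2] in the exponent,
   while the constant of the inequality loses at most [(r + 1) * nu ^+ 2 / 4], which is at most
   [nu * delta / 4]. *)
pose nu := Num.min (1 / 2) (delta / (r + 1)).
have nu0 : 0 < nu by rewrite lt_min divr_gt0 ?divr_gt0 //; lra.
have nu1 : nu <= 1 / 2 by rewrite ge_min lexx.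
have nu2 : nu * (r + 1) <= delta.
  by rewrite -ler_pdivlMr; [rewrite ge_min lexx orbT | lra].
(* Paley-Zygmund loses [3 * e1] and distinctness of the edges another [e1], against a net gain of
   [nu * delta / 4]; a rate of [nu * delta / 8] remains. *)
pose e1 := Num.min (eta / 2) (nu * delta / 32).
have nd0 : 0 < nu * delta by exact: mulr_gt0.
have e10 : 0 < e1 by rewrite lt_min; apply/andP; split; lra.
have e11 : e1 <= eta / 2 by rewrite ge_min lexx.
have e12 : e1 <= nu * delta / 32 by rewrite ge_min lexx orbT.
have [xi1 x10 SM] := second_moment D1 k1 r0 e10 hlam hs hpt hm.
have [xi2 x20 FM] := first_moment D1 k1 r0 e10 hm.
exists (Num.min 1 (Num.min xi1 xi2)); first by rewrite !lt_min ltr01 x10.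
move=> xi; rewrite !le_min => /and4P[x0 xle1 xle2 xle3] eps eps0.
near=> n.
have sm : \sum_(s : {ffun 'I_n -> D} | balanced xi s) \sum_(t : {ffun 'I_n -> D} | balanced xi t)
       (#|allowed kap s :&: allowed kap t|%:R / 'C(n, kap)%:R) ^+ m n
    <= expR (e1 * n%:R) * phi ^+ (2 * m n) * q ^+ (2 * n).
  by near: n; apply: SM; rewrite x0.
have fm : forall s : {ffun 'I_n -> D}, forall h, (h <= m n)%N ->
    (#|allowed kap s|%:R / 'C(n, kap)%:R) ^+ h
      <= expR (e1 * n%:R) * phi ^+ h /\
    (balanced xi s -> expR (- (e1 * n%:R)) * phi ^+ h <=
        (#|allowed kap s|%:R / 'C(n, kap)%:R) ^+ h).
  by near: n; apply: FM; rewrite x0.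
have [mN Nf] : (m n <= 'C(n, kap))%N /\
     'C(n, kap)%:R ^+ m n <= expR (e1 * n%:R) * ('C(n, kap) ^_ m n)%:R :> R.
  by near: n; exact: (expn_le_ffact_exp k1 r0 e10 hm).
have nk : (kap <= n)%N by near: n; exact: nbhs_infty_ge.
have mn : (m n)%:R <= (r + 1) * n%:R by near: n; apply: near_linear_le hm _; lra.
have unb : q * expR (- (xi ^+ 2 / 8 * n%:R)) <= 1 / 2.
  by near: n; apply: near_exp_decay; [rewrite divr_gt0 ?exprn_gt0 | exact: ltW | lra].
have quarter : 1 * expR (- (eta / 2 * n%:R)) <= 1 / 4.
  by near: n; apply: near_exp_decay => //; lra.
have fin : 32 * expR (- (nu * delta / 8 * n%:R)) <= eps.
  by near: n; apply: near_exp_decay => //; rewrite ?mulr_gt0 ?invr_gt0.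
have n0 : (0 < n)%N by apply: leq_trans nk; exact: ltnW.
set N := 'C(n, kap) in sm fm mN Nf *.
have N0 : 0 < N%:R :> R by rewrite ltr0n bin_gt0.
have D0 : (0 < #|D|)%N by exact: ltnW.
pose mu (e : {set 'I_n}) : R := if e \in edges n kap then N%:R^-1 else 0.
have mu0 e : 0 <= mu e by rewrite /mu; case: ifP => // _; rewrite invr_ge0 ltW.
have muA (A : hypergraph n) : A \subset edges n kap -> \sum_(e in A) mu e = #|A|%:R / N%:R.
  move=> /subsetP AO; rewrite (eq_bigr (fun=> N%:R^-1)); last first.
    by move=> e /AO eO; rewrite /mu eO.
  by rewrite sumr_const mulr_natl.
have mu1 : \sum_e mu e = 1.
  transitivity (\sum_(e in edges n kap) mu e).
    by rewrite [RHS]big_mkcond; apply: eq_bigr => e _; rewrite /mu; case: ifP.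
  by rewrite muA // card_edges divff // gt_eqF.
pose tm := @tuple_measure R _ mu (m n).
have tm0 x : 0 <= tm x by apply: prodr_ge0.
have tm1 : \sum_x tm x = 1.
  have := sum_tuple_all mu (m n) xpredT; rewrite mu1 expr1n => <-.
  by apply: eq_bigr => x _; rewrite all_predT mulr1.
have subO (s : {ffun 'I_n -> D}) : allowed kap s \subset edges n kap.
  by apply/subsetP => e; rewrite inE => /andP[].
pose sol (s : {ffun 'I_n -> D}) (x : (m n).-tuple {set 'I_n}) := all (mem (allowed kap s)) x.
pose Z x : R := \sum_(s : {ffun 'I_n -> D} | balanced xi s) (sol s x)%:R.
have Z0 x : 0 <= Z x by apply: sumr_ge0.
have EZ : \sum_x tm x * Z x =
   \sum_(s : {ffun 'I_n -> D} | balanced xi s) (#|allowed kap s|%:R / N%:R) ^+ m n.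
  transitivity (\sum_x \sum_(s : {ffun 'I_n -> D} | balanced xi s) tm x * (sol s x)%:R).
    by apply: eq_bigr => x _; rewrite mulr_sumr.
  rewrite exchange_big /=; apply: eq_bigr => s _.
  by rewrite sum_tuple_all -muA.
have EZ2 : \sum_x tm x * Z x ^+ 2 =
  \sum_(s : {ffun 'I_n -> D} | balanced xi s) \sum_(t : {ffun 'I_n -> D} | balanced xi t)
       (#|allowed kap s :&: allowed kap t|%:R / N%:R) ^+ m n.
  transitivity (\sum_x \sum_(s : {ffun 'I_n -> D} | balanced xi s)
      \sum_(t : {ffun 'I_n -> D} | balanced xi t)
        tm x * (all (mem (allowed kap s :&: allowed kap t)) x)%:R).
    apply: eq_bigr => x _; rewrite expr2 {1}/Z mulr_suml mulr_sumr.
    apply: eq_bigr => s _; rewrite /Z !mulr_sumr; apply: eq_bigr => t _.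
    rewrite -natrM mulnb; congr (_ * (nat_of_bool _)%:R).
    rewrite /sol -all_predI; apply: eq_all => e /=.
    by rewrite in_setI.
  rewrite exchange_big /=; apply: eq_bigr => s _.
  rewrite exchange_big /=; apply: eq_bigr => t _.
  rewrite sum_tuple_all -muA //; apply: subset_trans (subsetIl _ _) (subO s).
pose bal := [set s : {ffun 'I_n -> D} | balanced xi s].
have cbal : q ^+ n / 2 <= #|bal|%:R.
  have := card_unbalanced D0 (_ : 0 < xi <= 1) n; rewrite x0 xle1 => /(_ isT).
  set U := [set s | _].
  have -> : #|bal|%:R = q ^+ n - #|U|%:R.
    have := cardsC bal; rewrite card_ffun card_ord => cE.
    have -> : U = ~: bal by apply/setP => s; rewrite !inE.
    have -> : q ^+ n = (#|D| ^ n)%:R by rewrite natrX.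
    by rewrite -cE natrD addrK.
  rewrite mulNr => hU.
  have : q * (q ^+ n * expR (- (xi ^+ 2 / 8 * n%:R))) <= q ^+ n / 2.
    rewrite mulrCA; apply: ler_wpM2l; first by rewrite exprn_ge0 // ltW.
    by move: unb; clear; lra.
  by move=> hq; rewrite lerBrDr [leRHS]splitr lerD2l; exact: le_trans hU hq.
set ez := \sum_x tm x * Z x in EZ.
pose B := expR (- (e1 * n%:R)) * phi ^+ m n * q ^+ n.
have B0 : 0 < B by rewrite !mulr_gt0 ?expR_gt0 ?exprn_gt0.
have ezB : B / 2 <= ez.
  rewrite EZ; apply: (@le_trans _ _ (#|bal|%:R * (expR (- (e1 * n%:R)) * phi ^+ m n))).
    rewrite [leRHS]mulrC /B -[leLHS]mulrA; apply: ler_wpM2l => //.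
    by rewrite mulr_ge0 ?expR_ge0 ?exprn_ge0 // ltW.
  rewrite mulr_natl -sumr_const big_mkcond [leRHS]big_mkcond; apply: ler_sum => s _.
  rewrite inE; case: ifP => // bs.
  by have [_] := fm s (m n) (leqnn _); apply.
have ez0 : 0 < ez by apply: lt_le_trans ezB; rewrite divr_gt0.
pose S := expR (e1 * n%:R) * phi ^+ (2 * m n) * q ^+ (2 * n).
have S0 : 0 < S by rewrite !mulr_gt0 ?expR_gt0 ?exprn_gt0.
have hS : \sum_x tm x * Z x ^+ 2 <= S by rewrite EZ2.
have PZ := paley_zygmund tm0 tm1 Z0 ez0 S0 hS; rewrite -/ez in PZ.
pose A : pred ((m n).-tuple {set 'I_n}) := fun x => ez / 2 <= Z x.
set PA := \sum_(x | _) _ in PZ.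
have PAge : expR (- (3 * e1 * n%:R)) / 16 <= PA.
  have h1 : (B / 2) ^+ 2 <= ez ^+ 2.
    apply: lerXn2r => //; first by rewrite nnegrE divr_ge0 // ltW.
    by rewrite nnegrE ltW.
  have h2 := le_trans h1 PZ.
  have h3 : B ^+ 2 = expR (- (3 * e1 * n%:R)) * S.
    have -> : - (3 * e1 * n%:R) = - (e1 * n%:R) + - (e1 * n%:R) + - (e1 * n%:R) by ring.
    rewrite /B /S !exprMn -!exprM ![(_ * 2)%N]mulnC !expRD expr2 -mulrA.
    by rewrite expRN; field; rewrite gt_eqF ?expR_gt0.
  rewrite -(ler_pM2r S0); move: h2; rewrite expr_div_n h3; clear; lra.
pose k0 := Num.truncn (delta * n%:R).
have dn0 : 0 <= delta * n%:R by rewrite mulr_ge0 // ltW.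
have /andP[k0le k0gt] : k0%:R <= delta * n%:R < k0.+1%:R by exact: truncn_itv.
pose near_A x := [exists y, A y && (tuple_dist x y <= k0)%N].
(* A minorant of the distance to [A] with only two values is enough, because only the event of being
   farther than [k0] matters. *)
pose d (x : (m n).-tuple {set 'I_n}) : nat := if near_A x then 0%N else k0.
pose w := 1 + nu.
have w1 : 1 <= w by have := nu0; rewrite /w; clear; lra.
have hd x y : A y -> (d x <= tuple_dist x y)%N.
  move=> Ay; rewrite /d; case: ifP => // /negbT; rewrite negb_exists => /forallP /(_ y).
  by rewrite Ay /= -ltnNge => /ltnW.
have BU := tuple_blowup mu0 mu1 w1 hd.
rewrite -/tm -/PA in BU.
pose PF := \sum_(x | ~~ near_A x) tm x.
have PF0 : 0 <= PF by apply: sumr_ge0.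
have PFle : PF * w ^+ k0 <= \sum_x tm x * w ^+ d x.
  rewrite /PF mulr_suml big_mkcond; apply: ler_sum => x _ /=.
  rewrite /d; case: (near_A x) => //=.
  by rewrite expr0 mulr1.
have PA0 : 0 <= PA by apply: sumr_ge0.
have cm : ((1 + w) ^+ 2 / (4 * w)) ^+ m n <= expR (nu * delta / 4 * n%:R).
  apply: (@le_trans _ _ (expR (nu ^+ 2 / 4) ^+ m n)).
    apply: lerXn2r; rewrite ?nnegrE ?expR_ge0 //.
      by rewrite divr_ge0 ?sqr_ge0 //; move: w1; clear; lra.
    apply: le_trans (expR_ge1Dx _).
    rewrite ler_pdivrMr; last by move: w1; clear; lra.
    have : 0 <= nu ^+ 3 by apply: exprn_ge0; exact: ltW.
    by have := nu0; rewrite /w !exprS expr0; clear; lra.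
  rewrite -expRM_natl ler_expR.
  apply: (@le_trans _ _ ((r + 1) * n%:R * (nu ^+ 2 / 4))).
    by apply: ler_wpM2r => //; rewrite divr_ge0 ?sqr_ge0.
  have : nu * n%:R * (nu * (r + 1)) <= nu * n%:R * delta.
    by apply: ler_wpM2l => //; rewrite mulr_ge0 // ltW.
  rewrite expr2; clear; lra.
have wk : expR (nu * delta / 2 * n%:R) <= 2 * w ^+ k0.
  apply: (@le_trans _ _ (w ^+ k0.+1)); last first.
    by rewrite exprS; apply: ler_wpM2r; [apply: exprn_ge0; move: w1; clear; lra | have := nu1; rewrite /w; clear; lra].
  apply: (@le_trans _ _ (expR (nu / 2) ^+ k0.+1)).
    rewrite -expRM_natl ler_expR.
    have : nu * (delta * n%:R) <= nu * k0.+1%:R by apply: ler_wpM2l; exact: ltW.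
    clear; lra.
  apply: lerXn2r; rewrite ?nnegrE ?expR_ge0 //; first by move: w1; clear; lra.
  have := expR_ge1Dx (- (nu / 2)); rewrite expRN => h.
  have i0 : 0 < 1 + - (nu / 2) by have := nu1; clear; lra.
  have h2 : (1 + - (nu / 2)) * expR (nu / 2) <= 1.
    by move: h; rewrite -[X in _ <= X]mul1r ler_pdivlMr ?expR_gt0.
  rewrite -(ler_pM2l i0); apply: (le_trans h2).
  have : 0 <= nu * (1 / 2 - nu).
    by apply: mulr_ge0; [exact: ltW | have := nu1; clear; lra].
  by have := nu0; rewrite /w; clear; lra.
have PFbound : PF <= 32 * expR ((3 * e1 - nu * delta / 4) * n%:R).
  have h1 : PF * w ^+ k0 * PA <= expR (nu * delta / 4 * n%:R).
    by apply: le_trans cm; apply: le_trans BU; exact: ler_wpM2r.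
  have h2 : PF * (expR (nu * delta / 2 * n%:R) / 2) * (expR (- (3 * e1 * n%:R)) / 16)
      <= expR (nu * delta / 4 * n%:R).
    apply: le_trans h1; apply: ler_pM.
    - by rewrite mulr_ge0 // divr_ge0 // expR_ge0.
    - by rewrite divr_ge0 // expR_ge0.
    - by apply: ler_wpM2l => //; move: wk; clear; lra.
    - exact: PAge.
  have h3 : 0 < expR (nu * delta / 2 * n%:R) * expR (- (3 * e1 * n%:R)).
    by rewrite mulr_gt0 ?expR_gt0.
  have h4 : 32 * expR ((3 * e1 - nu * delta / 4) * n%:R) *
      (expR (nu * delta / 2 * n%:R) * expR (- (3 * e1 * n%:R))) =
      32 * expR (nu * delta / 4 * n%:R).
    by rewrite -mulrA -!expRD; congr (_ * expR _); clear; lra.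
  by rewrite -(ler_pM2r h3) h4; move: h2; clear; lra.
set Bs := [set E in _ | _].
have cBs : (m n)`!%:R * #|Bs|%:R <= PF * N%:R ^+ m n.
  have := card_uniq_tuples_onto (m n) (edges n kap)
     (fun E => ~~ nearly_rich xi delta eta kap (m n) D E).
  set F1 := [set E | _]; set F2 := [set x | _].
  have -> : F1 = Bs.
    by apply/setP => E; rewrite [RHS]inE uniform_hypergraphsE inE andbA.
  rewrite -(ler_nat R) natrM => h; apply: (le_trans h).
  rewrite -ler_pdivrMr ?exprn_gt0 // -sum1_card natr_sum mulr_suml /PF.
  rewrite big_mkcond [leRHS]big_mkcond; apply: ler_sum => x _ /=.
  case: ifP => [|_]; last by case: ifP.
  rewrite inE => /and3P[ux xO nr].
  have -> : tm x = N%:R^-1 ^+ m n.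
    rewrite /tm /tuple_measure (eq_big_seq (fun=> N%:R^-1)).
      by rewrite big_const_seq count_predT size_tuple iter_mulr_1.
    by move=> e ex; have eO : e \in edges n kap := allP xO e ex; rewrite /mu eO.
  rewrite ifT ?mul1r ?exprVn //.
  apply: contra nr => /existsP[y /andP[Ay dxy]].
  have [H H1 [H2 H3]] := tuple_dist_agree x y.
  apply/existsP; exists H; rewrite H1 /=; apply/andP; split.
    by apply: le_trans k0le; rewrite ler_nat; exact: leq_trans dxy.
  apply: (@le_trans _ _ (B / 4)).
    have -> : B / 4 = expR (- (e1 * n%:R)) * (1 / 4) * (phi ^+ m n * q ^+ n).
      by rewrite /B; ring.
    rewrite -mulrA; apply: ler_wpM2r; first by rewrite mulr_ge0 ?exprn_ge0 // ltW.
    apply: (@le_trans _ _ (expR (- (e1 * n%:R)) * expR (- (eta / 2 * n%:R)))).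
      rewrite -expRD ler_expR; have : e1 * n%:R <= eta / 2 * n%:R by apply: ler_wpM2r.
      clear; lra.
    by apply: ler_wpM2l; [exact: expR_ge0 | rewrite mul1r in quarter].
  (* A balanced colouring that solves all entries of [y] solves [H], which consists of entries of
     [y]. *)
  apply: (@le_trans _ _ (Z y)); first by move: ezB Ay; rewrite /A; clear; lra.
  rewrite /Z -natr_sum ler_nat -sum1_card big_mkcond [leqRHS]big_mkcond /=.
  apply: leq_sum => s _; case: ifP => // bs; case: (boolP (sol s y)) => // sy.
  rewrite ifT // !inE bs andbT; apply/forall_inP => e eH.
  have := subsetP H2 e eH; rewrite inE => ey.
  by have := allP sy e ey; rewrite !inE => /andP[].
rewrite card_uniform_hypergraphs -/N.
have f0 : 0 < (m n)`!%:R :> R by rewrite ltr0n fact_gt0.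
rewrite -(ler_pM2l f0); apply: (le_trans cBs).
apply: (@le_trans _ _ (PF * (expR (e1 * n%:R) * (N ^_ m n)%:R))).
  exact: ler_wpM2l.
rewrite -bin_ffact natrM.
have -> : (m n)`!%:R * (eps * 'C(N, m n)%:R) = eps * ('C(N, m n)%:R * (m n)`!%:R) by ring.
rewrite mulrA; apply: ler_wpM2r; first by rewrite mulr_ge0.
apply: (@le_trans _ _ (32 * expR ((3 * e1 - nu * delta / 4) * n%:R) * expR (e1 * n%:R))).
  by apply: ler_wpM2r; rewrite ?expR_ge0.
apply: le_trans fin; rewrite -mulrA -expRD; apply: ler_wpM2l => //.
rewrite ler_expR; have : e1 * n%:R <= nu * delta / 32 * n%:R by apply: ler_wpM2r.
clear; lra.
Unshelve. all: by end_near. Qed.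

(** The colouring [s] of [H] need not solve [E]. For [H = E] this is the looseness to be proved; for
    smaller [H] it supplies a solution of [E] close to [s]. *)
Definition repairable (R : realType) (gam delta : R) (n : nat) (D : finType)
    (good : hypergraph n -> {ffun 'I_n -> D} -> bool) (E : hypergraph n) : bool :=
  [forall H : hypergraph n,
    ((H \subset E) && (#|E :\: H|%:R <= delta * n%:R)) ==>
    [forall s in colorings D H,
       good H s ==> [forall v, loose (colorings D E) (gam * n%:R) s v]]].

(* The [j]-th term is multiplied by [(y / w)^(x - j) >= 1]. *)
Lemma sum_bin_small_le (R : realType) (m : nat) (w y x : R) :
  0 < w <= 1 -> 1 <= y -> 0 <= x ->
  \sum_(j < m.+1 | j%:R <= x) 'C(m, j)%:R * y ^+ j <=
    expR (w * m%:R + x * (ln y - ln w)).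
Proof.
move=> /andP[w0 w1] y1 x0.
have y0 : 0 < y by lra.
have lyw : 0 <= ln y - ln w.
  by have := ln_ge0 y1; have := ln_le0 w1; lra.
apply: (@le_trans _ _ (\sum_(j < m.+1) 'C(m, j)%:R * w ^+ j * expR (x * (ln y - ln w)))).
  rewrite big_mkcond; apply: ler_sum => j _; case: ifP => [jx|_]; last first.
    by rewrite !mulr_ge0 ?expR_ge0 ?exprn_ge0 // ltW.
  rewrite -mulrA; apply: ler_wpM2l => //.
  have -> : y ^+ j = w ^+ j * expR (j%:R * (ln y - ln w)).
    rewrite expRM_natl -exprMn expRD expRN !lnK ?posrE //.
    by rewrite mulrCA divff ?mulr1 // gt_eqF.
  apply: ler_wpM2l; first by rewrite exprn_ge0 // ltW.
  by rewrite ler_expR; apply: ler_wpM2r.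
rewrite -mulr_suml expRD; apply: ler_wpM2r; first exact: expR_ge0.
have -> : \sum_(j < m.+1) 'C(m, j)%:R * w ^+ j = (1 + w) ^+ m.
  rewrite exprDn; apply: eq_bigr => j _.
  by rewrite expr1n mul1r mulr_natl.
rewrite mulrC expRM_natl; apply: lerXn2r; rewrite ?nnegrE ?expR_ge0 //; first lra.
exact: expR_ge1Dx.
Qed.

(** * Counting failures of the repair, and the transfer to uniform pairs *)

Lemma bin_mul_sub (N m h : nat) : (h <= m <= N)%N ->
  ('C(N, h) * 'C(N - h, m - h) = 'C(N, m) * 'C(m, h))%N.
Proof.
move=> /andP[hm mN]; have hN := leq_trans hm mN.
have f1 := bin_fact hN; have f2 := bin_fact mN; have f3 := bin_fact hm.
have f4 : ('C(N - h, m - h) * ((m - h)`! * (N - m)`!) = (N - h)`!)%N.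
  have := @bin_fact (N - h) (m - h); rewrite leq_sub2r // => /(_ isT).
  by rewrite subnBA // subnK.
apply/eqP; rewrite -(eqn_pmul2r (_ : 0 < h`! * ((m - h)`! * (N - m)`!)))%N; last first.
  by rewrite !muln_gt0 !fact_gt0.
apply/eqP.
transitivity ('C(N, h) * (h`! * ('C(N - h, m - h) * ((m - h)`! * (N - m)`!))))%N.
  ring.
rewrite f4 f1.
transitivity ('C(N, m) * ('C(m, h) * (h`! * (m - h)`!) * (N - m)`!))%N; last by ring.
by rewrite f3 f2.
Qed.

Lemma card_supersets (X : finType) (Om H : {set X}) (m : nat) :
  H \subset Om -> (#|H| <= m)%N ->
  #|[set E : {set X} | [&& E \subset Om, #|E| == m & H \subset E]]| =
    'C(#|Om| - #|H|, m - #|H|).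
Proof.
move=> HO cH.
have -> : (#|Om| - #|H|)%N = #|Om :\: H| by rewrite cardsD (setIidPr HO).
rewrite -cards_draws.
rewrite -[RHS](card_in_imset (f := fun F : {set X} => H :|: F)).
  apply: eq_card => E; rewrite inE; apply/and3P/imsetP.
    move=> [EO /eqP cE HE]; exists (E :\: H); last first.
      apply/setP => x; rewrite !inE; case: (boolP (x \in H)) => //= xH.
      by rewrite (subsetP HE).
    rewrite inE setSD //=; rewrite cardsD (setIidPr HE) cE //.
  move=> [F]; rewrite inE => /andP[FO /eqP cF] ->; split.
  - by rewrite subUset HO; apply: subset_trans FO (subsetDl _ _).
  - have /eqP HF : H :&: F == set0.
      by rewrite setI_eq0 disjoint_sym disjoints_subset; apply: subset_trans FO _; rewrite setDE subsetIr.
    by rewrite cardsU HF cards0 subn0 cF subnKC.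
  - exact: subsetUl.
move=> F G; rewrite !inE => /andP[FO _] /andP[GO _] /setP eq.
apply/setP => x; have := eq x; rewrite !inE.
case: (boolP (x \in H)) => //= xH _.
have := subsetP FO x; have := subsetP GO x; rewrite !inE xH /=.
by case: (x \in F) => //; case: (x \in G) => // h1 h2; rewrite ?(h1 isT) ?(h2 isT).
Qed.

(** All admissible [H] are counted together, so that a bound applies to the unknown [H] that
    [nearly_rich] provides. *)
Definition bad_count (R : realType) (xi delta : R) (n : nat) (D : finType)
    (good : hypergraph n -> {ffun 'I_n -> D} -> bool) (E : hypergraph n) : nat :=
  \sum_(H : hypergraph n | (H \subset E) && (#|E :\: H|%:R <= delta * n%:R))
    #|[set s in balanced_colorings xi D H | ~~ good H s]|.

(** Reverse the order of choice: [s], then a bad [H] with [m - j] edges, then the [j] further edges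
    of [E]. Each missing edge loses a factor [phi^-1], and there are ['C(m, j)] ways to miss [j] of
    the edges of [E]. *)
Lemma sum_bad_count (R : realType) (xi xis delta c : R) (n kap m : nat) (D : finType)
    (good : hypergraph n -> {ffun 'I_n -> D} -> bool) (phi eta : R) :
  0 <= delta -> 0 <= c -> (0 < #|D|)%N -> 0 < phi <= 1 -> (m <= 'C(n, kap))%N ->
  (0 < 'C(n, kap))%N -> xi <= xis ->
  (forall s : {ffun 'I_n -> D}, balanced xis s -> forall h, (h <= m)%N ->
     #|[set H : hypergraph n | [&& H \subset allowed kap s, #|H| == h & ~~ good H s]]|%:R
      <= expR (- (c * n%:R)) * 'C(#|allowed kap s|, h)%:R) ->
  (forall s : {ffun 'I_n -> D}, forall h, (h <= m)%N ->
    (#|allowed kap s|%:R / 'C(n, kap)%:R) ^+ h <= expR (eta * n%:R) * phi ^+ h) ->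
  \sum_(E in uniform_hypergraphs n kap m) (bad_count xi delta good E)%:R <=
   #|uniform_hypergraphs n kap m|%:R *
   (expR ((eta - c) * n%:R) * #|D|%:R ^+ n * phi ^+ m *
    \sum_(j < m.+1 | j%:R <= delta * n%:R) 'C(m, j)%:R * phi^-1 ^+ j).
Proof.
move=> de0 c0 D0 /andP[phi0 phi1] mN N0 xixi hgood hfm.
set N := 'C(n, kap) in mN N0 hfm *.
have balS (s : {ffun 'I_n -> D}) : balanced xi s -> balanced xis s.
  move=> /forallP h; apply/forallP => d; apply: (le_trans (h d)).
  by apply: ler_wpM2r => //; rewrite lerD2l.
pose P (s : {ffun 'I_n -> D}) (h : nat) (H : hypergraph n) :=
  [&& H \subset allowed kap s, #|H| == h & ~~ good H s].
apply: (@le_trans _ _ (\sum_(s : {ffun 'I_n -> D} | balanced xi s)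
   \sum_(j < m.+1 | j%:R <= delta * n%:R) \sum_(H | P s (m - j)%N H)
      'C(N - (m - j), j)%:R)).
  pose I (E H : hypergraph n) (s : {ffun 'I_n -> D}) : bool :=
    [&& E \in uniform_hypergraphs n kap m, H \subset E, #|E :\: H|%:R <= delta * n%:R,
        s \in colorings D H, balanced xi s & ~~ good H s].
  have -> : \sum_(E in uniform_hypergraphs n kap m) (bad_count xi delta good E)%:R =
      \sum_s \sum_H \sum_E (I E H s)%:R :> R.
    under [RHS]eq_bigr do rewrite exchange_big.
    rewrite [RHS]exchange_big /= big_mkcond; apply: eq_bigr => E _.
    rewrite [RHS]exchange_big /= /bad_count.
    case: ifP => EI; last first.
      by rewrite big1 // => H _; rewrite big1 // => s _; rewrite /I EI.
    rewrite natr_sum big_mkcond; apply: eq_bigr => H _.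
    case: ifP => /= [/andP[HE dE]|hh]; last first.
      rewrite big1 // => s _; rewrite /I EI /= [X in nat_of_bool X](_ : _ = false) //.
      by apply/negbTE; apply: contraFN hh => /and3P[-> ->].
    rewrite -sum1_card natr_sum big_mkcond; apply: eq_bigr => s _.
    by rewrite /I EI HE dE /= !inE -andbA; case: ifP.
  rewrite [leRHS]big_mkcond; apply: ler_sum => s _; case: ifP => bs; last first.
    by rewrite big1 // => H _; rewrite big1 // => E _; rewrite /I bs !andbF.
  rewrite [leRHS](exchange_big_dep xpredT) //=; apply: ler_sum => H _.
  have [E IE|none] := pickP (fun E => I E H s); last first.
    rewrite big1 ?sumr_ge0 // => E _.
    by rewrite none.
  have /and3P[EI HE /and4P[dE sH _ ng]] := IE.
  have /andP[EO /eqP cE] : (E \subset edges n kap) && (#|E| == m).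
    by rewrite -uniform_hypergraphsE.
  have HO := subset_trans HE EO.
  have cH : (#|H| <= m)%N by rewrite -cE subset_leq_card.
  have dj : (m - #|H| < m.+1)%N by rewrite ltnS leq_subr.
  have dD : #|E :\: H| = (m - #|H|)%N by rewrite cardsD (setIidPr HE) cE.
  rewrite (bigD1 (Ordinal dj)) /=; last first.
    rewrite -dD dE /= /P -(colorings_allowed _ HO) sH ng andbT.
    by rewrite dD subKn /=.
  rewrite subKn //.
  apply: le_trans (_ : ('C(#|edges n kap| - #|H|, m - #|H|))%:R <= _); last first.
    by rewrite card_edges -/N lerDl sumr_ge0.
  rewrite -card_supersets // -natr_sum ler_nat -sum1_card [leqRHS]big_mkcond.
  apply: leq_sum => F _; case: (boolP (I F H s)) => // /and3P[FI HF _].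
  by rewrite inE HF andbT -uniform_hypergraphsE FI.
rewrite card_uniform_hypergraphs -/N.
have bound (s : {ffun 'I_n -> D}) (j : 'I_m.+1) : balanced xi s ->
   \sum_(H | P s (m - j)%N H) 'C(N - (m - j), j)%:R <=
   'C(N, m)%:R * (expR ((eta - c) * n%:R) * phi ^+ m) * ('C(m, j)%:R * phi^-1 ^+ j).
  move=> bs; have jm : (j <= m)%N by rewrite -ltnS.
  set h := (m - j)%N; have hm : (h <= m)%N by exact: leq_subr.
  have hj : (m - h)%N = j by rewrite subKn.
  have MN : (#|allowed kap s| <= N)%N.
    by rewrite /N -card_edges subset_leq_card //; apply/subsetP => e; rewrite inE => /andP[].
  set M := #|allowed kap s| in MN *.
  rewrite sumr_const -[_ *+ _]mulr_natl.
  have -> : #|[pred H | P s h H]| =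
      #|[set H : hypergraph n | [&& H \subset allowed kap s, #|H| == h & ~~ good H s]]|.
    by apply: eq_card => H; rewrite !inE.
  apply: (@le_trans _ _ (expR (- (c * n%:R)) * 'C(M, h)%:R * 'C(N - h, j)%:R)).
    by apply: ler_wpM2r => //; apply: hgood => //; exact: balS.
  have C1 : 'C(M, h)%:R <= (M%:R / N%:R) ^+ h * 'C(N, h)%:R :> R.
    have NR : 0 < N%:R ^+ h :> R by rewrite exprn_gt0 // ltr0n.
    rewrite expr_div_n mulrAC ler_pdivlMr // -!natrX -!natrM ler_nat.
    exact: bin_ratio_le.
  have C2 : 'C(N, h)%:R * 'C(N - h, j)%:R = 'C(N, m)%:R * 'C(m, j)%:R :> R.
    by rewrite -!natrM -hj bin_mul_sub ?hm // hj bin_sub.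
  have e0 := expR_ge0 (- (c * n%:R)).
  apply: (@le_trans _ _ (expR (- (c * n%:R)) * ((M%:R / N%:R) ^+ h * 'C(N, h)%:R) * 'C(N - h, j)%:R)).
    by apply: ler_wpM2r => //; apply: ler_wpM2l.
  rewrite (_ : _ * _ * _ = expR (- (c * n%:R)) * (M%:R / N%:R) ^+ h *
     ('C(N, h)%:R * 'C(N - h, j)%:R)); last by ring.
  rewrite C2.
  apply: (@le_trans _ _ (expR (- (c * n%:R)) * (expR (eta * n%:R) * phi ^+ h) * ('C(N, m)%:R * 'C(m, j)%:R))).
    apply: ler_wpM2r; first by rewrite mulr_ge0.
    by apply: ler_wpM2l => //; apply: hfm.
  have -> : phi ^+ h = phi ^+ m * phi^-1 ^+ j.
    have -> : phi ^+ m = phi ^+ h * phi ^+ j by rewrite -exprD /h subnK.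
    by rewrite -mulrA -exprMn divff ?gt_eqF // expr1n mulr1.
  rewrite mulrBl expRD le_eqVlt; apply/orP; left; apply/eqP; ring.
apply: (@le_trans _ _ (\sum_(s : {ffun 'I_n -> D}) 'C(N, m)%:R * (expR ((eta - c) * n%:R) * phi ^+ m) *
    \sum_(j < m.+1 | j%:R <= delta * n%:R) ('C(m, j)%:R * phi^-1 ^+ j))).
  rewrite big_mkcond; apply: ler_sum => s _; case: ifP => bs; last first.
    rewrite !mulr_ge0 ?expR_ge0 ?exprn_ge0 ?sumr_ge0 //; first exact: ltW.
    by move=> j _; rewrite mulr_ge0 // exprn_ge0 // invr_ge0 ltW.
  by rewrite mulr_sumr; apply: ler_sum => j _; apply: bound.
rewrite sumr_const card_ffun card_ord -[_ *+ _]mulr_natl natrX.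
by rewrite le_eqVlt; apply/orP; left; apply/eqP; ring.
Qed.

Lemma markov_count (R : realType) (T : finType) (I : {set T}) (f : T -> R) (a M : R) :
  (forall x, 0 <= f x) -> 0 < a -> \sum_(x in I) f x <= M ->
  #|[set x in I | a <= f x]|%:R <= M / a.
Proof.
move=> f0 a0 hM; rewrite ler_pdivlMr //; apply: le_trans hM.
rewrite -sum1_card natr_sum mulr_suml big_mkcond [leRHS]big_mkcond.
apply: ler_sum => x _ /=; rewrite inE; case: (x \in I) => //=.
by case: ifP => [|_]; rewrite ?mul1r.
Qed.

(** Unbalanced colourings are charged to their own rarity, hence [c <= xis ^+ 2 / 8] and the summand
    [#|D|%:R]. The summand 1 pays for balanced colourings that are not good. *)
Lemma sum_unlucky_colorings (R : realType) (xis c : R) (n kap m : nat) (D : finType)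
    (good : hypergraph n -> {ffun 'I_n -> D} -> bool) (phi eta : R) :
  0 < xis <= 1 -> c <= xis ^+ 2 / 8 -> (0 < #|D|)%N -> 0 < phi <= 1 ->
  (0 < 'C(n, kap))%N ->
  (forall s : {ffun 'I_n -> D}, balanced xis s -> forall h, (h <= m)%N ->
     #|[set H : hypergraph n | [&& H \subset allowed kap s, #|H| == h & ~~ good H s]]|%:R
      <= expR (- (c * n%:R)) * 'C(#|allowed kap s|, h)%:R) ->
  (forall s : {ffun 'I_n -> D}, forall h, (h <= m)%N ->
    (#|allowed kap s|%:R / 'C(n, kap)%:R) ^+ h <= expR (eta * n%:R) * phi ^+ h) ->
  \sum_(E in uniform_hypergraphs n kap m)
     #|[set s in colorings D E | ~~ (balanced xis s && good E s)]|%:R <=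
   #|uniform_hypergraphs n kap m|%:R *
   (expR ((eta - c) * n%:R) * #|D|%:R ^+ n * phi ^+ m * (#|D|%:R + 1)).
Proof.
move=> hx cx D0 /andP[phi0 phi1] N0 hgood hfm.
set N := 'C(n, kap) in N0 hfm *.
pose J (s : {ffun 'I_n -> D}) : nat :=
  #|[set H : hypergraph n | [&& H \subset allowed kap s, #|H| == m &
       ~~ (balanced xis s && good H s)]]|.
have -> : \sum_(E in uniform_hypergraphs n kap m)
     #|[set s in colorings D E | ~~ (balanced xis s && good E s)]|%:R =
   \sum_s (J s)%:R :> R.
  transitivity (\sum_(E in uniform_hypergraphs n kap m)
     \sum_(s | (s \in colorings D E) && ~~ (balanced xis s && good E s)) (1 : R)).
    apply: eq_bigr => E _; rewrite -sum1_card natr_sum; apply: eq_bigl => s.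
    by rewrite in_set.
  rewrite (exchange_big_dep xpredT) //=; apply: eq_bigr => s _.
  rewrite sumr_const; congr (_%:R); apply: eq_card => E; rewrite [RHS]inE.
  rewrite unfold_in /= uniform_hypergraphsE.
  case: (boolP (E \subset edges n kap)) => [EO|EO] /=.
    by rewrite (colorings_allowed s EO) andbCA.
  rewrite [RHS](_ : _ = false) //; apply/negbTE; apply: contra EO => /andP[h _].
  by apply: subset_trans h _; apply/subsetP => e; rewrite inE => /andP[].
have C1 (s : {ffun 'I_n -> D}) : 'C(#|allowed kap s|, m)%:R <=
    'C(N, m)%:R * (expR (eta * n%:R) * phi ^+ m).
  set M := #|allowed kap s|.
  have MN : (M <= N)%N.
    by rewrite /N -card_edges subset_leq_card //; apply/subsetP => e; rewrite inE => /andP[].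
  apply: (@le_trans _ _ ((M%:R / N%:R) ^+ m * 'C(N, m)%:R)).
    have NR : 0 < N%:R ^+ m :> R by rewrite exprn_gt0 // ltr0n.
    rewrite expr_div_n mulrAC ler_pdivlMr // -!natrX -!natrM ler_nat.
    exact: bin_ratio_le.
  by rewrite mulrC; apply: ler_wpM2l => //; apply: hfm.
have J1 s : (J s)%:R <= (~~ balanced xis s)%:R * ('C(N, m)%:R * (expR (eta * n%:R) * phi ^+ m)) +
   expR (- (c * n%:R)) * ('C(N, m)%:R * (expR (eta * n%:R) * phi ^+ m)).
  have X0 : 0 <= 'C(N, m)%:R * (expR (eta * n%:R) * phi ^+ m).
    by rewrite !mulr_ge0 ?expR_ge0 ?exprn_ge0 // ltW.
  rewrite /J; case: (boolP (balanced xis s)) => bs /=.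
    rewrite mul0r add0r; apply: (le_trans (hgood s bs m (leqnn m))).
    by apply: ler_wpM2l; rewrite ?expR_ge0.
  rewrite mul1r -[leLHS]addr0; apply: lerD; last by rewrite mulr_ge0 ?expR_ge0.
  apply: le_trans (C1 s); rewrite ler_nat -cards_draws; apply: subset_leq_card.
  by apply/subsetP => H; rewrite !inE andbT.
apply: (le_trans (ler_sum _ (fun s _ => J1 s))).
rewrite big_split /= -mulr_suml sumr_const card_ffun card_ord -[_ *+ (_ ^ _)]mulr_natl natrX.
have -> : \sum_(i : {ffun 'I_n -> D}) (~~ balanced xis i)%:R =
    #|[set s : {ffun 'I_n -> D} | ~~ balanced xis s]|%:R :> R.
  by rewrite -natr_sum -sum1_card big_mkcond [in RHS]big_mkcond /=; congr (_%:R);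
     apply: eq_bigr => s _; rewrite inE; case: balanced.
have U := card_unbalanced D0 hx n.
have U2 : expR (- (xis ^+ 2 / 8) * n%:R) <= expR (- (c * n%:R)).
  by rewrite ler_expR mulNr lerN2; apply: ler_wpM2r.
have X0 : 0 <= 'C(N, m)%:R * (expR (eta * n%:R) * phi ^+ m).
  by rewrite !mulr_ge0 ?expR_ge0 ?exprn_ge0 // ltW.
rewrite card_uniform_hypergraphs -/N mulrBl expRD.
apply: (@le_trans _ _ (#|D|%:R * (#|D|%:R ^+ n * expR (- (c * n%:R))) *
    ('C(N, m)%:R * (expR (eta * n%:R) * phi ^+ m)) + #|D|%:R ^+ n *
   (expR (- (c * n%:R)) * ('C(N, m)%:R * (expR (eta * n%:R) * phi ^+ m))))).
  rewrite lerD2r; apply: ler_wpM2r => //; apply: (le_trans U).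
  by apply: ler_wpM2l => //; apply: ler_wpM2l => //; rewrite exprn_ge0.
by rewrite le_eqVlt; apply/orP; left; apply/eqP; ring.
Qed.

(** In an instance with at least [B2] colourings a uniform one lies in [X E] with probability at
    most [#|X E|%:R / B2]. This turns a count of pairs, which is the planted measure up to
    normalisation, into a bound for the uniform pair. *)
Lemma all_loose_prob_ge (R : realType) (n : nat) (D : finType) (I G : {set hypergraph n})
    (f B2 : R) (X : hypergraph n -> {set {ffun 'I_n -> D}}) :
  (0 < #|I|)%N -> 0 < B2 -> G \subset I ->
  (forall E, E \in G -> B2 <= #|colorings D E|%:R /\
     forall s, s \in colorings D E -> s \notin X E ->
        [forall v, loose (colorings D E) f s v]) ->
  (#|G|%:R - (\sum_(E in I) #|X E|%:R) / B2) / #|I|%:R <=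
    all_loose_prob I (@colorings n D) f.
Proof.
move=> I0 B20 /subsetP GI hG.
have IR : 0 < #|I|%:R :> R by rewrite ltr0n.
rewrite /all_loose_prob /pair_prob ler_pdivrMr // [leRHS]mulr_suml.
have inv0 (E : hypergraph n) : 0 <= #|colorings D E|%:R^-1 :> R by rewrite invr_ge0.
apply: (@le_trans _ _ (\sum_(E in G) (1 - #|X E|%:R / B2))).
  rewrite sumrB sumr_const lerD2l lerN2 mulr_suml big_mkcond [leRHS]big_mkcond.
  apply: ler_sum => E _; case: ifP => [/GI -> //|_]; case: ifP => // _.
  by rewrite divr_ge0 // ltW.
rewrite big_mkcond [leRHS]big_mkcond; apply: ler_sum => E _; case: ifP => [EG|_]; last first.
  case: ifP => // _; apply: mulr_ge0 => //; apply: sumr_ge0 => s _.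
  by apply: mulr_ge0 => //; rewrite invr_ge0.
rewrite GI // sumr_const -[Y in _ <= Y * _]mulr_natl.
have [cB hs] := hG E EG.
have c0 : 0 < #|colorings D E|%:R :> R by exact: lt_le_trans cB.
set L := (Y in _ <= Y%:R * _ * _).
have -> : L%:R * (#|I|%:R^-1 * #|colorings D E|%:R^-1) * #|I|%:R = L%:R / #|colorings D E|%:R :> R.
  by field; rewrite !gt_eqF.
have cL : (#|colorings D E| <= L + #|X E|)%N.
  apply: leq_trans (_ : #|[set s in colorings D E | [forall v, loose (colorings D E) f s v]] :|: X E| <= _)%N.
    apply: subset_leq_card; apply/subsetP => s sE; rewrite in_setU.
    case: (boolP (s \in X E)) => sX; rewrite ?orbT // orbF in_set sE /=.
    exact: hs.
  apply: leq_trans (leq_card_setU _ _) _; rewrite leq_add2r.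
  by apply: subset_leq_card; apply/subsetP => s; rewrite in_set.
rewrite ler_pdivlMr // mulrBl mul1r lerBlDr.
have h1 : #|colorings D E|%:R <= L%:R + #|X E|%:R :> R by rewrite -natrD ler_nat.
apply: (le_trans h1); rewrite lerD2l -mulrA ler_peMr //.
by rewrite mulrC ler_pdivlMr // mul1r.
Qed.

Lemma all_loose_prob_le1 (R : realType) (n : nat) (D : finType) (I : {set hypergraph n})
    (Sol : hypergraph n -> {set {ffun 'I_n -> D}}) (f : R) :
  all_loose_prob I Sol f <= 1.
Proof.
rewrite /all_loose_prob /pair_prob.
have [I0|I0] := posnP #|I|.
  by rewrite big1 // => E; rewrite (cards0_eq I0) inE.
apply: (@le_trans _ _ (\sum_(E in I) #|I|%:R^-1)); last first.
  by rewrite sumr_const -[_ *+ _]mulr_natl divff // pnatr_eq0 -lt0n.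
apply: ler_sum => E _; rewrite sumr_const -[_ *+ _]mulr_natr -mulrA.
rewrite -[leRHS]mulr1; apply: ler_wpM2l; first by rewrite invr_ge0.
set L := (X in _ * X%:R <= _); have LE : (L <= #|Sol E|)%N.
  by apply: subset_leq_card; apply/subsetP => s /andP[].
have [S0|S0] := posnP #|Sol E|; first by rewrite S0 invr0 mul0r.
by rewrite mulrC ler_pdivrMr ?ltr0n // mul1r ler_nat.
Qed.

Lemma loose_whp (R : realType) (kap : nat) (D : finType) (r lam smax xis : R)
    (m : nat -> nat) :
  (1 < #|D|)%N -> (1 < kap)%N -> 0 <= r ->
  r * #|D|%:R ^+ 2 < lam * edge_phi R D kap ^+ 2 * (#|D|%:R ^+ 2) ^+ kap ->
  #|D|%:R < smax ->
  (forall s : R, 0 <= s <= smax ->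
     lam * (s ^+ kap - 1 - kap%:R * (s - 1)) <= s * ln s - s + 1) ->
  (forall n, (m n)%:R <= r * n%:R + 1) ->
  0 < xis <= 1 ->
  (forall gam : R, 0 < gam ->
     exists (c delta : R) (good : forall n, hypergraph n -> {ffun 'I_n -> D} -> bool),
     [/\ 0 < c, 0 < delta,
       \forall n \near \oo%classic, forall s : {ffun 'I_n -> D}, balanced xis s ->
         forall h, (h <= m n)%N ->
         #|[set H : hypergraph n | [&& H \subset allowed kap s, #|H| == h & ~~ good n H s]]|%:R
          <= expR (- (c * n%:R)) * 'C(#|allowed kap s|, h)%:R :> R &
       forall eps : R, 0 < eps -> \forall n \near \oo%classic,
         #|[set E in uniform_hypergraphs n kap (m n) |
              ~~ repairable gam delta (good n) E]|%:R
         <= eps * #|uniform_hypergraphs n kap (m n)|%:R]) ->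
  forall gam eps : R, 0 < gam -> 0 < eps ->
  \forall n \near \oo%classic,
    1 - eps <= all_loose_prob (uniform_hypergraphs n kap (m n)) (@colorings n D) (gam * n%:R).
Proof.
move=> D1 k1 r0 hlam hs hpt hm xis01 hgood gam eps gam0 eps0.
have [c2 [de2 [good2 [c20 de20 G2 W2]]]] := hgood gam gam0.
set q : R := #|D|%:R; set phi := edge_phi R D kap.
have D0 : (0 < #|D|)%N by exact: ltnW.
have q0 : 0 < q by rewrite ltr0n.
have phi0 : 0 < phi by exact: edge_phi_gt0.
have phi1 : phi <= 1 by exact: edge_phi_le1.
have /andP[xis0 xis1] := xis01.
pose c := Num.min c2 (xis ^+ 2 / 8).
have c0 : 0 < c by rewrite lt_min c20 divr_gt0 ?exprn_gt0.
have cc2 : c <= c2 by rewrite ge_min lexx.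
have cx : c <= xis ^+ 2 / 8 by rewrite ge_min lexx orbT.
(* [w] and then [gam1] make the rate [q * w - gam1 * ln w] of a Hamming ball of radius [gam1 * n%:R]
   at most [c / 4]. *)
pose w := Num.min 1 (c / (8 * q)).
have w0 : 0 < w by rewrite lt_min ltr01 divr_gt0 ?mulr_gt0.
have w1 : w <= 1 by rewrite ge_min lexx.
have qw : q * w <= c / 8.
  rewrite mulrC -ler_pdivlMr //; apply: (@le_trans _ _ (c / (8 * q))).
    by rewrite ge_min lexx orbT.
  by rewrite le_eqVlt; apply/orP; left; apply/eqP; field; rewrite gt_eqF.
have lw : ln w <= 0 by exact: ln_le0.
have lw1 : 0 < 1 - ln w by move: lw; clear; lra.
pose gam1 := c / (8 * (1 - ln w)).
have gam10 : 0 < gam1 by rewrite divr_gt0 ?mulr_gt0.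
have gamw : - (gam1 * ln w) <= c / 8.
  have -> : c / 8 = gam1 * (1 - ln w) by rewrite /gam1; field; rewrite gt_eqF.
  by move: gam10; rewrite mulrBr mulr1; clear; lra.
have [c1 [de1 [good1 [c10 de10 G1 W1]]]] := hgood gam1 gam10.
(* Failures at either radius must stay rare after a loss of a few multiples of [eta], so it is
   chosen after both [c] and [c1]. *)
pose eta := Num.min (c / 16) (c1 / 16).
have eta0 : 0 < eta by rewrite lt_min !divr_gt0.
have etac : eta <= c / 16 by rewrite ge_min lexx.
have etac1 : eta <= c1 / 16 by rewrite ge_min lexx orbT.
pose w' := Num.min 1 (eta / (r + 1)).
have r1 : 0 < r + 1 by move: r0; clear; lra.
have rr1 : r < r + 1 by rewrite ltrDl.
have w'0 : 0 < w' by rewrite lt_min ltr01 divr_gt0.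
have w'1 : w' <= 1 by rewrite ge_min lexx.
have w'r : w' * (r + 1) <= eta.
  by rewrite -ler_pdivlMr // ge_min lexx orbT.
have phiV1 : 1 <= phi^-1 by rewrite invf_ge1.
have lwp : 0 <= ln phi^-1 - ln w'.
  by have := ln_ge0 phiV1; have := ln_le0 w'1; clear; lra.
have lwp1 : 0 < 1 + (ln phi^-1 - ln w') by move: lwp; clear; lra.
(* So few missing edges that selecting them costs at most [2 * eta] in the exponent. *)
pose de := Num.min de1 (eta / (1 + (ln phi^-1 - ln w'))).
have de0 : 0 < de by rewrite lt_min de10 divr_gt0.
have dede1 : de <= de1 by rewrite ge_min lexx.
have delw : de * (ln phi^-1 - ln w') <= eta.
  apply: (@le_trans _ _ (de * (1 + (ln phi^-1 - ln w')))).
    by apply: ler_wpM2l; [exact: ltW | rewrite lerDr].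
  by rewrite -ler_pdivlMr // ge_min lexx orbT.
have [xi1 xi10 NR] := nearly_rich_whp D1 k1 r0 de0 eta0 hlam hs hpt hm.
have [xi2 xi20 FM] := first_moment D1 k1 r0 eta0 hm.
pose xi := Num.min xis (Num.min xi1 xi2).
have xi0 : 0 < xi by rewrite !lt_min xis0 xi10.
have xixis : xi <= xis by rewrite ge_min lexx.
have xixi1 : xi <= xi1 by rewrite !ge_min lexx orbT.
have xixi2 : xi <= xi2 by rewrite !ge_min lexx !orbT.
have e8 : 0 < eps / 8 by rewrite divr_gt0.
have c12 : 0 < c1 / 2 by rewrite divr_gt0.
have ch2 : 0 < c / 2 by rewrite divr_gt0.
have qq : 0 <= 2 * (q + 1) by rewrite mulr_ge0 // addr_ge0 // ltW.
near=> n.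
have nr : #|[set E in uniform_hypergraphs n kap (m n) | ~~ nearly_rich xi de eta kap (m n) D E]|%:R <= eps / 8 * #|uniform_hypergraphs n kap (m n)|%:R.
  by near: n; apply: NR => //; rewrite xi0.
have fm : forall s : {ffun 'I_n -> D}, forall h, (h <= m n)%N ->
    (#|allowed kap s|%:R / 'C(n, kap)%:R) ^+ h
      <= expR (eta * n%:R) * phi ^+ h /\
    (balanced xi s -> expR (- (eta * n%:R)) * phi ^+ h <=
        (#|allowed kap s|%:R / 'C(n, kap)%:R) ^+ h).
  by near: n; apply: FM; rewrite xi0.
have g1 : forall s : {ffun 'I_n -> D}, balanced xis s -> forall h, (h <= m n)%N ->
         #|[set H : hypergraph n | [&& H \subset allowed kap s, #|H| == h & ~~ good1 n H s]]|%:R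
          <= expR (- (c1 * n%:R)) * 'C(#|allowed kap s|, h)%:R :> R.
  by near: n.
have g2 : forall s : {ffun 'I_n -> D}, balanced xis s -> forall h, (h <= m n)%N ->
         #|[set H : hypergraph n | [&& H \subset allowed kap s, #|H| == h & ~~ good2 n H s]]|%:R
          <= expR (- (c2 * n%:R)) * 'C(#|allowed kap s|, h)%:R :> R.
  by near: n.
have rp1 : #|[set E in uniform_hypergraphs n kap (m n) | ~~ repairable gam1 de1 (good1 n) E]|%:R <= eps / 8 * #|uniform_hypergraphs n kap (m n)|%:R.
  by near: n; exact: (W1 _ e8).
have rp2 : #|[set E in uniform_hypergraphs n kap (m n) | ~~ repairable gam de2 (good2 n) E]|%:R <= eps / 8 * #|uniform_hypergraphs n kap (m n)|%:R.
  by near: n; exact: (W2 _ e8).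
have [mN _] : (m n <= 'C(n, kap))%N /\
     'C(n, kap)%:R ^+ m n <= expR (eta * n%:R) * ('C(n, kap) ^_ m n)%:R :> R.
  by near: n; exact: (expn_le_ffact_exp k1 r0 eta0 hm).
have nk : (kap <= n)%N by near: n; exact: nbhs_infty_ge.
have mn : (m n)%:R <= (r + 1) * n%:R by near: n; exact: near_linear_le hm rr1.
have f1 : 2 * expR (- (c1 / 2 * n%:R)) <= eps / 8.
  by near: n; exact: near_exp_decay.
have f2 : 2 * (q + 1) * expR (- (c / 2 * n%:R)) <= eps / 8.
  by near: n; exact: near_exp_decay.
set I := uniform_hypergraphs n kap (m n) in nr rp1 rp2 *.
have n0 : (0 < n)%N by apply: leq_trans nk; exact: ltnW.
have N0 : (0 < 'C(n, kap))%N by rewrite bin_gt0.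
have I0 : (0 < #|I|)%N by rewrite card_uniform_hypergraphs bin_gt0.
have IR : 0 < #|I|%:R :> R by rewrite ltr0n.
have phi01 : 0 < phi <= 1 by rewrite phi0.
have fm1 : forall s : {ffun 'I_n -> D}, forall h, (h <= m n)%N ->
    (#|allowed kap s|%:R / 'C(n, kap)%:R) ^+ h <= expR (eta * n%:R) * phi ^+ h.
  by move=> s h hm'; case: (fm s h hm').
pose B := expR (- (eta * n%:R)) * phi ^+ m n * q ^+ n.
have B0 : 0 < B by rewrite !mulr_gt0 ?expR_gt0 ?exprn_gt0.
(* In most instances fewer than [B / 2] pairs are bad, so a subinstance with at least [B] balanced
   colourings keeps [B / 2] good ones. *)
have bc : #|[set E in I | B / 2 <= (bad_count xi de (good1 n) E)%:R]|%:R <= eps / 8 * #|I|%:R.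
  have := sum_bad_count (ltW de0) (ltW c10) D0 phi01 mN N0 xixis g1 fm1.
  set Sm := \sum_(j < _ | _) _ => hsum.
  have hSm : Sm <= expR (2 * eta * n%:R).
    have w'01 : 0 < w' <= 1 by rewrite w'0.
    have dn0 : 0 <= de * n%:R by rewrite mulr_ge0 // ltW.
    apply: (le_trans (sum_bin_small_le (m n) w'01 phiV1 dn0)); rewrite ler_expR.
    have h1 : w' * (m n)%:R <= eta * n%:R.
      apply: (@le_trans _ _ (w' * ((r + 1) * n%:R))).
        by apply: ler_wpM2l => //; exact: ltW.
      by rewrite mulrA; apply: ler_wpM2r.
    have h2 : de * n%:R * (ln phi^-1 - ln w') <= eta * n%:R.
      by rewrite mulrAC; apply: ler_wpM2r.
    by move: h1 h2; clear; lra.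
  have B20 : 0 < B / 2 by rewrite divr_gt0.
  apply: (le_trans (markov_count _ B20 hsum)) => //.
  rewrite -/I -mulrA [leRHS]mulrC; apply: ler_wpM2l => //.
  apply: le_trans f1; rewrite ler_pdivrMr //.
  have X0 : 0 <= expR ((eta - c1) * n%:R) * q ^+ n * phi ^+ m n.
    by rewrite !mulr_ge0 ?expR_ge0 ?exprn_ge0 // ltW.
  apply: (le_trans (ler_wpM2l X0 hSm)).
  have -> : 2 * expR (- (c1 / 2 * n%:R)) * (B / 2) =
     (expR (- (c1 / 2 * n%:R)) * expR (- (eta * n%:R))) * (q ^+ n * phi ^+ m n).
    by rewrite /B; field.
  have -> : expR ((eta - c1) * n%:R) * q ^+ n * phi ^+ m n * expR (2 * eta * n%:R) =
     (expR ((eta - c1) * n%:R) * expR (2 * eta * n%:R)) * (q ^+ n * phi ^+ m n) by ring.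
  apply: ler_wpM2r; first by rewrite mulr_ge0 ?exprn_ge0 // ltW.
  rewrite -!expRD ler_expR.
  have : eta * n%:R <= c1 / 16 * n%:R by apply: ler_wpM2r.
  have : 0 <= c1 * n%:R by rewrite mulr_ge0 // ltW.
  by clear; lra.
pose X (E : hypergraph n) := [set s in colorings D E | ~~ (balanced xis s && good2 n E s)].
have g2' : forall s : {ffun 'I_n -> D}, balanced xis s -> forall h, (h <= m n)%N ->
         #|[set H : hypergraph n | [&& H \subset allowed kap s, #|H| == h & ~~ good2 n H s]]|%:R
          <= expR (- (c * n%:R)) * 'C(#|allowed kap s|, h)%:R :> R.
  move=> s bs h hm'; apply: (le_trans (g2 s bs h hm')); apply: ler_wpM2r => //.
  by rewrite ler_expR lerN2; apply: ler_wpM2r.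
have SX := sum_unlucky_colorings xis01 cx D0 phi01 N0 g2' fm1.
rewrite -/I -/q in SX.
pose B2 := B / 2 * expR (- (c / 4 * n%:R)).
have B20 : 0 < B2 by rewrite mulr_gt0 ?expR_gt0 // divr_gt0.
pose G := [set E in I | [&& nearly_rich xi de eta kap (m n) D E,
   repairable gam1 de1 (good1 n) E, repairable gam de2 (good2 n) E &
   ~~ (B / 2 <= (bad_count xi de (good1 n) E)%:R)]].
have GI : G \subset I by apply/subsetP => E; rewrite in_set => /andP[].
have hG E : E \in G -> B2 <= #|colorings D E|%:R /\
     forall s, s \in colorings D E -> s \notin X E ->
        [forall v, loose (colorings D E) (gam * n%:R) s v].
  rewrite in_set => /andP[EI /and4P[/existsP[H /and3P[HE dH richH]] rep1 rep2 bcE]].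
  split; last first.
    move=> s sE; rewrite in_set sE /= negbK => /andP[_ gs].
    have /forallP/(_ E) := rep2; rewrite subxx setDv cards0 mulr_ge0 ?(ltW de20) //=.
    by move=> /forall_inP/(_ s sE)/implyP/(_ gs).
  pose bad := [set s in balanced_colorings xi D H | ~~ good1 n H s].
  pose gd := [set s in balanced_colorings xi D H | good1 n H s].
  have cbad : #|bad|%:R < B / 2.
    move: bcE; rewrite -ltNge; apply: le_lt_trans; rewrite ler_nat /bad_count.
    by rewrite (bigD1 H) /= ?HE ?dH //; exact: leq_addr.
  have cgd : B / 2 <= #|gd|%:R.
    have : #|balanced_colorings xi D H|%:R = #|gd|%:R + #|bad|%:R :> R.
      rewrite -natrD; congr (_%:R); rewrite -(cardsID [set s | good1 n H s]).
      by congr (_ + _)%N; apply: eq_card => s; rewrite !inE // andbC.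
    move: richH cbad; rewrite -/phi -/q -/B; clear; lra.
  (* Repair gives a colouring of [E] within [gam1 * n%:R] of each good colouring of [H], whatever
     vertex and colour are prescribed; vertex 0 and an arbitrary colour [d] serve. *)
  have sub : gd \subset \bigcup_(t in colorings D E)
      [set s : {ffun 'I_n -> D} | (hamming s t)%:R <= gam1 * n%:R].
    apply/subsetP => s; rewrite in_set => /andP[]; rewrite in_set => /andP[sH bs] gs.
    have /forallP/(_ H) := rep1; rewrite HE (le_trans dH) /=; last by apply: ler_wpM2r.
    move=> /forall_inP/(_ s sH)/implyP/(_ gs)/forallP/(_ (Ordinal n0))/forallP.
    have /card_gt0P[d _] := D0.
    move=> /(_ d)/exists_inP[t tE /andP[_ ht]].
    by apply/bigcupP; exists t => //; rewrite in_set.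
  have cgd2 : #|gd|%:R <= #|colorings D E|%:R * expR (c / 4 * n%:R) :> R.
    apply: (@le_trans _ _ (\sum_(t in colorings D E)
       #|[set s : {ffun 'I_n -> D} | (hamming s t)%:R <= gam1 * n%:R]|%:R)).
      rewrite -natr_sum ler_nat; apply: leq_trans (subset_leq_card sub) _.
      elim/big_rec2: _ => [|t a b _ h]; first by rewrite cards0.
      by apply: leq_trans (leq_card_setU _ _) _; rewrite leq_add2l.
    rewrite mulr_natl -sumr_const; apply: ler_sum => t _.
    have w01 : 0 < w <= 1 by rewrite w0.
    apply: (le_trans (card_hamming_ball _ _ w01 D0)); rewrite ler_expR.
    apply: ler_wpM2r => //; rewrite -/q.
    by have := qw; have := gamw; clear; lra.
  rewrite /B2 expRN ler_pdivrMr ?expR_gt0 //.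
  exact: le_trans cgd cgd2.
have P := all_loose_prob_ge I0 B20 GI hG.
apply: le_trans P; rewrite ler_pdivlMr //.
have cG : #|I|%:R - 4 * (eps / 8 * #|I|%:R) <= #|G|%:R.
  have : (#|I| <= #|G| + (#|[set E in I | ~~ nearly_rich xi de eta kap (m n) D E]| +
     #|[set E in I | ~~ repairable gam1 de1 (good1 n) E]| +
     #|[set E in I | ~~ repairable gam de2 (good2 n) E]| +
     #|[set E in I | (B / 2 <= (bad_count xi de (good1 n) E)%:R)%R]|))%N.
    set A1 := [set E in I | _]; set A2 := [set E in I | _]; set A3 := [set E in I | _].
    set A4 := [set E in I | _].
    apply: leq_trans (_ : #|G :|: (A1 :|: A2 :|: A3 :|: A4)| <= _)%N.
      apply: subset_leq_card; apply/subsetP => E EI.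
      have inI Q : (E \in [set F in I | Q F]) = Q E by rewrite in_set EI.
      rewrite !in_setU /G /A1 /A2 /A3 /A4 !inI /=.
      by case: nearly_rich => //=; case: repairable => //=; case: repairable => //=; case: (B / 2 <= _).
    apply: leq_trans (leq_card_setU _ _) _; rewrite leq_add2l.
    apply: leq_trans (leq_card_setU _ _) _; rewrite leq_add2r.
    apply: leq_trans (leq_card_setU _ _) _; rewrite leq_add2r.
    exact: leq_card_setU.
  rewrite -(ler_nat R) !natrD; move: nr rp1 rp2 bc; clear; lra.
have SX2 : (\sum_(E in I) #|X E|%:R) / B2 <= eps / 8 * #|I|%:R.
  rewrite ler_pdivrMr //; apply: (le_trans SX).
  rewrite [leRHS]mulrAC [leRHS]mulrC; apply: ler_wpM2l => //.
  apply: (@le_trans _ _ (2 * (q + 1) * expR (- (c / 2 * n%:R)) * B2)); last first.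
    by apply: ler_wpM2r => //; exact: ltW.
  have -> : 2 * (q + 1) * expR (- (c / 2 * n%:R)) * B2 =
    expR (- (c / 2 * n%:R) - eta * n%:R - c / 4 * n%:R) * (q ^+ n * phi ^+ m n * (q + 1)).
    by rewrite !expRD /B2 /B; field.
  rewrite (_ : _ * _ * _ * _ = expR ((eta - c) * n%:R) * (q ^+ n * phi ^+ m n * (q + 1))); last by ring.
  apply: ler_wpM2r.
    apply: mulr_ge0; last by rewrite addr_ge0 // ltW.
    by rewrite mulr_ge0 ?exprn_ge0 // ltW.
  rewrite ler_expR.
  have : eta * n%:R <= c / 16 * n%:R by apply: ler_wpM2r.
  have : 0 <= c * n%:R by rewrite mulr_ge0 // ltW.
  by clear; lra.
have : 0 <= eps * #|I|%:R by rewrite mulr_ge0 // ltW.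
by move: cG SX2; clear; lra.
Unshelve. all: by end_near. Qed.

(** * Sparsity of random hypergraphs *)

Lemma card_cover_le (n kap : nat) (T : hypergraph n) :
  T \subset edges n kap -> (#|cover T| <= kap * #|T|)%N.
Proof.
move=> /subsetP TO; rewrite /cover mulnC -sum_nat_const.
apply: leq_trans (_ : \sum_(e in T) #|e| <= _)%N.
  elim/big_rec2: _ => [|e a b _ h]; first by rewrite cards0.
  by apply: leq_trans (leq_card_setU _ _) _; rewrite leq_add2l.
by apply: leq_sum => e /TO; rewrite inE => /eqP ->.
Qed.

Lemma cover_setU1 (n : nat) (e : {set 'I_n}) (T : hypergraph n) :
  cover (e |: T) = e :|: cover T.
Proof.
apply/setP => x; apply/bigcupP/setUP => [[f]|[xe|/bigcupP[f fT xf]]].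
- by rewrite in_setU1 => /orP[/eqP -> xe|fT xf]; [left|right; apply/bigcupP; exists f].
- by exists e => //; rewrite setU11.
- by exists f => //; rewrite in_setU1 fT orbT.
Qed.

(** [kap * #|T| - #|cover T|] counts the vertex coincidences of [T]. Adding an edge [e] creates
    [#|e :&: cover T|] new ones, so building [T] edge by edge costs at most [Q] per edge. *)
Lemma sum_cover_weight (R : realType) (n kap t : nat) (C : hypergraph n) (rho Q : R) :
  C \subset edges n kap -> 0 <= rho ->
  (forall Y : {set 'I_n}, (#|Y| <= kap * t)%N ->
     \sum_(e in C) rho ^+ #|e :&: Y| <= Q) ->
  0 <= Q ->
  t`!%:R * \sum_(T : hypergraph n | (T \subset C) && (#|T| == t))
     rho ^+ (kap * #|T| - #|cover T|) <= Q ^+ t.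
Proof.
move=> CO rho0 hQ Q0.
pose W (T : hypergraph n) : R :=
  if T \subset C then rho ^+ (kap * #|T| - #|cover T|) else 0.
have := @sum_subsets_weight R _ W Q t Q0.
have -> : W set0 = 1.
  by rewrite /W sub0set cards0 muln0 sub0n expr0.
have -> : \sum_(T : {set {set 'I_n}} | #|T| == t) W T =
   \sum_(T : hypergraph n | (T \subset C) && (#|T| == t)) rho ^+ (kap * #|T| - #|cover T|).
  by rewrite /W -big_mkcondr; apply: eq_bigl => T; exact: andbC.
rewrite mulr1; apply => T cT; rewrite /W.
case: (boolP (T \subset C)) => TC; last first.
  rewrite mulr0 big1 // => e _; rewrite ifF //.
  apply/negbTE; apply: contra TC => /subsetP h; apply/subsetP => x xT.
  by apply: h; rewrite in_setU1 xT orbT.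
have TO := subset_trans TC CO.
have cc := card_cover_le TO.
apply: (@le_trans _ _ (\sum_(e in C) rho ^+ #|e :&: cover T| *
    rho ^+ (kap * #|T| - #|cover T|))).
  rewrite big_mkcond [leRHS]big_mkcond /=; apply: ler_sum => e _.
  have r0 j : 0 <= rho ^+ j by exact: exprn_ge0.
  case: (boolP (e \in T)) => eT /=; first by case: ifP => // _; rewrite mulr_ge0.
  rewrite subUset sub1set TC andbT; case: ifP => // eC.
  rewrite -exprD cardsU1 eT /= cover_setU1.
  have /eqP ce : #|e| == kap by have := subsetP CO e eC; rewrite inE.
  rewrite [X in X <= _](_ : _ = rho ^+ (#|e :&: cover T| + (kap * #|T| - #|cover T|))) //.
  congr (_ ^+ _); have := cardsU e (cover T); rewrite ce.
  have : (#|e :&: cover T| <= kap)%N by rewrite -ce subset_leq_card // subsetIl.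
  move=> h1 h2; have aux (K c i u x : nat) : (c <= K * x)%N -> (i <= K)%N ->
    u = (K + c - i)%N -> (K * (1 + x) - u)%N = (i + (K * x - c))%N by nia.
  exact: aux.
rewrite -mulr_suml; apply: ler_wpM2r; first exact: exprn_ge0.
apply: hQ; apply: leq_trans cc _; rewrite leq_mul2l; apply/orP; right; exact: ltnW.
Qed.

(** Markov for the previous weight: sets with [x] coincidences or more are rare by a factor
    [rho ^+ x]. *)
Lemma card_small_cover (R : realType) (n kap t x : nat) (C : hypergraph n) (rho Q : R) :
  C \subset edges n kap -> 1 <= rho ->
  (forall Y : {set 'I_n}, (#|Y| <= kap * t)%N ->
     \sum_(e in C) rho ^+ #|e :&: Y| <= Q) ->
  0 <= Q ->
  t`!%:R * #|[set T : hypergraph n | [&& T \subset C, #|T| == t &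
                (#|cover T| + x <= kap * t)%N]]|%:R * rho ^+ x <= Q ^+ t.
Proof.
move=> CO rho1 hQ Q0; apply: le_trans (sum_cover_weight CO _ hQ Q0); last lra.
rewrite -mulrA; apply: ler_wpM2l => //.
rewrite -sum1_card natr_sum mulr_suml big_mkcond [leRHS]big_mkcond /=.
apply: ler_sum => T _; rewrite inE.
case: (T \subset C) => //=; case: eqP => //= ->; case: leqP => h; rewrite ?mul1r.
  by apply: ler_weXn2l => //; lia.
by apply: exprn_ge0; lra.
Qed.

(** An elementary symmetric polynomial with weight [rho] on [Y] and 1 elsewhere. *)
Lemma sum_edges_weight (R : realType) (n kap : nat) (Y Z : {set 'I_n}) (rho : R) :
  0 <= rho ->
  kap`!%:R * \sum_(e : {set 'I_n} | (e \subset Z) && (#|e| == kap)) rho ^+ #|e :&: Y|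
   <= (#|Z|%:R + rho * #|Y|%:R) ^+ kap.
Proof.
move=> rho0.
pose a v : R := if v \in Y then rho else 1.
have a0 v : 0 <= a v by rewrite /a; case: ifP.
apply: (@le_trans _ _ ((\sum_(v in Z) a v) ^+ kap)).
  apply: le_trans (elementary_symmetric_le Z kap a0).
  apply: ler_wpM2l => //; apply: ler_sum => e _.
  rewrite /a -big_mkcondr /= prodr_const le_eqVlt; apply/orP; left; apply/eqP.
  by congr (_ ^+ _); apply: eq_card => v; rewrite !inE.
apply: lerXn2r; rewrite ?nnegrE ?sumr_ge0 ?addr_ge0 ?mulr_ge0 //.
apply: (@le_trans _ _ (\sum_(v in Z) 1 + \sum_(v in Y) rho)); last first.
  by rewrite !sumr_const -[rho *+ _]mulr_natr.
rewrite [X in X + _]big_mkcond [X in _ + X]big_mkcond [leLHS]big_mkcond -big_split /=.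
apply: ler_sum => v _; rewrite /a.
by case: (v \in Z); case: (v \in Y) => /=; rewrite ?addr0 ?add0r ?lerDr.
Qed.

Lemma expn_self_le (R : realType) (t : nat) : t%:R ^+ t <= expR t%:R * t`!%:R :> R.
Proof.
elim: t => [|t IH]; first by rewrite expR0 fact0 expr0 mul1r.
have [->|t0] := posnP t; 
  first by have := expR_ge1Dx (1 : R); rewrite expr1 (_ : 1`! = 1%N) // mulr1; lra.
have tR : 0 < t%:R :> R by rewrite ltr0n.
have h : t.+1%:R ^+ t <= expR 1 * t%:R ^+ t :> R.
  have -> : t.+1%:R = (1 + t%:R^-1) * t%:R :> R.
    by rewrite mulrDl mulVf ?gt_eqF // mul1r -natr1 addrC.
  rewrite exprMn; apply: ler_wpM2r; first by rewrite exprn_ge0.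
  have -> : expR 1 = expR t%:R^-1 ^+ t :> R by rewrite -expRM_natl divff ?gt_eqF.
  apply: lerXn2r; rewrite ?nnegrE ?expR_ge0 ?addr_ge0 ?invr_ge0 //.
  exact: expR_ge1Dx.
rewrite exprS factS -natr1 expRD natrM.
apply: (@le_trans _ _ ((t%:R + 1) * (expR 1 * t%:R ^+ t))).
  by rewrite natr1; apply: ler_wpM2l.
apply: (@le_trans _ _ ((t%:R + 1) * (expR 1 * (expR t%:R * t`!%:R)))).
  by rewrite natr1; apply: ler_wpM2l => //; apply: ler_wpM2l; rewrite ?expR_ge0.
by rewrite -natr1 le_eqVlt; apply/orP; left; apply/eqP; ring.
Qed.

Lemma card_contains_le (R : realType) (n kap m t : nat) (F : {set hypergraph n}) :
  (m <= 'C(n, kap))%N -> (0 < 'C(n, kap))%N ->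
  (forall T, T \in F -> (T \subset edges n kap) && (#|T| == t)) ->
  #|[set E in uniform_hypergraphs n kap m | [exists T in F, T \subset E]]|%:R <=
  #|F|%:R * (m%:R / 'C(n, kap)%:R) ^+ t * #|uniform_hypergraphs n kap m|%:R :> R.
Proof.
move=> mN N0 hF; set N := 'C(n, kap) in mN N0 *.
have NR : 0 < N%:R :> R by rewrite ltr0n.
have one T : T \in F ->
  #|[set E in uniform_hypergraphs n kap m | T \subset E]|%:R <=
     (m%:R / N%:R) ^+ t * #|uniform_hypergraphs n kap m|%:R :> R.
  move=> TF; have /andP[TO /eqP cT] := hF T TF.
  have -> : [set E in uniform_hypergraphs n kap m | T \subset E] =
     [set E : hypergraph n | [&& E \subset edges n kap, #|E| == m & T \subset E]].
    by apply/setP => E; rewrite [LHS]in_set uniform_hypergraphsE [RHS]in_set andbA.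
  case: (leqP t m) => tm; last first.
    set A := [set E : hypergraph n | _]; have -> : A = set0; last first.
      by rewrite cards0 mulr_ge0 // exprn_ge0 // divr_ge0.
    apply/setP => E; rewrite !inE; apply/negbTE/negP => /and3P[_ /eqP cE /subset_leq_card].
    by rewrite cT cE leqNgt tm.
  rewrite card_supersets ?cT // card_edges -/N card_uniform_hypergraphs -/N.
  rewrite expr_div_n mulrAC ler_pdivlMr ?exprn_gt0 // -!natrX -!natrM ler_nat.
  have tN := leq_trans tm mN.
  have C0 : (0 < 'C(N, t))%N by rewrite bin_gt0.
  rewrite -(leq_pmul2l C0) mulnA bin_mul_sub ?tm // -mulnA.
  rewrite [X in (_ <= X)%N](_ : _ = 'C(N, m) * (m ^ t * 'C(N, t)))%N; last by ring.
  by rewrite leq_mul2l bin_ratio_le // orbT.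
apply: (@le_trans _ _ (\sum_(T in F) #|[set E in uniform_hypergraphs n kap m | T \subset E]|%:R)).
  rewrite -natr_sum ler_nat.
  apply: leq_trans (_ : #|\bigcup_(T in F) [set E in uniform_hypergraphs n kap m | T \subset E]| <= _)%N.
    apply: subset_leq_card; apply/subsetP => E; rewrite in_set => /andP[EI /exists_inP[T TF TE]].
    by apply/bigcupP; exists T => //; rewrite in_set EI.
  elim/big_rec2: _ => [|T a b _ h]; first by rewrite cards0.
  by apply: leq_trans (leq_card_setU _ _) _; rewrite leq_add2l.
apply: (le_trans (ler_sum _ one)).
by rewrite sumr_const -[_ *+ _]mulr_natl mulrA.
Qed.

(** Every small set of edges covers at least [kap - 3/2] vertices per edge, doubled to stay in the
    integers; a tree would cover slightly more than [kap - 1]. For graphs the condition bounds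
    average degrees by 4. *)
Definition sparse (R : realType) (tau : R) (n kap : nat) (E : hypergraph n) : bool :=
  [forall T : hypergraph n, ((T \subset E) && (#|T|%:R <= tau * n%:R)) ==>
     ((2 * kap - 3) * #|T| <= 2 * #|cover T|)%N].

Definition spread (R : realType) (ups gam : R) (n : nat) (E : hypergraph n) : bool :=
  [forall Y : {set 'I_n}, (#|Y|%:R <= ups * n%:R) ==>
     (#|[set e in E | ~~ [disjoint e & Y]]|%:R <= gam * n%:R)].

Lemma near_bin_lower (R : realType) (kap : nat) : (0 < kap)%N ->
  \forall n \near \oo%classic, n%:R ^+ kap <= 2 * kap`!%:R * 'C(n, kap)%:R :> R.
Proof.
case: kap => // kap _; near=> n.
have K : (2 * kap.+1 ^ 2 <= n)%N by near: n; exact: nbhs_infty_ge.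
rewrite -mulrA -natrM mulnC bin_ffact -natrM -natrX ler_nat.
have := expn_ffact_le kap (leqnn n).
have : (2 * (kap.+1 ^ 2 * n ^ kap) <= n ^ kap.+1)%N.
  by rewrite mulnA [(n ^ kap.+1)%N]expnS leq_mul2r K orbT.
move: (kap.+1 ^ 2 * n ^ kap)%N (n ^ kap.+1)%N (n ^_ kap.+1)%N => x y w; lia.
Unshelve. all: by end_near. Qed.

(** As long as [rho * #|Y|] is at most [n], weighting the vertices of [Y] by [rho] at most doubles
    the total vertex weight, and the expected weighted number of edges stays linear. *)
Lemma edge_density (R : realType) (kap : nat) (r : R) (m : nat -> nat) :
  (0 < kap)%N -> 0 <= r -> (forall n, (m n)%:R <= r * n%:R + 1) ->
  \forall n \near \oo%classic, forall (Y : {set 'I_n}) (rho : R),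
   0 <= rho -> rho * #|Y|%:R <= n%:R ->
   (m n)%:R / 'C(n, kap)%:R * \sum_(e in edges n kap) rho ^+ #|e :&: Y|
     <= (r + 1) * 2 ^+ kap.+1 * n%:R.
Proof.
move=> k0 r0 hm.
have rr1 : r < r + 1 by rewrite ltrDl.
near=> n.
have mn : (m n)%:R <= (r + 1) * n%:R by near: n; exact: near_linear_le hm rr1.
have nl : n%:R ^+ kap <= 2 * kap`!%:R * 'C(n, kap)%:R :> R.
  by near: n; exact: near_bin_lower.
have nk : (kap < n)%N by near: n; exact: nbhs_infty_gt.
move=> Y rho rho0 hY.
have f0 : 0 < kap`!%:R :> R by rewrite ltr0n fact_gt0.
have N0 : 0 < 'C(n, kap)%:R :> R by rewrite ltr0n bin_gt0 ltnW.
have n0 : 0 < n%:R :> R by rewrite ltr0n; apply: leq_trans nk.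
set S := \sum_(e in _) _.
have hS : kap`!%:R * S <= (2 * n%:R) ^+ kap.
  have -> : S = \sum_(e : {set 'I_n} | (e \subset setT) && (#|e| == kap)) rho ^+ #|e :&: Y|.
    by apply: eq_bigl => e; rewrite inE subsetT.
  apply: (le_trans (sum_edges_weight _ _ _ rho0)); apply: lerXn2r; rewrite ?nnegrE.
  - by rewrite addr_ge0 // mulr_ge0.
  - by rewrite mulr_ge0.
  - by rewrite cardsT card_ord; move: hY; clear; lra.
have S0 : 0 <= S by apply: sumr_ge0 => e _; exact: exprn_ge0.
have hSN : S <= 2 ^+ kap.+1 * 'C(n, kap)%:R.
  rewrite -(ler_pM2l f0); apply: (le_trans hS); rewrite exprMn exprS.
  have : 2 ^+ kap * n%:R ^+ kap <= 2 ^+ kap * (2 * kap`!%:R * 'C(n, kap)%:R) :> R.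
    by apply: ler_wpM2l; rewrite ?exprn_ge0.
  by move=> h; apply: (le_trans h); rewrite le_eqVlt; apply/orP; left; apply/eqP; ring.
rewrite mulrAC ler_pdivrMr //.
apply: (le_trans (ler_pM _ _ mn hSN)) => //.
by rewrite le_eqVlt; apply/orP; left; apply/eqP; ring.
Unshelve. all: by end_near. Qed.

Lemma geometric_half_le (R : realType) (K : nat) :
  \sum_(i < K) (2^-1 : R) ^+ i <= 2.
Proof.
have -> : \sum_(i < K) (2^-1 : R) ^+ i = 2 - 2 * 2^-1 ^+ K.
  elim: K => [|K IH]; first by rewrite big_ord0 expr0; lra.
  by rewrite big_ord_recr /= IH exprS; lra.
have : 0 <= (2^-1 : R) ^+ K by apply: exprn_ge0; rewrite invr_ge0.
lra.
Qed.

Lemma sparse_whp (R : realType) (kap : nat) (r : R) (m : nat -> nat) :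
  (1 < kap)%N -> 0 <= r -> (forall n, (m n)%:R <= r * n%:R + 1) ->
  exists2 tau : R, 0 < tau & forall eps : R, 0 < eps ->
  \forall n \near \oo%classic,
    #|[set E in uniform_hypergraphs n kap (m n) | ~~ sparse tau kap E]|%:R
    <= eps * #|uniform_hypergraphs n kap (m n)|%:R :> R.
Proof.
move=> k1 r0 hm.
have k0 : (0 < kap)%N by exact: ltnW.
pose A := (r + 1) * 2 ^+ kap.+1 : R.
have A0 : 0 < A by rewrite mulr_gt0 ?exprn_gt0 //; lra.
have kR : 0 < kap%:R :> R by rewrite ltr0n.
pose B := expR 1 * A * kap%:R.
have B0 : 0 < B.
  by apply: mulr_gt0 => //; apply: mulr_gt0 => //; exact: expR_gt0.
pose s := Num.min 1 (4 * B)^-1.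
have s0 : 0 < s by rewrite lt_min ltr01 invr_gt0 mulr_gt0.
have s1 : s <= 1 by rewrite ge_min lexx.
have sB : B * s <= 4^-1.
  have : s <= (4 * B)^-1 by rewrite ge_min lexx orbT.
  move=> h; apply: (le_trans (ler_wpM2l (ltW B0) h)).
  by rewrite le_eqVlt; apply/orP; left; apply/eqP; field; rewrite gt_eqF.
have kB : 0 <= kap%:R * B by apply: mulr_ge0; exact: ltW.
pose tau := s ^+ 2 / kap%:R.
have tau0 : 0 < tau by rewrite divr_gt0 ?exprn_gt0.
have tauk : kap%:R * tau = s ^+ 2 by rewrite /tau mulrC mulfVK // gt_eqF.
have tau1 : tau <= 1.
  rewrite /tau ler_pdivrMr // mul1r; apply: (@le_trans _ _ 1); last by rewrite ler1n.
  by apply: exprn_ile1 => //; exact: ltW.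
have rr1 : r < r + 1 by rewrite ltrDl.
exists tau => // eps eps0; near=> n.
have dens : forall (Y : {set 'I_n}) (rho : R),
   0 <= rho -> rho * #|Y|%:R <= n%:R ->
   (m n)%:R / 'C(n, kap)%:R * \sum_(e in edges n kap) rho ^+ #|e :&: Y| <= A * n%:R.
  by near: n; exact: edge_density.
have [mN _] : (m n <= 'C(n, kap))%N /\
     'C(n, kap)%:R ^+ m n <= expR (1 * n%:R) * ('C(n, kap) ^_ m n)%:R :> R.
  by near: n; exact: (expn_le_ffact_exp k1 r0 ltr01 hm).
have nk : (kap < n)%N by near: n; exact: nbhs_infty_gt.
have nbig : 2 * (kap%:R * B) / eps <= n%:R by near: n; exact: near_large_nat.
have N0 : (0 < 'C(n, kap))%N by rewrite bin_gt0 ltnW.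
have n0 : 0 < n%:R :> R by rewrite ltr0n; apply: leq_trans nk.
set I := uniform_hypergraphs n kap (m n).
(* [T] violates sparsity exactly when its cover falls short of [kap * t] by at least this amount:
   the rounding and the 1 express the strict inequality of the negation. *)
pose xx t := ((3 * t)./2 + 1)%N.
pose F t := [set T : hypergraph n | [&& T \subset edges n kap, #|T| == t &
                (#|cover T| + xx t <= kap * t)%N]].
pose p : R := (m n)%:R / 'C(n, kap)%:R.
have p0 : 0 <= p by exact: divr_ge0.
have one t : (0 < t)%N -> t%:R <= tau * n%:R ->
   #|[set E in I | [exists T in F t, T \subset E]]|%:R <=
     kap%:R * B / n%:R * 2^-1 ^+ t.-1 * #|I|%:R :> R.
  move=> t0 tt.
  have tR : 0 < t%:R :> R by rewrite ltr0n.
  have hF T : T \in F t -> (T \subset edges n kap) && (#|T| == t).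
    by rewrite in_set => /and3P[-> ->].
  apply: (le_trans (card_contains_le _ mN N0 hF)); apply: ler_wpM2r => //.
  rewrite -/p.
  (* The largest weight for which the cover of [t] edges, at most [kap * t] vertices, still
     satisfies the condition of [edge_density]. *)
  pose rho : R := n%:R / (kap * t)%:R.
  have kt0 : 0 < (kap * t)%:R :> R by rewrite ltr0n muln_gt0 k0.
  have ktn : (kap * t)%:R <= s ^+ 2 * n%:R.
    by rewrite natrM -tauk -mulrA; apply: ler_wpM2l.
  have s21 : s ^+ 2 <= 1 by apply: exprn_ile1 => //; exact: ltW.
  have rho1 : 1 <= rho.
    rewrite /rho ler_pdivlMr // mul1r; apply: (le_trans ktn).
    by rewrite ler_piMl.
  have rho0 : 0 < rho by apply: lt_le_trans rho1.
  have Fb : #|F t|%:R * p ^+ t <= (expR 1 * A * kap%:R) ^+ t * (rho^-1) ^+ (xx t - t).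
    have xt : (t <= xx t)%N by rewrite /xx; clear; lia.
    have tf : 0 < t`!%:R :> R by rewrite ltr0n fact_gt0.
    have [p00|pn0] := eqVneq p 0.
      rewrite p00 expr0n; case: (t) t0 => // t' _ /=; rewrite mulr0.
      by apply: mulr_ge0; apply: exprn_ge0; rewrite ?invr_ge0 ltW.
    have pp : 0 < p by rewrite lt_neqAle eq_sym pn0.
    have Q0 : 0 <= A * n%:R / p by rewrite divr_ge0 // mulr_ge0 // ltW.
    have hQ (Y : {set 'I_n}) : (#|Y| <= kap * t)%N ->
       \sum_(e in edges n kap) rho ^+ #|e :&: Y| <= A * n%:R / p.
      move=> cY; rewrite ler_pdivlMr // mulrC; apply: dens; first exact: ltW.
      rewrite /rho mulrAC ler_pdivrMr //; apply: ler_wpM2l => //.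
      by rewrite ler_nat.
    have := card_small_cover (xx t) (subxx _) rho1 hQ Q0; rewrite -/(F t) => h.
    have h2 : t`!%:R * (#|F t|%:R * p ^+ t) * rho ^+ xx t <= (A * n%:R) ^+ t.
      have -> : (A * n%:R) ^+ t = (A * n%:R / p) ^+ t * p ^+ t.
        by rewrite -exprMn mulfVK.
      rewrite [leLHS](_ : _ = t`!%:R * #|F t|%:R * rho ^+ xx t * p ^+ t); last by ring.
      by apply: ler_wpM2r => //; exact: exprn_ge0.
    have h3 := expn_self_le R t.
    rewrite -(ler_pM2l tf).
    have rx : 0 < rho ^+ xx t by exact: exprn_gt0.
    rewrite -(ler_pM2r rx); apply: (le_trans h2).
    have -> : rho ^+ xx t = rho ^+ (xx t - t) * rho ^+ t by rewrite -exprD subnK.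
    rewrite [leRHS](_ : _ = (A * kap%:R) ^+ t * rho ^+ t * (expR 1 ^+ t * t`!%:R) *
        (rho^-1 ^+ (xx t - t) * rho ^+ (xx t - t))); last by rewrite !exprMn; ring.
    rewrite -[rho^-1 ^+ _ * _]exprMn mulVf ?gt_eqF // expr1n mulr1.
    rewrite -expRM_natl mulr1.
    apply: (@le_trans _ _ ((A * kap%:R) ^+ t * rho ^+ t * t%:R ^+ t)); last first.
      apply: ler_wpM2l => //; apply: mulr_ge0; apply: exprn_ge0; last exact: ltW.
      by apply: mulr_ge0; exact: ltW.
    rewrite -!exprMn le_eqVlt; apply/orP; left; apply/eqP; congr (_ ^+ _).
    by rewrite /rho natrM; field; rewrite !gt_eqF.
  apply: (le_trans Fb); rewrite -/B.
  have -> : (xx t - t)%N = (xx t - t).-1.+1 by rewrite prednK // /xx; clear; lia.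
  rewrite exprS.
  have rV : rho^-1 = (kap * t)%:R / n%:R by rewrite /rho invf_div.
  have rV0 : 0 <= rho^-1 by rewrite invr_ge0 ltW.
  have rs : rho^-1 <= s ^+ 2 by rewrite rV ler_pdivrMr.
  have rs2 : rho^-1 ^+ (xx t - t).-1 <= s ^+ t.-1.
    apply: (@le_trans _ _ ((s ^+ 2) ^+ (xx t - t).-1)).
      by apply: lerXn2r; rewrite ?nnegrE ?exprn_ge0 // ltW.
    rewrite -exprM; apply: ler_wiXn2l => //; first exact: ltW.
    by rewrite /xx; clear; lia.
  have Bt : B ^+ t * s ^+ t.-1 <= B * 4^-1 ^+ t.-1.
    case: (t) t0 => // t' _ /=; rewrite exprS -mulrA -exprMn; apply: ler_wpM2l; first exact: ltW.
    apply: lerXn2r => //; rewrite nnegrE ?invr_ge0 //.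
    by apply: mulr_ge0; exact: ltW.
  (* One factor [rho^-1] provides the [1 / n]. The remaining ones beat [B ^+ t] geometrically, since
     [rho^-1 <= s ^+ 2] and [B * s <= 4^-1]. *)
  apply: (@le_trans _ _ (rho^-1 * (B * 4^-1 ^+ t.-1))).
    rewrite mulrCA; apply: ler_wpM2l => //; apply: le_trans Bt; apply: ler_wpM2l => //.
    by rewrite exprn_ge0 // ltW.
  have t2 : t%:R <= 2 ^+ t.-1 :> R.
    rewrite -natrX ler_nat; case: (t) t0 => // t' _ /=; exact: ltn_expl.
  rewrite rV natrM.
  have -> : (4^-1 : R) ^+ t.-1 = 2^-1 ^+ t.-1 * 2^-1 ^+ t.-1.
    by rewrite -exprMn; congr (_ ^+ _); lra.
  rewrite [leLHS](_ : _ = kap%:R * B / n%:R * 2^-1 ^+ t.-1 * (t%:R * 2^-1 ^+ t.-1)); last by ring.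
  rewrite -[leRHS]mulr1; apply: ler_wpM2l.
    by apply: mulr_ge0; [exact: divr_ge0 | apply: exprn_ge0; rewrite invr_ge0].
  apply: (@le_trans _ _ (2 ^+ t.-1 * 2^-1 ^+ t.-1)).
    by apply: ler_wpM2r => //; rewrite exprn_ge0 // invr_ge0.
  by rewrite -exprMn divff // expr1n.
have trn : (Num.truncn (tau * n%:R) <= n)%N.
  rewrite -(ler_nat R); apply: (@le_trans _ _ (tau * n%:R)).
    by rewrite truncn_le mulr_ge0 // ltW.
  by rewrite ler_piMl.
apply: (@le_trans _ _ (\sum_(t < n) kap%:R * B / n%:R * 2^-1 ^+ t * #|I|%:R)); last first.
  rewrite -mulr_suml; apply: ler_wpM2r => //; rewrite -mulr_sumr.
  apply: (@le_trans _ _ (kap%:R * B / n%:R * 2)).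
    by apply: ler_wpM2l; rewrite ?geometric_half_le // divr_ge0.
  move: nbig; rewrite ler_pdivrMr // mulrAC ler_pdivrMr //; clear; lra.
apply: (@le_trans _ _ (\sum_(t < n | t.+1%:R <= tau * n%:R)
     #|[set E in I | [exists T in F t.+1, T \subset E]]|%:R)); last first.
  rewrite big_mkcond; apply: ler_sum => t _; case: ifP => [h|_]; first exact: one.
  apply: mulr_ge0 => //; apply: mulr_ge0; first exact: divr_ge0.
  by apply: exprn_ge0; rewrite invr_ge0.
rewrite -natr_sum ler_nat.
apply: leq_trans (_ : #|\bigcup_(t < n | (t.+1%:R <= tau * n%:R)%R)
    [set E in I | [exists T in F t.+1, T \subset E]]| <= _)%N; last first.
  elim/big_rec2: _ => [|t a b _ h]; first by rewrite cards0.
  by apply: leq_trans (leq_card_setU _ _) _; rewrite leq_add2l.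
apply: subset_leq_card; apply/subsetP => E; rewrite in_set => /andP[EI].
rewrite negb_forall => /existsP[T]; rewrite negb_imply => /andP[/andP[TE cT] nT].
have EO : E \subset edges n kap by move: EI; rewrite uniform_hypergraphsE => /andP[].
have TO := subset_trans TE EO.
have T0 : (0 < #|T|)%N by rewrite lt0n; apply: contra nT => /eqP ->; rewrite muln0.
have Tn : (#|T|.-1 < n)%N.
  rewrite prednK // -(ler_nat R); apply: (le_trans cT); by rewrite ler_piMl.
apply/bigcupP; exists (Ordinal Tn); rewrite /= prednK //.
rewrite in_set EI /=; apply/exists_inP; exists T => //.
rewrite in_set TO eqxx /= /xx; move: nT; rewrite -ltnNge.
have := card_cover_le TO; move: (#|T|) (#|cover T|) T0 => a b a0.
have := k1; move: a0; clear; case: (kap) => [|[|kk]] // a0 _; nia.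
Unshelve. all: by end_near. Qed.

Lemma spread_whp (R : realType) (kap : nat) (r gam : R) (m : nat -> nat) :
  (1 < kap)%N -> 0 <= r -> (forall n, (m n)%:R <= r * n%:R + 1) -> 0 < gam ->
  exists2 ups : R, 0 < ups & forall eps : R, 0 < eps ->
  \forall n \near \oo%classic,
    #|[set E in uniform_hypergraphs n kap (m n) | ~~ spread ups gam E]|%:R
    <= eps * #|uniform_hypergraphs n kap (m n)|%:R :> R.
Proof.
move=> k1 r0 hm gam0.
have k0 : (0 < kap)%N by exact: ltnW.
have [A A0 AE] : exists2 A : R, 0 < A & A = (r + 1) * 2 ^+ kap.+1.
  by exists ((r + 1) * 2 ^+ kap.+1) => //; rewrite mulr_gt0 ?exprn_gt0 //; lra.
(* A union bound over [2 ^ n] sets [Y] asks for probability [exp (- 2 n)] each. That about [gam n]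
   edges meet [Y] has probability at most the power [gam n] of [expR 1 * A * ups / gam], whence this
   choice. *)
pose ups := Num.min 1 (gam / (expR 1 * A) * expR (- (2 / gam))).
have eA : 0 < expR 1 * A by rewrite mulr_gt0 ?expR_gt0.
have ups0 : 0 < ups by rewrite lt_min ltr01 mulr_gt0 ?expR_gt0 // divr_gt0.
have ups1 : ups <= 1 by rewrite ge_min lexx.
have upsA : expR 1 * A * ups / gam <= expR (- (2 / gam)).
  rewrite ler_pdivrMr // mulrC -ler_pdivlMr //.
  apply: (@le_trans _ _ (gam / (expR 1 * A) * expR (- (2 / gam)))).
    by rewrite ge_min lexx orbT.
  by rewrite le_eqVlt; apply/orP; left; apply/eqP; ring.
exists ups => // eps eps0; near=> n.
have dens : forall (Y : {set 'I_n}) (rho : R),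
   0 <= rho -> rho * #|Y|%:R <= n%:R ->
   (m n)%:R / 'C(n, kap)%:R * \sum_(e in edges n kap) rho ^+ #|e :&: Y| <= A * n%:R.
  by rewrite AE; near: n; exact: edge_density.
have [mN _] : (m n <= 'C(n, kap))%N /\
     'C(n, kap)%:R ^+ m n <= expR (1 * n%:R) * ('C(n, kap) ^_ m n)%:R :> R.
  by near: n; exact: (expn_le_ffact_exp k1 r0 ltr01 hm).
have nk : (kap < n)%N by near: n; exact: nbhs_infty_gt.
have fin : 1 * expR (- (1 * n%:R)) <= eps by near: n; exact: near_exp_decay.
have N0 : (0 < 'C(n, kap))%N by rewrite bin_gt0 ltnW.
have n0 : 0 < n%:R :> R by rewrite ltr0n; apply: leq_trans nk.
set I := uniform_hypergraphs n kap (m n).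
pose t := (Num.truncn (gam * n%:R)).+1.
have gn0 : 0 <= gam * n%:R by rewrite mulr_ge0 // ltW.
have /andP[tle tgt] := truncn_itv gn0.
have tR : 0 < t%:R :> R by rewrite ltr0n.
pose F (Y : {set 'I_n}) := [set T : hypergraph n | (T \subset edges n kap) && (#|T| == t)
    & [forall e in T, ~~ [disjoint e & Y]]].
pose p : R := (m n)%:R / 'C(n, kap)%:R.
have p0 : 0 <= p by exact: divr_ge0.
have one (Y : {set 'I_n}) : #|Y|%:R <= ups * n%:R ->
   #|[set E in I | [exists T in F Y, T \subset E]]|%:R <= expR (- (2 * n%:R)) * #|I|%:R :> R.
  move=> cY.
  have hF T : T \in F Y -> (T \subset edges n kap) && (#|T| == t).
    by rewrite in_set => /andP[].
  apply: (le_trans (card_contains_le _ mN N0 hF)); apply: ler_wpM2r => //.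
  rewrite -/p.
  (* An edge that meets [Y] has weight at least [rho], so [ups] times the weight dominates the
     indicator. *)
  pose rho := ups^-1; have rho0 : 0 < rho by rewrite invr_gt0.
  have rY : rho * #|Y|%:R <= n%:R by rewrite mulrC ler_pdivrMr // mulrC.
  have hS : p * (\sum_(e in edges n kap) rho ^+ #|e :&: Y|) <= A * n%:R.
    by apply: dens => //; exact: ltW.
  have tf : 0 < t`!%:R :> R by rewrite ltr0n fact_gt0.
  have a0 (e : {set 'I_n}) : 0 <= (if ~~ [disjoint e & Y] then 1 else 0 : R) by case: ifP.
  have E1 := elementary_symmetric_le (edges n kap) t a0.
  have F1 : #|F Y|%:R <= \sum_(T : {set {set 'I_n}} | (T \subset edges n kap) && (#|T| == t))
       \prod_(e in T) (if ~~ [disjoint e & Y] then 1 else 0 : R).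
    rewrite -sum1_card natr_sum big_mkcond [leRHS]big_mkcond; apply: ler_sum => T _ /=.
    rewrite in_set; case: ifP => [/andP[-> /forall_inP h]|_].
      by rewrite big1 // => e eT; rewrite h.
    by case: ifP => // _; apply: prodr_ge0.
  have F2 : \sum_(e in edges n kap) (if ~~ [disjoint e & Y] then 1 else 0 : R) <=
      ups * \sum_(e in edges n kap) rho ^+ #|e :&: Y|.
    rewrite mulr_sumr; apply: ler_sum => e _.
    case: ifP => h; last by apply: mulr_ge0; [exact: ltW | apply: exprn_ge0; exact: ltW].
    have : (0 < #|e :&: Y|)%N by rewrite card_gt0 setI_eq0.
    case: #|e :&: Y| => // j _; rewrite exprS mulrA divff ?gt_eqF // mul1r.
    by apply: exprn_ege1; rewrite invf_ge1.
  have SS0 : 0 <= \sum_(e in edges n kap) (if ~~ [disjoint e & Y] then 1 else 0 : R).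
    exact: sumr_ge0.
  have E2 : t`!%:R * (#|F Y|%:R * p ^+ t) <= (ups * A * n%:R) ^+ t.
    apply: (@le_trans _ _ ((\sum_(e in edges n kap) (if ~~ [disjoint e & Y] then 1 else 0)) ^+ t * p ^+ t)).
      rewrite mulrA; apply: ler_wpM2r; first exact: exprn_ge0.
      by apply: le_trans E1; apply: ler_wpM2l.
    rewrite -exprMn; apply: lerXn2r; rewrite ?nnegrE.
    - exact: mulr_ge0.
    - by apply: mulr_ge0 => //; apply: mulr_ge0; exact: ltW.
    apply: (le_trans (ler_wpM2r p0 F2)); rewrite -[leLHS]mulrA -[leRHS]mulrA.
    by apply: ler_wpM2l; [exact: ltW | rewrite mulrC].
  have E3 := expn_self_le R t.
  have nt : n%:R <= t%:R / gam by rewrite ler_pdivlMr // mulrC; exact: ltW.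
  have E4 : (ups * A * n%:R) ^+ t <= t`!%:R * (expR 1 * A * ups / gam) ^+ t.
    apply: (@le_trans _ _ ((ups * A / gam) ^+ t * t%:R ^+ t)).
      rewrite -exprMn; apply: lerXn2r; rewrite ?nnegrE.
      - by apply: mulr_ge0 => //; apply: mulr_ge0; exact: ltW.
      - by apply: mulr_ge0 => //; apply: divr_ge0; [apply: mulr_ge0|]; exact: ltW.
      rewrite -[leRHS]mulrA [_^-1 * _]mulrC; apply: ler_wpM2l => //.
      by apply: mulr_ge0; exact: ltW.
    apply: (@le_trans _ _ ((ups * A / gam) ^+ t * (expR t%:R * t`!%:R))).
      apply: ler_wpM2l => //; apply: exprn_ge0.
      by apply: divr_ge0; [apply: mulr_ge0|]; exact: ltW.
    rewrite -[X in expR X]mulr1 expRM_natl le_eqVlt; apply/orP; left; apply/eqP.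
    by rewrite !exprMn; ring.
  rewrite -(ler_pM2l tf); apply: (le_trans E2); apply: (le_trans E4).
  apply: ler_wpM2l => //; apply: (@le_trans _ _ (expR (- (2 / gam)) ^+ t)).
    apply: lerXn2r; rewrite ?nnegrE ?expR_ge0 //.
    by apply: divr_ge0; [apply: mulr_ge0|]; exact: ltW.
  rewrite -expRM_natl ler_expR mulrN lerN2 mulrCA.
  by apply: ler_wpM2l.
apply: (@le_trans _ _ (\sum_(Y : {set 'I_n} | #|Y|%:R <= ups * n%:R)
     #|[set E in I | [exists T in F Y, T \subset E]]|%:R)); last first.
  apply: (le_trans (ler_sum _ one)); rewrite -mulr_suml; apply: ler_wpM2r => //.
  apply: le_trans fin; rewrite mul1r.
  apply: (@le_trans _ _ (\sum_(Y : {set 'I_n}) expR (- (2 * n%:R)))).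
    by rewrite big_mkcond; apply: ler_sum => Y _; case: ifP => // _; exact: expR_ge0.
  have -> : \sum_(Y : {set 'I_n}) expR (- (2 * n%:R)) = (2 ^ n)%:R * expR (- (2 * n%:R)) :> R.
    rewrite sumr_const -[_ *+ _]mulr_natl; congr (_%:R * _).
    by rewrite -cardsT -powersetT card_powerset cardsT card_ord.
  apply: (@le_trans _ _ (expR n%:R * expR (- (2 * n%:R)))).
    apply: ler_wpM2r; first exact: expR_ge0.
    rewrite natrX -[X in expR X]mulr1 expRM_natl; apply: lerXn2r; rewrite ?nnegrE ?expR_ge0 //.
    by apply: le_trans (expR_ge1Dx _); clear; lra.
  by rewrite -expRD ler_expR; clear; lra.
rewrite -natr_sum ler_nat.
apply: leq_trans (_ : #|\bigcup_(Y : {set 'I_n} | (#|Y|%:R <= ups * n%:R)%R)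
    [set E in I | [exists T in F Y, T \subset E]]| <= _)%N; last first.
  elim/big_rec2: _ => [|Y x y _ h]; first by rewrite cards0.
  by apply: leq_trans (leq_card_setU _ _) _; rewrite leq_add2l.
apply: subset_leq_card; apply/subsetP => E; rewrite in_set => /andP[EI].
rewrite negb_forall => /existsP[Y]; rewrite negb_imply -ltNge => /andP[cY nY].
have EO : E \subset edges n kap by move: EI; rewrite uniform_hypergraphsE => /andP[].
apply/bigcupP; exists Y => //; rewrite in_set EI /=.
set B := [set e in E | _] in nY.
have tB : (t <= #|B|)%N.
  rewrite -(ltr_nat R) /= in nY *; rewrite /t.
  exact: le_lt_trans nY.
have [T [TB cT]] : exists T : {set {set 'I_n}}, T \subset B /\ #|T| = t.
  have /card_gt0P[T] : (0 < #|[set T : {set {set 'I_n}} | T \subset B & #|T| == t]|)%N.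
    by rewrite cards_draws bin_gt0.
  by rewrite in_set => /andP[h /eqP h2]; exists T.
have BE : B \subset E by apply/subsetP => e; rewrite in_set => /andP[].
have TE := subset_trans TB BE.
apply/exists_inP; exists T => //; rewrite in_set (subset_trans TE EO) cT eqxx /=.
by apply/forall_inP => e /(subsetP TB); rewrite in_set => /andP[].
Unshelve. all: by end_near. Qed.

(** Common to graphs and hypergraphs: [T] stands for the edges recorded while a closure grows from
    about [u] vertices. Finding such a [T] inside [H] costs [expR 1 * A * a] per edge, up to
    [rho ^+ u] for the roots. The slots [Y T] have disjoint blocks, each unhit with probability
    about [z] or more, so having only [Lp] unhit blocks per edge costs
    [2 ^+ Lp * expR (- (z * xn%:R / 4))] per edge. The last hypothesis makes the product at most
    [expR (- 2)]. *)
Lemma planted_bound (R : realType) (kap Lp xn : nat) (A a z tau : R) :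
  (0 < kap)%N -> 1 <= a -> 0 < A -> 0 <= z <= 1 -> 0 < tau ->
  expR 1 * A * a * 2 ^+ Lp * expR (- (z * xn%:R / 4)) <= expR (- 2) ->
  exists2 ups : R, 0 < ups & \forall n \near \oo%classic,
  forall (Om C : hypergraph n) (h t u : nat) (I : finType)
    (Y : hypergraph n -> {set I}) (S : hypergraph n -> I -> {set {set 'I_n}}),
  C \subset edges n kap -> C \subset Om -> (0 < #|Om| < n.+1 ^ kap)%N ->
  (h <= #|Om|)%N -> tau * n%:R <= t%:R -> a * t%:R <= n%:R ->
  u%:R <= ups * n%:R -> (u <= t)%N ->
  (forall V : {set 'I_n}, (#|V| <= kap * t)%N ->
     h%:R / #|Om|%:R * \sum_(e in C) (n%:R / (a * t%:R)) ^+ #|e :&: V| <= A * n%:R) ->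
  (forall T : hypergraph n, T \subset C -> forall i, i \in Y T ->
     [/\ S T i \subset Om, [disjoint T & S T i] &
      z <= (1 - h%:R / #|Om|%:R) ^+ #|S T i|]) ->
  (forall T : hypergraph n, T \subset C ->
     forall i j, i \in Y T -> j \in Y T -> i != j -> [disjoint S T i & S T j]) ->
  #|[set H : hypergraph n | [&& H \subset Om, #|H| == h &
      [exists T : hypergraph n, [&& T \subset C, #|T| == t,
         (#|cover T| <= (kap - 1) * t + u)%N, (t * xn <= 2 * #|Y T|)%N, T \subset H &
         (#|[set i in Y T | [disjoint H & S T i]]| <= Lp * t)%N]]]]|%:R
   <= expR (- (tau * n%:R)) * 'C(#|Om|, h)%:R.
Proof.
move=> k0 a1 A0 /andP[z0 z1] tau0 cond.
(* As [rho <= tau^-1], the roots cost at most [exp (tau n / 2)] for [u <= tau ^+ 2 n / 2]. The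
   factor [M.+1] costs as much again, and [expR (- 2) ^+ t] still leaves [exp (- tau n)]. *)
exists (tau ^+ 2 / 2); first by rewrite divr_gt0 ?exprn_gt0.
have tau2 : 0 < tau / 2 by rewrite divr_gt0.
near=> n.
have poly : n.+1%:R ^+ kap <= expR (tau / 2 * n%:R) :> R.
  by near: n; exact: near_poly_le_expR.
have n1 : (0 < n)%N by near: n; exact: nbhs_infty_gt.
have n0 : 0 < n%:R :> R by rewrite ltr0n.
move=> Om C h t u I Y S CO COm /andP[M0 Mn] hM taut atn un ut hdens hS hd.
have t0 : (0 < t)%N.
  by rewrite -(ltr0n R); apply: lt_le_trans taut; rewrite mulr_gt0.
have tR : 0 < t%:R :> R by rewrite ltr0n.
have a0 : 0 < a by apply: lt_le_trans a1.
have at0 : 0 < a * t%:R by rewrite mulr_gt0.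
set M := #|Om| in M0 Mn hM hdens hS *.
pose p : R := h%:R / M%:R.
have MR : 0 < M%:R :> R by rewrite ltr0n.
have p01 : 0 <= p <= 1 by rewrite /p divr_ge0 //= ler_pdivrMr // mul1r ler_nat.
have /andP[p0 p1] := p01.
pose F := [set T : hypergraph n | [&& T \subset C, #|T| == t &
   (#|cover T| + (t - u) <= kap * t)%N]].
pose F' := [set T : hypergraph n | [&& T \subset C, #|T| == t,
         (#|cover T| <= (kap - 1) * t + u)%N & (t * xn <= 2 * #|Y T|)%N]].
have FF : F' \subset F.
  apply/subsetP => T; rewrite !in_set => /and4P[-> -> cT _] /=.
  move: cT k0 ut; clear; move: #|cover T| => x; case: kap => // k; rewrite subn1 /= mulSn; lia.
pose HT (T : hypergraph n) := [set H : hypergraph n | [&& H \subset Om, #|H| == h &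
   (T \subset H) && (#|[set i in Y T | [disjoint H & S T i]]| <= Lp * t)%N]].
pose K := (M.+1)%:R * 'C(M, h)%:R * (p ^+ t * 2 ^+ (Lp * t) * expR (- (z * xn%:R / 4)) ^+ t).
have cHT T : T \in F' -> #|HT T|%:R <= K.
  rewrite in_set => /and4P[TC /eqP cT _ cY].
  have := card_few_unhit_le (Lp * t) hM M0 (subset_trans TC COm) z0 (hS T TC) (hd T TC).
  rewrite -/M -/p cT => h1; apply: (le_trans h1).
  rewrite /K; apply: ler_wpM2l; first by rewrite mulr_ge0.
  apply: ler_wpM2l; first by rewrite mulr_ge0 ?exprn_ge0.
  apply: (@le_trans _ _ (expR (- (z / 2)) ^+ #|Y T|)).
    apply: lerXn2r; rewrite ?nnegrE ?expR_ge0 //; first by move: z1; clear; lra.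
    by apply: le_trans (expR_ge1Dx _); clear; lra.
  rewrite -!expRM_natl ler_expR.
  have : (t * xn)%:R <= (2 * #|Y T|)%:R :> R by rewrite ler_nat.
  rewrite !natrM => hh; have := ler_wpM2l z0 hh; clear; lra.
have union : #|[set H : hypergraph n | [&& H \subset Om, #|H| == h &
      [exists T : hypergraph n, [&& T \subset C, #|T| == t,
         (#|cover T| <= (kap - 1) * t + u)%N, (t * xn <= 2 * #|Y T|)%N, T \subset H &
         (#|[set i in Y T | [disjoint H & S T i]]| <= Lp * t)%N]]]]|%:R <= #|F'|%:R * K.
  apply: (@le_trans _ _ (\sum_(T in F') #|HT T|%:R)); last first.
    by rewrite mulr_natl -sumr_const; apply: ler_sum => T; apply: cHT.
  rewrite -natr_sum ler_nat.
  apply: leq_trans (_ : #|\bigcup_(T in F') HT T| <= _)%N; last first.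
    elim/big_rec2: _ => [|T x y _ hxy]; first by rewrite cards0.
    by apply: leq_trans (leq_card_setU _ _) _; rewrite leq_add2l.
  apply: subset_leq_card; apply/subsetP => H; rewrite in_set => /and3P[HO cH /existsP[T]].
  move=> /and5P[TC cT cov cY /andP[TH un']].
  apply/bigcupP; exists T; first by rewrite in_set TC cT cov cY.
  by rewrite in_set HO cH TH un'.
apply: (le_trans union).
have K0 : 0 <= K.
  by rewrite /K !mulr_ge0 ?exprn_ge0 ?expR_ge0.
apply: (@le_trans _ _ (#|F|%:R * K)).
  by apply: ler_wpM2r => //; rewrite ler_nat subset_leq_card.
pose rho : R := n%:R / (a * t%:R).
have rho1 : 1 <= rho by rewrite /rho ler_pdivlMr // mul1r.
have rho0 : 0 < rho by apply: lt_le_trans rho1.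
have Fb : #|F|%:R * p ^+ t <= (expR 1 * A * a) ^+ t * rho ^+ u.
  have [p00|pn0] := eqVneq p 0.
    rewrite p00 expr0n (gtn_eqF t0) mulr0 mulr_ge0 ?exprn_ge0 //; last exact: ltW.
    by rewrite mulr_ge0 ?mulr_ge0 ?expR_ge0 // ltW.
  have pp : 0 < p by rewrite lt_neqAle eq_sym pn0.
  have Q0 : 0 <= A * n%:R / p by rewrite divr_ge0 // mulr_ge0 // ltW.
  have hQ (V : {set 'I_n}) : (#|V| <= kap * t)%N ->
     \sum_(e in C) rho ^+ #|e :&: V| <= A * n%:R / p.
    by move=> cV; rewrite ler_pdivlMr // mulrC; apply: hdens.
  have := card_small_cover (t - u) CO rho1 hQ Q0; rewrite -/F => h1.
  have h2 : t`!%:R * (#|F|%:R * p ^+ t) * rho ^+ (t - u) <= (A * n%:R) ^+ t.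
    have -> : (A * n%:R) ^+ t = (A * n%:R / p) ^+ t * p ^+ t.
      by rewrite -exprMn mulfVK.
    rewrite [leLHS](_ : _ = t`!%:R * #|F|%:R * rho ^+ (t - u) * p ^+ t); last by ring.
    by apply: ler_wpM2r => //; exact: exprn_ge0.
  have h3 := expn_self_le R t.
  have tf : 0 < t`!%:R :> R by rewrite ltr0n fact_gt0.
  rewrite -(ler_pM2l tf).
  have rx : 0 < rho ^+ (t - u) by exact: exprn_gt0.
  rewrite -(ler_pM2r rx); apply: (le_trans h2).
  rewrite [leRHS](_ : _ = (A * a) ^+ t * (rho ^+ (t - u) * rho ^+ u) * (expR 1 ^+ t * t`!%:R));
    last by rewrite !exprMn; ring.
  rewrite -exprD subnK // -expRM_natl mulr1.
  apply: (@le_trans _ _ ((A * a) ^+ t * rho ^+ t * t%:R ^+ t)); last first.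
    apply: ler_wpM2l => //; apply: mulr_ge0; apply: exprn_ge0; last exact: ltW.
    by apply: mulr_ge0; exact: ltW.
  rewrite -!exprMn le_eqVlt; apply/orP; left; apply/eqP; congr (_ ^+ _).
  by rewrite /rho; field; rewrite !gt_eqF.
have rhou : rho ^+ u <= expR (tau / 2 * n%:R).
  apply: (@le_trans _ _ (expR tau^-1 ^+ u)).
    apply: lerXn2r; rewrite ?nnegrE ?expR_ge0 //; first exact: ltW.
    apply: (@le_trans _ _ tau^-1).
      rewrite /rho ler_pdivrMr // mulrC -ler_pdivrMr ?invr_gt0 // invrK.
      rewrite mulrC; apply: (le_trans taut).
      by rewrite -[leLHS]mul1r ler_wpM2r // ltW.
    by apply: le_trans (expR_ge1Dx _); rewrite lerDr.
  rewrite -expRM_natl ler_expR ler_pdivrMr //; apply: (le_trans un).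
  by rewrite expr2; clear; lra.
have M1 : (M.+1)%:R <= expR (tau / 2 * n%:R) :> R.
  by apply: le_trans poly; rewrite -natrX ler_nat.
rewrite /K [leLHS](_ : _ = (#|F|%:R * p ^+ t) * (2 ^+ (Lp * t) * expR (- (z * xn%:R / 4)) ^+ t)
    * (M.+1)%:R * 'C(M, h)%:R); last by ring.
apply: ler_wpM2r => //.
apply: (@le_trans _ _ ((expR 1 * A * a) ^+ t * expR (tau / 2 * n%:R) *
   (2 ^+ (Lp * t) * expR (- (z * xn%:R / 4)) ^+ t) * expR (tau / 2 * n%:R))).
  apply: ler_pM => //.
  - by rewrite !mulr_ge0 ?exprn_ge0 ?expR_ge0.
  - apply: ler_wpM2r; first by rewrite mulr_ge0 ?exprn_ge0 ?expR_ge0.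
    apply: (le_trans Fb); apply: ler_wpM2l => //; apply: exprn_ge0.
    by rewrite mulr_ge0 ?mulr_ge0 ?expR_ge0 // ltW.
rewrite exprM [leLHS](_ : _ = (expR 1 * A * a * 2 ^+ Lp * expR (- (z * xn%:R / 4))) ^+ t *
   (expR (tau / 2 * n%:R) * expR (tau / 2 * n%:R))); last by rewrite !exprMn; ring.
apply: (@le_trans _ _ (expR (- 2) ^+ t * (expR (tau / 2 * n%:R) * expR (tau / 2 * n%:R)))).
  apply: ler_wpM2r; first by rewrite mulr_ge0 ?expR_ge0.
  apply: lerXn2r => //; rewrite nnegrE ?expR_ge0 //.
  by rewrite !mulr_ge0 ?expR_ge0 ?exprn_ge0 // ltW.
rewrite -expRM_natl -!expRD ler_expR; move: taut; clear; lra.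
Unshelve. all: by end_near. Qed.

(** * Repairing colourings of graphs *)

Lemma sub_card_subset (X : finType) (B : {set X}) (t : nat) :
  (t <= #|B|)%N -> exists2 T : {set X}, T \subset B & #|T| = t.
Proof.
move=> tB; have /card_gt0P[T] : (0 < #|[set T : {set X} | T \subset B & #|T| == t]|)%N.
  by rewrite cards_draws bin_gt0.
by rewrite in_set => /andP[h /eqP h2]; exists T.
Qed.

Lemma sparseS (R : realType) (tau : R) (n kap : nat) (E H : hypergraph n) :
  H \subset E -> sparse tau kap E -> sparse tau kap H.
Proof.
move=> HE /forallP h; apply/forallP => T; have := h T.
by case: (boolP (T \subset H)) => //= TH; rewrite (subset_trans TH HE).
Qed.

Lemma edges2P (n : nat) (E : hypergraph n) (e : {set 'I_n}) :
  E \subset edges n 2 -> e \in E -> exists x y, x != y /\ e = [set x; y].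
Proof.
move=> /subsetP h /h; rewrite inE => /cards2P[x [y [xy ->]]].
by exists x, y.
Qed.

Lemma edge_neq (n : nat) (E : hypergraph n) (x y : 'I_n) :
  E \subset edges n 2 -> [set x; y] \in E -> x != y.
Proof.
move=> /subsetP h /h; rewrite inE; apply: contraL => /eqP ->.
by rewrite setUid cards1.
Qed.

Lemma set2_inj (n : nat) (x y z : 'I_n) : [set x; y] = [set x; z] -> y = z.
Proof.
move=> /setP h; have := h y; have := h z; rewrite !inE !eqxx !orbT.
by move=> /orP[/eqP zx|/eqP -> //] /esym/orP[/eqP ->|/eqP -> //]; rewrite zx.
Qed.

(** [sparse] speaks of small edge sets only, so a surplus of induced edges is first cut down to
    [2 * #|S| + 1]; these would cover at most [#|S|] vertices. *)
Lemma sparse_pairs_le (R : realType) (tau : R) (n : nat) (E : hypergraph n)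
    (S : {set 'I_n}) :
  E \subset edges n 2 -> sparse tau 2 E -> (2 * #|S|).+1%:R <= tau * n%:R ->
  (#|[set wy : 'I_n * 'I_n | [&& wy.1 \in S, wy.2 \in S & [set wy.1; wy.2] \in E]]|
    <= 4 * #|S|)%N.
Proof.
move=> EO /forallP sp cS.
pose Tin := [set e in E | e \subset S].
have cT : (#|Tin| <= 2 * #|S|)%N.
  rewrite leqNgt; apply/negP => h; have [T TT cT] := sub_card_subset h.
  have TE : T \subset E by apply: subset_trans TT _; apply/subsetP => e; rewrite in_set => /andP[].
  have := sp T; rewrite TE cT cS /= mul1n ltnNge => /negP; apply.
  rewrite leq_mul2l /=; apply: subset_leq_card; apply/bigcupsP => e /(subsetP TT).
  by rewrite in_set => /andP[].
set A := [set wy | _].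
pose g (wy : 'I_n * 'I_n) : {set 'I_n} * 'I_n := ([set wy.1; wy.2], wy.1).
have gi : {in A &, injective g}.
  by move=> [w y] [w' y'] _ _ [] e ww; move: e; rewrite /= in ww *; rewrite -ww => /set2_inj ->.
rewrite -(card_in_imset gi).
apply: leq_trans (_ : #|[set ew : {set 'I_n} * 'I_n | (ew.1 \in Tin) && (ew.2 \in ew.1)]| <= _)%N.
  apply: subset_leq_card; apply/subsetP => _ /imsetP[[w y] wyA ->].
  move: wyA; rewrite !in_set /= => /and3P[wS yS ->].
  by rewrite set11 /= andbT subUset !sub1set wS.
apply: leq_trans (_ : 2 * #|Tin| <= _)%N; last by rewrite -[4%N]/(2 * 2)%N -mulnA leq_mul2l.
rewrite -sum1_card (eq_bigl (fun ew => (ew.1 \in Tin) && (ew.2 \in ew.1))); last first.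
  by move=> ew; rewrite in_set.
rewrite -(pair_big_dep (fun e => e \in Tin) (fun e w => w \in e) (fun _ _ => 1%N)) /=.
rewrite mulnC -sum_nat_const; apply: leq_sum => e; rewrite in_set => /andP[eE _].
by rewrite sum1_card; have := subsetP EO e eE; rewrite inE => /eqP ->.
Qed.

(* Degeneracy: some vertex of [S] has at most 4 neighbours inside [S]. *)
Lemma sparse_list_coloring (R : realType) (tau : R) (n : nat) (D : finType)
    (E : hypergraph n) (Lst : 'I_n -> {set D}) (d0 : D) (S : {set 'I_n}) :
  E \subset edges n 2 -> sparse tau 2 E -> (2 * #|S|).+1%:R <= tau * n%:R ->
  (forall x, x \in S -> (4 < #|Lst x|)%N) ->
  exists f : 'I_n -> D, (forall x, x \in S -> f x \in Lst x) /\
    (forall x y, x \in S -> y \in S -> [set x; y] \in E -> f x != f y).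
Proof.
move=> EO sp; move: {2}#|S| (leqnn #|S|) => j.
elim: j S => [|j IH] S cS cn hL.
  exists (fun=> d0); split=> [x|x y]; move: cS; rewrite leqn0 cards_eq0 => /eqP ->; by rewrite inE.
case: (posnP #|S|) => [S0|Spos].
  exists (fun=> d0); split=> [x|x y]; move/eqP: S0; rewrite cards_eq0 => /eqP ->; by rewrite inE.
pose nb x := [set y in S | [set x; y] \in E].
have [x xS dx] : exists2 x, x \in S & (#|nb x| <= 4)%N.
  apply/exists_inP; apply: contraT; rewrite negb_exists_in => /forall_inP h.
  have := sparse_pairs_le EO sp cn; rewrite leqNgt => /negP; case.
  rewrite -[X in (_ < X)%N]sum1_card (eq_bigl (fun wy => (wy.1 \in S) && (wy.2 \in nb wy.1))); last first.
    by move=> wy; rewrite !in_set.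
  rewrite -(pair_big_dep (fun w => w \in S) (fun w y => y \in nb w) (fun _ _ => 1%N)) /=.
  apply: leq_trans (_ : \sum_(w in S) 5 <= _)%N.
    by rewrite sum_nat_const [(4 * _)%N]mulnC ltn_mul2l Spos.
  by apply: leq_sum => w wS; rewrite sum1_card ltnNge h.
have cS' : #|S :\ x| = #|S|.-1 by rewrite (cardsD1 x S) xS.
have [f [f1 f2]] : exists f : 'I_n -> D, (forall y, y \in S :\ x -> f y \in Lst y) /\
    (forall y z, y \in S :\ x -> z \in S :\ x -> [set y; z] \in E -> f y != f z).
  apply: IH.
  - by rewrite cS'; case: #|S| Spos cS.
  - by apply: le_trans cn; rewrite ler_nat ltnS leq_mul2l cS' leq_pred.
  - by move=> y; rewrite in_setD1 => /andP[_ /hL].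
have /card_gt0P[c] : (0 < #|Lst x :\: [set f y | y in nb x]|)%N.
  rewrite cardsD subn_gt0; apply: leq_ltn_trans (hL x xS); apply: leq_trans dx.
  by apply: leq_trans (leq_imset_card f (nb x)); apply: subset_leq_card; apply: subsetIr.
rewrite in_setD => /andP[cn' cL].
have cnb y : y \in S -> [set x; y] \in E -> c != f y.
  move=> yS xyE; apply: contra cn' => /eqP ->; apply: imset_f.
  by rewrite in_set yS.
exists (fun y => if y == x then c else f y); split.
  by move=> y yS; case: eqP => [->|/eqP yx] //; apply: f1; rewrite in_setD1 yx.
move=> y z yS zS yzE; have yz := edge_neq EO yzE.
case: (eqVneq y x) => [yx|yx]; case: (eqVneq z x) => [zx|zx].
- by move: yz; rewrite yx zx eqxx.
- by apply: cnb => //; rewrite -yx.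
- by rewrite eq_sym; apply: cnb => //; rewrite setUC -zx.
- by apply: f2 => //; rewrite in_setD1 ?yx ?zx.
Qed.

Definition free_colors (n : nat) (D : finType) (H : hypergraph n)
    (s : {ffun 'I_n -> D}) (w : 'I_n) : {set D} :=
  [set c | [forall y, ([set w; y] \in H) ==> (s y != c)]].

(** Six: one free colour may be the prescribed one, four may be taken by neighbours coloured
    earlier, and one must be left. *)
Definition poor_vertex (n : nat) (D : finType) (H : hypergraph n)
    (s : {ffun 'I_n -> D}) (w : 'I_n) : bool := (#|free_colors H s w| < 6)%N.

Definition vertex_closed (n : nat) (D : finType) (H : hypergraph n)
    (s : {ffun 'I_n -> D}) (P : {set 'I_n}) : bool :=
  [forall w in P, forall y, ([set w; y] \in H) && poor_vertex H s y ==> (y \in P)].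

(** [T] keeps the edge through which each vertex was added, a forest rooted in [U]. A growth that
    goes on for long is therefore a configuration that the planted bound can exclude. *)
Lemma vertex_closure_grow (n : nat) (D : finType) (H : hypergraph n)
    (s : {ffun 'I_n -> D}) (U : {set 'I_n}) (i : nat) :
  (exists P : {set 'I_n}, [/\ U \subset P, (#|P| <= #|U| + i)%N & vertex_closed H s P]) \/
  (exists (P : {set 'I_n}) (T : hypergraph n),
     [/\ U \subset P, #|P| = (#|U| + i)%N, T \subset H, #|T| = i /\ cover T \subset P &
       forall y, y \in P -> y \notin U -> poor_vertex H s y]).
Proof.
elim: i => [|i [[P [UP cP cl]]|[P [T [UP cP TH [cT covT] poor]]]]].
- right; exists U, set0; split=> //; first by rewrite addn0.
  + exact: sub0set.
  + by split; [rewrite cards0 | rewrite /cover big_set0 sub0set].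
  + by move=> y ->.
- by left; exists P; split=> //; apply: leq_trans cP _; rewrite leq_add2l.
case: (boolP (vertex_closed H s P)) => cl.
  by left; exists P; split=> //; rewrite cP leq_add2l.
right; move: cl; rewrite negb_forall => /existsP[w]; rewrite negb_imply => /andP[wP].
rewrite negb_forall => /existsP[y]; rewrite negb_imply => /andP[/andP[wyH py] yP].
exists (y |: P), ([set w; y] |: T); split.
- exact: subset_trans UP (subsetUr _ _).
- by rewrite cardsU1 yP cP addnS.
- by rewrite subUset sub1set wyH.
- have wyT : [set w; y] \notin T.
    apply: contra yP => wyT; apply: (subsetP covT); apply/bigcupP.
    by exists [set w; y] => //; rewrite set22.
  split; first by rewrite cardsU1 wyT cT.
  rewrite cover_setU1 !subUset !sub1set setU11 in_setU1 wP orbT /=.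
  by apply: subset_trans covT (subsetUr _ _).
- by move=> x; rewrite in_setU1 => /orP[/eqP ->|xP] // xU; apply: poor.
Qed.

(** The colour of [w] itself is left out because no allowed edge joins a vertex to its own class. *)
Definition graph_slots (n : nat) (D : finType) (s : {ffun 'I_n -> D})
    (T : hypergraph n) : {set 'I_n * D} :=
  [set wc | (wc.1 \in cover T) && (wc.2 != s wc.1)].

(** If [H] misses the block, the colour is free at the vertex up to edges inside [cover T]. Going
    only to vertices outside [cover T] makes the blocks disjoint from [T] and from each other. *)
Definition graph_block (n : nat) (D : finType) (s : {ffun 'I_n -> D})
    (T : hypergraph n) (wc : 'I_n * D) : {set {set 'I_n}} :=
  [set [set wc.1; y] | y in [set y | (y \notin cover T) && (s y == wc.2)]].

(** Ten unhit slots per edge of [T]: 5 free colours at a poor vertex, 4 colours blocked only inside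
    [cover T], and 1 that absorbs the roots. *)
Definition graph_good (n : nat) (D : finType) (t u : nat)
    (H : hypergraph n) (s : {ffun 'I_n -> D}) : bool :=
  ~~ [exists T : hypergraph n, [&& T \subset allowed 2 s, #|T| == t,
         (#|cover T| <= (2 - 1) * t + u)%N, (t * (#|D| - 1) <= 2 * #|graph_slots s T|)%N,
         T \subset H &
         (#|[set i in graph_slots s T | [disjoint H & graph_block s T i]]| <= 10 * t)%N]].

Lemma card_graph_slots (n : nat) (D : finType) (s : {ffun 'I_n -> D}) (T : hypergraph n) :
  #|graph_slots s T| = (#|cover T| * (#|D| - 1))%N.
Proof.
rewrite -sum1_card (eq_bigl (fun wc => (wc.1 \in cover T) && (wc.2 != s wc.1))); last first.
  by move=> wc; rewrite in_set.
rewrite -(pair_big_dep (fun w => w \in cover T) (fun w c => c != s w) (fun _ _ => 1%N)) /=.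
rewrite -sum_nat_const; apply: eq_bigr => w _.
by rewrite sum1_card subn1 -(cardC1 (s w)); apply: eq_card => c.
Qed.

Lemma graph_good_closure (R : realType) (tau : R) (n : nat) (D : finType) (t u : nat)
    (H : hypergraph n) (s : {ffun 'I_n -> D}) (U : {set 'I_n}) :
  H \subset edges n 2 -> sparse tau 2 H -> s \in colorings D H -> graph_good t u H s ->
  (#|U| <= u)%N -> ((#|D| + 9) * u <= t)%N -> (2 * (t + u)).+1%:R <= tau * n%:R ->
  exists P : {set 'I_n}, [/\ U \subset P, (#|P| <= #|U| + t)%N & vertex_closed H s P].
Proof.
move=> HO sp sH good Uu ut cn.
have [//|[P [T [UP cP TH [cT covT] poor]]]] := vertex_closure_grow H s U t.
move: good => /negP; case; apply/existsP; exists T.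
have covle : (#|cover T| <= t + u)%N.
  by apply: leq_trans (subset_leq_card covT) _; rewrite cP addnC leq_add2l.
have Tsp : (t <= 2 * #|cover T|)%N.
  move/forallP: sp => /(_ T); rewrite TH cT /= mul1n => /implyP; apply.
  by apply: le_trans cn; rewrite ler_nat; lia.
have HA : H \subset allowed 2 s by rewrite -colorings_allowed.
rewrite (subset_trans TH HA) cT eqxx TH /= mul1n covle card_graph_slots mulnA leq_mul2r Tsp orbT /=.
(* Every unhit slot is at a root, which need not be poor ([B1]), or is a free colour at a poor
   vertex ([B2]), or is taken by a neighbour inside [cover T] ([B3]); the last are few by
   sparsity. *)
pose B1 := setX (cover T :&: U) [set: D].
pose B2 := [set wc : 'I_n * D | (wc.1 \in cover T :\: U) && (wc.2 \in free_colors H s wc.1)].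
pose pr := [set wy : 'I_n * 'I_n | [&& wy.1 \in cover T, wy.2 \in cover T & [set wy.1; wy.2] \in H]].
pose B3 := [set (wy.1, s wy.2) | wy in pr].
apply: leq_trans (_ : #|B1 :|: B2 :|: B3| <= _)%N.
  apply: subset_leq_card; apply/subsetP => -[w c]; rewrite in_set => /andP[].
  rewrite in_set /= => /andP[wT cw] dis.
  rewrite !in_setU; case: (boolP (w \in U)) => wU.
    by rewrite in_setX in_setI wT wU in_setT.
  case: (boolP (c \in free_colors H s w)) => cf.
    by rewrite [(w, c) \in B2]in_set /= in_setD wT wU cf orbT.
  apply/orP; right; move: cf; rewrite in_set negb_forall => /existsP[y].
  rewrite negb_imply negbK => /andP[wyH /eqP syc].
  case: (boolP (y \in cover T)) => yT.
    by apply/imsetP; exists (w, y) => /=; rewrite ?syc // in_set /= wT yT.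
  move: dis => /pred0P/(_ [set w; y]) /=; rewrite wyH /= => /negbT/negP; case.
  by apply/imsetP; exists y => //; rewrite in_set yT syc /=.
apply: leq_trans (leq_card_setU _ _) _.
apply: leq_trans (leq_add (leq_card_setU _ _) (leqnn _)) _.
have c1 : (#|B1| <= u * #|D|)%N.
  rewrite cardsX cardsT leq_mul2r; apply/orP; right.
  by apply: leq_trans Uu; apply: subset_leq_card; apply: subsetIr.
have c2 : (#|B2| <= #|cover T| * 5)%N.
  rewrite -sum1_card (eq_bigl (fun wc => (wc.1 \in cover T :\: U) && (wc.2 \in free_colors H s wc.1))); last first.
    by move=> wc; rewrite in_set.
  rewrite -(pair_big_dep (fun w => w \in cover T :\: U) (fun w c => c \in free_colors H s w) (fun _ _ => 1%N)) /=.
  apply: leq_trans (_ : \sum_(w in cover T :\: U) 5 <= _)%N.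
    apply: leq_sum => w; rewrite in_setD => /andP[wU wT]; rewrite sum1_card -ltnS.
    by apply: poor => //; exact: (subsetP covT).
  by rewrite sum_nat_const leq_mul2r; apply/orP; right; apply: subset_leq_card; exact: subsetDl.
have c3 : (#|B3| <= 4 * #|cover T|)%N.
  apply: leq_trans (leq_imset_card _ _) _; apply: (sparse_pairs_le HO sp).
  by apply: le_trans cn; rewrite ler_nat ltnS leq_mul2l.
move: c1 c2 c3 covle ut; move: #|B1| #|B2| #|B3| #|cover T| #|D| => a b c d e; clear.
by rewrite mulnDl; nia.
Qed.

(** [v] gets [j] and no other recoloured vertex does. Vertices of [P] choose among all other
    colours, and those of [C] outside [P] that are not poor among their free colours. A poor vertex
    outside [P] keeps its colour and has no neighbour in [P] along [H], since [P] is closed. A free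
    colour clashes with no vertex that keeps its colour, and the edges missing from [H] lie inside
    [P]. *)
Lemma graph_repair (R : realType) (tau : R) (n : nat) (D : finType)
    (E H : hypergraph n) (s : {ffun 'I_n -> D}) (P C : {set 'I_n}) (v : 'I_n) (j : D) :
  (5 < #|D|)%N -> E \subset edges n 2 -> sparse tau 2 E -> H \subset E -> s \in colorings D H ->
  vertex_closed H s P -> cover (E :\: H) \subset P -> v \in P -> P \subset C ->
  (forall x y, x \in P -> [set x; y] \in H -> y \in C) ->
  (2 * #|C|).+1%:R <= tau * n%:R ->
  exists2 t, t \in colorings D E & (t v == j) && (hamming s t <= #|C|)%N.
Proof.
move=> D5 EO sp HE sH cl FP vP PC NC cn.
pose Lst x := (if x \in P then [set: D] else free_colors H s x) :\ j.
have [c0 _] : exists c : D, true by exists j.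
pose C' := [set x in C | (x \in P) || ~~ poor_vertex H s x] :\ v.
have C'C : C' \subset C by apply/subsetP => x; rewrite in_setD1 in_set => /andP[_ /andP[]].
have cn' : (2 * #|C'|).+1%:R <= tau * n%:R.
  by apply: le_trans cn; rewrite ler_nat ltnS leq_mul2l /= subset_leq_card.
have LstC x : x \in C' -> (4 < #|Lst x|)%N.
  rewrite in_setD1 in_set /Lst => /and3P[_ _].
  have cD1 (A : {set D}) : (5 < #|A| -> 4 < #|A :\ j|)%N.
    by rewrite (cardsD1 j A); case: (j \in A) => //=; rewrite ?add1n ?add0n // => /ltnW.
  case: ifP => xP; first by move=> _; apply: cD1; rewrite cardsT.
  by rewrite /poor_vertex -leqNgt /= => h; apply: cD1.
have [f [f1 f2]] := sparse_list_coloring c0 EO sp cn' LstC.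
pose g : {ffun 'I_n -> D} := [ffun x => if x == v then j else if x \in C' then f x else s x].
have vC' : v \notin C' by rewrite in_setD1 eqxx.
have fj x : x \in C' -> f x != j by move=> /f1; rewrite in_setD1 => /andP[].
exists g; last first.
  rewrite ffunE eqxx eqxx /=; apply: subset_leq_card; apply/subsetP => x.
  rewrite in_set ffunE; case: (eqVneq x v) => [-> _|xv]; first exact: (subsetP PC).
  case: ifP => [xC' _|_]; first exact: (subsetP C'C).
  by rewrite eqxx.
rewrite in_set; apply/forall_inP => e eE; apply/negP => /monochromaticP[d hd].
have [x [y [xy ee]]] := edges2P EO eE.
(* If neither end is recoloured, the edge belongs to [H], as edges outside [H] have both ends in
   [P]; and [s] solves [H]. *)
wlog : x y xy ee / (x == v) || (x \in C').
  move=> W; case: (boolP ((x == v) || (x \in C'))) => [h|nx]; first exact: (W x y).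
  case: (boolP ((y == v) || (y \in C'))) => [h|ny].
    by apply: (W y x) => //; [rewrite eq_sym | rewrite setUC].
  have gx : g x = s x by move: nx; rewrite negb_or ffunE => /andP[/negbTE -> /negbTE ->].
  have gy : g y = s y by move: ny; rewrite negb_or ffunE => /andP[/negbTE -> /negbTE ->].
  have eH : e \in H.
    apply: contraT => eH; have xF : x \in cover (E :\: H).
      by apply/bigcupP; exists e; rewrite ?in_setD ?eH // ee set21.
    have xP := subsetP FP x xF; move: nx; rewrite in_setD1 in_set xP (subsetP PC x xP) /=.
    by rewrite andbT; case: eqP.
  move: sH; rewrite in_set => /forall_inP/(_ e eH)/negP; case.
  apply/monochromaticP; exists d => z; rewrite ee in_set2 => /orP[/eqP ->|/eqP ->].
    by rewrite -gx; apply: hd; rewrite ee set21.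
  by rewrite -gy; apply: hd; rewrite ee set22.
move=> hx; have gxy : g x = g y.
  by rewrite (hd x) ?(hd y) // ee ?set21 ?set22.
have xyE : [set x; y] \in E by rewrite -ee.
have Hsym : [set x; y] = [set y; x] by rewrite setUC.
case: (boolP ((y == v) || (y \in C'))) => hy.
  move: gxy; rewrite !ffunE; case: (eqVneq x v) => xv; case: (eqVneq y v) => yv.
  - by move: xy; rewrite xv yv eqxx.
  - move: hy; rewrite (negbTE yv) /= => yC'; rewrite yC' => jf.
    by have := fj y yC'; rewrite -jf eqxx.
  - move: hx; rewrite (negbTE xv) /= => xC'; rewrite xC' => jf.
    by have := fj x xC'; rewrite jf eqxx.
  - move: hx hy; rewrite (negbTE xv) (negbTE yv) /= => xC' yC'; rewrite xC' yC' => ff.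
    by have := f2 x y xC' yC' xyE; rewrite ff eqxx.
have [yv yC'] : y != v /\ y \notin C' by move: hy; rewrite negb_or => /andP[].
have yP : y \notin P.
  by apply: contra yC' => yP; rewrite in_setD1 yv in_set yP (subsetP PC y yP).
have xyH : [set x; y] \in H.
  apply: contraT => nH; have : y \in cover (E :\: H).
    by apply/bigcupP; exists [set x; y]; rewrite ?in_setD ?nH // set22.
  by move/(subsetP FP); rewrite (negbTE yP).
case: (boolP (x \in P)) => xP.
  have yC := NC x y xP xyH.
  move: yC'; rewrite in_setD1 yv in_set yC (negbTE yP) /= negbK => py.
  by move/forall_inP: cl => /(_ x xP)/forallP/(_ y); rewrite xyH py (negbTE yP).
have xv : x != v by apply: contraNneq xP => ->.
move: hx; rewrite (negbTE xv) /= => xC'.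
move: gxy; rewrite !ffunE (negbTE xv) (negbTE yv) xC' (negbTE yC') => fs.
have := f1 x xC'; rewrite /Lst (negbTE xP) in_setD1 => /andP[_]; rewrite in_set.
by move=> /forallP/(_ y); rewrite xyH fs eqxx.
Qed.

Lemma sub_sum_weight (R : realType) (n : nat) (A B : hypergraph n) (V : {set 'I_n}) (rho : R) :
  A \subset B -> 0 <= rho ->
  \sum_(e in A) rho ^+ #|e :&: V| <= \sum_(e in B) rho ^+ #|e :&: V|.
Proof.
move=> /subsetP AB rho0; rewrite big_mkcond [leRHS]big_mkcond; apply: ler_sum => e _.
case: ifP => [/AB -> //|_]; case: ifP => // _; exact: exprn_ge0.
Qed.

Lemma allowed_edges (n kap : nat) (D : finType) (s : {ffun 'I_n -> D}) :
  allowed kap s \subset edges n kap.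
Proof. by apply/subsetP => e; rewrite inE => /andP[]. Qed.

Lemma bin_lt_expn (n kap : nat) : (0 < kap)%N -> ('C(n, kap) < n.+1 ^ kap)%N.
Proof.
move=> k0; apply: leq_ltn_trans (_ : n ^ kap < _)%N; last by rewrite ltn_exp2r.
apply: leq_trans (ffact_le_expn n kap); rewrite -bin_ffact leq_pmulr //.
exact: fact_gt0.
Qed.

Lemma near_allowed_quarter (R : realType) (kap : nat) (D : finType) :
  (1 < #|D|)%N -> (1 < kap)%N -> 1 / 2 <= edge_phi R D kap ->
  exists2 xi0 : R, 0 < xi0 & forall xi : R, 0 < xi <= xi0 ->
  \forall n \near \oo%classic, forall s : {ffun 'I_n -> D}, balanced xi s ->
    'C(n, kap)%:R <= 4 * #|allowed kap s|%:R :> R.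
Proof.
move=> D1 k1 hphi.
have e0 : 0 < 1 / 4 :> R by lra.
have [xi0 x0 H] := allowed_frac_bounds D1 k1 e0.
exists xi0 => // xi hxi; near=> n.
have nk : (kap <= n)%N by near: n; exact: nbhs_infty_ge.
have h : forall s : {ffun 'I_n -> D},
    #|allowed kap s|%:R / 'C(n, kap)%:R <= edge_phi R D kap + 1 / 4 /\
    (balanced xi s -> edge_phi R D kap - 1 / 4 <= #|allowed kap s|%:R / 'C(n, kap)%:R).
  by near: n; exact: H.
have N0 : 0 < 'C(n, kap)%:R :> R by rewrite ltr0n bin_gt0.
move=> s bs; have [_ /(_ bs)] := h s; rewrite ler_pdivlMr // => h2.
have : 1 / 4 * 'C(n, kap)%:R <= (edge_phi R D kap - 1 / 4) * 'C(n, kap)%:R.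
  by apply: ler_wpM2r; [exact: ltW | have := hphi; clear; lra].
by move: h2; clear; lra.
Unshelve. all: by end_near. Qed.

(** Charge each neighbour outside [P] to an edge that joins it to [P]; such an edge has a single end
    outside. *)
Lemma card_graph_nbhd (n : nat) (E H : hypergraph n) (P : {set 'I_n}) :
  H \subset E ->
  (#|P :|: [set y | [exists x in P, [set x; y] \in H]]| <=
    #|P| + #|[set e in E | ~~ [disjoint e & P]]|)%N.
Proof.
move=> HE; set Nb := [set y | _]; set To := [set e in E | _].
have -> : P :|: Nb = P :|: (Nb :\: P) by apply/setP => x; rewrite !inE; case: (x \in P).
apply: leq_trans (leq_card_setU _ _) _; rewrite leq_add2l.
pose h (e : {set 'I_n}) : option 'I_n := [pick y in e :\: P].
apply: leq_trans (leq_imset_card h To).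
rewrite -(card_imset _ (@Some_inj _)); apply: subset_leq_card.
apply/subsetP => _ /imsetP[y yN ->].
move: yN; rewrite in_setD => /andP[yP]; rewrite in_set => /exists_inP[x xP xyH].
apply/imsetP; exists [set x; y].
  rewrite in_set (subsetP HE _ xyH) /= -setI_eq0; apply/set0Pn; exists x.
  by rewrite in_setI set21.
rewrite /h; case: pickP => [z|/(_ y)]; last by rewrite in_setD yP set22.
by rewrite in_setD in_set2 => /andP[zP /orP[/eqP zx|/eqP -> //]]; rewrite zx xP in zP.
Qed.

Lemma graph_blocks (R : realType) (xis z : R) (n h : nat) (D : finType)
    (s : {ffun 'I_n -> D}) (T : hypergraph n) :
  balanced xis s -> T \subset allowed 2 s ->
  (forall j : nat, j%:R <= (#|D|%:R^-1 + xis) * n%:R ->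
     z <= (1 - h%:R / #|allowed 2 s|%:R) ^+ j) ->
  (forall i, i \in graph_slots s T ->
     [/\ graph_block s T i \subset allowed 2 s, [disjoint T & graph_block s T i] &
      z <= (1 - h%:R / #|allowed 2 s|%:R) ^+ #|graph_block s T i|]) /\
  (forall i j, i \in graph_slots s T -> j \in graph_slots s T -> i != j ->
     [disjoint graph_block s T i & graph_block s T j]).
Proof.
move=> bs TA hz; split.
  move=> [w c]; rewrite in_set /= => /andP[wT cw]; split.
  - apply/subsetP => e /imsetP[y yA ->]; move: yA; rewrite in_set => /andP[yT /eqP sy].
    have wy : w != y by apply: contraNneq yT => <-.
    rewrite in_set in_set cards2 wy /=; apply/negP => /monochromaticP[d hd].
    rewrite /= in sy.
    by move: cw; rewrite -sy (hd w) ?(hd y) ?eqxx // ?set21 ?set22.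
  - rewrite disjoint_subset; apply/subsetP => e eT; rewrite inE; apply/negP => /imsetP[y yA ee].
    move: yA; rewrite in_set => /andP[yT _]; move: yT => /negP; apply; apply/bigcupP.
    by exists e => //; rewrite ee set22.
  - apply: hz; apply: (@le_trans _ _ #|color_class s c|%:R).
      rewrite ler_nat; apply: leq_trans (leq_imset_card _ _) _; apply: subset_leq_card.
      by apply/subsetP => y; rewrite !in_set => /andP[].
    by move/forallP: bs; apply.
move=> [w c] [w' c']; rewrite !in_set /= => /andP[wT cw] /andP[wT' cw'] ne.
rewrite disjoint_subset; apply/subsetP => e /imsetP[y yA ->].
move: yA; rewrite in_set => /andP[yT /eqP sy].
rewrite inE; apply/negP => /imsetP[y' yA' ee].
move: yA'; rewrite in_set => /andP[yT' /eqP sy']; rewrite /= in sy sy' ee.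
have : w \in [set w'; y'] by rewrite -ee set21.
rewrite in_set2 => /orP[/eqP ww|/eqP wy]; last by rewrite -wy wT in yT'.
move: ee; rewrite /= ww => /set2_inj yy.
by move: ne; rewrite ww -sy -sy' yy eqxx.
Qed.

Lemma graph_good_whp (R : realType) (D : finType) (r xis z : R) (m : nat -> nat) :
  (5 < #|D|)%N -> 0 <= r -> (forall n, (m n)%:R <= r * n%:R + 1) ->
  0 < xis -> 0 <= z <= 1 ->
  (\forall n \near \oo%classic, forall s : {ffun 'I_n -> D}, balanced xis s ->
    'C(n, 2)%:R <= 4 * #|allowed 2 s|%:R :> R) ->
  (\forall n \near \oo%classic, forall s : {ffun 'I_n -> D}, balanced xis s ->
    forall h j : nat, (h <= m n)%N -> j%:R <= (#|D|%:R^-1 + xis) * n%:R ->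
     z <= (1 - h%:R / #|allowed 2 s|%:R) ^+ j) ->
  expR 1 * (32 * (r + 1)) * 2 * 2 ^+ 10 * expR (- (z * (#|D| - 1)%:R / 4)) <= expR (- 2) ->
  forall gam : R, 0 < gam ->
     exists (c delta : R) (good : forall n, hypergraph n -> {ffun 'I_n -> D} -> bool),
     [/\ 0 < c, 0 < delta,
       \forall n \near \oo%classic, forall s : {ffun 'I_n -> D}, balanced xis s ->
         forall h, (h <= m n)%N ->
         #|[set H : hypergraph n | [&& H \subset allowed 2 s, #|H| == h & ~~ good n H s]]|%:R
          <= expR (- (c * n%:R)) * 'C(#|allowed 2 s|, h)%:R :> R &
       forall eps : R, 0 < eps -> \forall n \near \oo%classic,
         #|[set E in uniform_hypergraphs n 2 (m n) |
              ~~ repairable gam delta (good n) E]|%:R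
         <= eps * #|uniform_hypergraphs n 2 (m n)|%:R].
Proof.
move=> D5 r0 hm xis0 z01 hM hz cond gam gam0.
have k1 : (1 < 2)%N by [].
have [tau0 tau00 SP] := sparse_whp k1 r0 hm.
pose g := Num.min gam (tau0 / 4) / 4.
have g0 : 0 < g by rewrite divr_gt0 // lt_min gam0 divr_gt0.
have gg : 4 * g <= gam.
  by rewrite /g mulrC mulfVK // ge_min lexx.
have gt : 16 * g <= tau0.
  have : Num.min gam (tau0 / 4) <= tau0 / 4 by rewrite ge_min lexx orbT.
  by rewrite /g; clear; lra.
have [ups0 ups00 SD] := spread_whp k1 r0 hm g0.
pose tau := Num.min (Num.min ups0 g) (Num.min (tau0 / 8) 1) / 4.
have tau00' : 0 < tau by rewrite divr_gt0 // !lt_min ups00 g0 ltr01 divr_gt0.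
have [tA tB tC tD] : [/\ 4 * tau <= ups0, 4 * tau <= g, 4 * tau <= tau0 / 8 & 4 * tau <= 1].
  have e : 4 * tau = Num.min (Num.min ups0 g) (Num.min (tau0 / 8) 1).
    by rewrite /tau mulrC mulfVK.
  by rewrite e !ge_min !lexx !orbT.
(* [32 = 4 * 2 ^ 3]: the constant of [edge_density] for edges of size 2, times 4 because
   [allowed 2 s] may be only a quarter of all edges. *)
have A0 : 0 < 32 * (r + 1) by move: r0; clear; lra.
have [ups ups_0 PB] := planted_bound (isT : (0 < 2)%N) (ler1n R 2) A0 z01 tau00' cond.
pose ups' := Num.min ups (tau / (#|D| + 9)%:R).
have D9 : 0 < (#|D| + 9)%:R :> R by rewrite ltr0n addn_gt0 orbT.
have ups'0 : 0 < ups' by rewrite lt_min ups_0 divr_gt0.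
have ups'1 : ups' <= ups by rewrite ge_min lexx.
have ups'2 : ups' * (#|D| + 9)%:R <= tau.
  by rewrite -ler_pdivlMr // ge_min lexx orbT.
pose t n := (Num.truncn (tau * n%:R)).+1.
pose u n := Num.truncn (ups' * n%:R).
(* Putting back [ups' n / 4] edges touches at most [ups' n / 2] vertices, so [u n] has room for [v]
   as well once [n] is large. *)
exists tau, (ups' / 4), (fun n => @graph_good n D (t n) (u n)).
have tun n : [/\ tau * n%:R <= (t n)%:R, (t n)%:R <= tau * n%:R + 1, (u n)%:R <= ups' * n%:R,
     ups' * n%:R < (u n).+1%:R & ((#|D| + 9) * u n <= t n)%N].
  have tn0 : 0 <= tau * n%:R by rewrite mulr_ge0 // ltW.
  have un0 : 0 <= ups' * n%:R by rewrite mulr_ge0 // ltW.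
  have /andP[a1 a2] := truncn_itv tn0; have /andP[b1 b2] := truncn_itv un0.
  split=> //; first exact: ltW.
    by rewrite /t -natr1 lerD2r.
  rewrite -ltnS -(ltr_nat R) natrM.
  apply: (@le_lt_trans _ _ (tau * n%:R)); last by apply: lt_le_trans a2 _; rewrite ler_nat.
  apply: (@le_trans _ _ ((#|D| + 9)%:R * (ups' * n%:R))).
    by apply: ler_wpM2l => //; exact: ltW.
  by rewrite mulrA [_ * ups']mulrC; apply: ler_wpM2r.
split=> //; first by rewrite divr_gt0.
  have F1 : \forall n \near \oo%classic, [/\ (2 <= n)%N, 1 / tau <= n%:R,
     (forall (Y : {set 'I_n}) (rho : R), 0 <= rho -> rho * #|Y|%:R <= n%:R ->
       (m n)%:R / 'C(n, 2)%:R * \sum_(e in edges n 2) rho ^+ #|e :&: Y|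
        <= (r + 1) * 2 ^+ 3 * n%:R) & (m n)%:R * 4 <= 'C(n, 2)%:R :> R].
    near=> n; split.
    - by near: n; exact: nbhs_infty_ge.
    - by near: n; exact: near_large_nat.
    - by near: n; exact: edge_density.
    have : (r + 1) * 4 * n%:R <= 'C(n, 2)%:R by near: n; exact: near_bin_superlinear.
    have : (m n)%:R <= (r + 1) * n%:R.
      by near: n; apply: near_linear_le hm _; rewrite ltrDl.
    by clear; lra.
  apply: filterS (filterI PB (filterI hM (filterI hz F1))).
  move=> n [pb [hMn [hzn [n2 nt dens N4]]]].
  move=> s bs h hm'.
  have [t1 t2 u1 u2 tu] := tun n.
  have n0 : 0 < n%:R :> R by rewrite ltr0n; apply: leq_trans n2.
  have N0 : 0 < 'C(n, 2)%:R :> R by rewrite ltr0n bin_gt0.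
  have NM := hMn s bs.
  have M0 : 0 < #|allowed 2 s|%:R :> R by move: NM N0; clear; lra.
  have hMle : (h <= #|allowed 2 s|)%N.
    rewrite -(ler_nat R); apply: (@le_trans _ _ (m n)%:R); first by rewrite ler_nat.
    by move: NM N4; clear; lra.
  have t2' : (t n)%:R <= 2 * tau * n%:R.
    by move: t2 nt; rewrite ler_pdivrMr // [n%:R * _]mulrC; clear; lra.
  have := pb (allowed 2 s) (allowed 2 s) h (t n) (u n) _ (graph_slots s) (graph_block s)
    (allowed_edges _ _) (subxx _) _ hMle t1.
  have -> : (0 < #|allowed 2 s| < n.+1 ^ 2)%N.
    rewrite -(ltr0n R) M0 /=; apply: leq_ltn_trans (bin_lt_expn n (isT : (0 < 2)%N)).
    by rewrite -card_edges subset_leq_card // allowed_edges.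
  have -> : 2 * (t n)%:R <= n%:R :> R.
    have : 4 * tau * n%:R <= 1 * n%:R by apply: ler_wpM2r => //.
    by move: t2'; clear; lra.
  have -> : (u n)%:R <= ups * n%:R.
    by apply: (le_trans u1); apply: ler_wpM2r.
  have -> : (u n <= t n)%N.
    by apply: leq_trans tu; rewrite leq_pmull // addn_gt0 orbT.
  move=> /(_ isT isT isT isT) H; apply: le_trans (H _ _ _).
  - rewrite ler_nat; apply: subset_leq_card; apply/subsetP => F.
    by rewrite !in_set /graph_good negbK.
  - move=> V cV.
    have rho0 : 0 <= n%:R / (2 * (t n)%:R) :> R by rewrite divr_ge0 // mulr_ge0.
    have tpos : 0 < 2 * (t n)%:R :> R by rewrite mulr_gt0 // ltr0n.
    have rV : n%:R / (2 * (t n)%:R) * #|V|%:R <= n%:R :> R.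
      rewrite mulrAC ler_pdivrMr //; apply: ler_wpM2l => //.
      by rewrite -natrM ler_nat.
    have := dens V _ rho0 rV; set S1 := \sum_(e in edges n 2) _ => hS1.
    have S10 : 0 <= S1 by apply: sumr_ge0 => e _; exact: exprn_ge0.
    apply: (@le_trans _ _ (4 * ((m n)%:R / 'C(n, 2)%:R) * S1)).
      apply: ler_pM.
      - exact: divr_ge0.
      - by apply: sumr_ge0 => e _; exact: exprn_ge0.
      - rewrite ler_pdivrMr // mulrA mulrAC ler_pdivlMr //.
        have h1 : h%:R <= (m n)%:R :> R by rewrite ler_nat.
        have : h%:R * 'C(n, 2)%:R <= (m n)%:R * (4 * #|allowed 2 s|%:R) :> R by apply: ler_pM.
        by clear; lra.
      - exact: sub_sum_weight (allowed_edges _ _) rho0.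
    rewrite -mulrA; move: hS1; rewrite !exprS expr0; clear; lra.
  - by move=> T TA; have [] := graph_blocks bs TA (fun j => hzn s bs h j hm').
  - by move=> T TA; have [] := graph_blocks bs TA (fun j => hzn s bs h j hm').
move=> eps eps0; have e2 : 0 < eps / 2 by rewrite divr_gt0.
have SP' := SP _ e2; have SD' := SD _ e2.
near=> n.
have sp : #|[set E in uniform_hypergraphs n 2 (m n) | ~~ sparse tau0 2 E]|%:R
    <= eps / 2 * #|uniform_hypergraphs n 2 (m n)|%:R :> R by near: n.
have sd : #|[set E in uniform_hypergraphs n 2 (m n) | ~~ spread ups0 g E]|%:R
    <= eps / 2 * #|uniform_hypergraphs n 2 (m n)|%:R :> R by near: n.
have n1 : 1 / tau <= n%:R by near: n; exact: near_large_nat.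
have n2 : 4 / ups' <= n%:R by near: n; exact: near_large_nat.
have n3 : 2 / tau0 <= n%:R by near: n; exact: near_large_nat.
set In := uniform_hypergraphs n 2 (m n) in sp sd *.
apply: (@le_trans _ _ (#|[set E in In | ~~ sparse tau0 2 E]|%:R +
   #|[set E in In | ~~ spread ups0 g E]|%:R)); last by move: sp sd; clear; lra.
rewrite -natrD ler_nat; apply: leq_trans (leq_card_setU _ _).
apply: subset_leq_card; apply/subsetP => E; rewrite in_set => /andP[EI nrep].
have inI Q : (E \in [set F in In | Q F]) = Q E by rewrite in_set EI.
rewrite in_setU !inI; apply: contraR nrep; rewrite negb_or !negbK => /andP[spE sdE].
have EO : E \subset edges n 2 by move: EI; rewrite uniform_hypergraphsE => /andP[].
have [t1 t2 u1 u2 tu] := tun n.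
move: n1 n2 n3; rewrite !ler_pdivrMr // => n1 n2 n3.
have t2' : (t n)%:R <= 2 * tau * n%:R by move: t2 n1; clear; lra.
have ut : (u n <= t n)%N by apply: leq_trans tu; rewrite leq_pmull // addn_gt0 orbT.
have utR : (u n)%:R <= (t n)%:R :> R by rewrite ler_nat.
have tA' : 4 * tau * n%:R <= ups0 * n%:R by apply: ler_wpM2r.
have tB' : 4 * tau * n%:R <= g * n%:R by apply: ler_wpM2r.
have tC' : 4 * tau * n%:R <= tau0 / 8 * n%:R by apply: ler_wpM2r.
have gg' : 4 * g * n%:R <= gam * n%:R by apply: ler_wpM2r.
have gt' : 16 * g * n%:R <= tau0 * n%:R by apply: ler_wpM2r.
apply/forallP => H; apply/implyP => /andP[HE dH].
apply/forall_inP => s sH; apply/implyP => good.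
apply/forallP => v; apply/forallP => j.
pose U := v |: cover (E :\: H).
have cU : (#|U| <= u n)%N.
  have FO : E :\: H \subset edges n 2 by apply: subset_trans EO; exact: subsetDl.
  have h1 : (#|U| <= 1 + 2 * #|E :\: H|)%N.
    apply: leq_trans (leq_card_setU _ _) _; rewrite cards1 leq_add2l.
    exact: card_cover_le.
  rewrite -ltnS -(ltr_nat R); apply: le_lt_trans u2.
  apply: (@le_trans _ _ (1 + 2 * #|E :\: H|)%:R); first by rewrite ler_nat.
  by rewrite natrD natrM; move: dH n2; clear; lra.
have HO := subset_trans HE EO.
have [P [UP cP cl]] : exists P : {set 'I_n}, [/\ U \subset P, (#|P| <= #|U| + t n)%N & vertex_closed H s P].
  apply: (graph_good_closure HO (sparseS HE spE) sH good cU tu).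
  rewrite -natr1 natrM natrD; move: t2' utR tC' n3; clear; lra.
have cP' : #|P|%:R <= 4 * tau * n%:R.
  have : #|P|%:R <= (u n)%:R + (t n)%:R :> R.
    by rewrite -natrD ler_nat; apply: leq_trans cP _; rewrite leq_add2r.
  by move: t2' utR; clear; lra.
pose C := P :|: [set y | [exists x in P, [set x; y] \in H]].
have cC : #|C|%:R <= 2 * g * n%:R.
  have h1 : #|C|%:R <= #|P|%:R + #|[set e in E | ~~ [disjoint e & P]]|%:R :> R.
    by rewrite -natrD ler_nat; exact: card_graph_nbhd.
  have h2 : #|[set e in E | ~~ [disjoint e & P]]|%:R <= g * n%:R.
    by move/forallP: sdE => /(_ P)/implyP; apply; apply: le_trans tA'.
  by move: h1 h2 cP' tB'; clear; lra.
have vP : v \in P by apply: (subsetP UP); exact: setU11.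
have FP : cover (E :\: H) \subset P by apply: subset_trans UP; exact: subsetUr.
have NC x y : x \in P -> [set x; y] \in H -> y \in C.
  move=> xP xyH; rewrite in_setU in_set; apply/orP; right.
  by apply/exists_inP; exists x.
have cC2 : (2 * #|C|).+1%:R <= tau0 * n%:R.
  by rewrite -natr1 natrM; move: cC gt' n3; clear; lra.
have [g' gE /andP[gv gh]] := graph_repair j D5 EO spE HE sH cl FP vP (subsetUl _ _) NC cC2.
apply/exists_inP; exists g' => //; rewrite gv /=.
apply: (@le_trans _ _ #|C|%:R); first by rewrite ler_nat.
by move: cC gg' tB'; have := tau00'; move: n1; clear; lra.
Unshelve. all: by end_near. Qed.

(** * Repairing 2-colourings of hypergraphs *)

Lemma cover_setU (n : nat) (A B : hypergraph n) : cover (A :|: B) = cover A :|: cover B.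
Proof.
apply/setP => x; apply/bigcupP/setUP => [[e]|[]].
- by rewrite in_setU => /orP[eA|eB] xe; [left|right]; apply/bigcupP; exists e.
- by move=> /bigcupP[e eA xe]; exists e => //; rewrite in_setU eA.
- by move=> /bigcupP[e eA xe]; exists e => //; rewrite in_setU eA orbT.
Qed.

Lemma card_bigcup_le (I X : finType) (B : {set I}) (F : I -> {set X}) :
  (#|\bigcup_(i in B) F i| <= \sum_(i in B) #|F i|)%N.
Proof.
elim/big_rec2: _ => [|i a b _ h]; first by rewrite cards0.
by apply: leq_trans (leq_card_setU _ _) _; rewrite leq_add2l.
Qed.

(* The edges outside [T] that meet [S] twice are few: each of them adds at most
   [k - 2] vertices to the cover. *)
Lemma sparse_double_edges (R : realType) (tau : R) (n k : nat) (E T : hypergraph n)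
    (v : 'I_n) :
  (1 < k)%N -> E \subset edges n k -> sparse tau k E -> T \subset E -> (0 < #|T|)%N ->
  (4 * #|T| + 3)%:R <= tau * n%:R ->
  (\sum_(e in E :\: T | (2 <= #|e :&: (v |: cover T)|)%N) #|e :&: (v |: cover T)|
    <= 10 * #|T|)%N.
Proof.
move=> k1 EO /forallP sp TE T0 cn.
set S := v |: cover T; pose T2 := [set e in E :\: T | (2 <= #|e :&: S|)%N].
have cS : (#|S| <= 1 + k * #|T|)%N.
  apply: leq_trans (leq_card_setU _ _) _; rewrite cards1 leq_add2l.
  by apply: card_cover_le; exact: subset_trans TE EO.
have step (T3 : hypergraph n) : T3 \subset T2 -> (#|T| + #|T3|)%:R <= tau * n%:R ->
    (2 * \sum_(e in T3) #|e :&: S| <= 2 + 3 * #|T| + 3 * #|T3|)%N.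
  move=> T32 c3.
  have T3E : T3 \subset E.
    by apply: subset_trans T32 _; apply/subsetP => e; rewrite in_set in_setD => /andP[/andP[]].
  have dis : [disjoint T & T3].
    rewrite disjoint_sym disjoint_subset; apply/subsetP => e /(subsetP T32).
    by rewrite in_set in_setD => /andP[/andP[]].
  have cU : #|T :|: T3| = (#|T| + #|T3|)%N.
    by rewrite cardsU; move: dis; rewrite -setI_eq0 => /eqP ->; rewrite cards0 subn0.
  have := sp (T :|: T3); rewrite subUset TE T3E cU c3 /= => h1.
  have h2 : (#|cover (T :|: T3)| <= #|S| + \sum_(e in T3) (k - #|e :&: S|))%N.
    apply: leq_trans (_ : #|S :|: \bigcup_(e in T3) (e :\: S)| <= _)%N.
      apply: subset_leq_card; rewrite cover_setU; apply/subsetP => x.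
      rewrite !in_setU => /orP[xT|/bigcupP[e eT xe]]; first by rewrite xT orbT.
      case: (boolP (x \in S)) => [xS|xS]; first by move: xS; rewrite in_setU => ->.
      by apply/orP; right; apply/bigcupP; exists e => //; rewrite in_setD xS.
    apply: leq_trans (leq_card_setU _ _) _; rewrite leq_add2l.
    apply: leq_trans (card_bigcup_le _ _) _; apply: leq_sum => e eT; rewrite cardsD.
    by have := subsetP EO e (subsetP T3E e eT); rewrite inE => /eqP ->.
  have h3 : (\sum_(e in T3) (k - #|e :&: S|) + \sum_(e in T3) #|e :&: S| = k * #|T3|)%N.
    rewrite -big_split /= mulnC -sum_nat_const; apply: eq_bigr => e eT.
    have := subsetP EO e (subsetP T3E e eT); rewrite inE => /eqP ce.
    by rewrite subnK // -ce subset_leq_card // subsetIl.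
  move: h1 h2 h3 cS k1; clear.
  move: #|T| #|T3| #|S| #|cover _| (\sum_(e in T3) (k - _))%N (\sum_(e in T3) #|_|)%N.
  move=> a b c d e f; case: k => [|[|k]] // ; nia.
(* [step] needs a set small enough for [sparse]. So the number of edges in [T2] is bounded first, by
   testing a subset of [3 * #|T| + 3] of them; after that [step] applies to [T2] itself. *)
have cT2 : (#|T2| <= 2 + 3 * #|T|)%N.
  rewrite leqNgt; apply/negP => h.
  have [T3 T32 cT3] := sub_card_subset h.
  have := step T3 T32; rewrite cT3 => /(_ _) h1.
  have {h1} : (2 * \sum_(e in T3) #|e :&: S| <= 2 + 3 * #|T| + 3 * (2 + 3 * #|T|).+1)%N.
    by apply: h1; apply: le_trans cn; rewrite ler_nat; lia.
  have : (2 * (2 + 3 * #|T|).+1 <= \sum_(e in T3) #|e :&: S|)%N.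
    rewrite -cT3 mulnC -sum_nat_const; apply: leq_sum => e /(subsetP T32).
    by rewrite in_set => /andP[].
  move: #|T| (\sum_(e in T3) _)%N => a b; lia.
have := step T2 (subxx _); rewrite (_ : \sum_(e in T2) _ =
   \sum_(e in E :\: T | (2 <= #|e :&: S|)%N) #|e :&: S|)%N; last first.
  by apply: eq_bigl => e; rewrite in_set.
move=> h; have {h} : (2 * (\sum_(e in E :\: T | (2 <= #|e :&: S|)%N) #|e :&: S|)
    <= 2 + 3 * #|T| + 3 * #|T2|)%N.
  by apply: h; apply: le_trans cn; rewrite ler_nat; move: cT2; clear; move: #|T2| #|T| => a b; lia.
by move: cT2 T0; clear; move: #|T2| #|T| (\sum_(e in _ | _) _)%N => a b c; lia.
Qed.

(** A vertex of the cover is private to one edge or lies in two edges at least; either way it is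
    counted twice in the sum of the edge sizes and the private parts. *)
Lemma sum_shared_le (n k : nat) (T : hypergraph n) :
  T \subset edges n k ->
  (\sum_(e in T) #|e :&: cover (T :\ e)| + 2 * #|cover T| <= 2 * (k * #|T|))%N.
Proof.
move=> TO.
pose pv e := e :\: cover (T :\ e).
have ce e : e \in T -> #|e| = k by move/(subsetP TO); rewrite inE => /eqP.
have h1 : (\sum_(e in T) #|e :&: cover (T :\ e)| + \sum_(e in T) #|pv e| = k * #|T|)%N.
  rewrite -big_split /= mulnC -sum_nat_const; apply: eq_bigr => e eT.
  by rewrite cardsID ce.
have h2 : (2 * #|cover T| <= \sum_(e in T) #|e| + \sum_(e in T) #|pv e|)%N.
  have cardE (F : {set 'I_n} -> {set 'I_n}) : (\sum_(e in T) #|F e| = \sum_x \sum_(e in T) (x \in F e))%N.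
    rewrite exchange_big /=; apply: eq_bigr => e _.
    by rewrite -sum1_card big_mkcond /=; apply: eq_bigr => x _; case: (x \in F e).
  rewrite (cardE id) (cardE pv) -big_split /= mulnC -sum_nat_const big_mkcond /=.
  apply: leq_sum => x _; case: ifP => // /bigcupP[e eT xe].
  rewrite (bigD1 e) //= [X in (_ <= _ + X)%N](bigD1 e) //= xe.
  case: (boolP (x \in pv e)) => xp; first by lia.
  move: xp; rewrite in_setD xe andbT negbK => /bigcupP[e']; rewrite in_setD1 => /andP[ee e'T] xe'.
  by rewrite (bigD1 e') /= ?e'T // xe'; lia.
have h3 : (\sum_(e in T) #|e| = k * #|T|)%N.
  by rewrite mulnC -sum_nat_const; apply: eq_bigr => e eT; rewrite ce.
move: h1 h2 h3; clear; lia.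
Qed.

(** The vertices that [e] must not take as its representative: [v], vertices of other edges of [T],
    and vertices that share an edge outside [T] with a point where another representative, or [v],
    may lie. *)
Definition clash (n : nat) (E T : hypergraph n) (v : 'I_n) (e : {set 'I_n}) : {set 'I_n} :=
  [set x in e | [|| x == v, x \in cover (T :\ e) |
    [exists e2 in E :\: T, (x \in e2) &&
       [exists y in v |: cover (T :\ e), (y != x) && (y \in e2)]]]].

(** Averaging over [T]: sharing inside [T] gives at most 3 per edge by sparsity, edges outside [T]
    that meet the cover twice at most 10, and [v] at most 1. The last two are charged only to
    private vertices, hence once. *)
Lemma sparse_few_clashes (R : realType) (tau : R) (n k : nat) (E T : hypergraph n)
    (v : 'I_n) :
  (1 < k)%N -> E \subset edges n k -> sparse tau k E -> T \subset E -> (0 < #|T|)%N ->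
  (4 * #|T| + 3)%:R <= tau * n%:R ->
  exists2 e, e \in T & (#|clash E T v e| <= 14)%N.
Proof.
move=> k1 EO sp TE T0 cn.
set S := v |: cover T; pose T2 := [set e in E :\: T | (2 <= #|e :&: S|)%N].
have D2 : (\sum_(e in T2) #|e :&: S| <= 10 * #|T|)%N.
  rewrite (eq_bigl (fun e => (e \in E :\: T) && (2 <= #|e :&: S|)%N)); last first.
    by move=> e; rewrite in_set.
  exact: (sparse_double_edges v k1 EO sp TE T0 cn).
pose pv e := e :\: cover (T :\ e).
pose W := v |: \bigcup_(e in T2) (e :&: S).
have cW : (#|W| <= 1 + 10 * #|T|)%N.
  apply: leq_trans (leq_card_setU _ _) _; rewrite cards1 leq_add2l.
  exact: leq_trans (card_bigcup_le _ _) D2.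
have ce e : e \in T -> (#|clash E T v e| <= #|e :&: cover (T :\ e)| + #|pv e :&: W|)%N.
  move=> eT; apply: leq_trans (leq_card_setU _ _); apply: subset_leq_card.
  apply/subsetP => x; rewrite in_set => /andP[xe h].
  rewrite in_setU !in_setI xe /= in_setD xe andbT.
  case: (boolP (x \in cover (T :\ e))) => xc //=; move: h; rewrite (negbTE xc) /= => h.
  rewrite in_setU in_set1; case/orP: h => [->//|/exists_inP[e2 e2T /andP[xe2 /exists_inP[y yS /andP[yx ye2]]]]].
  apply/orP; right; apply/bigcupP; exists e2; last first.
    by rewrite in_setI xe2 in_setU; apply/orP; right; apply/bigcupP; exists e.
  rewrite in_set e2T /=.
  have xS : x \in S by rewrite in_setU; apply/orP; right; apply/bigcupP; exists e.
  have yS' : y \in S.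
    move: yS; rewrite !in_setU => /orP[->//|/bigcupP[e3]]; rewrite in_setD1 => /andP[_ e3T] ye3.
    by apply/orP; right; apply/bigcupP; exists e3.
  apply: leq_trans (_ : #|[set x; y]| <= _)%N; first by rewrite cards2 eq_sym yx.
  apply: subset_leq_card; apply/subsetP => z; rewrite in_set2 in_setI.
  by move=> /orP[/eqP ->|/eqP ->]; rewrite ?xe2 ?ye2 ?xS ?yS'.
have sp2 : (\sum_(e in T) #|pv e :&: W| <= #|W|)%N.
  have -> : (\sum_(e in T) #|pv e :&: W| = \sum_x \sum_(e in T) (x \in pv e :&: W))%N.
    rewrite exchange_big /=; apply: eq_bigr => e _.
    by rewrite -sum1_card big_mkcond /=; apply: eq_bigr => x _; case: (x \in _).
  rewrite -[X in (_ <= X)%N]sum1_card [X in (_ <= X)%N]big_mkcond /=; apply: leq_sum => x _.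
  case: (boolP (x \in W)) => xW; last first.
    by rewrite big1 // => e _; rewrite in_setI (negbTE xW) andbF.
  have [e /andP[eT xe]|none] := pickP (fun e => (e \in T) && (x \in pv e)); last first.
    rewrite big1 // => e eT; rewrite in_setI.
    by have := none e; rewrite eT /= => ->.
  rewrite (bigD1 e) //= big1 ?addn0 ?leq_b1 // => e' /andP[e'T ne].
  apply/eqP; rewrite eqb0 in_setI negb_and; apply/orP; left.
  rewrite in_setD negb_and negbK; apply/orP; left; apply/bigcupP; exists e.
    by rewrite in_setD1 eq_sym ne.
  by move: xe; rewrite in_setD => /andP[].
have h1 := sum_shared_le (subset_trans TE EO).
have h2 : ((2 * k - 3) * #|T| <= 2 * #|cover T|)%N.
  move/forallP: sp => /(_ T); rewrite TE /= => /implyP; apply.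
  by apply: le_trans cn; rewrite ler_nat; apply: leq_trans (leq_addr 3 _); exact: leq_pmull.
have tot : (\sum_(e in T) #|clash E T v e| <= 14 * #|T|)%N.
  apply: leq_trans (_ : \sum_(e in T) (#|e :&: cover (T :\ e)| + #|pv e :&: W|) <= _)%N.
    by apply: leq_sum => e eT; exact: ce.
  rewrite big_split /=.
  move: h1 h2 sp2 cW k1 T0; clear.
  move: (\sum_(e in T) #|e :&: _|)%N (\sum_(e in T) #|pv e :&: W|)%N #|W| #|T| #|cover T|.
  move=> a b c d e; case: k => [|[|k]] //; nia.
apply/exists_inP; apply: contraT; rewrite negb_exists_in => /forall_inP h.
have : (15 * #|T| <= \sum_(e in T) #|clash E T v e|)%N.
  by rewrite mulnC -sum_nat_const; apply: leq_sum => e eT; rewrite ltnNge h.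
by move: tot T0; clear; move: #|T| (\sum_(e in T) _)%N => a b; lia.
Qed.

(** The edge with few clashes chooses last and so avoids conflicts with all the others. An edge of
    [T] then meets [Q] in its own representative and at most one point chosen before. *)
Lemma sparse_representatives (R : realType) (tau : R) (n k : nat) (E T : hypergraph n)
    (v : 'I_n) (Cand : {set 'I_n} -> {set 'I_n}) :
  (1 < k)%N -> E \subset edges n k -> sparse tau k E -> T \subset E ->
  (4 * #|T| + 3)%:R <= tau * n%:R ->
  (forall e, e \in T -> (Cand e \subset e) && (14 < #|Cand e|)%N) ->
  exists f : {set 'I_n} -> 'I_n, let Q := v |: [set f e | e in T] in
    [/\ forall e, e \in T -> (f e \in Cand e) && (f e != v),
        forall e, e \in T -> (#|e :&: Q| <= 2)%N &
        forall e, e \in E -> e \notin T -> (#|e :&: Q| <= 1)%N].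
Proof.
move=> k1 EO sp; move: {2}#|T| (leqnn #|T|) => j.
elim: j T => [|j IH] T cT TE cn hC.
  move: cT; rewrite leqn0 cards_eq0 => /eqP ->; exists (fun=> v) => Q; split=> [e|e|e _ _]; rewrite ?inE //.
  rewrite /Q imset0 setU0; apply: leq_trans (subset_leq_card (subsetIr _ _)) _.
  by rewrite cards1.
case: (posnP #|T|) => [T0|T0].
  move/eqP: T0; rewrite cards_eq0 => /eqP ->; exists (fun=> v) => Q; split=> [e|e|e _ _]; rewrite ?inE //.
  rewrite /Q imset0 setU0; apply: leq_trans (subset_leq_card (subsetIr _ _)) _.
  by rewrite cards1.
have [e eT ce] := sparse_few_clashes v k1 EO sp TE T0 cn.
have cT' : #|T :\ e| = #|T|.-1 by rewrite (cardsD1 e T) eT.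
have T'T : T :\ e \subset T by exact: subD1set.
have [f [f1 f2 f3]] : exists f : {set 'I_n} -> 'I_n, let Q := v |: [set f e | e in T :\ e] in
    [/\ forall e1, e1 \in T :\ e -> (f e1 \in Cand e1) && (f e1 != v),
        forall e1, e1 \in T :\ e -> (#|e1 :&: Q| <= 2)%N &
        forall e1, e1 \in E -> e1 \notin T :\ e -> (#|e1 :&: Q| <= 1)%N].
  apply: IH.
  - by rewrite cT'; case: #|T| T0 cT.
  - exact: subset_trans T'T TE.
  - by apply: le_trans cn; rewrite ler_nat leq_add2r leq_mul2l cT' leq_pred.
  - by move=> e1 /(subsetP T'T); exact: hC.
have /andP[Ce Cn] := hC e eT.
have /card_gt0P[x] : (0 < #|Cand e :\: clash E T v e|)%N.
  rewrite cardsD subn_gt0; apply: leq_ltn_trans Cn; apply: leq_trans ce.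
  by apply: subset_leq_card; exact: subsetIr.
rewrite in_setD => /andP[xcl xC]; have xe := subsetP Ce x xC.
move: xcl; rewrite in_set xe /= !negb_or => /and3P[xv xcov /exists_inP xE].
pose f' e1 := if e1 == e then x else f e1.
set Q' := v |: [set f e | e in T :\ e] in f2 f3.
have Qsub : Q' \subset v |: cover (T :\ e).
  rewrite subUset sub1set setU11 /=; apply/subsetP => y /imsetP[e1 e1T ->].
  rewrite in_setU; apply/orP; right; apply/bigcupP; exists e1 => //.
  have /andP[C1 _] := hC e1 (subsetP T'T e1 e1T); apply: (subsetP C1); by have /andP[] := f1 e1 e1T.
have QE : v |: [set f' e1 | e1 in T] = x |: Q'.
  apply/setP => y; rewrite !in_setU !in_set1; apply/idP/idP.
    case/orP => [->|/imsetP[e1 e1T ->]]; first by rewrite orbT.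
    rewrite /f'; case: (eqVneq e1 e) => [_|ne]; first by rewrite eqxx.
    by apply/orP; right; apply/orP; right; apply: imset_f; rewrite in_setD1 ne.
  case/or3P => [/eqP ->|->//|/imsetP[e1 e1T ->]].
    by apply/orP; right; apply/imsetP; exists e => //; rewrite /f' eqxx.
  apply/orP; right; apply/imsetP; exists e1; first exact: (subsetP T'T).
  by move: e1T; rewrite in_setD1 /f' => /andP[/negbTE ->].
exists f' => /=; rewrite QE; split.
- move=> e1 e1T; rewrite /f'; case: eqP => [->|/eqP ne]; first by rewrite xC.
  apply: f1.
  by rewrite in_setD1 ne.
- move=> e1 e1T; case: (eqVneq e1 e) => [->|ne].
    have eE := subsetP TE e eT.
    have h : (#|e :&: Q'| <= 1)%N by apply: f3 => //; rewrite in_setD1 eqxx.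
    apply: leq_trans (_ : #|x |: (e :&: Q')| <= _)%N.
      apply: subset_leq_card; apply/subsetP => y; rewrite !inE => /andP[-> ].
      by case: (y == x).
    by apply: leq_trans (leq_card_setU _ _) _; rewrite cards1 (leq_add (leqnn 1) h).
  have e1T' : e1 \in T :\ e by rewrite in_setD1 ne.
  apply: leq_trans (f2 e1 e1T'); apply: subset_leq_card; apply/subsetP => y.
  rewrite !in_setI in_setU1 => /andP[ye1 /orP[/eqP yx|->]]; last by rewrite ye1.
  by case/negP: xcov; apply/bigcupP; exists e1 => //; rewrite -yx.
move=> e2 e2E e2T.
have e2T' : e2 \notin T :\ e by apply: contra e2T; exact: (subsetP T'T).
case: (boolP (x \in e2)) => xe2; last first.
  apply: leq_trans (f3 e2 e2E e2T'); apply: subset_leq_card; apply/subsetP => y.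
  rewrite !in_setI in_setU1 => /andP[ye2 /orP[/eqP yx|->]]; last by rewrite ye2.
  by rewrite -yx ye2 in xe2.
apply: leq_trans (_ : #|[set x]| <= _)%N; last by rewrite cards1.
apply: subset_leq_card; apply/subsetP => y; rewrite in_setI in_setU1 in_set1.
move=> /andP[ye2 /orP[//|yQ]]; apply: contraT => yx; case: xE; exists e2.
  by rewrite in_setD e2T.
rewrite xe2 /=; apply/exists_inP; exists y; first exact: (subsetP Qsub).
by rewrite yx.
Qed.

(** With two colours: flipping [w] makes [e] monochromatic, or [e] is monochromatic already. The
    second case covers the edges of [E] that a colouring of [H] violates. *)
Definition fragile (n : nat) (D : finType) (s : {ffun 'I_n -> D}) (w : 'I_n)
    (e : {set 'I_n}) : bool :=
  (w \in e) && [forall y in e :\ w, forall y' in e :\ w, s y == s y'].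

Definition free_vertex (n : nat) (D : finType) (H : hypergraph n)
    (s : {ffun 'I_n -> D}) (x : 'I_n) : bool := [forall e in H, ~~ fragile s x e].

(** Sixteen: one free vertex may be the vertex at which the edge is fragile, 14 may clash with other
    representatives, and one must be left. *)
Definition poor_edge (n : nat) (D : finType) (H : hypergraph n)
    (s : {ffun 'I_n -> D}) (e : {set 'I_n}) : bool :=
  (#|[set x in e | free_vertex H s x]| < 16)%N.

Definition edge_closed (n : nat) (D : finType) (H : hypergraph n)
    (s : {ffun 'I_n -> D}) (P : {set 'I_n}) : bool :=
  [forall w in P, forall e in H, fragile s w e && poor_edge H s e ==> (e \subset P)].

Lemma fragile_eq (n : nat) (D : finType) (s : {ffun 'I_n -> D}) (w : 'I_n)
    (e : {set 'I_n}) y y' :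
  fragile s w e -> y \in e -> y' \in e -> y != w -> y' != w -> s y = s y'.
Proof.
move=> /andP[_ /forall_inP h] ye y'e yw y'w.
have /forall_inP h2 : [forall y' in e :\ w, s y == s y'] by apply: h; rewrite in_setD1 yw.
by apply/eqP/h2; rewrite in_setD1 y'w.
Qed.

Lemma fragile_unique (n : nat) (D : finType) (s : {ffun 'I_n -> D}) (w w' : 'I_n)
    (e : {set 'I_n}) :
  (2 < #|e|)%N -> ~~ monochromatic s e -> fragile s w e -> fragile s w' e -> w = w'.
Proof.
move=> e3 nm f1 f2; apply/eqP; apply: contraNT nm => ww.
have we : w \in e by case/andP: f1.
have we' : w' \in e by case/andP: f2.
have /card_gt0P[y] : (0 < #|e :\: [set w; w']|)%N.
  rewrite cardsD subn_gt0; apply: leq_ltn_trans e3.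
  by apply: leq_trans (subset_leq_card (subsetIr _ _)) _; rewrite cards2 ww.
rewrite in_setD in_set2 negb_or => /andP[/andP[yw yw'] ye].
apply/monochromaticP; exists (s y) => z ze.
case: (eqVneq z w) => [->|zw]; last exact: (fragile_eq f1).
by apply: (fragile_eq f2) => //.
Qed.

(** A new edge contains the vertex of the current set at which it is fragile, so it adds at most
    [k - 1] vertices. *)
Lemma edge_closure_grow (n k : nat) (D : finType) (H : hypergraph n)
    (s : {ffun 'I_n -> D}) (U : {set 'I_n}) (i : nat) :
  H \subset edges n k ->
  (exists P : {set 'I_n}, [/\ U \subset P, (#|P| <= #|U| + (k - 1) * i)%N & edge_closed H s P]) \/
  (exists T : hypergraph n,
     [/\ T \subset H, #|T| = i, (#|U :|: cover T| <= #|U| + (k - 1) * i)%N &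
       forall e, e \in T -> poor_edge H s e /\ exists w, fragile s w e]).
Proof.
move=> HO; elim: i => [|i [[P [UP cP cl]]|[T [TH cT cov hT]]]].
- right; exists set0; split=> //; first exact: sub0set.
  + by rewrite cards0.
  + by rewrite /cover big_set0 setU0 muln0 addn0.
  + by move=> e; rewrite inE.
- by left; exists P; split=> //; apply: leq_trans cP _; rewrite leq_add2l leq_mul2l leqnSn orbT.
set P := U :|: cover T in cov.
case: (boolP (edge_closed H s P)) => cl.
  left; exists P; split=> //; first exact: subsetUl.
  by apply: leq_trans cov _; rewrite leq_add2l leq_mul2l leqnSn orbT.
right; move: cl; rewrite negb_forall => /existsP[w]; rewrite negb_imply => /andP[wP].
rewrite negb_forall => /existsP[e]; rewrite negb_imply => /andP[eH].
rewrite negb_imply => /andP[/andP[fe pe] eP].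
exists (e |: T); split.
- by rewrite subUset sub1set eH.
- have eT : e \notin T.
    apply: contra eP => eT; apply: subset_trans (subsetUr _ _).
    by apply/subsetP => x xe; apply/bigcupP; exists e.
  by rewrite cardsU1 eT cT.
- have we : w \in e by case/andP: fe.
  have ce : #|e| = k by have := subsetP HO e eH; rewrite inE => /eqP.
  rewrite cover_setU1 setUCA -/P.
  have -> : e :|: P = (e :\ w) :|: P.
    apply/setP => x; rewrite !inE; case: (eqVneq x w) => //= ->.
    by move: wP; rewrite !inE => ->; rewrite !orbT.
  apply: leq_trans (leq_card_setU _ _) _; rewrite mulnS addnCA.
  apply: leq_add => //; have := cardsD1 w e; rewrite we ce => ->.
  by rewrite add1n subn1.
- move=> e1; rewrite in_setU1 => /orP[/eqP ->|]; last exact: hT.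
  by split=> //; exists w.
Qed.

Definition fragile_edges (n k : nat) (D : finType) (s : {ffun 'I_n -> D}) : hypergraph n :=
  [set e in allowed k s | [exists w, fragile s w e]].

(** If [H] misses the block, then [w] is free up to edges with a second vertex in [cover T]. Meeting
    [cover T] in [w] alone makes the blocks of different vertices disjoint. *)
Definition hyper_block (n k : nat) (D : finType) (s : {ffun 'I_n -> D})
    (T : hypergraph n) (w : 'I_n) : {set {set 'I_n}} :=
  [set e in allowed k s | (e :&: cover T == [set w]) && fragile s w e].

(** Twenty-six unhit blocks per edge of [T]: at most 15 free vertices in a poor edge, 1 vertex at
    which an edge of [T] is fragile, and 10 vertices on edges that meet [cover T] twice. *)
Definition hyper_good (n k : nat) (D : finType) (t u : nat)
    (H : hypergraph n) (s : {ffun 'I_n -> D}) : bool :=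
  ~~ [exists T : hypergraph n, [&& T \subset fragile_edges k s, #|T| == t,
         (#|cover T| <= (k - 1) * t + u)%N, (t * (2 * k - 3) <= 2 * #|cover T|)%N,
         T \subset H &
         (#|[set w in cover T | [disjoint H & hyper_block k s T w]]| <= 26 * t)%N]].

Lemma hyper_good_closure (R : realType) (tau : R) (n k : nat) (D : finType) (t u : nat)
    (H : hypergraph n) (s : {ffun 'I_n -> D}) (U : {set 'I_n}) :
  (2 < k)%N -> (0 < t)%N ->
  H \subset edges n k -> sparse tau k H -> s \in colorings D H -> hyper_good k t u H s ->
  (#|U| <= u)%N -> (4 * t + 3)%:R <= tau * n%:R ->
  exists P : {set 'I_n}, [/\ U \subset P, (#|P| <= #|U| + (k - 1) * t)%N & edge_closed H s P].
Proof.
move=> k2 t0 HO sp sH good Uu cn.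
have k1 : (1 < k)%N by exact: ltnW.
have [//|[T [TH cT cov hT]]] := edge_closure_grow s U t HO.
move: good => /negP; case; apply/existsP; exists T.
have HA : H \subset allowed k s by rewrite -colorings_allowed.
have TC : T \subset fragile_edges k s.
  apply/subsetP => e eT; rewrite in_set (subsetP HA) ?(subsetP TH) //=.
  by apply/existsP; have [_] := hT e eT.
have covle : (#|cover T| <= (k - 1) * t + u)%N.
  apply: leq_trans (subset_leq_card (subsetUr U _)) _; apply: leq_trans cov _.
  by rewrite addnC leq_add2l.
have Tsp : (t * (2 * k - 3) <= 2 * #|cover T|)%N.
  move/forallP: sp => /(_ T); rewrite TH cT /= mulnC => /implyP; apply.
  by apply: le_trans cn; rewrite ler_nat; lia.
rewrite TC cT eqxx covle Tsp TH /=.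
have T0 : (0 < #|T|)%N by rewrite cT.
have /card_gt0P[e0 e0T] := T0.
have ce e : e \in T -> #|e| = k.
  by move=> eT; have := subsetP HO e (subsetP TH e eT); rewrite inE => /eqP.
have /card_gt0P[v ve0] : (0 < #|e0|)%N by rewrite ce // ltnW.
have vT : v \in cover T by apply/bigcupP; exists e0.
(* [sparse_double_edges] allows for an extra vertex; a vertex already covered is given to it. *)
have vS : v |: cover T = cover T by apply/setUidPr; rewrite sub1set.
have D2 := sparse_double_edges v k1 HO sp TH T0.
rewrite vS cT in D2; have {}D2 := D2 cn.
pose B1 := \bigcup_(e in T) [set x in e | free_vertex H s x].
pose B2 := \bigcup_(e in T) [set w | fragile s w e].
pose T2 := [set e in H :\: T | (2 <= #|e :&: cover T|)%N].
pose B3 := \bigcup_(e in T2) (e :&: cover T).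
apply: leq_trans (_ : #|B1 :|: B2 :|: B3| <= _)%N.
  apply: subset_leq_card; apply/subsetP => w; rewrite in_set => /andP[wT dis].
  rewrite !in_setU; case: (boolP (free_vertex H s w)) => fw.
    apply/orP; left; apply/orP; left; have /bigcupP[e eT we] := wT.
    by apply/bigcupP; exists e => //; rewrite in_set we.
  move: fw; rewrite negb_forall => /existsP[e]; rewrite negb_imply negbK => /andP[eH fe].
  case: (boolP (e \in T)) => eT.
    by apply/orP; left; apply/orP; right; apply/bigcupP; exists e => //; rewrite in_set.
  have we : w \in e by case/andP: fe.
  apply/orP; right; apply/bigcupP; exists e; last by rewrite in_setI we.
  rewrite in_set in_setD eT eH /= ltnNge; apply/negP => c1.
  move: dis => /pred0P/(_ e) /=; rewrite eH /= in_set (subsetP HA e eH) fe andbT /=.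
  by rewrite eq_sym eqEcard sub1set in_setI we wT cards1 c1.
apply: leq_trans (leq_card_setU _ _) _.
apply: leq_trans (leq_add (leq_card_setU _ _) (leqnn _)) _.
have c1 : (#|B1| <= 15 * t)%N.
  apply: leq_trans (card_bigcup_le _ _) _; rewrite mulnC -cT -sum_nat_const.
  by apply: leq_sum => e eT; rewrite -ltnS; have [] := hT e eT.
have c2 : (#|B2| <= 1 * t)%N.
  apply: leq_trans (card_bigcup_le _ _) _; rewrite mulnC -cT -sum_nat_const.
  apply: leq_sum => e eT; have [_ [w fw]] := hT e eT.
  rewrite -(cards1 w); apply: subset_leq_card; apply/subsetP => w'; rewrite in_set in_set1 => fw'.
  apply/eqP; apply: (fragile_unique _ _ fw' fw); first by rewrite ce.
  by have := subsetP HA e (subsetP TH e eT); rewrite in_set => /andP[].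
have c3 : (#|B3| <= 10 * t)%N.
  apply: leq_trans (card_bigcup_le _ _) _; apply: leq_trans D2.
  by rewrite (eq_bigl (fun e => (e \in H :\: T) && (1 < #|e :&: cover T|)%N)) // => e; rewrite in_set.
by move: c1 c2 c3; clear; move: #|B1| #|B2| #|B3| => a b c; lia.
Qed.

Lemma rev_ord2_neq (c : 'I_2) : rev_ord c != c.
Proof. by case: c => [[|[|]]]. Qed.

Lemma rev_ord2_eq (c d : 'I_2) : c != d -> rev_ord d == c.
Proof. by case: c d => [[|[|]]] // ? [[|[|]]]. Qed.

(** Flip one vertex in every edge of [F], the edges endangered by [P], and [v] if its colour is
    wrong. An edge of [F] keeps an unflipped vertex that had the colour of its representative. An
    edge outside [F] has at most one flipped vertex [x]; if it became monochromatic it would be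
    fragile at [x], so [x] is not in [P]. But a representative is free when its edge is not poor,
    and lies in [P] when its edge is poor, by closure or because the edge is missing from [H]. *)
Lemma hyper_repair (R : realType) (tau : R) (n k : nat) (E H : hypergraph n)
    (s : {ffun 'I_n -> 'I_2}) (P : {set 'I_n}) (v : 'I_n) (j : 'I_2) :
  let F := [set e in E | [exists w in P, fragile s w e]] in
  (20 < k)%N -> E \subset edges n k -> sparse tau k E -> H \subset E ->
  s \in colorings 'I_2 H -> edge_closed H s P -> cover (E :\: H) \subset P -> v \in P ->
  (4 * #|F| + 3)%:R <= tau * n%:R ->
  exists2 t, t \in colorings 'I_2 E & (t v == j) && (hamming s t <= #|F|.+1)%N.
Proof.
move=> F k20 EO sp HE sH cl FP vP cn.
have FE : F \subset E by apply/subsetP => e; rewrite in_set => /andP[].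
have ce e : e \in E -> #|e| = k.
  by move=> eE; have := subsetP EO e eE; rewrite inE => /eqP.
pose wf e := odflt v [pick w in P | fragile s w e].
have wfP e : e \in F -> wf e \in P /\ fragile s (wf e) e.
  rewrite in_set /wf => /andP[_ /exists_inP[w wP fw]]; case: pickP => [w' /andP[]//|/(_ w)].
  by rewrite /= wP fw.
(* A representative other than the fragile vertex shares its colour with the rest of the edge, so
   flipping it leaves two colours there. *)
pose Cand e := (if poor_edge H s e then e else [set x in e | free_vertex H s x]) :\ wf e.
have hC e : e \in F -> (Cand e \subset e) && (14 < #|Cand e|)%N.
  move=> eF; apply/andP; split.
    rewrite /Cand; case: ifP => _; first exact: subD1set.
    by apply: subset_trans (subD1set _ _) _; apply/subsetP => x; rewrite in_set => /andP[].
  rewrite /Cand; set A := (if _ then _ else _).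
  have : (15 < #|A|)%N.
    rewrite /A; case: (boolP (poor_edge H s e)) => [_|]; last by rewrite /poor_edge -leqNgt.
    by rewrite ce ?(subsetP FE) //; apply: leq_trans k20.
  by rewrite (cardsD1 (wf e) A); case: (_ \in A); rewrite ?add1n ?add0n // => /ltnW.
have k1 : (1 < k)%N by apply: leq_trans k20.
have [f [f1 f2 f3]] := sparse_representatives v k1 EO sp FE cn hC.
set Q0 := v |: [set f e | e in F] in f2 f3.
pose Q := if j == s v then Q0 :\ v else Q0.
have QQ : Q \subset Q0 by rewrite /Q; case: ifP => // _; exact: subD1set.
have {}f2 e : e \in F -> (#|e :&: Q| <= 2)%N.
  by move=> eF; apply: leq_trans (f2 e eF); apply: subset_leq_card; exact: setIS.
have {}f3 e : e \in E -> e \notin F -> (#|e :&: Q| <= 1)%N.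
  by move=> eE eF; apply: leq_trans (f3 e eE eF); apply: subset_leq_card; exact: setIS.
have fQ e : e \in F -> f e \in Q.
  move=> eF; have fQ0 : f e \in Q0 by rewrite in_setU; apply/orP; right; exact: imset_f.
  by rewrite /Q; case: ifP => // _; rewrite in_setD1 fQ0; have /andP[_ ->] := f1 e eF.
pose g : {ffun 'I_n -> 'I_2} := [ffun x => if x \in Q then rev_ord (s x) else s x].
exists g; last first.
  apply/andP; split.
    rewrite ffunE /Q; case: (eqVneq j (s v)) => [->|jv]; first by rewrite setD11.
    rewrite setU11; exact: rev_ord2_eq.
  apply: leq_trans (_ : #|Q0| <= _)%N.
    apply: subset_leq_card; apply/subsetP => x; rewrite in_set ffunE.
    by case: ifP => [/(subsetP QQ)//|]; rewrite eqxx.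
  apply: leq_trans (leq_card_setU _ _) _; rewrite cards1 add1n ltnS; exact: leq_imset_card.
rewrite in_set; apply/forall_inP => e eE; apply/negP => /monochromaticP[d hd].
have eHP : e \notin H -> e \subset P.
  move=> eH; apply: subset_trans FP; apply/subsetP => x xe; apply/bigcupP; exists e => //.
  by rewrite in_setD eH.
case: (boolP (e \in F)) => eF.
  have [wP fw] := wfP e eF.
  have := f1 e eF; rewrite in_setD1 => /andP[/andP[xw xC] _].
  have xe : f e \in e.
    by move: xC; case: ifP => // _; rewrite in_set => /andP[].
  have xQ := fQ e eF.
  have /card_gt0P[y] : (0 < #|e :\: (wf e |: (e :&: Q))|)%N.
    rewrite cardsD subn_gt0 (ce e eE); have k3 : (3 < k)%N by apply: leq_trans k20.
    refine (leq_ltn_trans _ k3).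
    apply: leq_trans (subset_leq_card (subsetIr _ _)) _.
    by apply: leq_trans (leq_card_setU _ _) _; rewrite cards1 (leq_add (leqnn 1) (f2 e eF)).
  rewrite in_setD in_setU1 in_setI negb_or => /andP[/andP[yw yQ] ye].
  rewrite ye /= in yQ.
  have := hd y ye; have := hd (f e) xe; rewrite !ffunE xQ (negbTE yQ).
  rewrite (fragile_eq fw xe ye xw yw) => <- /eqP.
  by rewrite eq_sym (negbTE (rev_ord2_neq _)).
have := f3 e eE eF; rewrite leq_eqVlt ltnS leqn0 => /orP[/cards1P[x ex]|].
  have xQe : x \in e :&: Q by rewrite ex set11.
  move: (xQe); rewrite in_setI => /andP[xe xQ].
  have others y : y \in e -> y != x -> s y = d.
    move=> ye yx; rewrite -(hd y ye) ffunE ifF //; apply: contraNF yx => yQ.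
    by have : y \in e :&: Q by [rewrite in_setI ye]; rewrite ex in_set1.
  have fx : fragile s x e.
    rewrite /fragile xe; apply/forall_inP => y; rewrite in_setD1 => /andP[yx ye].
    by apply/forall_inP => y'; rewrite in_setD1 => /andP[y'x y'e]; rewrite !others.
  have xP : x \notin P.
    by apply: contra eF => xP; rewrite in_set eE; apply/exists_inP; exists x.
  have eH : e \in H.
    by apply: contraT => /eHP /subsetP/(_ x xe); rewrite (negbTE xP).
  move: xQ => /(subsetP QQ); rewrite in_setU1 => /orP[/eqP xv|/imsetP[e1 e1F xf]]; first by rewrite xv vP in xP.
  have [wP1 fw1] := wfP e1 e1F.
  have := f1 e1 e1F; rewrite -xf /Cand in_setD1 => /andP[/andP[_ +] _].
  case: (boolP (poor_edge H s e1)) => pe1; last first.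
    by rewrite in_set => /andP[_ /forall_inP/(_ e eH)]; rewrite fx.
  move=> xe1; case/negP: xP.
  case: (boolP (e1 \in H)) => e1H.
    move/forall_inP: cl => /(_ _ wP1)/forall_inP/(_ e1 e1H); rewrite fw1 pe1 /=.
    by move/subsetP; apply.
  apply: (subsetP FP); apply/bigcupP; exists e1 => //.
  by rewrite in_setD e1H (subsetP FE).
rewrite cards_eq0 => /eqP e0.
have sd y : y \in e -> s y = d.
  move=> ye; rewrite -(hd y ye) ffunE ifF //; apply/negbTE/negP => yQ.
  by have : y \in e :&: Q by [rewrite in_setI ye]; rewrite e0 inE.
have eH : e \notin H.
  apply/negP => eH; move: sH; rewrite in_set => /forall_inP/(_ e eH)/negP; apply.
  by apply/monochromaticP; exists d.
have /card_gt0P[w we] : (0 < #|e|)%N by rewrite ce // ltnW.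
case/negP: eF; rewrite in_set eE; apply/exists_inP; exists w; first exact: (subsetP (eHP eH)).
rewrite /fragile we; apply/forall_inP => y; rewrite in_setD1 => /andP[_ ye].
by apply/forall_inP => y'; rewrite in_setD1 => /andP[_ y'e]; rewrite !sd.
Qed.

Lemma card_star_le (n k : nat) (Z : {set 'I_n}) (w : 'I_n) :
  (#|[set e : {set 'I_n} | [&& w \in e, #|e| == k & e :\ w \subset Z]]| * (k.-1)`!
     <= #|Z| ^ k.-1)%N.
Proof.
set A := [set e : {set 'I_n} | _].
have inj : {in A &, injective (fun e : {set 'I_n} => e :\ w)}.
  move=> e e'; rewrite !in_set => /and3P[we _ _] /and3P[we' _ _] h.
  by rewrite -(setD1K we) h (setD1K we').
rewrite -(card_in_imset inj).
apply: leq_trans (ffact_le_expn _ _); rewrite -bin_ffact leq_mul2r; apply/orP; right.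
rewrite -cards_draws; apply: subset_leq_card; apply/subsetP => _ /imsetP[e eA ->].
move: eA; rewrite !in_set => /and3P[we /eqP ce ->] /=.
by have := cardsD1 w e; rewrite we ce => ->.
Qed.

(* An edge fragile at [w] is [w] together with [k - 1] vertices of one colour. *)
Lemma fragile_edges_weight (R : realType) (n k : nat) (D : finType)
    (s : {ffun 'I_n -> D}) (V : {set 'I_n}) (rho B : R) :
  (1 < k)%N -> 0 <= rho -> 0 <= B -> (forall c : D, #|color_class s c|%:R <= B) ->
  (k.-1)`!%:R * \sum_(e in fragile_edges k s) rho ^+ #|e :&: V| <=
  #|D|%:R * (n%:R + rho * #|V|%:R) * (B + rho * #|V|%:R) ^+ k.-1.
Proof.
move=> k1 rho0 B0 hB.
pose W (w : 'I_n) : R := if w \in V then rho else 1.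
have W0 w : 0 <= W w by rewrite /W; case: ifP.
pose Z w c := [set e : {set 'I_n} | [&& w \in e, #|e| == k & e :\ w \subset color_class s c]].
have h1 : \sum_(e in fragile_edges k s) rho ^+ #|e :&: V| <=
    \sum_(w : 'I_n) \sum_(c : D) \sum_(e in Z w c) rho ^+ #|e :&: V|.
  have -> : \sum_(w : 'I_n) \sum_(c : D) \sum_(e in Z w c) rho ^+ #|e :&: V| =
      \sum_(e : {set 'I_n}) \sum_(w : 'I_n) \sum_(c : D)
        (if e \in Z w c then rho ^+ #|e :&: V| else 0).
    rewrite [RHS]exchange_big /=; apply: eq_bigr => w _.
    by rewrite [RHS]exchange_big /=; apply: eq_bigr => c _; exact: big_mkcond.
  rewrite big_mkcond /=; apply: ler_sum => e _.
  have nn w c : 0 <= (if e \in Z w c then rho ^+ #|e :&: V| else 0).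
    by case: ifP => // _; exact: exprn_ge0.
  case: ifP => [|_]; last by apply: sumr_ge0 => w _; apply: sumr_ge0.
  rewrite in_set => /andP[eA /existsP[w fw]].
  have ce : #|e| = k by move: eA; rewrite in_set in_set => /andP[/eqP].
  have we : w \in e by case/andP: fw.
  have /card_gt0P[y] : (0 < #|e :\ w|)%N.
    by have := cardsD1 w e; rewrite we ce add1n => h; rewrite -ltnS -h.
  rewrite in_setD1 => /andP[yw ye].
  have eZ : e \in Z w (s y).
    rewrite in_set we ce eqxx /=; apply/subsetP => x; rewrite in_setD1 => /andP[xw xe].
    by rewrite in_set (fragile_eq fw xe ye xw yw).
  rewrite (bigD1 w) //= (bigD1 (s y)) //= eZ -addrA lerDl addr_ge0 //; first exact: sumr_ge0.
  by apply: sumr_ge0 => w' _; apply: sumr_ge0.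
have h2 w c : (k.-1)`!%:R * \sum_(e in Z w c) rho ^+ #|e :&: V| <=
    W w * (B + rho * #|V|%:R) ^+ k.-1.
  have inj : {in Z w c &, injective (fun e : {set 'I_n} => e :\ w)}.
    move=> e e'; rewrite !in_set => /and3P[we _ _] /and3P[we' _ _] h.
    by rewrite -(setD1K we) h (setD1K we').
  have -> : \sum_(e in Z w c) rho ^+ #|e :&: V| =
      W w * \sum_(e in [set e :\ w | e in Z w c]) rho ^+ #|e :&: V|.
    rewrite (big_imset _ inj) /= mulr_sumr; apply: eq_bigr => e; rewrite in_set => /and3P[we _ _].
    have -> : (e :\ w) :&: V = (e :&: V) :\ w by apply/setP => x; rewrite !inE andbA.
    rewrite (cardsD1 w (e :&: V)) in_setI we /W /=; case: (w \in V); last by rewrite mul1r.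
    by rewrite add1n exprS.
  rewrite mulrCA; apply: ler_wpM2l => //.
  apply: (@le_trans _ _ (k.-1`!%:R * \sum_(e : {set 'I_n} |
     (e \subset color_class s c) && (#|e| == k.-1)) rho ^+ #|e :&: V|)).
    apply: ler_wpM2l => //; rewrite big_mkcond [leRHS]big_mkcond; apply: ler_sum => e _.
    case: ifP => [|_]; last by case: ifP => // _; exact: exprn_ge0.
    move=> /imsetP[e' + ->]; rewrite in_set => /and3P[we /eqP ce ->] /=.
    by have := cardsD1 w e'; rewrite we ce => -> /=; rewrite eqxx.
  apply: le_trans (sum_edges_weight _ _ _ rho0) _; apply: lerXn2r.
  - by rewrite nnegrE addr_ge0 // mulr_ge0.
  - by rewrite nnegrE addr_ge0 // mulr_ge0.
  - by rewrite lerD2r.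
apply: (@le_trans _ _ ((k.-1)`!%:R *
   \sum_(w : 'I_n) \sum_(c : D) \sum_(e in Z w c) rho ^+ #|e :&: V|)).
  by apply: ler_wpM2l.
rewrite mulr_sumr.
apply: (@le_trans _ _ (\sum_(w : 'I_n) \sum_(c : D) W w * (B + rho * #|V|%:R) ^+ k.-1)).
  by apply: ler_sum => w _; rewrite mulr_sumr; apply: ler_sum.
under eq_bigr do rewrite sumr_const.
rewrite sumrMnl -[leLHS]mulr_natl -mulrA; apply: ler_wpM2l => //.
rewrite -mulr_suml; apply: ler_wpM2r.
  by apply: exprn_ge0; rewrite addr_ge0 // mulr_ge0.
apply: (@le_trans _ _ (\sum_(w : 'I_n) (1 + rho * (w \in V)%:R))).
  by apply: ler_sum => w _; rewrite /W; case: (w \in V) => /=; rewrite ?mulr1 ?mulr0 ?addr0 ?lerDr.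
by rewrite big_split /= sumr_const card_ord -mulr_sumr -natr_sum -sum1_card [in leRHS]big_mkcond /=.
Qed.

(** With two colours, an allowed edge fragile at [w] is [w] together with [k - 1] vertices of the
    opposite colour, so a power of that class bounds the block. *)
Lemma hyper_blocks (R : realType) (B z p : R) (n k : nat)
    (s : {ffun 'I_n -> 'I_2}) (T : hypergraph n) :
  (2 < k)%N -> (forall c, #|color_class s c|%:R <= B) -> T \subset fragile_edges k s ->
  (forall j : nat, (j * (k.-1)`!)%:R <= B ^+ k.-1 -> z <= (1 - p) ^+ j) ->
  (forall i, i \in cover T ->
     [/\ hyper_block k s T i \subset allowed k s, [disjoint T & hyper_block k s T i] &
      z <= (1 - p) ^+ #|hyper_block k s T i|]) /\
  (forall i j, i \in cover T -> j \in cover T -> i != j ->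
     [disjoint hyper_block k s T i & hyper_block k s T j]).
Proof.
move=> k2 hB TC hz; split.
  move=> w wT; split.
  - by apply/subsetP => e; rewrite in_set => /andP[].
  - rewrite disjoint_subset; apply/subsetP => e eT; rewrite inE; apply/negP.
    rewrite in_set => /andP[eA /andP[/eqP ee _]].
    have ce : #|e| = k by move: eA; rewrite in_set in_set => /andP[/eqP].
    have es : e :&: cover T = e.
      by apply/setIidPl/subsetP => x xe; apply/bigcupP; exists e.
    by move: k2; rewrite -ce -es ee cards1.
  - apply: hz; apply: (@le_trans _ _ (#|color_class s (rev_ord (s w))| ^ k.-1)%:R); last first.
      have B0 : 0 <= B := le_trans (ler0n _ _) (hB (rev_ord (s w))).
      by rewrite natrX; apply: lerXn2r; rewrite ?nnegrE ?ler0n //; exact: hB.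
    rewrite ler_nat; apply: leq_trans (card_star_le k _ w).
    rewrite leq_mul2r; apply/orP; right; apply: subset_leq_card; apply/subsetP => e.
    rewrite in_set => /andP[eA /andP[_ fw]].
    have [ce nm] : #|e| = k /\ ~~ monochromatic s e.
      by move: eA; rewrite in_set in_set => /andP[/eqP].
    have we : w \in e by case/andP: fw.
    rewrite in_set we ce eqxx /=; apply/subsetP => x; rewrite in_setD1 => /andP[xw xe].
    rewrite in_set eq_sym; apply: rev_ord2_eq; apply: contra nm => /eqP sx.
    apply/monochromaticP; exists (s x) => y ye; case: (eqVneq y w) => [->//|yw].
    exact: (fragile_eq fw).
move=> w w' wT wT' ne; rewrite disjoint_subset; apply/subsetP => e; rewrite in_set.
move=> /andP[_ /andP[/eqP e1 _]]; rewrite inE; apply/negP; rewrite in_set.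
move=> /andP[_ /andP[/eqP e2 _]]; case/negP: ne; apply/eqP/set1_inj.
by rewrite -e1 -e2.
Qed.

(** Only a fraction of order [k / 2 ^ (k - 1)] of the edges is fragile, and this compensates the
    density [r], which may be that large up to a logarithm. The factor [expR 4] bounds the power
    [k - 1] of [1 + 4 / k], where imbalance and weighted vertices contribute [1 / k] each to the
    class frequency [1 / 2]. *)
Lemma near_fragile_density (R : realType) (k : nat) (r xis : R) (m : nat -> nat) :
  (2 < k)%N -> 0 <= r -> (forall n, (m n)%:R <= r * n%:R + 1) ->
  0 < xis -> xis * k%:R <= 1 ->
  (\forall n \near \oo%classic, forall s : {ffun 'I_n -> 'I_2}, balanced xis s ->
    'C(n, k)%:R <= 4 * #|allowed k s|%:R :> R) ->
  \forall n \near \oo%classic, forall s : {ffun 'I_n -> 'I_2}, balanced xis s ->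
    forall (h : nat) (V : {set 'I_n}) (rho : R), (h <= m n)%N ->
    0 <= rho -> k%:R * (rho * #|V|%:R) <= n%:R ->
    h%:R / #|allowed k s|%:R * \sum_(e in fragile_edges k s) rho ^+ #|e :&: V| <=
    32 * expR 4 * k%:R / 2 ^+ k.-1 * (r + 1) * n%:R.
Proof.
move=> k2 r0 hm xis0 xk hM.
have k0 : (0 < k)%N by apply: leq_trans k2.
near=> n => s bs h V rho hh rho0 rV.
have kR : 0 < k%:R :> R by rewrite ltr0n.
have nk : (k <= n)%N by near: n; exact: nbhs_infty_ge.
have n0 : 0 < n%:R :> R by rewrite ltr0n; apply: leq_trans nk.
have mn : (m n)%:R <= (r + 1) * n%:R.
  by near: n; apply: near_linear_le hm _; rewrite ltrDl.
have Nlow : n%:R ^+ k <= 2 * k`!%:R * 'C(n, k)%:R :> R by near: n; exact: near_bin_lower.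
have NM : 'C(n, k)%:R <= 4 * #|allowed k s|%:R :> R.
  by move: s bs {V rho rho0 rV}; near: n.
have N0 : 0 < 'C(n, k)%:R :> R by rewrite ltr0n bin_gt0.
have M0 : 0 < #|allowed k s|%:R :> R by move: NM N0; clear; lra.
set x := rho * #|V|%:R in rV.
have x0 : 0 <= x by rewrite /x mulr_ge0.
have xn : x <= n%:R / k%:R by rewrite ler_pdivlMr // mulrC.
have xin : xis <= k%:R^-1 by rewrite -div1r ler_pdivlMr.
have hB c : #|color_class s c|%:R <= (2^-1 + k%:R^-1) * n%:R :> R.
  move/forallP: bs => /(_ c) /le_trans; apply; rewrite card_ord.
  by apply: ler_wpM2r; [exact: ltW | rewrite lerD2l].
have B0 : 0 <= (2^-1 + k%:R^-1) * n%:R :> R.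
  by rewrite mulr_ge0 // addr_ge0 // invr_ge0.
have := fragile_edges_weight V (ltnW k2) rho0 B0 hB; rewrite card_ord -/x.
set S1 := \sum_(e in _) _ => hS1.
have S10 : 0 <= S1 by apply: sumr_ge0 => e _; exact: exprn_ge0.
have hp : h%:R / #|allowed k s|%:R <= 8 * (r + 1) * k`!%:R / n%:R ^+ k.-1 :> R.
  rewrite ler_pdivrMr // mulrAC ler_pdivlMr ?exprn_gt0 //.
  apply: (@le_trans _ _ ((r + 1) * n%:R * n%:R ^+ k.-1)).
    apply: ler_wpM2r; first by rewrite exprn_ge0.
    by apply: le_trans mn; rewrite ler_nat.
  rewrite -mulrA -exprS prednK // .
  apply: (@le_trans _ _ ((r + 1) * (2 * k`!%:R * (4 * #|allowed k s|%:R)))).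
    apply: ler_wpM2l; first by rewrite addr_ge0.
    by apply: le_trans Nlow _; apply: ler_wpM2l.
  by rewrite le_eqVlt; apply/orP; left; apply/eqP; ring.
have hx : (2^-1 + k%:R^-1) * n%:R + x <= 2^-1 * n%:R * (1 + 4 / k%:R).
  by move: xn; clear; lra.
have hx2 : ((2^-1 + k%:R^-1) * n%:R + x) ^+ k.-1 <= n%:R ^+ k.-1 / 2 ^+ k.-1 * expR 4.
  apply: (@le_trans _ _ ((2^-1 * n%:R * (1 + 4 / k%:R)) ^+ k.-1)).
    by apply: lerXn2r => //; rewrite nnegrE ?addr_ge0 // !mulr_ge0 ?invr_ge0 ?addr_ge0 ?divr_ge0.
  rewrite exprMn exprMn exprVn [_^-1 * _]mulrC; apply: ler_wpM2l.
    by rewrite divr_ge0 // exprn_ge0.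
  apply: (@le_trans _ _ (expR (4 / k%:R) ^+ k.-1)).
    apply: lerXn2r; rewrite ?nnegrE ?expR_ge0 ?addr_ge0 ?divr_ge0 //.
    exact: expR_ge1Dx.
  rewrite -expRM_natl ler_expR mulrA ler_pdivrMr // mulrC ler_wpM2l //.
  by rewrite ler_nat leq_pred.
have nx : n%:R + x <= 2 * n%:R.
  have : n%:R / k%:R <= n%:R :> R by rewrite ler_pdivrMr // ler_peMr ?ler1n // ltW.
  by move: xn; clear; lra.
have hS : (k.-1)`!%:R * S1 <= 2 * (2 * n%:R) * (n%:R ^+ k.-1 / 2 ^+ k.-1 * expR 4).
  apply: le_trans hS1 _; apply: ler_pM => //.
  - by rewrite mulr_ge0 // addr_ge0 // ltW.
  - by rewrite exprn_ge0 // addr_ge0.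
  - by apply: ler_wpM2l.
apply: (@le_trans _ _ (8 * (r + 1) * k`!%:R / n%:R ^+ k.-1 * S1)).
  by apply: ler_wpM2r.
have -> : 8 * (r + 1) * k`!%:R / n%:R ^+ k.-1 * S1 =
   8 * (r + 1) * k%:R / n%:R ^+ k.-1 * ((k.-1)`!%:R * S1).
  have -> : k`!%:R = k%:R * (k.-1)`!%:R :> R by rewrite -natrM -{1}(prednK k0) factS prednK.
  by ring.
apply: le_trans (ler_wpM2l _ hS) _.
  by rewrite !mulr_ge0 ?invr_ge0 ?exprn_ge0 ?addr_ge0 // ltW.
have nz : n%:R ^+ k.-1 != 0 :> R by rewrite gt_eqF // exprn_gt0.
have tz : 2 ^+ k.-1 != 0 :> R by rewrite gt_eqF // exprn_gt0.
rewrite le_eqVlt; apply/orP; left; apply/eqP; field.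
by rewrite nz tz.
Unshelve. all: by end_near. Qed.

Lemma hyper_good_whp (R : realType) (k : nat) (r xis z : R) (m : nat -> nat) :
  (20 < k)%N -> 0 <= r -> (forall n, (m n)%:R <= r * n%:R + 1) ->
  0 < xis -> xis * k%:R <= 1 -> 0 <= z <= 1 ->
  (\forall n \near \oo%classic, forall s : {ffun 'I_n -> 'I_2}, balanced xis s ->
    'C(n, k)%:R <= 4 * #|allowed k s|%:R :> R) ->
  (\forall n \near \oo%classic, forall s : {ffun 'I_n -> 'I_2}, balanced xis s ->
    forall h j : nat, (h <= m n)%N ->
     (j * (k.-1)`!)%:R <= ((2^-1 + xis) * n%:R) ^+ k.-1 ->
     z <= (1 - h%:R / #|allowed k s|%:R) ^+ j) ->
  expR 1 * (32 * expR 4 * k%:R / 2 ^+ k.-1 * (r + 1)) * k%:R ^+ 2 * 2 ^+ 26 *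
    expR (- (z * (2 * k - 3)%:R / 4)) <= expR (- 2) ->
  forall gam : R, 0 < gam ->
     exists (c delta : R) (good : forall n, hypergraph n -> {ffun 'I_n -> 'I_2} -> bool),
     [/\ 0 < c, 0 < delta,
       \forall n \near \oo%classic, forall s : {ffun 'I_n -> 'I_2}, balanced xis s ->
         forall h, (h <= m n)%N ->
         #|[set H : hypergraph n | [&& H \subset allowed k s, #|H| == h & ~~ good n H s]]|%:R
          <= expR (- (c * n%:R)) * 'C(#|allowed k s|, h)%:R :> R &
       forall eps : R, 0 < eps -> \forall n \near \oo%classic,
         #|[set E in uniform_hypergraphs n k (m n) |
              ~~ repairable gam delta (good n) E]|%:R
         <= eps * #|uniform_hypergraphs n k (m n)|%:R].
Proof.
move=> k20 r0 hm xis0 xk z01 hM hz cond gam gam0.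
have k2 : (2 < k)%N by apply: leq_trans k20.
have k1 : (1 < k)%N by exact: ltnW.
have k0 : (0 < k)%N by exact: ltnW.
have kR : 1 <= k%:R :> R by rewrite ler1n.
have kR0 : 0 < k%:R :> R by rewrite ltr0n.
have [tau0 tau00 SP] := sparse_whp k1 r0 hm.
pose g := Num.min gam (tau0 / 4) / 4.
have g0 : 0 < g by rewrite divr_gt0 // lt_min gam0 divr_gt0.
have gg : 4 * g <= gam.
  by rewrite /g mulrC mulfVK // ge_min lexx.
have gt : 16 * g <= tau0.
  have : Num.min gam (tau0 / 4) <= tau0 / 4 by rewrite ge_min lexx orbT.
  by rewrite /g; clear; lra.
have [ups0 ups00 SD] := spread_whp k1 r0 hm g0.
have [tau [tau00' tA tC tD]] : exists tau : R,
    [/\ 0 < tau, 2 * k%:R * tau <= ups0, 16 * tau <= tau0 & 2 * k%:R ^+ 2 * tau <= 1].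
  exists (Num.min (ups0 / (2 * k%:R)) (Num.min (tau0 / 16) (1 / (2 * k%:R ^+ 2)))).
  have a0 : 0 < 2 * k%:R :> R by rewrite mulr_gt0.
  have b0 : 0 < 2 * k%:R ^+ 2 :> R by rewrite mulr_gt0 // exprn_gt0.
  split; first by rewrite !lt_min !divr_gt0.
  - by rewrite mulrC -ler_pdivlMr // ge_min lexx.
  - by rewrite mulrC -ler_pdivlMr // !ge_min lexx !orbT.
  - by rewrite mulrC -ler_pdivlMr // !ge_min lexx !orbT.
have A0 : 0 < 32 * expR 4 * k%:R / 2 ^+ k.-1 * (r + 1) :> R.
  apply: mulr_gt0; last by apply: ltr_wpDl.
  by rewrite divr_gt0 ?exprn_gt0 // !mulr_gt0 // expR_gt0.
(* The parameter [a] is [k ^ 2] because the density of fragile edges is controlled only for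
   [rho * #|V|] up to [n / k], and covers have up to [k * t] vertices. *)
have a1 : 1 <= k%:R ^+ 2 :> R by rewrite exprn_ege1.
have [ups ups_0 PB] := planted_bound k0 a1 A0 z01 tau00' cond.
pose ups' := Num.min ups tau.
have ups'0 : 0 < ups' by rewrite lt_min ups_0.
have ups'1 : ups' <= ups by rewrite ge_min lexx.
have ups'2 : ups' <= tau by rewrite ge_min lexx orbT.
pose t n := (Num.truncn (tau * n%:R)).+1.
pose u n := Num.truncn (ups' * n%:R).
exists tau, (ups' / (2 * k%:R)), (fun n => @hyper_good n k 'I_2 (t n) (u n)).
have tun n : [/\ tau * n%:R <= (t n)%:R, (t n)%:R <= tau * n%:R + 1, (u n)%:R <= ups' * n%:R,
     ups' * n%:R < (u n).+1%:R & (u n <= t n)%N].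
  have tn0 : 0 <= tau * n%:R by rewrite mulr_ge0 // ltW.
  have un0 : 0 <= ups' * n%:R by rewrite mulr_ge0 // ltW.
  have /andP[c1 c2] := truncn_itv tn0; have /andP[b1 b2] := truncn_itv un0.
  split=> //; first exact: ltW.
    by rewrite /t -natr1 lerD2r.
  rewrite -ltnS -(ltr_nat R).
  apply: (@le_lt_trans _ _ (tau * n%:R)); last by apply: lt_le_trans c2 _; rewrite ler_nat.
  by apply: le_trans b1 _; apply: ler_wpM2r.
split=> //; first by rewrite divr_gt0 // mulr_gt0.
  have F1 : \forall n \near \oo%classic, [/\ (k <= n)%N, 1 / tau <= n%:R
     & (m n)%:R * 4 <= 'C(n, k)%:R :> R].
    near=> n; split.
    - by near: n; exact: nbhs_infty_ge.
    - by near: n; exact: near_large_nat.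
    have : (r + 1) * 4 * n%:R <= 'C(n, k)%:R by near: n; exact: near_bin_superlinear.
    have : (m n)%:R <= (r + 1) * n%:R.
      by near: n; apply: near_linear_le hm _; rewrite ltrDl.
    by clear; lra.
  have FD := near_fragile_density k2 r0 hm xis0 xk hM.
  apply: filterS (filterI PB (filterI hM (filterI hz (filterI FD F1)))).
  move=> n [pb [hMn [hzn [dens [nk nt N4]]]]].
  move=> s bs h hm'.
  have [t1 t2 u1 u2 tu] := tun n.
  have n0 : 0 < n%:R :> R by rewrite ltr0n; apply: leq_trans nk.
  have N0 : 0 < 'C(n, k)%:R :> R by rewrite ltr0n bin_gt0.
  have NM := hMn s bs.
  have M0 : 0 < #|allowed k s|%:R :> R by move: NM N0; clear; lra.
  have hMle : (h <= #|allowed k s|)%N.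
    rewrite -(ler_nat R); apply: (@le_trans _ _ (m n)%:R); first by rewrite ler_nat.
    by move: NM N4; clear; lra.
  have t2' : (t n)%:R <= 2 * tau * n%:R.
    by move: t2 nt; rewrite ler_pdivrMr // [n%:R * _]mulrC; clear; lra.
  have CA : fragile_edges k s \subset allowed k s.
    by apply/subsetP => e; rewrite in_set => /andP[].
  have atn : k%:R ^+ 2 * (t n)%:R <= n%:R :> R.
    apply: (@le_trans _ _ (k%:R ^+ 2 * (2 * tau * n%:R))).
      by apply: ler_wpM2l => //; exact: exprn_ge0.
    have : 2 * k%:R ^+ 2 * tau * n%:R <= 1 * n%:R by apply: ler_wpM2r.
    by clear; lra.
  have := pb (allowed k s) (fragile_edges k s) h (t n) (u n) _ (fun T => cover T)
    (hyper_block k s) (subset_trans CA (allowed_edges _ _)) CA _ hMle t1 atn.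
  have -> : (0 < #|allowed k s| < n.+1 ^ k)%N.
    rewrite -(ltr0n R) M0 /=; apply: leq_ltn_trans (bin_lt_expn n k0).
    by rewrite -card_edges subset_leq_card // allowed_edges.
  have -> : (u n)%:R <= ups * n%:R.
    by apply: (le_trans u1); apply: ler_wpM2r.
  rewrite tu => /(_ isT isT isT) H; apply: le_trans (H _ _ _).
  - rewrite ler_nat; apply: subset_leq_card; apply/subsetP => F.
    by rewrite !in_set /hyper_good negbK.
  - move=> V cV; apply: (dens s bs h V _ hm').
      by apply: divr_ge0 => //; apply: mulr_ge0 => //; exact: exprn_ge0.
    have tpos : 0 < k%:R ^+ 2 * (t n)%:R :> R by rewrite mulr_gt0 ?exprn_gt0 // ltr0n.
    have cV' : #|V|%:R <= k%:R * (t n)%:R :> R by rewrite -natrM ler_nat.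
    rewrite mulrCA [leLHS]mulrAC ler_pdivrMr //; apply: ler_wpM2l => //.
    by rewrite expr2 -mulrA; apply: ler_wpM2l.
  - move=> T TA; have [] // := hyper_blocks (z := z) (p := h%:R / #|allowed k s|%:R) k2 _ TA
      (fun j => hzn s bs h j hm').
    by move=> c; have /forallP/(_ c) := bs; rewrite card_ord.
  - move=> T TA; have [] // := hyper_blocks (z := z) (p := h%:R / #|allowed k s|%:R) k2 _ TA
      (fun j => hzn s bs h j hm').
    by move=> c; have /forallP/(_ c) := bs; rewrite card_ord.
move=> eps eps0; have e2 : 0 < eps / 2 by rewrite divr_gt0.
have SP' := SP _ e2; have SD' := SD _ e2.
near=> n.
have sp : #|[set E in uniform_hypergraphs n k (m n) | ~~ sparse tau0 k E]|%:R
    <= eps / 2 * #|uniform_hypergraphs n k (m n)|%:R :> R by near: n.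
have sd : #|[set E in uniform_hypergraphs n k (m n) | ~~ spread ups0 g E]|%:R
    <= eps / 2 * #|uniform_hypergraphs n k (m n)|%:R :> R by near: n.
have n1 : 1 / tau <= n%:R by near: n; exact: near_large_nat.
have n2 : 4 / ups' <= n%:R by near: n; exact: near_large_nat.
have n3 : 8 / tau0 <= n%:R by near: n; exact: near_large_nat.
have n4 : 1 / g <= n%:R by near: n; exact: near_large_nat.
set In := uniform_hypergraphs n k (m n) in sp sd *.
apply: (@le_trans _ _ (#|[set E in In | ~~ sparse tau0 k E]|%:R +
   #|[set E in In | ~~ spread ups0 g E]|%:R)); last by move: sp sd; clear; lra.
rewrite -natrD ler_nat; apply: leq_trans (leq_card_setU _ _).
apply: subset_leq_card; apply/subsetP => E; rewrite in_set => /andP[EI nrep].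
have inI Q : (E \in [set F in In | Q F]) = Q E by rewrite in_set EI.
rewrite in_setU !inI; apply: contraR nrep; rewrite negb_or !negbK => /andP[spE sdE].
have EO : E \subset edges n k by move: EI; rewrite uniform_hypergraphsE => /andP[].
have [t1 t2 u1 u2 ut] := tun n.
move: n1 n2 n3 n4; rewrite !ler_pdivrMr // => n1 n2 n3 n4.
have t2' : (t n)%:R <= 2 * tau * n%:R by move: t2 n1; clear; lra.
have utR : (u n)%:R <= (t n)%:R :> R by rewrite ler_nat.
have tA' : 2 * k%:R * tau * n%:R <= ups0 * n%:R by apply: ler_wpM2r.
have tC' : 16 * tau * n%:R <= tau0 * n%:R by apply: ler_wpM2r.
have gg' : 4 * g * n%:R <= gam * n%:R by apply: ler_wpM2r.
have gt' : 16 * g * n%:R <= tau0 * n%:R by apply: ler_wpM2r.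
apply/forallP => H; apply/implyP => /andP[HE dH].
apply/forall_inP => s sH; apply/implyP => good.
apply/forallP => v; apply/forallP => j.
pose U := v |: cover (E :\: H).
have cU : (#|U| <= u n)%N.
  have FO : E :\: H \subset edges n k by apply: subset_trans EO; exact: subsetDl.
  have h1 : (#|U| <= 1 + k * #|E :\: H|)%N.
    apply: leq_trans (leq_card_setU _ _) _; rewrite cards1 leq_add2l.
    exact: card_cover_le.
  rewrite -ltnS -(ltr_nat R); apply: le_lt_trans u2.
  apply: (@le_trans _ _ (1 + k * #|E :\: H|)%:R); first by rewrite ler_nat.
  rewrite natrD natrM.
  have : k%:R * #|E :\: H|%:R <= k%:R * (ups' / (2 * k%:R) * n%:R) by apply: ler_wpM2l.
  have -> : k%:R * (ups' / (2 * k%:R) * n%:R) = ups' * n%:R / 2.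
    by field; rewrite gt_eqF.
  by move: n2; clear; lra.
have HO := subset_trans HE EO.
have [P [UP cP cl]] : exists P : {set 'I_n},
    [/\ U \subset P, (#|P| <= #|U| + (k - 1) * t n)%N & edge_closed H s P].
  apply: (hyper_good_closure k2 _ HO (sparseS HE spE) sH good cU) => //.
  rewrite natrD natrM; move: t2' tC' n3; clear; lra.
have cP' : #|P|%:R <= ups0 * n%:R.
  apply: le_trans tA'.
  have h1 : (#|P| <= k * t n)%N.
    apply: leq_trans cP _; apply: leq_trans (leq_add (leq_trans cU ut) (leqnn _)) _.
    by rewrite -mulSn subn1 prednK.
  apply: (@le_trans _ _ (k%:R * (t n)%:R)); first by rewrite -natrM ler_nat.
  apply: le_trans (ler_wpM2l (ltW kR0) t2') _.
  by rewrite le_eqVlt; apply/orP; left; apply/eqP; ring.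
have vP : v \in P by apply: (subsetP UP); exact: setU11.
have FP : cover (E :\: H) \subset P by apply: subset_trans UP; exact: subsetUr.
pose F := [set e in E | [exists w in P, fragile s w e]].
have cF : #|F|%:R <= g * n%:R.
  have h2 : #|[set e in E | ~~ [disjoint e & P]]|%:R <= g * n%:R.
    by move/forallP: sdE => /(_ P)/implyP; apply.
  apply: le_trans h2; rewrite ler_nat; apply: subset_leq_card; apply/subsetP => e.
  rewrite !in_set => /andP[-> /exists_inP[w wP /andP[we _]]] /=.
  by rewrite -setI_eq0; apply/set0Pn; exists w; rewrite in_setI we.
have cF2 : (4 * #|F| + 3)%:R <= tau0 * n%:R.
  by rewrite natrD natrM; move: cF gt' n3; clear; lra.
have [g' gE /andP[gv gh]] := hyper_repair j k20 EO spE HE sH cl FP vP cF2.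
apply/exists_inP; exists g' => //; rewrite gv /=.
apply: (@le_trans _ _ #|F|.+1%:R); first by rewrite ler_nat.
by rewrite -natr1; move: cF gg' n4; clear; lra.
Unshelve. all: by end_near. Qed.

(** * Estimates below the threshold *)

Lemma near_bin_sharp (R : realType) (kap : nat) (eta : R) : 0 < eta ->
  \forall n \near \oo%classic,
    n%:R ^+ kap <= (1 + eta) * kap`!%:R * 'C(n, kap)%:R :> R.
Proof.
move=> eta0; case: kap => [|kap].
  by near=> n; rewrite expr0 bin0 fact0 !mulr1 lerDl ltW.
near=> n.
have n1 : kap.+1%:R ^+ 2 * (1 + eta) / eta <= n%:R by near: n; exact: near_large_nat.
rewrite -mulrA -natrM mulnC bin_ffact.
have : (n ^ kap.+1)%:R <= (n ^_ kap.+1 + kap.+1 ^ 2 * n ^ kap)%:R :> R.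
  by rewrite ler_nat; exact: expn_ffact_le.
rewrite natrD natrM !natrX exprS => h1.
have h2 : kap.+1%:R ^+ 2 * (1 + eta) * n%:R ^+ kap <= n%:R * eta * n%:R ^+ kap :> R.
  by apply: ler_wpM2r; [exact: exprn_ge0 | move: n1; rewrite ler_pdivrMr].
have : (1 + eta) * (n%:R * n%:R ^+ kap) <=
    (1 + eta) * ((n ^_ kap.+1)%:R + kap.+1%:R ^+ 2 * n%:R ^+ kap) :> R.
  by apply: ler_wpM2l => //; rewrite addr_ge0 // ltW.
by move: h2; clear; lra.
Unshelve. all: by end_near. Qed.

Lemma expR_opp_le_1Bx (R : realType) (p eta : R) :
  0 <= p -> 0 < eta -> p * (1 + eta) <= eta -> expR (- ((1 + eta) * p)) <= 1 - p.
Proof.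
move=> p0 eta0 hp; set x := (1 + eta) * p.
have x0 : 0 <= x by rewrite mulr_ge0 // addr_ge0 // ltW.
rewrite expRN -div1r ler_pdivrMr ?expR_gt0 // mulrC.
have x1 : 1 + x <= expR x by exact: expR_ge1Dx.
have p1 : 0 <= 1 - p.
  have : 0 <= p * eta by rewrite mulr_ge0 // ltW.
  by move: hp eta0 p0; clear; nra.
apply: le_trans (_ : (1 + x) * (1 - p) <= _); last by apply: ler_wpM2r.
rewrite /x; have : p * (p * (1 + eta)) <= p * eta by apply: ler_wpM2l.
by clear; lra.
Qed.

(** A block of full size contains [r * kap * q ^ (1 - kap) / edge_phi] edges on average, for [q]
    colours, and is unhit with about the exponential of minus this number. The strict inequality
    absorbs all errors. *)
Lemma unhit_prob_ge (R : realType) (kap : nat) (D : finType) (r Lam : R) (m : nat -> nat) :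
  (1 < #|D|)%N -> (1 < kap)%N -> 0 <= r -> (forall n, (m n)%:R <= r * n%:R + 1) ->
  r * kap%:R * #|D|%:R^-1 ^+ kap.-1 < Lam * edge_phi R D kap ->
  exists2 xi0 : R, 0 < xi0 & forall xi : R, 0 < xi <= xi0 ->
  \forall n \near \oo%classic, forall s : {ffun 'I_n -> D}, balanced xi s ->
    forall h j : nat, (h <= m n)%N ->
     (j * (kap.-1)`!)%:R <= ((#|D|%:R^-1 + xi) * n%:R) ^+ kap.-1 ->
     expR (- Lam) <= (1 - h%:R / #|allowed kap s|%:R) ^+ j.
Proof.
move=> D1 k1 r0 hm hL.
set q := #|D|%:R^-1 in hL *; set phi := edge_phi R D kap in hL.
have q0 : 0 < q by rewrite invr_gt0 ltr0n ltnW.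
have phi0 : 0 < phi by exact: edge_phi_gt0.
have k0 : (0 < kap)%N by exact: ltnW.
(* All errors are bounded in terms of a single [eta]. The hypothesis says that [F] is positive at 0,
   and continuity gives a positive [eta] where it still is. *)
pose F (x : R) := Lam * (phi - x) - (r + x) * (1 + x) ^+ 2 * kap%:R * (q + x) ^+ kap.-1.
have Fc : {for 0, continuous F}.
  apply: continuousB.
    apply: continuousM; first exact: cvg_cst.
    by apply: continuousB; [exact: cvg_cst | exact: cvg_id].
  apply: continuousM; first apply: continuousM; first apply: continuousM.
  - by apply: continuousD; [exact: cvg_cst | exact: cvg_id].
  - apply: (@continuous_comp _ _ _ (fun x : R => 1 + x) (fun x : R => x ^+ 2)).
      by apply: continuousD; [exact: cvg_cst | exact: cvg_id].
    exact: exprn_continuous.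
  - exact: cvg_cst.
  - apply: (@continuous_comp _ _ _ (fun x : R => q + x) (fun x : R => x ^+ kap.-1)).
      by apply: continuousD; [exact: cvg_cst | exact: cvg_id].
    exact: exprn_continuous.
have [eta [eta0 etaphi Feta]] : exists eta : R, [/\ 0 < eta, eta < phi & 0 < F eta].
  have F0 : 0 < F 0 by rewrite /F !addr0 subr0 expr1n mulr1 subr_gt0.
  have N1 : \forall x \near (0 : R), 0 < F x by exact: (cvgr_gt (F 0) Fc _ F0).
  move/nbhs_ballP: N1 => [e /= e0 he].
  have m0 : 0 < Num.min (e / 2) (phi / 2) by rewrite lt_min !divr_gt0.
  have m1 : Num.min (e / 2) (phi / 2) < e.
    by apply: (@le_lt_trans _ _ (e / 2)); [rewrite ge_min lexx | move: e0; clear; lra].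
  have m2 : Num.min (e / 2) (phi / 2) < phi.
    by apply: (@le_lt_trans _ _ (phi / 2)); [rewrite ge_min lexx orbT | move: phi0; clear; lra].
  exists (Num.min (e / 2) (phi / 2)); split=> //; apply: he.
  by rewrite /ball /= sub0r normrN gtr0_norm.
have [xi1 xi10 HA] := allowed_frac_bounds D1 k1 eta0.
exists (Num.min xi1 eta); first by rewrite lt_min xi10.
move=> xi /andP[xi0]; rewrite le_min => /andP[xix xie].
have HA' := HA xi _.
near=> n => s bs h j hh hj.
have nk : (kap <= n)%N by near: n; exact: nbhs_infty_ge.
have n0 : 0 < n%:R :> R by rewrite ltr0n; apply: leq_trans nk.
have mn : (m n)%:R <= (r + eta) * n%:R.
  by near: n; apply: near_linear_le hm _; rewrite ltrDl.
have Ns : n%:R ^+ kap <= (1 + eta) * kap`!%:R * 'C(n, kap)%:R :> R.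
  by near: n; exact: near_bin_sharp.
have Nl : (r + eta) * (1 + eta) / (eta * (phi - eta)) * n%:R <= 'C(n, kap)%:R.
  by near: n; exact: near_bin_superlinear.
have hA : forall s : {ffun 'I_n -> D},
    #|allowed kap s|%:R / 'C(n, kap)%:R <= edge_phi R D kap + eta /\
    (balanced xi s -> edge_phi R D kap - eta <= #|allowed kap s|%:R / 'C(n, kap)%:R).
  by near: n; apply: HA; rewrite xi0.
have N0 : 0 < 'C(n, kap)%:R :> R by rewrite ltr0n bin_gt0.
have [_ /(_ bs)] := hA s; rewrite -/phi ler_pdivlMr // => hM.
have pe0 : 0 < phi - eta by rewrite subr_gt0.
have M0 : 0 < #|allowed kap s|%:R :> R by apply: lt_le_trans hM; rewrite mulr_gt0.
set p := h%:R / #|allowed kap s|%:R.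
have p0 : 0 <= p by rewrite divr_ge0.
have e1 : 0 < 1 + eta by rewrite addr_gt0.
have re : 0 < r + eta by rewrite ltr_wpDl.
have hp : p <= (r + eta) * n%:R / ((phi - eta) * 'C(n, kap)%:R).
  apply: ler_pM => //; first by apply: le_trans mn; rewrite ler_nat.
  by rewrite lef_pV2 ?posrE // mulr_gt0.
have pe : p * (1 + eta) <= eta.
  apply: le_trans (ler_wpM2r (ltW e1) hp) _.
  rewrite mulrAC ler_pdivrMr ?mulr_gt0 //.
  move: Nl; rewrite mulrAC ler_pdivrMr ?mulr_gt0 //.
  by clear; lra.
apply: (@le_trans _ _ (expR (- ((1 + eta) * p)) ^+ j)); last first.
  apply: lerXn2r; rewrite ?nnegrE ?expR_ge0 //; last exact: expR_opp_le_1Bx.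
  by apply: le_trans (expR_opp_le_1Bx p0 eta0 pe); exact: expR_ge0.
rewrite -expRM_natl ler_expR mulrN lerN2.
have jb : j%:R * (kap.-1)`!%:R <= (q + eta) ^+ kap.-1 * n%:R ^+ kap.-1 :> R.
  rewrite -natrM -exprMn; apply: le_trans hj _; apply: lerXn2r.
  - by rewrite nnegrE mulr_ge0 // addr_ge0 // ltW.
  - by rewrite nnegrE mulr_ge0 // addr_ge0 // ltW.
  - by apply: ler_wpM2r; [exact: ltW | rewrite lerD2l].
have f0 : 0 < (kap.-1)`!%:R :> R by rewrite ltr0n fact_gt0.
have kf : kap`!%:R = kap%:R * (kap.-1)`!%:R :> R.
  by rewrite -natrM -{1}(prednK k0) factS prednK.
rewrite -(ler_pM2r (mulr_gt0 pe0 f0)).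
apply: (@le_trans _ _ ((r + eta) * (1 + eta) ^+ 2 * kap%:R * (q + eta) ^+ kap.-1 * (kap.-1)`!%:R)); last first.
  rewrite mulrA; apply: ler_wpM2r; first exact: ltW.
  by move: Feta; rewrite /F subr_gt0 => /ltW.
have c1 : p * ((phi - eta) * 'C(n, kap)%:R) <= (r + eta) * n%:R.
  by rewrite -ler_pdivlMr // mulr_gt0.
rewrite -(ler_pM2r N0).
have -> : j%:R * ((1 + eta) * p) * ((phi - eta) * (kap.-1)`!%:R) * 'C(n, kap)%:R =
   (1 + eta) * ((j%:R * (kap.-1)`!%:R) * (p * ((phi - eta) * 'C(n, kap)%:R))) by ring.
apply: (@le_trans _ _ ((1 + eta) * ((q + eta) ^+ kap.-1 * n%:R ^+ kap.-1 * ((r + eta) * n%:R)))).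
  apply: ler_wpM2l; first exact: ltW.
  by apply: ler_pM => //; rewrite mulr_ge0 // mulr_ge0 // ltW.
have -> : (1 + eta) * ((q + eta) ^+ kap.-1 * n%:R ^+ kap.-1 * ((r + eta) * n%:R)) =
   (1 + eta) * (q + eta) ^+ kap.-1 * (r + eta) * n%:R ^+ kap.
  have nE : n%:R ^+ kap = n%:R * n%:R ^+ kap.-1 :> R by rewrite -exprS prednK.
  by rewrite nE; ring.
apply: (@le_trans _ _ ((1 + eta) * (q + eta) ^+ kap.-1 * (r + eta) *
   ((1 + eta) * kap`!%:R * 'C(n, kap)%:R))).
  apply: ler_wpM2l => //; rewrite mulr_ge0 ?(ltW re) // mulr_ge0 ?(ltW e1) //.
  by rewrite exprn_ge0 // addr_ge0 // ltW.
by rewrite kf le_eqVlt; apply/orP; left; apply/eqP; ring.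
Unshelve. all: by end_near. Qed.

(* With [u = sqrt s] and [ln u >= 1 - 1/u] the right factor is at least [(u - 1)^2]. *)
Lemma sqr_le_entropy (R : realType) (s : R) : 0 <= s ->
  (s - 1) ^+ 2 <= 2 * (s + 1) * (s * ln s - s + 1).
Proof.
rewrite le_eqVlt => /orP[/eqP <-|s0].
  by rewrite ln0 // mul0r !sub0r oppr0 sqrrN expr1n; lra.
have [u u0 su] : exists2 u : R, 0 < u & s = u ^+ 2.
  by exists (Num.sqrt s); rewrite ?sqrtr_gt0 // sqr_sqrtr // ltW.
have h : - ln u <= u^-1 - 1.
  rewrite -lnV ?posrE // -{1}[u^-1](addrNK 1) addrC; apply: le_ln1Dx.
  by rewrite ltrBrDr addNr invr_gt0.
have h2 : u ^+ 2 * (- ln u) <= u ^+ 2 * (u^-1 - 1) by apply: ler_wpM2l; rewrite ?sqr_ge0.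
have h3 : u ^+ 2 * (u^-1 - 1) = u - u ^+ 2 by field; rewrite gt_eqF.
rewrite h3 in h2.
have e : (u - 1) ^+ 2 <= s * ln s - s + 1.
  by rewrite su lnXn // -mulr_natr; move: h2; clear; nra.
apply: (@le_trans _ _ (2 * (s + 1) * (u - 1) ^+ 2)); last first.
  by apply: ler_wpM2l => //; rewrite mulr_ge0 // addr_ge0 // ltW.
have -> : 2 * (s + 1) * (u - 1) ^+ 2 = (s - 1) ^+ 2 + (u - 1) ^+ 4.
  by rewrite su; ring.
by rewrite lerDl exprn_even_ge0.
Qed.

(* [f_(k+1) = s f_k + k (s - 1)^2] for [f_k = s^k - 1 - k (s - 1)]. *)
Lemma exprn_taylor2_le (R : realType) (S s : R) (k : nat) :
  2 <= S -> 0 <= s <= S ->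
  s ^+ k - 1 - k%:R * (s - 1) <= (S ^+ k - k%:R - 1) * (s - 1) ^+ 2.
Proof.
move=> S2 /andP[s0 sS]; elim: k => [|k IH]; first by rewrite !expr0; lra.
have -> : s ^+ k.+1 - 1 - k.+1%:R * (s - 1) =
    s * (s ^+ k - 1 - k%:R * (s - 1)) + k%:R * (s - 1) ^+ 2.
  by rewrite exprS -natr1; ring.
have Sk : k%:R + 1 <= S ^+ k.
  apply: (@le_trans _ _ (2 ^+ k)).
    by rewrite natr1 -natrX ler_nat ltn_expl.
  by apply: lerXn2r; rewrite ?nnegrE // (le_trans _ S2).
have q0 : 0 <= (s - 1) ^+ 2 by exact: sqr_ge0.
have h1 : s * (s ^+ k - 1 - k%:R * (s - 1)) <= s * ((S ^+ k - k%:R - 1) * (s - 1) ^+ 2).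
  by apply: ler_wpM2l.
have h2 : s * ((S ^+ k - k%:R - 1) * (s - 1) ^+ 2) <= S * ((S ^+ k - k%:R - 1) * (s - 1) ^+ 2).
  by apply: ler_wpM2r => //; apply: mulr_ge0 => //; move: Sk; clear; lra.
have h3 : (S * (S ^+ k - k%:R - 1) + k%:R) * (s - 1) ^+ 2 <=
    (S ^+ k.+1 - k.+1%:R - 1) * (s - 1) ^+ 2.
  apply: ler_wpM2r => //; rewrite exprS -natr1.
  have : 0 <= (S - 2) * k%:R :> R by rewrite mulr_ge0 // subr_ge0.
  by move: S2; clear; lra.
by move: h1 h2 h3; clear; lra.
Qed.

Lemma expR_ge_sqr (R : realType) (x : R) : 0 <= x -> x ^+ 2 / 2 <= expR x.
Proof.
move=> x0; have := expR_ge1Dxn 1 x0; rewrite (_ : 2`! = 2)%N //; clear; lra.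
Qed.

Lemma expR_ge_quartic (R : realType) (x : R) : 0 <= x -> x ^+ 4 / 24 <= expR x.
Proof.
move=> x0; have := expR_ge1Dxn 3 x0; rewrite (_ : 4`! = 24)%N //; clear; lra.
Qed.

Lemma natr_ge_ln (R : realType) (k : nat) : 10 ^+ 5 <= ln k%:R :> R ->
  [/\ (0 < k)%N, k%:R = expR (ln k%:R) :> R & 10 ^+ 4 * ln k%:R <= k%:R :> R].
Proof.
move=> L; have k0 : (0 < k)%N.
  by case: k L => // L; rewrite ln0 // in L; move: L; lra.
have kE : k%:R = expR (ln k%:R) :> R by rewrite lnK // posrE ltr0n.
split=> //; rewrite {2}kE.
apply: le_trans (expR_ge_sqr _); last by move: L; lra.
move: (ln _) L => x L; have : 10 ^+ 5 * x <= x * x.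
  by apply: ler_wpM2r => //; apply: le_trans L; exact: exprn_ge0.
by move: L; clear; lra.
Qed.

(** The term [38 + 3 * L] is what the final comparison for hypergraphs consumes; graphs need less.
    The fourth order term of the exponential is [L ^ 2 / 384], which is enough from [10 ^ 5] on. *)
Lemma expR_sqrt_ge (R : realType) (L : R) : 10 ^+ 5 <= L ->
  38 + 3 * L <= expR (Num.sqrt L / 2) / 8.
Proof.
move=> hL.
have L0 : 0 <= L by lra.
have y0 : 0 <= Num.sqrt L / 2 by rewrite divr_ge0 // sqrtr_ge0.
have := expR_ge_quartic y0.
have -> : (Num.sqrt L / 2) ^+ 4 = L ^+ 2 / 16.
  have e : Num.sqrt L ^+ 2 = L by rewrite sqr_sqrtr.
  by rewrite -[in RHS]e; field.
have : 10 ^+ 5 * L <= L * L by exact: ler_wpM2r.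
by move: hL; clear; move: (expR _) => e; lra.
Qed.

(** Two ranges: up to [k / (2 L)], with [L = ln k], the quadratic bound [sqr_le_entropy] suffices;
    beyond, [ln s] is at least [7 L / 8], while the left side is at most about [5 L / 8] per unit of
    [s]. The constant [5 / 8] exceeds the [1 / 2] that the density requires. *)
Lemma graph_entropy_ge (R : realType) (k : nat) (s : R) : 10 ^+ 5 <= ln k%:R :> R ->
  0 <= s <= k%:R + 1 ->
  5 / 8 * ln k%:R / k%:R * (s ^+ 2 - 1 - 2 * (s - 1)) <= s * ln s - s + 1.
Proof.
move=> hL /andP[s0 sk]; have [k0 kE kL] := natr_ge_ln hL.
move: (ln k%:R) hL kE kL => L hL kE kL.
have kR : 0 < k%:R :> R by rewrite ltr0n.
have L0 : 0 < L by apply: lt_le_trans hL.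
have -> : s ^+ 2 - 1 - 2 * (s - 1) = (s - 1) ^+ 2 by ring.
have q0 : 0 <= (s - 1) ^+ 2 by exact: sqr_ge0.
have lam0 : 0 <= 5 / 8 * L / k%:R.
  by apply: divr_ge0 => //; move: L0; clear; lra.
have Lk : L / k%:R <= 1 / 10 ^+ 4 by rewrite ler_pdivrMr //; move: kL; clear; lra.
have [s1|s1] := leP s (k%:R / (2 * L)).
  have ent := sqr_le_entropy s0.
  have ent0 : 0 <= s * ln s - s + 1.
    have : 0 <= 2 * (s + 1) * (s * ln s - s + 1) by apply: le_trans ent.
    by rewrite pmulr_rge0 //; move: s0; clear; lra.
  apply: (le_trans (ler_wpM2l lam0 ent)); rewrite mulrA; apply: ler_piMl => //.
  have : 5 / 8 * L / k%:R * (2 * s) <= 5 / 8 * L / k%:R * (2 * (k%:R / (2 * L))).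
    by apply: ler_wpM2l => //; apply: ler_wpM2l.
  have -> : 5 / 8 * L / k%:R * (2 * (k%:R / (2 * L))) = 5 / 8.
    by field; rewrite !gt_eqF.
  by move: Lk; clear; lra.
have S0 : 0 < k%:R / (2 * L) by apply: divr_gt0 => //; apply: mulr_gt0.
have sp : 0 < s by apply: lt_trans s1.
have ss1 : 1 <= s.
  apply: le_trans (ltW s1); rewrite ler_pdivlMr ?mulr_gt0 //; move: kL hL; clear; lra.
have l2 : ln (2 * L) <= L / 8.
  rewrite -[leRHS]expRK ler_ln ?posrE ?expR_gt0 ?mulr_gt0 //.
  apply: le_trans (expR_ge_sqr _); last by rewrite divr_ge0 // ltW.
  have : 10 ^+ 5 * L <= L * L by apply: ler_wpM2r => //; exact: ltW.
  by move: L0; clear; lra.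
have ls : 7 / 8 * L <= ln s.
  apply: (@le_trans _ _ (ln (k%:R / (2 * L)))); last by rewrite ler_ln ?posrE // ltW.
  by rewrite ln_div ?posrE ?mulr_gt0 // kE expRK; move: l2; clear; lra.
have h1 : s * (7 / 8 * L) <= s * ln s by apply: ler_wpM2l.
have h2 : (s - 1) ^+ 2 <= s * (k%:R + 1).
  have : s * s <= s * (k%:R + 1) by apply: ler_wpM2l.
  by move: ss1; clear; lra.
apply: le_trans (ler_wpM2l lam0 h2) _.
have -> : 5 / 8 * L / k%:R * (s * (k%:R + 1)) = s * (5 / 8 * L + 5 / 8 * (L / k%:R)).
  by field; rewrite gt_eqF.
have : s * (5 / 8 * L + 5 / 8 * (L / k%:R)) <= s * (7 / 8 * L - 1).
  by apply: ler_wpM2l => //; move: Lk hL; clear; lra.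
by move: h1; clear; lra.
Qed.

(** Here [s] is at most 3, so one quadratic comparison does: the polynomial is at most
    [4 * 2 ^ (k - 1)] times the square of [s - 1], and [8 * ln k / k] is tiny. *)
Lemma hyper_entropy_ge (R : realType) (k : nat) (s : R) : 10 ^+ 5 <= ln k%:R :> R ->
  0 <= s <= 2 + k%:R^-1 ->
  2 * ln k%:R / (k%:R * 2 ^+ k.-1) * (s ^+ k - 1 - k%:R * (s - 1)) <= s * ln s - s + 1.
Proof.
move=> hL /andP[s0 sS]; have [k0 kE kL] := natr_ge_ln hL.
move: (ln k%:R) hL kE kL => L hL kE kL.
have kR : 0 < k%:R :> R by rewrite ltr0n.
have ki : 0 < k%:R^-1 :> R by rewrite invr_gt0.
have ki1 : k%:R^-1 <= 1 :> R by rewrite invf_le1 // ler1n.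
have L0 : 0 < L by apply: lt_le_trans hL.
have Lk : L / k%:R <= 1 / 10 ^+ 4 by rewrite ler_pdivrMr //; move: kL; clear; lra.
set P : R := 2 ^+ k.-1.
have P0 : 0 < P by rewrite exprn_gt0.
have PE : 2 ^+ k = 2 * P by rewrite -exprS prednK.
have S2 : 2 <= 2 + k%:R^-1 :> R by rewrite lerDl ltW.
have h1 := exprn_taylor2_le k S2 (introT andP (conj s0 sS)).
have Sk : (2 + k%:R^-1) ^+ k <= 4 * P.
  have -> : 2 + k%:R^-1 = 2 * (1 + (2 * k%:R)^-1) :> R by field; rewrite gt_eqF.
  rewrite exprMn PE.
  have e2 : (1 + (2 * k%:R)^-1) ^+ k <= expR (1 / 2) :> R.
    apply: (@le_trans _ _ (expR ((2 * k%:R)^-1) ^+ k)).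
      apply: lerXn2r; rewrite ?nnegrE ?expR_ge0 ?expR_ge1Dx //.
    rewrite -expRM_natl ler_expR le_eqVlt; apply/orP; left; apply/eqP.
    by field; rewrite gt_eqF.
  have e3 : expR (1 / 2) <= 2 :> R.
    have := expR_ge1Dx (- (1 / 2) : R); rewrite expRN -[leRHS]div1r ler_pdivlMr ?expR_gt0 //.
    by clear; lra.
  have : 2 * P * (1 + (2 * k%:R)^-1) ^+ k <= 2 * P * 2.
    by apply: ler_wpM2l; [rewrite mulr_ge0 // ltW | exact: le_trans e3].
  by clear; lra.
have q0 : 0 <= (s - 1) ^+ 2 by exact: sqr_ge0.
have h2 : s ^+ k - 1 - k%:R * (s - 1) <= 4 * P * (s - 1) ^+ 2.
  by apply: (le_trans h1); apply: ler_wpM2r => //; move: Sk kR; clear; lra.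
have lam0 : 0 <= 2 * L / (k%:R * P) by rewrite divr_ge0 // mulr_ge0 // ltW.
apply: le_trans (ler_wpM2l lam0 h2) _.
have -> : 2 * L / (k%:R * P) * (4 * P * (s - 1) ^+ 2) = 8 * (L / k%:R) * (s - 1) ^+ 2.
  by field; rewrite !gt_eqF.
have ent := sqr_le_entropy s0.
have ent0 : 0 <= s * ln s - s + 1.
  have : 0 <= 2 * (s + 1) * (s * ln s - s + 1) by apply: le_trans ent.
  by rewrite pmulr_rge0 //; move: s0; clear; lra.
apply: (@le_trans _ _ (1 / 8 * (s - 1) ^+ 2)).
  by apply: ler_wpM2r => //; move: Lk; clear; lra.
have : 2 * (s + 1) * (s * ln s - s + 1) <= 8 * (s * ln s - s + 1).
  by apply: ler_wpM2r => //; move: sS ki1; clear; lra.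
by move: ent; clear; lra.
Qed.

Lemma exp2_le_expR (R : realType) (j : nat) : 2 ^+ j <= expR j%:R :> R.
Proof.
rewrite -[j%:R]mulr1 expRM_natl; apply: lerXn2r; rewrite ?nnegrE ?expR_ge0 //.
by have := expR_ge1Dx (1 : R); lra.
Qed.

Lemma graph_loose_whp (R : realType) (k : nat) (r : R) (m : nat -> nat) :
  10 ^+ 5 <= ln k%:R :> R -> 0 <= r ->
  2 * r <= (1 - (Num.sqrt (ln k%:R))^-1) * (k%:R * ln k%:R) ->
  (forall n, (m n)%:R <= r * n%:R + 1) ->
  forall gam eps : R, 0 < gam -> 0 < eps ->
  \forall n \near \oo%classic,
    1 - eps <= all_loose_prob (uniform_hypergraphs n 2 (m n)) (@colorings n 'I_k) (gam * n%:R).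
Proof.
move=> hL r0 hr hm; have [k0 kE kL] := natr_ge_ln hL.
have hent s := graph_entropy_ge (s := s) hL.
have hbig := expR_sqrt_ge hL.
move: (ln k%:R) hL hr hent kE kL hbig => L hL hr hent kE kL hbig.
have kR : 0 < k%:R :> R by rewrite ltr0n.
have L0 : 0 < L by apply: lt_le_trans hL; exact: exprn_gt0.
have y2 : Num.sqrt L ^+ 2 = L by rewrite sqr_sqrtr // ltW.
have y0 : 0 < Num.sqrt L by rewrite sqrtr_gt0.
move: (Num.sqrt L) y2 y0 hr hbig => y y2 y0 hr hbig.
have y100 : 100 <= y.
  rewrite -ler_sqr ?nnegrE // ?(ltW y0) // y2; apply: le_trans hL.
  by rewrite -[100]/(100%:R) (_ : 100 = 10 ^ 2)%N // natrX -exprM ler_weXn2l // ler1n.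
have yL : 100 * y <= L by rewrite -y2 expr2; apply: ler_wpM2r => //; exact: ltW.
have k100 : 10 ^+ 9 <= k%:R :> R.
  by apply: le_trans kL; rewrite -[9%N]/(4 + 5)%N exprD; apply: ler_wpM2l => //; exact: exprn_ge0.
have {}hr : 2 * r <= k%:R * L - k%:R * y.
  apply: (le_trans hr); rewrite le_eqVlt; apply/orP; left; apply/eqP.
  by rewrite -y2; field; rewrite gt_eqF.
have D1 : (1 < #|'I_k|)%N.
  by rewrite card_ord -(ltr_nat R); apply: lt_le_trans k100; clear; lra.
have D5 : (5 < #|'I_k|)%N.
  by rewrite card_ord -(ltr_nat R); apply: lt_le_trans k100; clear; lra.
have phiE : edge_phi R 'I_k 2 = 1 - k%:R^-1.
  by rewrite /edge_phi card_ord; field; rewrite gt_eqF.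
have ki : 0 < k%:R^-1 :> R by rewrite invr_gt0.
have ki1 : k%:R^-1 <= 1 / 10 :> R.
  by rewrite -[leLHS]div1r ler_pdivrMr //; move: k100; clear; lra.
have ph2 : 1 / 2 <= edge_phi R 'I_k 2 by rewrite phiE; move: ki1; clear; lra.
(* The density leaves a gap of [y], the root of [L], below [L]. Half of it pays for the factor
   [1 - 1 / k] and for strictness; the other half makes a colour free with probability at least
   about [expR (y / 2) / k]. *)
pose Lam := L - y / 2.
have Lam0 : 0 <= Lam by rewrite /Lam; move: yL y0; clear; lra.
have [xi1 xi10 H1] := near_allowed_quarter D1 (isT : (1 < 2)%N) ph2.
have hLam : r * 2%:R * #|'I_k|%:R^-1 ^+ 2.-1 < Lam * edge_phi R 'I_k 2.
  rewrite /= expr1 card_ord phiE -(ltr_pM2r kR).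
  have -> : r * 2 / k%:R * k%:R = 2 * r by field; rewrite gt_eqF.
  have -> : Lam * (1 - k%:R^-1) * k%:R = Lam * (k%:R - 1) by field; rewrite gt_eqF.
  apply: (le_lt_trans hr); rewrite /Lam.
  have : 10 ^+ 4 * L * y <= k%:R * y by apply: ler_wpM2r => //; exact: ltW.
  have : L * 100 <= L * y by apply: ler_wpM2l => //; exact: ltW.
  by move: L0 y0 yL; clear; lra.
have [xi2 xi20 H2] := unhit_prob_ge D1 (isT : (1 < 2)%N) r0 hm hLam.
pose xis := Num.min 1 (Num.min xi1 xi2).
have xis0 : 0 < xis by rewrite !lt_min ltr01 xi10.
have [xisA xisB xisC] : [/\ xis <= 1, xis <= xi1 & xis <= xi2].
  by rewrite !ge_min !lexx !orbT.
have hpt : r * #|'I_k|%:R ^+ 2 <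
    5 / 8 * L / k%:R * edge_phi R 'I_k 2 ^+ 2 * (#|'I_k|%:R ^+ 2) ^+ 2.
  rewrite phiE card_ord.
  have -> : 5 / 8 * L / k%:R * (1 - k%:R^-1) ^+ 2 * (k%:R ^+ 2) ^+ 2 =
     5 / 8 * (L / k%:R * (k%:R - 1) ^+ 2) * k%:R ^+ 2 by field; rewrite gt_eqF.
  rewrite ltr_pM2r ?exprn_gt0 //.
  apply: (@le_lt_trans _ _ (k%:R * L / 2)).
    by have := mulr_gt0 kR y0; move: hr; clear; lra.
  have -> : 5 / 8 * (L / k%:R * (k%:R - 1) ^+ 2) =
    k%:R * L / 2 + L * (k%:R / 8 - 5 / 4 + 5 / 8 / k%:R) by field; rewrite gt_eqF.
  rewrite ltrDl; apply: mulr_gt0 => //; move: k100 ki; clear; lra.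
apply: (loose_whp (smax := k%:R + 1) (xis := xis) D1 (isT : (1 < 2)%N) r0 hpt) => //.
- by rewrite card_ord ltrDl.
- by rewrite xis0.
have zE : expR (- Lam) * k%:R = expR (y / 2).
  by rewrite kE -expRD /Lam; congr expR; ring.
apply: (graph_good_whp (z := expR (- Lam)) D5 r0 hm xis0).
- by rewrite expR_ge0 -expR0 ler_expR oppr_le0.
- by apply: H1; rewrite xis0.
- have := H2 xis _; rewrite xis0 xisC => /(_ isT); apply: filterS => n hn s bs h j hh hj.
  by apply: (hn s bs h j hh); rewrite muln1 expr1.
rewrite card_ord.
have zk : 38 + 3 * L <= expR (- Lam) * (k - 1)%:R / 4.
  apply: (le_trans hbig); rewrite -zE natrB // -!mulrA; apply: ler_wpM2l; first exact: expR_ge0.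
  by move: k100; clear; lra.
have r1 : r + 1 <= expR (2 * L).
  have -> : expR (2 * L) = k%:R * k%:R by rewrite kE -expRD; congr expR; ring.
  have : 10 ^+ 4 * L * k%:R <= k%:R * k%:R by apply: ler_wpM2r => //; exact: ltW.
  have : 1 * k%:R <= L * k%:R.
    by apply: ler_wpM2r; [exact: ltW | move: yL y100; clear; lra].
  by have := mulr_gt0 kR y0; move: hr k100; clear; lra.
have -> : expR 1 * (32 * (r + 1)) * 2 * 2 ^+ 10 * expR (- (expR (- Lam) * (k - 1)%:R / 4))
   = expR 1 * 2 ^+ 16 * (r + 1) * expR (- (expR (- Lam) * (k - 1)%:R / 4)).
  by rewrite -[16%N]/(6 + 10)%N exprD; ring.
apply: (@le_trans _ _ (expR 1 * expR 16 * expR (2 * L) * expR (- (38 + 3 * L)))).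
  apply: ler_pM.
  - by rewrite !mulr_ge0 ?expR_ge0 ?exprn_ge0 // addr_ge0.
  - exact: expR_ge0.
  - apply: ler_pM => //.
    + by rewrite addr_ge0.
    + by apply: ler_wpM2l; [exact: expR_ge0 | exact: (exp2_le_expR R 16)].
  - by rewrite ler_expR lerN2.
by rewrite -!expRD ler_expR; move: L0; clear; lra.
Qed.

Lemma hyper_loose_whp (R : realType) (k : nat) (r : R) (m : nat -> nat) :
  10 ^+ 5 <= ln k%:R :> R -> 0 <= r ->
  r <= (1 - (Num.sqrt (ln k%:R))^-1) * (2 ^+ k.-1 / k%:R * ln k%:R) ->
  (forall n, (m n)%:R <= r * n%:R + 1) ->
  forall gam eps : R, 0 < gam -> 0 < eps ->
  \forall n \near \oo%classic,
    1 - eps <= all_loose_prob (uniform_hypergraphs n k (m n)) (@colorings n 'I_2) (gam * n%:R).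
Proof.
move=> hL r0 hr hm; have [k0 kE kL] := natr_ge_ln hL.
have hent s := hyper_entropy_ge (s := s) hL.
have hbig := expR_sqrt_ge hL.
move: (ln k%:R) hL hr hent kE kL hbig => L hL hr hent kE kL hbig.
have kR : 0 < k%:R :> R by rewrite ltr0n.
have L0 : 0 < L by apply: lt_le_trans hL; exact: exprn_gt0.
have y2 : Num.sqrt L ^+ 2 = L by rewrite sqr_sqrtr // ltW.
have y0 : 0 < Num.sqrt L by rewrite sqrtr_gt0.
move: (Num.sqrt L) y2 y0 hr hbig => y y2 y0 hr hbig.
have y100 : 100 <= y.
  rewrite -ler_sqr ?nnegrE // ?(ltW y0) // y2; apply: le_trans hL.
  by rewrite -[100]/(100%:R) (_ : 100 = 10 ^ 2)%N // natrX -exprM ler_weXn2l // ler1n.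
have yL : 100 * y <= L by rewrite -y2 expr2; apply: ler_wpM2r => //; exact: ltW.
have k100 : 10 ^+ 9 <= k%:R :> R.
  by apply: le_trans kL; rewrite -[9%N]/(4 + 5)%N exprD; apply: ler_wpM2l => //; exact: exprn_ge0.
have k20 : (20 < k)%N by rewrite -(ltr_nat R); apply: lt_le_trans k100; clear; lra.
have k1 : (1 < k)%N by apply: leq_trans k20.
have kP : k%:R <= 2 ^+ k.-1 :> R.
  by rewrite -natrX ler_nat -{1}(prednK k0); exact: ltn_expl.
have P2 : 2 ^+ k = 2 * 2 ^+ k.-1 :> R by rewrite -exprS prednK.
have [P [PE P2E kP' hentP hrP]] : exists P : R, [/\ 2 ^+ k.-1 = P, 2 ^+ k = 2 * P, k%:R <= P,
    (forall s, 0 <= s <= 2 + k%:R^-1 ->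
      2 * L / (k%:R * P) * (s ^+ k - 1 - k%:R * (s - 1)) <= s * ln s - s + 1) &
    r <= (1 - y^-1) * (P / k%:R * L)].
  by exists (2 ^+ k.-1).
have P0 : 0 < P by apply: lt_le_trans kP'.
have {hrP} hr1 : r * k%:R <= P * (L - y).
  rewrite -ler_pdivlMr //; apply: (le_trans hrP); rewrite le_eqVlt; apply/orP; left; apply/eqP.
  by rewrite -y2; field; rewrite !gt_eqF.
have D1 : (1 < #|'I_2|)%N by rewrite card_ord.
have phiE : edge_phi R 'I_2 k = 1 - P^-1.
  by rewrite /edge_phi card_ord P2E; field; rewrite gt_eqF.
have Pi : 0 < P^-1 by rewrite invr_gt0.
have Pi1 : P^-1 <= 1 / 10.
  by rewrite -[leLHS]div1r ler_pdivrMr //; move: k100 kP'; clear; lra.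
have ph2 : 1 / 2 <= edge_phi R 'I_2 k by rewrite phiE; move: Pi1; clear; lra.
(* The gap [y] is split as for graphs. The vertices covered by [T], at least [k - 3/2] per edge, now
   play the role of the colours. *)
pose Lam := L - y / 2.
have Lam0 : 0 <= Lam by rewrite /Lam; move: yL y0; clear; lra.
have [xi1 xi10 H1] := near_allowed_quarter D1 k1 ph2.
have hLam : r * k%:R * #|'I_2|%:R^-1 ^+ k.-1 < Lam * edge_phi R 'I_2 k.
  rewrite card_ord exprVn PE phiE ltr_pdivrMr //.
  have -> : Lam * (1 - P^-1) * P = Lam * (P - 1) by field; rewrite gt_eqF.
  apply: (le_lt_trans hr1); rewrite /Lam.
  have : 10 ^+ 4 * L * y <= P * y by apply: ler_wpM2r; [exact: ltW | exact: le_trans kP'].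
  have : L * 100 <= L * y by apply: ler_wpM2l => //; exact: ltW.
  by move: L0 y0 yL; clear; lra.
have [xi2 xi20 H2] := unhit_prob_ge D1 k1 r0 hm hLam.
pose xis := Num.min k%:R^-1 (Num.min xi1 xi2).
have xis0 : 0 < xis by rewrite !lt_min invr_gt0 kR xi10.
have [xisA xisB xisC] : [/\ xis <= k%:R^-1, xis <= xi1 & xis <= xi2].
  by rewrite !ge_min !lexx !orbT.
have xik : xis * k%:R <= 1 by rewrite -ler_pdivlMr // div1r.
have hpt : r * #|'I_2|%:R ^+ 2 <
    2 * L / (k%:R * P) * edge_phi R 'I_2 k ^+ 2 * (#|'I_2|%:R ^+ 2) ^+ k.
  rewrite card_ord -exprM mulnC exprM P2E phiE -(ltr_pM2r kR).
  have -> : 2 * L / (k%:R * P) * (1 - P^-1) ^+ 2 * (2 * P) ^+ 2 * k%:R =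
     L * P * 8 * (1 - P^-1) ^+ 2 by field; rewrite !gt_eqF.
  have f2 : 4 / 5 <= (1 - P^-1) ^+ 2 by move: Pi Pi1; clear; nra.
  have LP : 0 < L * P * 8 by rewrite !mulr_gt0.
  have : L * P * 8 * (4 / 5) <= L * P * 8 * (1 - P^-1) ^+ 2 by apply: ler_wpM2l => //; exact: ltW.
  have := mulr_gt0 P0 y0; move: hr1 LP; clear; lra.
apply: (loose_whp (smax := 2 + k%:R^-1) (xis := xis) D1 k1 r0 hpt) => //.
- by rewrite card_ord ltrDl invr_gt0.
- rewrite xis0 (le_trans xisA) // invf_le1 // ler1n //.
have zE : expR (- Lam) * k%:R = expR (y / 2).
  by rewrite kE -expRD /Lam; congr expR; ring.
apply: (hyper_good_whp (z := expR (- Lam)) k20 r0 hm xis0 xik).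
- by rewrite expR_ge0 -expR0 ler_expR oppr_le0.
- by apply: H1; rewrite xis0.
- have := H2 xis _; rewrite xis0 xisC => /(_ isT); apply: filterS => n hn s bs h j hh hj.
  by apply: (hn s bs h j hh); rewrite card_ord.
have zk : 38 + 3 * L <= expR (- Lam) * (2 * k - 3)%:R / 4.
  apply: (le_trans hbig); rewrite -zE natrB ?natrM; last by apply: leq_trans (_ : 2 * 20 <= _)%N; rewrite // leq_mul2l ltnW.
  rewrite -!mulrA; apply: ler_wpM2l; first exact: expR_ge0.
  by move: k100; clear; lra.
(* The fraction [k / P] of fragile edges cancels the exponential size of [r]. *)
have r1 : k%:R / P * (r + 1) <= expR L.
  apply: le_trans (expR_ge1Dx L).
  have -> : k%:R / P * (r + 1) = (r * k%:R + k%:R) / P by field; rewrite gt_eqF.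
  rewrite ler_pdivrMr //; have := mulr_gt0 P0 y0; move: hr1 kP'; clear; lra.
have k2 : k%:R ^+ 2 = expR (2 * L) :> R by rewrite expRM_natl -kE.
rewrite PE.
have -> : expR 1 * (32 * expR 4 * k%:R / P * (r + 1)) * k%:R ^+ 2 * 2 ^+ 26 *
    expR (- (expR (- Lam) * (2 * k - 3)%:R / 4))
   = expR 1 * expR 4 * 2 ^+ 31 * (k%:R / P * (r + 1)) * expR (2 * L) *
    expR (- (expR (- Lam) * (2 * k - 3)%:R / 4)).
  by rewrite k2 -[31%N]/(5 + 26)%N exprD; ring.
apply: (@le_trans _ _ (expR 1 * expR 4 * expR 31 * expR L * expR (2 * L) * expR (- (38 + 3 * L)))).
  have kPr : 0 <= k%:R / P * (r + 1) by rewrite mulr_ge0 ?divr_ge0 ?(ltW P0) // addr_ge0.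
  apply: ler_pM.
  - apply: mulr_ge0; last exact: expR_ge0.
    by apply: mulr_ge0 => //; rewrite !mulr_ge0 ?expR_ge0 ?exprn_ge0.
  - exact: expR_ge0.
  - apply: ler_wpM2r; first exact: expR_ge0.
    apply: ler_pM => //.
    by apply: ler_wpM2l; [rewrite mulr_ge0 ?expR_ge0 | exact: (exp2_le_expR R 31)].
  - by rewrite ler_expR lerN2.
by rewrite -!expRD ler_expR; clear; lra.
Qed.

(** * The theorem *)

Lemma proper_colorings_graph (n k m : nat) (E : hypergraph n) :
  E \in graphs n m -> proper_colorings k E = colorings 'I_k E.
Proof.
rewrite in_set => /andP[/forall_inP hE _]; apply/setP => s; rewrite !in_set.
apply/idP/idP => [/forallP h|/forall_inP h].
  apply/forall_inP => e eE; have /cards2P[u [v [uv ee]]] : #|e| == 2 by exact: hE.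
  have /forallP/(_ v) := h u; rewrite -ee eE /=; apply: contra => /monochromaticP[d hd].
  by rewrite !hd // ee ?set21 ?set22.
apply/forallP => u; apply/forallP => v; apply/implyP => eE; have := h _ eE.
apply: contra => /eqP suv; apply/monochromaticP; exists (s u) => w.
by rewrite in_set2 => /orP[/eqP ->|/eqP ->].
Qed.

Lemma eq_all_loose_prob (R : realType) (n : nat) (D : finType) (I : {set hypergraph n})
    (Sol Sol' : hypergraph n -> {set {ffun 'I_n -> D}}) (f : R) :
  (forall E, E \in I -> Sol E = Sol' E) -> all_loose_prob I Sol f = all_loose_prob I Sol' f.
Proof. by move=> h; apply: eq_bigr => E EI; rewrite h. Qed.

(** For nonpositive densities the instances are edgeless, and changing one vertex is always
    possible. *)
Lemma all_loose_prob_no_edges (R : realType) (n kap : nat) (D : finType) (f : R) :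
  (0 < #|D|)%N -> 1 <= f ->
  all_loose_prob (uniform_hypergraphs n kap 0) (@colorings n D) f = 1.
Proof.
move=> D0 f1.
have -> : uniform_hypergraphs n kap 0 = [set set0].
  apply/setP => E; rewrite in_set in_set1 cards_eq0.
  case: eqP => [->|_]; last by rewrite andbF.
  by rewrite andbT; apply/forall_inP => e; rewrite inE.
rewrite /all_loose_prob /pair_prob big_set1 cards1 invr1.
have CT : colorings D (set0 : hypergraph n) = setT.
  by apply/setP => s; rewrite in_set in_setT; apply/forall_inP => e; rewrite inE.
rewrite CT (eq_bigl (fun=> true)) => [|s]; last first.
  rewrite in_setT /=; apply/forallP => v; apply/forallP => j; apply/exists_inP.
  pose t : {ffun 'I_n -> D} := [ffun x => if x == v then j else s x].
  exists t; first by rewrite in_setT.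
  rewrite ffunE eqxx eqxx /=; apply: le_trans f1; rewrite -[1]/(1%:R) ler_nat.
  rewrite -(cards1 v); apply: subset_leq_card; apply/subsetP => x.
  by rewrite in_set in_set1 ffunE; case: (x == v) => //; rewrite eqxx.
rewrite sumr_const cardsT mul1r -[LHS]mulr_natr mulVf // pnatr_eq0 -lt0n card_ffun card_ord.
by rewrite expn_gt0 D0.
Qed.

Local Open Scope classical_set_scope.

Local Open Scope ring_scope.

(* Diagonal choice: [g n = n / (i + 1)] for the largest [i < n] whose threshold is below [n]. *)
Lemma little_o_diagonal (R : realType) (p : nat -> R -> R) :
  (forall n f, p n f <= 1) ->
  (forall gam eps : R, 0 < gam -> 0 < eps ->
     \forall n \near \oo, 1 - eps <= p n (gam * n%:R)) ->
  exists g : nat -> R, g =o_\oo (fun n : nat => n%:R : R) /\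
    (p n (g n) @[n --> \oo] --> (1 : R)).
Proof.
move=> p1 hp.
have hN i : exists N, forall n, (N <= n)%N -> 1 - i.+1%:R^-1 <= p n (i.+1%:R^-1 * n%:R).
  have i0 : 0 < i.+1%:R^-1 :> R by rewrite invr_gt0.
  have [N _ hN] := hp _ _ i0 i0.
  by exists N => n Nn; exact: hN.
have [N {}hN] := choice hN.
pose idx n := (\max_(i < n | (N i <= n)%N) i)%N.
have idx_ge i n : (maxn (N i) i.+1 <= n)%N -> (i <= idx n)%N.
  rewrite geq_max => /andP[Nn ni]; exact: (@leq_bigmax_cond _ _ _ (Ordinal ni)).
have idx_ok n : (maxn (N 0) 1 <= n)%N -> (N (idx n) <= n)%N.
  rewrite geq_max => /andP[Nn n0].
  have cA : (0 < #|[pred i : 'I_n | (N i <= n)%N]|)%N.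
    by apply/card_gt0P; exists (Ordinal n0).
  have [i Ni e] := eq_bigmax_cond (fun i : 'I_n => val i) cA.
  by have -> : idx n = i by [].
exists (fun n => (idx n).+1%:R^-1 * n%:R); split.
  apply/eqoP => e e0; near=> n.
  have e1 : e^-1 <= (Num.truncn e^-1).+1%:R.
    by apply/ltW; have /andP[] := truncn_itv (ltW (etrans (invr_gt0 e) e0)).
  rewrite normrM; apply: ler_wpM2r => //.
  rewrite ger0_norm ?invr_ge0 // -[leRHS]invrK lef_pV2 ?posrE ?invr_gt0 //.
  apply: (le_trans e1); rewrite ler_nat ltnS; apply: idx_ge.
  by near: n; exact: nbhs_infty_ge.
apply/cvgrPdist_le => e e0; near=> n.
have e1 : e^-1 <= (Num.truncn e^-1).+1%:R.
  by apply/ltW; have /andP[] := truncn_itv (ltW (etrans (invr_gt0 e) e0)).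
rewrite ger0_norm ?subr_ge0 // lerBlDr -lerBlDl.
apply: le_trans (hN (idx n) n _); last first.
  by apply: idx_ok; near: n; exact: nbhs_infty_ge.
rewrite lerB // -[leRHS]invrK lef_pV2 ?posrE ?invr_gt0 //.
apply: (le_trans e1); rewrite ler_nat ltnS; apply: idx_ge.
by near: n; exact: nbhs_infty_ge.
Unshelve. all: by end_near. Qed.

Lemma cst_little_o_id (R : realType) :
  (fun _ : nat => 1 : R) =o_\oo (fun n : nat => n%:R : R).
Proof.
apply/eqoP => e e0; near=> n.
rewrite normr1 -ler_pdivrMl // mulr1 ger0_norm //.
by near: n; exact: near_large_nat.
Unshelve. all: by end_near. Qed.

Lemma natr_le_add1 (R : realType) (m : nat) (x : R) : `|m%:R - x| < 1 -> m%:R <= x + 1.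
Proof. by rewrite ltr_norml => /andP[_]; rewrite ltrBlDl => /ltW; rewrite addrC. Qed.

Lemma natr_near_le0 (R : realType) (m : nat) (x : R) : `|m%:R - x| < 1 -> x <= 0 -> m = 0%N.
Proof.
rewrite ltr_norml => /andP[_]; rewrite ltrBlDl => h x0.
have : m%:R < 1 :> R by apply: lt_le_trans h _; rewrite addrC gerDl.
by rewrite -[1]/(1%:R) ltr_nat ltnS leqn0 => /eqP.
Qed.

Lemma near_ln_nat_ge (R : realType) (K : R) : \forall k \near \oo, K <= ln k%:R :> R.
Proof.
near=> k; have h : expR K <= k%:R by near: k; exact: near_large_nat.
have e0 := expR_gt0 K.
by rewrite -[K]expRK ler_ln // ?posrE //; apply: lt_le_trans h.
Unshelve. all: by end_near. Qed.

Theorem theorem5 (R : realType) :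
  exists eps : nat -> R,
    eps @ \oo --> (0 : R) /\
    forall k : nat, (0 < k)%N ->
      (* (a) k-colorings of graphs with dn/2 edges *)
      (forall (d : R) (m : nat -> nat),
         d <= (1 - eps k) * (k%:R * ln k%:R) ->
         (forall n : nat, `|(m n)%:R - d * n%:R / 2| < 1) ->
         exists g : nat -> R,
           g =o_\oo (fun n : nat => n%:R : R) /\
           all_loose_prob (graphs n (m n)) (@proper_colorings n k) (g n)
             @[n --> \oo] --> (1 : R))
      /\
      (* (b) 2-colorings of k-uniform hypergraphs with rn edges *)
      (forall (r : R) (m : nat -> nat),
         r <= (1 - eps k) * (2 ^+ k.-1 / k%:R * ln k%:R) ->
         (forall n : nat, `|(m n)%:R - r * n%:R| < 1) ->
         exists g : nat -> R,
           g =o_\oo (fun n : nat => n%:R : R) /\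
           all_loose_prob (uniform_hypergraphs n k (m n)) (@two_colorings n)
             (g n) @[n --> \oo] --> (1 : R)).
Proof.
(* For small [k] the value 1 leaves only nonpositive densities, hence edgeless instances. The
   threshold [10 ^ 5] is the one required by the numerical estimates above. *)
pose eps (k : nat) : R :=
  if 10 ^+ 5 <= ln k%:R :> R then (Num.sqrt (ln k%:R))^-1 else 1.
exists eps; split.
  apply/cvgrPdist_le => e e0; near=> k.
  have hL : 10 ^+ 5 <= ln k%:R :> R by near: k; exact: near_ln_nat_ge.
  have hE : e^-1 ^+ 2 <= ln k%:R :> R by near: k; exact: near_ln_nat_ge.
  have L0 : 0 < ln k%:R :> R by apply: lt_le_trans hL; exact: exprn_gt0.
  have y0 : 0 < Num.sqrt (ln k%:R : R) by rewrite sqrtr_gt0.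
  rewrite sub0r normrN /eps hL ger0_norm ?invr_ge0 ?(ltW y0) //.
  rewrite -[leRHS]invrK lef_pV2 ?posrE ?invr_gt0 //.
  rewrite -(@ler_pXn2r _ 2) ?nnegrE ?invr_ge0 ?(ltW e0) ?(ltW y0) //.
  by rewrite sqr_sqrtr // ltW.
move=> k k0; split=> [d m hd hm|r m hr hm].
  have Dk : (0 < #|'I_k|)%N by rewrite card_ord.
  have probE n f : all_loose_prob (graphs n (m n)) (@proper_colorings n k) f =
      all_loose_prob (uniform_hypergraphs n 2 (m n)) (@colorings n 'I_k) f :> R.
    by apply: eq_all_loose_prob => E EI; exact: proper_colorings_graph EI.
  have [d0|d0] := leP d 0.
    exists (fun=> 1); split; first exact: cst_little_o_id.
    apply: cvg_near_cst; near=> n.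
    have m0 : m n = 0%N.
      apply: (natr_near_le0 (hm n)).
      by rewrite -mulrA; apply: mulr_le0_ge0 => //; rewrite divr_ge0.
    by rewrite probE m0 all_loose_prob_no_edges.
  have hm' n : (m n)%:R <= d / 2 * n%:R + 1.
    by have := natr_le_add1 (hm n); rewrite mulrAC.
  move: hd; rewrite /eps; case: ifP => [hL hd|_]; last by rewrite subrr mul0r leNgt d0.
  have r0 : 0 <= d / 2 by rewrite divr_ge0 // ltW.
  have hd2 : 2 * (d / 2) <= (1 - (Num.sqrt (ln k%:R))^-1) * (k%:R * ln k%:R).
    by rewrite mulrC mulfVK.
  have [|gam e gam0 e0|g [go gp]] := @little_o_diagonal R
    (fun n f => all_loose_prob (graphs n (m n)) (@proper_colorings n k) f).
  - by move=> n f; exact: all_loose_prob_le1.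
  - have := graph_loose_whp hL r0 hd2 hm' gam0 e0.
    by apply: filterS => n; rewrite probE.
  by exists g.
have D2 : (0 < #|'I_2|)%N by rewrite card_ord.
have [r0|r0] := leP r 0.
  exists (fun=> 1); split; first exact: cst_little_o_id.
  apply: cvg_near_cst; near=> n.
  have m0 : m n = 0%N by apply: (natr_near_le0 (hm n)); apply: mulr_le0_ge0.
  by rewrite m0; apply: (all_loose_prob_no_edges n k D2 (lexx 1)).
move: hr; rewrite /eps; case: ifP => [hL hr|_]; last by rewrite subrr mul0r leNgt r0.
have [|gam e gam0 e0|g [go gp]] := @little_o_diagonal R
  (fun n f => all_loose_prob (uniform_hypergraphs n k (m n)) (@two_colorings n) f).
- by move=> n f; exact: all_loose_prob_le1.
- exact: (hyper_loose_whp hL (ltW r0) hr (fun n => natr_le_add1 (hm n)) gam0 e0).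
by exists g.
Unshelve. all: by end_near. Qed.
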